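(* Let $\nu\in\mathbb{C}\setminus\mathbb{Z}$ with $\Re(\nu)\ge0$, let $\chi$ be a non-principal even primitive Dirichlet character modulo $q$, and let $N$ be an integer with $N\ge\lfloor\frac{\Re(\nu)+1}{2}\rfloor$. Then for every $x>0$ with $qx\notin\mathbb{Z}_{>0}$, \begin{align*} &8\pi x^{\nu/2} \sum_{n=1}^{\infty} \bar{\sigma}_{-\nu, \bar{\chi}}(n) n^{\nu/2} K_{\nu}(4\pi\sqrt{nx}) = \frac{ q }{ \tau(\chi)} \left\{ \frac{ L(\nu,\chi)}{ \sin \left(\frac{\pi \nu}{2}\right)} (qx)^{\nu-1} - \frac{\pi L(1+\nu,\chi)}{ \cos \left(\frac{\pi \nu}{2}\right)}(qx)^{\nu} +\frac{2}{ \sin \left(\frac{\pi \nu}{2}\right)}\sum_{j=1}^N \zeta(2j-\nu)L(2j ,\chi)(qx)^{2j-1} \right.\\ &\left. \qquad + \frac{2}{ \sin \left(\frac{\pi \nu}{2}\right)}(qx)^{2N+1}\sum_{n=1}^{\infty} \sigma_{-\nu, \chi}(n) \left(\frac{ n^{\nu-2N}-(qx)^{\nu-2N} }{n^2-(qx)^2}\right) \right\}. \end{align*}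
   Context: For a Dirichlet character $\chi$ and $z\in\mathbb{C}$: $\sigma_{z,\chi}(n)=\sum_{d\mid n}d^z\chi(d)$ and $\bar{\sigma}_{z,\chi}(n)=\sum_{d\mid n}d^z\chi(n/d)$. $\tau(\chi)=\sum_{h=1}^q\chi(h)e^{2\pi i h/q}$ is the Gauss sum, $L(s,\chi)$ the Dirichlet $L$-function, $\zeta$ the Riemann zeta function, and $K_\nu$ the modified Bessel function of the second kind. *)

(* Defs.v *)
From Stdlib Require Import Reals ZArith Arith List ClassicalEpsilon.
From Coquelicot Require Import Coquelicot.
Open Scope R_scope.

Definition cexp (z : C) : C :=
  (exp (Re z) * cos (Im z), exp (Re z) * sin (Im z)).

Definition cpow (x : R) (s : C) : C := cexp (s * RtoC (ln x))%C.

Definition Ci : C := (0, 1).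
Definition csin (z : C) : C := ((cexp (Ci * z) - cexp (- (Ci * z))) / (2 * Ci))%C.
Definition ccos (z : C) : C := ((cexp (Ci * z) + cexp (- (Ci * z))) / 2)%C.
Definition ccosh (z : C) : C := ((cexp z + cexp (- z)) / 2)%C.

Definition csum (a len : nat) (f : nat -> C) : C :=
  fold_right Cplus (RtoC 0) (map f (seq a len)).

Definition divsum (n : nat) (f : nat -> C) : C :=
  fold_right Cplus (RtoC 0)
    (map f (filter (fun d => Nat.eqb (n mod d) 0) (seq 1 n))).

Definition dirichlet_character (q : nat) (chi : Z -> C) : Prop :=
  (1 <= q)%nat /\
  chi 1%Z = RtoC 1 /\
  (forall m n : Z, chi (m * n)%Z = (chi m * chi n)%C) /\
  (forall n : Z, chi (n + Z.of_nat q)%Z = chi n) /\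
  (forall n : Z, Z.gcd n (Z.of_nat q) = 1%Z <-> chi n <> RtoC 0).

Definition principal_character (q : nat) (chi : Z -> C) : Prop :=
  forall n : Z, Z.gcd n (Z.of_nat q) = 1%Z -> chi n = RtoC 1.

Definition even_character (chi : Z -> C) : Prop := chi (-1)%Z = RtoC 1.

Definition induced_modulus (q : nat) (chi : Z -> C) (d : nat) : Prop :=
  (0 < d)%nat /\ Nat.divide d q /\
  forall a : Z, Z.gcd a (Z.of_nat q) = 1%Z -> Z.modulo a (Z.of_nat d) = Z.modulo 1 (Z.of_nat d) ->
     chi a = RtoC 1.

Definition primitive_character (q : nat) (chi : Z -> C) : Prop :=
  forall d : nat, (d < q)%nat -> ~ induced_modulus q chi d.

Definition cconjchar (chi : Z -> C) : Z -> C := fun n => Cconj (chi n).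

Definition gauss_sum (q : nat) (chi : Z -> C) : C :=
  csum 1 q (fun h => (chi (Z.of_nat h) *
                      cexp (Ci * RtoC (2 * PI * INR h / INR q)))%C).

Definition sigma_chi (z : C) (chi : Z -> C) (n : nat) : C :=
  divsum n (fun d => (cpow (INR d) z * chi (Z.of_nat d))%C).

Definition sigmabar_chi (z : C) (chi : Z -> C) (n : nat) : C :=
  divsum n (fun d => (cpow (INR d) z * chi (Z.of_nat (n / d)))%C).

(* A function holomorphic on C \ {1} agreeing with sum_{n>=1} a(n) n^{-s}
   on Re s > 1 (unique by the identity theorem when it exists). *)
Definition is_dirichlet_continuation (a : nat -> C) (g : C -> C) : Prop :=
  (forall z : C, z <> RtoC 1 -> ex_derive (K := C_AbsRing) (V := C_NormedModule) g z) /\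
  (forall z : C, 1 < Re z ->
     is_series (K := C_AbsRing) (V := C_NormedModule)
       (fun n => (a (S n) * cpow (INR (S n)) (- z))%C) (g z)).

Definition dirichlet_cont (a : nat -> C) : C -> C :=
  epsilon (inhabits (fun _ : C => RtoC 0)) (is_dirichlet_continuation a).

Definition zeta (s : C) : C := dirichlet_cont (fun _ => RtoC 1) s.

Definition Lfun (chi : Z -> C) (s : C) : C :=
  dirichlet_cont (fun n => chi (Z.of_nat n)) s.

Definition BesselK (nu : C) (y : R) : C :=
  RInt_gen (V := C_R_CompleteNormedModule)
    (fun t : R => (cexp (RtoC (- y * cosh t)) * ccosh (nu * RtoC t))%C)
    (at_point 0) (Rbar_locally p_infty).

(* Main.v *)
From Stdlib Require Import Reals ZArith Arith List Lra Lia.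
From Stdlib Require Import Classical ClassicalEpsilon FunctionalExtensionality Permutation.
From Coquelicot Require Import Coquelicot.
Require Import Defs.
Open Scope R_scope.

(** Everything is a Mellin transform in the variable [v = ln t] of the function
    [logis v = 1 / (1 + exp (- 2 v))], whose transform is [PI / (2 sin (PI w / 2))].
    The partial fractions of [coth] and the separability of the Gauss sums give closed forms for
    [sum_m logis (v - ln m)] and [sum_k chi k * logis (v - ln k)]; integrating them yields the
    continuations of [zeta] and [L], and turns the Bessel series into one integral
    of [exp (nu v)] against the product of a theta series and a Bose kernel, entire in [nu].
    For [0 < Re nu < 1] that product is expanded back into [logis] sums: the two boundary terms
    give [L nu] and [L (1 + nu)], while the double sum, through the partial fractions of
    [logis (v - ln m) * logis (ln y - v)] with [y = q x / k], gives the divisor series with [N = 0].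
    Splitting off the absolutely convergent products [zeta (2 j - nu) * L (2 j)] raises [N], and
    the identity theorem, applied after multiplying by [sin (PI nu / 2) * cos (PI nu / 2)], extends
    the result to [-1 < Re nu < 2 N + 1] minus the integers. *)

(** * Complex exponentials, series and derivatives *)

(** [logis] lies below both [1] and [exp (2 v)], so its transform converges for [0 < Re w < 2], and
    summing over the index costs the part [Re w <= 1]. The closed forms win that part back: the
    [chi] sum decays faster than every [exp (- A v)] at plus infinity, and the sum for [zeta] does
    so after removal of [PI / 2 * exp v - 1 / 2]. Hence both transforms extend to all [Re w < 2],
    without functional equations or the Gamma function. In the variable [v] every integral has
    exponential bounds at both ends, so interchanges with sums and derivatives in [nu] reduce to
    dominated series of such bounds. The bound [Re nu < 1] in the starting strip comes from
    [L (1 + nu)], whose transform needs [Re (1 + nu) < 2], and from the double sum, where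
    convergence over [m] demands more than one power of [m]. The condition on [N] in the theorem
    amounts to [Re nu < 2 N + 1], the right edge of the strip in which the divisor series is
    dominated. That [q x] is not a positive integer keeps [n^2 - (q x)^2] away from [0], in the
    series and in the partial fractions alike. *)

Lemma C_ext (z w : C) : Re z = Re w -> Im z = Im w -> z = w.
Proof. destruct z, w; simpl; intros; subst; reflexivity. Qed.

Lemma Re_plus (z w : C) : Re (z + w) = Re z + Re w.
Proof. reflexivity. Qed.
Lemma Im_plus (z w : C) : Im (z + w) = Im z + Im w.
Proof. reflexivity. Qed.
Lemma Re_opp (z : C) : Re (- z) = - Re z.
Proof. reflexivity. Qed.
Lemma Re_minus (z w : C) : Re (z - w) = Re z - Re w.
Proof. reflexivity. Qed.
Lemma Im_minus (z w : C) : Im (z - w) = Im z - Im w.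
Proof. reflexivity. Qed.
Lemma Re_mult (z w : C) : Re (z * w) = Re z * Re w - Im z * Im w.
Proof. reflexivity. Qed.
Lemma Im_mult (z w : C) : Im (z * w) = Re z * Im w + Im z * Re w.
Proof. reflexivity. Qed.

Lemma im_le_Cmod (z : C) : Rabs (Im z) <= Cmod z.
Proof.
  eapply Rle_trans; [|apply Rmax_Cmod]. apply Rmax_r.
Qed.

Lemma Cmod_le_abs (z : C) : Cmod z <= Rabs (Re z) + Rabs (Im z).
Proof.
  replace z with ((Re z : C) + Cmult Complex.Ci (Im z))%C at 1.
  2:{ apply C_ext; simpl; ring. }
  eapply Rle_trans; [apply Cmod_triangle|].
  rewrite Cmod_mult, Cmod_Ci, !Cmod_R. lra.
Qed.

Lemma Cmod_sub_sym (z w : C) : Cmod (z - w) = Cmod (w - z).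
Proof. rewrite <- Cmod_opp. f_equal. ring. Qed.

Lemma Cmod_triangle_inv (z w : C) : Cmod z - Cmod w <= Cmod (z - w).
Proof.
  assert (H := Cmod_triangle (z - w) w).
  replace (z - w + w)%C with z in H by ring. lra.
Qed.

Lemma Cmod_triangle_minus (z w : C) : Cmod (z - w) <= Cmod z + Cmod w.
Proof. unfold Cminus. rewrite <- (Cmod_opp w). apply Cmod_triangle. Qed.

Lemma Cmod_zero_le (z : C) : (forall eps, 0 < eps -> Cmod z <= eps) -> z = RtoC 0.
Proof.
  intros H. apply Cmod_eq_0. apply Rle_antisym; [|apply Cmod_ge_0].
  apply Rnot_lt_le; intros Hp. specialize (H (Cmod z / 2)). lra.
Qed.

Lemma cexp_add (z w : C) : cexp (z + w) = (cexp z * cexp w)%C.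
Proof.
  unfold cexp. apply C_ext; rewrite Re_plus, Im_plus; simpl;
    rewrite exp_plus, ?cos_plus, ?sin_plus; ring.
Qed.

Lemma cexp_RtoC (r : R) : cexp (RtoC r) = RtoC (exp r).
Proof. unfold cexp; apply C_ext; simpl; rewrite ?cos_0, ?sin_0; ring. Qed.

Lemma cexp_0 : cexp (RtoC 0) = RtoC 1.
Proof. rewrite cexp_RtoC, exp_0. reflexivity. Qed.

Lemma Cmod_cexp (z : C) : Cmod (cexp z) = exp (Re z).
Proof.
  unfold Cmod, cexp; cbn [fst snd]. generalize (Re z) (Im z); intros x y.
  replace ((exp x * cos y) ^ 2 + (exp x * sin y) ^ 2)
    with (exp x * exp x * ((sin y)² + (cos y)²)) by (unfold Rsqr; ring).
  rewrite sin2_cos2, Rmult_1_r. apply sqrt_square. left; apply exp_pos.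
Qed.

Lemma cexp_nz (z : C) : cexp z <> RtoC 0.
Proof.
  intros H. assert (H1 := Cmod_cexp z). rewrite H, Cmod_0 in H1.
  assert (H2 := exp_pos (Re z)). lra.
Qed.

Lemma cexp_opp (z : C) : cexp (- z) = (/ cexp z)%C.
Proof.
  assert (H : (cexp (- z) * cexp z)%C = RtoC 1).
  { rewrite <- cexp_add. replace (- z + z)%C with (RtoC 0) by ring. apply cexp_0. }
  rewrite <- (Cmult_1_r (cexp (- z))), <- (Cinv_r (cexp z)) by apply cexp_nz.
  rewrite Cmult_assoc, H. ring.
Qed.

Lemma cpow_add (x : R) (s t : C) : cpow x (s + t) = (cpow x s * cpow x t)%C.
Proof. unfold cpow. rewrite <- cexp_add. f_equal. ring. Qed.

Lemma cpow_nz (x : R) (s : C) : cpow x s <> RtoC 0.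
Proof. apply cexp_nz. Qed.

Lemma Cmod_cpow (x : R) (s : C) : Cmod (cpow x s) = exp (Re s * ln x).
Proof. unfold cpow. rewrite Cmod_cexp. f_equal. rewrite Re_mult. simpl. ring. Qed.

Lemma cpow_nat (x : R) (n : nat) : 0 < x -> cpow x (RtoC (INR n)) = RtoC (x ^ n).
Proof.
  intros Hx. unfold cpow. rewrite <- RtoC_mult, cexp_RtoC, <- Rpower_pow by assumption. reflexivity.
Qed.

Lemma cpow_opp (x : R) (s : C) : cpow x (- s) = (/ cpow x s)%C.
Proof.
  unfold cpow. rewrite <- cexp_opp. f_equal. ring.
Qed.

(** * Complex series and their partial sums *)

Notation CS := (is_series (K := C_AbsRing) (V := C_NormedModule)).

(** The [n] terms below [n], in contrast to [sum_n], which runs through index [n]; the empty sum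
    lets inductions start at [0] and explains the shifts by one in the conversions. *)
Fixpoint psum (a : nat -> C) (n : nat) : C :=
  match n with O => RtoC 0 | S n => (psum a n + a n)%C end.

Fixpoint rsum (a : nat -> R) (n : nat) : R :=
  match n with O => 0 | S n => rsum a n + a n end.

Lemma psum_sum_n (a : nat -> C) (n : nat) :
  sum_n (G := C_NormedModule) a n = psum a (S n).
Proof.
  induction n.
  - rewrite sum_O. simpl. rewrite Cplus_0_l. reflexivity.
  - rewrite sum_Sn, IHn. reflexivity.
Qed.

Lemma rsum_sum_n (a : nat -> R) (n : nat) : sum_n a n = rsum a (S n).
Proof.
  induction n.
  - rewrite sum_O. simpl. ring.
  - rewrite sum_Sn, IHn. reflexivity.
Qed.

Lemma CS_eps (a : nat -> C) (l : C) :
  CS a l <-> forall eps, 0 < eps -> exists N, forall n, (N <= n)%nat -> Cmod (psum a n - l) <= eps.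
Proof.
  assert (E := filterlim_locally_ball_norm (U := C_NormedModule) (F := eventually)
    (sum_n (G := C_NormedModule) a) l).
  split.
  - intros H0 eps He. assert (H := proj1 E H0). destruct (H (mkposreal _ He)) as [N HN]. exists (S N).
    intros n Hn. destruct n as [|n]; [lia|]. specialize (HN n ltac:(lia)).
    unfold ball_norm in HN. rewrite psum_sum_n in HN. left. exact HN.
  - intros H. apply (proj2 E). intros eps. destruct (H (eps / 2)) as [N HN]. { assert (H0 := cond_pos eps). lra. }
    exists N. intros n Hn. unfold ball_norm. rewrite psum_sum_n.
    specialize (HN (S n) ltac:(lia)).
    assert (H0 := cond_pos eps). eapply Rle_lt_trans; [exact HN|]. lra.
Qed.

Lemma CS_unique (a : nat -> C) (l l' : C) : CS a l -> CS a l' -> l = l'.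
Proof. intros H H'. exact (filterlim_locally_unique (V := C_NormedModule) _ _ _ H H'). Qed.

Lemma CS_ext (a b : nat -> C) (l : C) : (forall n, a n = b n) -> CS a l -> CS b l.
Proof. intros H. apply is_series_ext. exact H. Qed.

Lemma CS_plus (a b : nat -> C) (la lb : C) :
  CS a la -> CS b lb -> CS (fun n => a n + b n)%C (la + lb)%C.
Proof. exact (is_series_plus (V := C_NormedModule) a b la lb). Qed.

Lemma CS_scal (c : C) (a : nat -> C) (l : C) : CS a l -> CS (fun n => c * a n)%C (c * l)%C.
Proof. exact (is_series_scal (V := C_NormedModule) c a l). Qed.

Lemma CS_minus (a b : nat -> C) (la lb : C) :
  CS a la -> CS b lb -> CS (fun n => a n - b n)%C (la - lb)%C.
Proof. exact (is_series_minus (V := C_NormedModule) a b la lb). Qed.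

Lemma CS_incr (a : nat -> C) (l : C) : CS (fun n => a (S n)) l -> CS a (a O + l)%C.
Proof.
  intros H. apply is_series_decr_1.
  match goal with |- is_series _ ?x => replace x with l; [exact H|] end.
  change (l = (a 0%nat + l + - a 0%nat)%C). ring.
Qed.

Lemma rsum_le_Series (M : nat -> R) (n : nat) :
  (forall n, 0 <= M n) -> ex_series M -> rsum M n <= Series M.
Proof.
  intros Hp He. destruct n as [|n].
  - simpl. rewrite <- (is_series_unique (fun _ => 0) 0).
    + apply Series_le; [|exact He]. intros k; split; [lra|apply Hp].
    + apply is_series_Reals. intros eps Heps. exists O. intros m _.
      rewrite sum_eq_R0 by auto. unfold Rdist. rewrite Rminus_0_r, Rabs_R0. exact Heps.
  - rewrite (Series_incr_n M (S n)) by (auto; lia). simpl pred.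
    rewrite <- sum_n_Reals, rsum_sum_n.
    assert (0 <= Series (fun k => M (S n + k)%nat)); [|lra].
    apply Rle_trans with (Series (fun _ => 0)).
    + right. symmetry. apply is_series_unique. apply is_series_Reals. intros eps Heps. exists O. intros m _.
      rewrite sum_eq_R0 by auto. unfold Rdist. rewrite Rminus_0_r, Rabs_R0. exact Heps.
    + apply Series_le. { intros k; split; [lra|apply Hp]. }
      apply ex_series_incr_n. exact He.
Qed.

Lemma rsum_lim (M : nat -> R) : ex_series M ->
  forall eps, 0 < eps -> exists N, forall n, (N <= n)%nat -> Rabs (rsum M n - Series M) <= eps.
Proof.
  intros He eps Heps. assert (H := Series_correct _ He).
  apply is_series_Reals in H. destruct (H eps Heps) as [N HN].
  exists (S N). intros n Hn. destruct n as [|n]; [lia|].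
  rewrite <- rsum_sum_n, sum_n_Reals. left. apply HN. lia.
Qed.

Lemma psum_diff_le (a : nat -> C) (M : nat -> R) (n m : nat) :
  (forall n, Cmod (a n) <= M n) -> (n <= m)%nat ->
  Cmod (psum a m - psum a n) <= rsum M m - rsum M n.
Proof.
  intros H Hnm. induction Hnm as [|m Hnm IH].
  - replace (psum a n - psum a n)%C with (RtoC 0) by ring. rewrite Cmod_0. lra.
  - simpl. replace (psum a m + a m - psum a n)%C with (psum a m - psum a n + a m)%C by ring.
    eapply Rle_trans; [apply Cmod_triangle|]. specialize (H m). lra.
Qed.

Lemma CS_dom_ex (a : nat -> C) (M : nat -> R) :
  (forall n, Cmod (a n) <= M n) -> ex_series M -> exists l, CS a l.
Proof.
  intros H HM. apply (ex_series_le (V := C_CompleteNormedModule) a M); [|exact HM].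
  intros n. eapply Rle_trans; [|apply (H n)]. right. reflexivity.
Qed.

(** Beyond [n], partial sums stay within [rsum M m - rsum M n <= Series M - rsum M n] of [psum a n];
    a limit farther away by a gap [g] would contradict closeness [g / 2] of some partial sum. *)
Lemma CS_tail (a : nat -> C) (M : nat -> R) (l : C) (n : nat) :
  (forall n, Cmod (a n) <= M n) -> ex_series M -> CS a l ->
  Cmod (l - psum a n) <= Series M - rsum M n.
Proof.
  intros H HM Hl. apply Rnot_lt_le. intros Hlt.
  set (g := Cmod (l - psum a n) - (Series M - rsum M n)). assert (Hg : 0 < g) by (unfold g; lra).
  destruct (proj1 (CS_eps a l) Hl (g / 2)) as [N HN]; [lra|].
  set (m := max N n). specialize (HN m (Nat.le_max_l _ _)).
  assert (H1 := psum_diff_le a M n m H (Nat.le_max_r _ _)).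
  assert (Hp : forall n, 0 <= M n).
  { intros k. eapply Rle_trans; [apply Cmod_ge_0|apply H]. }
  assert (H2 := rsum_le_Series M m Hp HM).
  assert (H3 := Cmod_triangle (l - psum a m) (psum a m - psum a n)).
  replace (l - psum a m + (psum a m - psum a n))%C with (l - psum a n)%C in H3 by ring.
  rewrite (Cmod_sub_sym l (psum a m)) in H3. unfold g in *. lra.
Qed.

Lemma CS_bound (a : nat -> C) (M : nat -> R) (l : C) :
  (forall n, Cmod (a n) <= M n) -> ex_series M -> CS a l -> Cmod l <= Series M.
Proof.
  intros H HM Hl. assert (H1 := CS_tail a M l 0 H HM Hl). simpl in H1.
  replace (l - RtoC 0)%C with l in H1 by ring. lra.
Qed.

Lemma ex_series_bounded (a : nat -> R) (B : R) :
  (forall n, 0 <= a n) -> (forall n, rsum a n <= B) -> ex_series a.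
Proof.
  intros Hp HB.
  destruct (ex_finite_lim_seq_incr (fun n => sum_n a n) B) as [l Hl].
  - intros n. rewrite sum_Sn. change (sum_n a n <= sum_n a n + a (S n)). specialize (Hp (S n)). lra.
  - intros n. rewrite rsum_sum_n. apply HB.
  - exists l. exact Hl.
Qed.

(** Telescoping: with [p n = (n + 1)^(- e)], the inequality [1 / (n + 2) <= ln (n + 2) - ln (n + 1)]
    gives [(n + 2)^(- 1 - e) <= (p n - p (n + 1)) / e]. *)
Lemma ex_series_power (e : R) :
  0 < e -> ex_series (fun n => exp (- (1 + e) * ln (INR (S n)))).
Proof.
  intros He. set (p := fun n => exp (- e * ln (INR (S n)))).
  assert (Hpos : forall n, 0 < INR (S n)) by (intros; apply lt_0_INR; lia).
  apply ex_series_incr_1.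
  assert (Hstep : forall n, exp (- (1 + e) * ln (INR (S (S n)))) <= / e * (p n - p (S n))).
  { intros n. unfold p.
    replace (- e * ln (INR (S n))) with
      (- e * ln (INR (S (S n))) + e * (ln (INR (S (S n))) - ln (INR (S n)))) by ring.
    rewrite exp_plus.
    assert (Hln : / INR (S (S n)) <= ln (INR (S (S n))) - ln (INR (S n))).
    { assert (H1 : ln (INR (S n) / INR (S (S n))) <= INR (S n) / INR (S (S n)) - 1).
      { rewrite <- (ln_exp (_ - 1)). apply ln_le.
        { apply Rdiv_lt_0_compat; apply Hpos. }
        assert (H2 := exp_ineq1_le (INR (S n) / INR (S (S n)) - 1)). lra. }
      rewrite ln_div in H1 by apply Hpos.
      assert (H2 : INR (S n) / INR (S (S n)) - 1 = - / INR (S (S n))).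
      { rewrite (S_INR (S n)). field. assert (H3 := Hpos n). lra. }
      lra. }
    assert (H1 := exp_ineq1_le (e * (ln (INR (S (S n))) - ln (INR (S n))))).
    replace (- (1 + e) * ln (INR (S (S n)))) with (- e * ln (INR (S (S n))) + - ln (INR (S (S n)))) by ring.
    rewrite exp_plus, exp_Ropp, exp_ln by apply Hpos.
    assert (Hq := exp_pos (- e * ln (INR (S (S n))))).
    set (Q := exp (- e * ln (INR (S (S n))))) in *.
    set (T := exp (e * _)) in *.
    assert (e * / INR (S (S n)) <= T - 1) by (assert (e * / INR (S (S n)) <= e * (ln (INR (S (S n))) - ln (INR (S n)))) by (apply Rmult_le_compat_l; lra); lra).
    replace (/ e * (Q * T - Q)) with (Q * (/ e * (T - 1))) by ring.
    apply Rmult_le_compat_l; [lra|].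
    apply Rmult_le_reg_l with e; [exact He|]. rewrite <- Rmult_assoc, Rinv_r, Rmult_1_l by lra. exact H. }
  apply ex_series_bounded with (/ e * p 0%nat).
  - intros n. left. apply exp_pos.
  - intros n. apply Rle_trans with (/ e * (p 0%nat - p n)).
    + induction n; cbn [rsum]; [lra|]. specialize (Hstep n). lra.
    + apply Rmult_le_compat_l; [left; apply Rinv_0_lt_compat; exact He|].
      assert (H := exp_pos (- e * ln (INR (S n)))). unfold p at 2. lra.
Qed.

(** * Complex differentiability *)

Definition cdiff (f : C -> C) (z l : C) : Prop :=
  forall eps, 0 < eps -> exists d, 0 < d /\
    forall h, Cmod h < d -> Cmod (f (z + h) - f z - l * h)%C <= eps * Cmod h.

Definition holo (f : C -> C) (z : C) : Prop := exists l, cdiff f z l.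

(** [is_dirichlet_continuation] is phrased with [ex_derive] over [C_AbsRing]; this equivalence lets
    the rest work with the bare epsilon condition of [cdiff]. *)
Lemma holo_ex_derive (f : C -> C) (z : C) :
  holo f z <-> ex_derive (K := C_AbsRing) (V := C_NormedModule) f z.
Proof.
  split.
  - intros [l H]. exists l. split.
    + apply is_linear_scal_l.
    + intros x Hx.
      assert (Ex : z = x) by exact (is_filter_lim_locally_unique (V := AbsRing_NormedModule C_AbsRing) z x Hx).
      subst x.
      intros eps. destruct (H eps (cond_pos eps)) as [d [Hd H1]].
      exists (mkposreal d Hd). intros y0 Hy. set (y := y0 : C).
      change y0 with y in Hy |- *. clearbody y.
      specialize (H1 (y - z)%C Hy).
      replace (z + (y - z))%C with (y : C) in H1 by ring.
      change (Cmod (f y - f z - (y - z) * l)%C <= eps * Cmod (y - z)%C).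
      rewrite (Cmult_comm (y - z)%C l). exact H1.
  - intros [l [_ H]]. exists l. intros eps He.
    destruct (H z (fun P HP => HP) (mkposreal _ He)) as [d H1].
    exists (pos d). split; [apply cond_pos|]. intros h Hh.
    specialize (H1 (z + h)%C).
    assert (E : (z + h - z)%C = h) by ring.
    assert (Hb : ball (M := AbsRing_UniformSpace C_AbsRing) z d (z + h)%C).
    { change (Cmod (z + h - z)%C < d). rewrite E. exact Hh. }
    specialize (H1 Hb).
    change (Cmod (f (z + h) - f z - (z + h - z) * l)%C <= eps * Cmod (z + h - z)%C) in H1.
    rewrite E, (Cmult_comm h l) in H1. exact H1.
Qed.

(** * Integrals of complex-valued functions *)

(** Continuity by components, so that the continuity and integration lemmas for real functions apply
    to each one separately. *)
Definition rcont (f : R -> C) (t : R) : Prop :=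
  continuous (fun s => Re (f s)) t /\ continuous (fun s => Im (f s)) t.

Lemma rcont_pair (f g : R -> R) (t : R) :
  continuous f t -> continuous g t -> rcont (fun s => (f s, g s)) t.
Proof. intros; split; assumption. Qed.

Lemma rcont_RtoC (f : R -> R) (t : R) : continuous f t -> rcont (fun s => RtoC (f s)) t.
Proof. intros H; split; [exact H | apply continuous_const]. Qed.

Lemma rcont_const (c : C) (t : R) : rcont (fun _ => c) t.
Proof. split; apply continuous_const. Qed.

Lemma rcont_plus (f g : R -> C) (t : R) : rcont f t -> rcont g t -> rcont (fun s => f s + g s)%C t.
Proof.
  intros [H1 H2] [H3 H4]; split.
  - exact (continuous_plus (V := R_NormedModule) _ _ t H1 H3).
  - exact (continuous_plus (V := R_NormedModule) _ _ t H2 H4).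
Qed.

Lemma rcont_opp (f : R -> C) (t : R) : rcont f t -> rcont (fun s => - f s)%C t.
Proof.
  intros [H1 H2]; split.
  - exact (continuous_opp (V := R_NormedModule) _ t H1).
  - exact (continuous_opp (V := R_NormedModule) _ t H2).
Qed.

Lemma rcont_minus (f g : R -> C) (t : R) : rcont f t -> rcont g t -> rcont (fun s => f s - g s)%C t.
Proof. intros H1 H2. apply rcont_plus; [|apply rcont_opp]; assumption. Qed.

Lemma rcont_mult (f g : R -> C) (t : R) : rcont f t -> rcont g t -> rcont (fun s => f s * g s)%C t.
Proof.
  intros [H1 H2] [H3 H4]; split.
  - apply (continuous_minus (V := R_NormedModule) (fun s => Re (f s) * Re (g s)) (fun s => Im (f s) * Im (g s))).
    + exact (continuous_mult (K := R_AbsRing) _ _ t H1 H3).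
    + exact (continuous_mult (K := R_AbsRing) _ _ t H2 H4).
  - apply (continuous_plus (V := R_NormedModule) (fun s => Re (f s) * Im (g s)) (fun s => Im (f s) * Re (g s))).
    + exact (continuous_mult (K := R_AbsRing) _ _ t H1 H4).
    + exact (continuous_mult (K := R_AbsRing) _ _ t H2 H3).
Qed.

Lemma rcont_cexp (f : R -> C) (t : R) : rcont f t -> rcont (fun s => cexp (f s)) t.
Proof.
  intros [H1 H2]; unfold cexp; apply rcont_pair.
  - apply (continuous_mult (K := R_AbsRing)); [apply continuous_exp_comp|apply continuous_cos_comp]; assumption.
  - apply (continuous_mult (K := R_AbsRing)); [apply continuous_exp_comp|apply continuous_sin_comp]; assumption.
Qed.

Lemma continuous_eps (f : R -> R) (t : R) :
  continuous f t <-> forall eps, 0 < eps -> exists d, 0 < d /\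
    forall s, Rabs (s - t) < d -> Rabs (f s - f t) <= eps.
Proof.
  split.
  - intros H eps He. destruct (proj1 (filterlim_locally _ _) H (mkposreal _ He)) as [d Hd].
    exists d; split; [apply cond_pos|]. intros s Hs. left. exact (Hd s Hs).
  - intros H. apply filterlim_locally. intros eps.
    destruct (H (eps / 2)) as [d [Hd Hs]]. { assert (H0 := cond_pos eps). lra. }
    exists (mkposreal _ Hd). intros s H1. assert (H0 := cond_pos eps).
    change (Rabs (f s - f t) < eps). specialize (Hs s H1). lra.
Qed.

Lemma rcont_eps (f : R -> C) (t : R) :
  rcont f t <-> forall eps, 0 < eps -> exists d, 0 < d /\
    forall s, Rabs (s - t) < d -> Cmod (f s - f t) <= eps.
Proof.
  unfold rcont. rewrite !continuous_eps. split.
  - intros [H1 H2] eps He.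
    destruct (H1 (eps / 2)) as [d1 [Hd1 H3]]; [lra|].
    destruct (H2 (eps / 2)) as [d2 [Hd2 H4]]; [lra|].
    exists (Rmin d1 d2). split; [apply Rmin_pos; assumption|]. intros s Hs.
    eapply Rle_trans; [apply Cmod_le_abs|].
    assert (H5 := Rmin_l d1 d2). assert (H6 := Rmin_r d1 d2).
    specialize (H3 s ltac:(lra)). specialize (H4 s ltac:(lra)).
    rewrite Re_minus, Im_minus. lra.
  - intros H; split; intros eps He; destruct (H eps He) as [d [Hd Hs]]; exists d; (split; [exact Hd|]);
      intros s H1; eapply Rle_trans; [|apply (Hs s H1)| |apply (Hs s H1)].
    + apply (re_le_Cmod (f s - f t)).
    + apply (im_le_Cmod (f s - f t)).
Qed.

Lemma rcont_comp (f : R -> C) (g : R -> R) (t : R) :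
  continuous g t -> rcont f (g t) -> rcont (fun s => f (g s)) t.
Proof.
  intros Hg [H1 H2]; split.
  - exact (continuous_comp g (fun s => Re (f s)) t Hg H1).
  - exact (continuous_comp g (fun s => Im (f s)) t Hg H2).
Qed.

Lemma rcont_ext (f g : R -> C) (t : R) : (forall s, f s = g s) -> rcont f t -> rcont g t.
Proof. intros H. replace g with f; [tauto|]. apply functional_extensionality; exact H. Qed.

Lemma rcont_psum (f : nat -> R -> C) (t : R) (n : nat) :
  (forall k, rcont (f k) t) -> rcont (fun s => psum (fun k => f k s) n) t.
Proof.
  intros H. induction n; simpl.
  - apply rcont_const.
  - apply rcont_plus; auto.
Qed.

(** Componentwise as well, hence total; [cint_is] identifies it with the integral in
    [C_R_NormedModule], where norm inequalities are available. *)
Definition cint (f : R -> C) (a b : R) : C :=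
  (RInt (fun t => Re (f t)) a b, RInt (fun t => Im (f t)) a b).

Lemma ex_RInt_cont_le (f : R -> R) (a b : R) :
  a <= b -> (forall t, a <= t <= b -> continuous f t) -> ex_RInt f a b.
Proof.
  intros Hab H. apply (ex_RInt_continuous (V := R_CompleteNormedModule)). intros z.
  rewrite Rmin_left, Rmax_right by assumption. apply H.
Qed.

Lemma cint_ex_Re (f : R -> C) (a b : R) : a <= b -> (forall t, a <= t <= b -> rcont f t) ->
  ex_RInt (fun t => Re (f t)) a b.
Proof. intros H1 H2. apply ex_RInt_cont_le; [exact H1|]. intros; apply H2; assumption. Qed.

Lemma cint_ex_Im (f : R -> C) (a b : R) : a <= b -> (forall t, a <= t <= b -> rcont f t) ->
  ex_RInt (fun t => Im (f t)) a b.
Proof. intros H1 H2. apply ex_RInt_cont_le; [exact H1|]. intros; apply H2; assumption. Qed.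

Lemma cint_is (f : R -> C) (a b : R) : a <= b -> (forall t, a <= t <= b -> rcont f t) ->
  is_RInt (V := C_R_NormedModule) f a b (cint f a b).
Proof.
  intros H1 H2. apply (is_RInt_fct_extend_pair (U := R_NormedModule) (V := R_NormedModule)).
  - apply (RInt_correct (V := R_CompleteNormedModule)), cint_ex_Re; assumption.
  - apply (RInt_correct (V := R_CompleteNormedModule)), cint_ex_Im; assumption.
Qed.

Lemma cint_ext (f g : R -> C) (a b : R) : a <= b ->
  (forall t, a <= t <= b -> f t = g t) -> cint f a b = cint g a b.
Proof.
  intros Hab H. unfold cint. f_equal; apply RInt_ext; intros t;
    rewrite Rmin_left, Rmax_right by assumption; intros Ht; rewrite H by lra; reflexivity.
Qed.

Lemma cint_plus (f g : R -> C) (a b : R) : a <= b ->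
  (forall t, a <= t <= b -> rcont f t) -> (forall t, a <= t <= b -> rcont g t) ->
  cint (fun t => f t + g t)%C a b = (cint f a b + cint g a b)%C.
Proof.
  intros Hab Hf Hg. unfold cint. apply C_ext; simpl.
  - apply (RInt_plus (V := R_CompleteNormedModule)); apply cint_ex_Re; assumption.
  - apply (RInt_plus (V := R_CompleteNormedModule)); apply cint_ex_Im; assumption.
Qed.

Lemma cint_scal (c : C) (f : R -> C) (a b : R) : a <= b ->
  (forall t, a <= t <= b -> rcont f t) ->
  cint (fun t => c * f t)%C a b = (c * cint f a b)%C.
Proof.
  intros Hab Hf. assert (H1 := cint_ex_Re f a b Hab Hf). assert (H2 := cint_ex_Im f a b Hab Hf).
  assert (S : forall r h, ex_RInt h a b -> RInt (fun t => r * h t) a b = r * RInt h a b).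
  { intros r h Hh. exact (RInt_scal (V := R_CompleteNormedModule) h a b r Hh). }
  assert (E : forall r h, ex_RInt h a b -> ex_RInt (fun t => r * h t) a b).
  { intros r h Hh. exact (ex_RInt_scal (V := R_NormedModule) h a b r Hh). }
  unfold cint. apply C_ext; simpl.
  - rewrite <- !S by assumption.
    exact (RInt_minus (V := R_CompleteNormedModule) _ _ a b (E _ _ H1) (E _ _ H2)).
  - rewrite <- !S by assumption.
    exact (RInt_plus (V := R_CompleteNormedModule) _ _ a b (E _ _ H2) (E _ _ H1)).
Qed.

Lemma cint_minus (f g : R -> C) (a b : R) : a <= b ->
  (forall t, a <= t <= b -> rcont f t) -> (forall t, a <= t <= b -> rcont g t) ->
  cint (fun t => f t - g t)%C a b = (cint f a b - cint g a b)%C.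
Proof.
  intros Hab Hf Hg. rewrite (cint_ext _ (fun t => f t + RtoC (-1) * g t)%C); [|exact Hab|].
  2:{ intros. ring. }
  rewrite cint_plus, cint_scal; try assumption; [ring|].
  intros t Ht. apply rcont_mult; [apply rcont_const|apply Hg; exact Ht].
Qed.

Lemma cint_Chasles (f : R -> C) (a b c : R) : a <= b -> b <= c ->
  (forall t, a <= t <= c -> rcont f t) -> (cint f a b + cint f b c)%C = cint f a c.
Proof.
  intros Hab Hbc Hf. unfold cint. apply C_ext; simpl.
  - apply (RInt_Chasles (V := R_CompleteNormedModule)); apply cint_ex_Re; try assumption;
      intros; apply Hf; lra.
  - apply (RInt_Chasles (V := R_CompleteNormedModule)); apply cint_ex_Im; try assumption;
      intros; apply Hf; lra.
Qed.

Lemma norm_C_R (z : C) : norm (V := C_R_NormedModule) z = Cmod z.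
Proof. rewrite Cmod_norm. reflexivity. Qed.

Lemma cint_le (f : R -> C) (g : R -> R) (a b : R) : a <= b ->
  (forall t, a <= t <= b -> rcont f t) -> (forall t, a <= t <= b -> continuous g t) ->
  (forall t, a <= t <= b -> Cmod (f t) <= g t) -> Cmod (cint f a b) <= RInt g a b.
Proof.
  intros Hab Hf Hg H. rewrite <- norm_C_R.
  apply (norm_RInt_le (V := C_R_NormedModule) f g a b); [exact Hab| | |].
  - intros t Ht. rewrite norm_C_R. auto.
  - apply cint_is; assumption.
  - apply (RInt_correct (V := R_CompleteNormedModule)), ex_RInt_cont_le; assumption.
Qed.

Lemma cint_le_const (f : R -> C) (M a b : R) : a <= b ->
  (forall t, a <= t <= b -> rcont f t) ->
  (forall t, a <= t <= b -> Cmod (f t) <= M) -> Cmod (cint f a b) <= (b - a) * M.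
Proof.
  intros Hab Hf H. rewrite <- norm_C_R.
  apply (norm_RInt_le_const (V := C_R_NormedModule) f a b); [exact Hab| |].
  - intros t Ht. rewrite norm_C_R. auto.
  - apply cint_is; assumption.
Qed.

Lemma cint_const (c : C) (a b : R) : cint (fun _ => c) a b = (RtoC (b - a) * c)%C.
Proof.
  unfold cint. rewrite !RInt_const. destruct c as [x y].
  change ((((b - a) * x)%R, ((b - a) * y)%R) = (RtoC (b - a) * (x, y))%C).
  apply C_ext; simpl; ring.
Qed.

Lemma cint_FTC (f f' : R -> C) (a b : R) : a <= b ->
  (forall t, a <= t <= b -> is_derive (fun s => Re (f s)) t (Re (f' t))) ->
  (forall t, a <= t <= b -> is_derive (fun s => Im (f s)) t (Im (f' t))) ->
  (forall t, a <= t <= b -> rcont f' t) ->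
  cint f' a b = (f b - f a)%C.
Proof.
  intros Hab H1 H2 H3. unfold cint. apply C_ext; simpl;
  apply (is_RInt_unique (V := R_CompleteNormedModule)).
  - apply (is_RInt_derive (V := R_CompleteNormedModule) (fun s => Re (f s))); intros t;
      rewrite Rmin_left, Rmax_right by assumption; intros Ht; [apply H1 | apply H3]; exact Ht.
  - apply (is_RInt_derive (V := R_CompleteNormedModule) (fun s => Im (f s))); intros t;
      rewrite Rmin_left, Rmax_right by assumption; intros Ht; [apply H2 | apply H3]; exact Ht.
Qed.

Lemma cint_shift (f : R -> C) (c a b : R) : a <= b ->
  (forall t, a + c <= t <= b + c -> rcont f t) ->
  cint (fun t => f (t + c)) a b = cint f (a + c) (b + c).
Proof.
  intros Hab Hf.
  assert (E : forall h : R -> R, ex_RInt h (a + c) (b + c) ->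
      RInt (fun t => h (t + c)) a b = RInt h (a + c) (b + c)).
  { intros h Hh. rewrite <- (Rmult_1_l a), <- (Rmult_1_l b) at 2.
    rewrite <- (RInt_comp_lin (V := R_CompleteNormedModule) h 1 c a b) by (rewrite !Rmult_1_l; exact Hh).
    apply RInt_ext. intros t _. change (h (t + c) = 1 * h (1 * t + c)). rewrite !Rmult_1_l. reflexivity. }
  unfold cint. rewrite (E (fun t => Re (f t))), (E (fun t => Im (f t))); [reflexivity| |].
  - apply cint_ex_Im; [lra|assumption].
  - apply cint_ex_Re; [lra|assumption].
Qed.

Lemma cint_reflect (f : R -> C) (a b : R) : a <= b ->
  (forall t, - b <= t <= - a -> rcont f t) ->
  cint (fun t => f (- t)) a b = cint f (- b) (- a).
Proof.
  intros Hab Hf.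
  assert (E : forall h : R -> R, ex_RInt h (- b) (- a) -> RInt (fun t => h (- t)) a b = RInt h (- b) (- a)).
  { intros h Hh. rewrite <- (opp_RInt_swap (V := R_CompleteNormedModule) h (- a) (- b)) by (apply ex_RInt_swap; exact Hh).
    assert (H := RInt_comp_lin (V := R_CompleteNormedModule) h (-1) 0 a b).
    replace (-1 * a + 0) with (- a) in H by ring. replace (-1 * b + 0) with (- b) in H by ring.
    rewrite <- H by (apply ex_RInt_swap; exact Hh).
    rewrite <- (RInt_opp (V := R_CompleteNormedModule)).
    - apply RInt_ext. intros t _. change (h (- t) = - (-1 * h (-1 * t + 0))).
      replace (-1 * t + 0) with (- t) by ring. ring.
    - apply (ex_RInt_comp_lin (V := R_NormedModule)).
      replace (-1 * a + 0) with (- a) by ring. replace (-1 * b + 0) with (- b) by ring.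
      apply ex_RInt_swap. exact Hh. }
  unfold cint. rewrite (E (fun t => Re (f t))), (E (fun t => Im (f t))); [reflexivity| |].
  - apply cint_ex_Im; [lra|assumption].
  - apply cint_ex_Re; [lra|assumption].
Qed.

(** * Derivatives and Taylor remainders of the exponential *)

Lemma exp_le (x y : R) : x <= y -> exp x <= exp y.
Proof. intros [H|H]; [left; apply exp_increasing; exact H|right; rewrite H; reflexivity]. Qed.

Lemma cexp_scal (b : C) (t : R) :
  cexp (RtoC t * b) = (exp (t * Re b) * cos (t * Im b), exp (t * Re b) * sin (t * Im b)).
Proof. unfold cexp. rewrite re_scal_l, im_scal_l. reflexivity. Qed.

Lemma is_derive_cexp_Re (b : C) (t : R) :
  is_derive (fun s => Re (cexp (RtoC s * b))) t (Re (b * cexp (RtoC t * b))).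
Proof.
  rewrite Re_mult, cexp_scal.
  apply (is_derive_ext (fun s => exp (s * Re b) * cos (s * Im b))).
  { intros s. rewrite cexp_scal. reflexivity. }
  cbn [Re Im fst snd]. generalize (Re b) (Im b); intros x y.
  auto_derive; [tauto|]. ring.
Qed.

Lemma is_derive_cexp_Im (b : C) (t : R) :
  is_derive (fun s => Im (cexp (RtoC s * b))) t (Im (b * cexp (RtoC t * b))).
Proof.
  rewrite Im_mult, cexp_scal.
  apply (is_derive_ext (fun s => exp (s * Re b) * sin (s * Im b))).
  { intros s. rewrite cexp_scal. reflexivity. }
  cbn [Re Im fst snd]. generalize (Re b) (Im b); intros x y.
  auto_derive; [tauto|]. ring.
Qed.

Lemma rcont_scal_id (b : C) (t : R) : rcont (fun s => RtoC s * b)%C t.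
Proof.
  apply rcont_mult; [|apply rcont_const]. apply rcont_RtoC. apply continuous_id.
Qed.

Lemma Re_le_Cmod (z : C) : Re z <= Cmod z.
Proof. eapply Rle_trans; [apply Rle_abs|apply re_le_Cmod]. Qed.

Lemma cexp_line_le (h : C) (t : R) : 0 <= t <= 1 -> exp (Re (RtoC t * h)) <= exp (Cmod h).
Proof.
  intros Ht. rewrite re_scal_l.
  assert (H1 := Re_le_Cmod h). assert (H2 := Cmod_ge_0 h).
  destruct (Rle_dec (Re h) 0).
  - apply exp_le. nra.
  - apply exp_le. nra.
Qed.

Lemma Cmod_scal_le (h : C) (t : R) : 0 <= t <= 1 -> Cmod (RtoC t * h) <= Cmod h.
Proof.
  intros Ht. rewrite Cmod_mult, Cmod_R, Rabs_pos_eq by lra.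
  assert (H2 := Cmod_ge_0 h). nra.
Qed.

Lemma cint_le_01 (f : R -> C) (M : R) :
  (forall t, 0 <= t <= 1 -> rcont f t) ->
  (forall t, 0 <= t <= 1 -> Cmod (f t) <= M) -> Cmod (cint f 0 1) <= M.
Proof.
  intros H1 H2. replace M with ((1 - 0) * M) by ring. apply cint_le_const; [lra|exact H1|exact H2].
Qed.

(** Each remainder is the integral over [[0, 1]] of [h] times the preceding remainder at [s h]; the
    constants are not sharp, only the power of [Cmod h] matters. *)
Lemma cexp_taylor1 (h : C) : Cmod (cexp h - 1) <= Cmod h * exp (Cmod h).
Proof.
  assert (E := cint_FTC (fun s => cexp (RtoC s * h)) (fun s => h * cexp (RtoC s * h))%C 0 1 ltac:(lra)).
  cbv beta in E.
  rewrite Cmult_1_l, Cmult_0_l, cexp_0 in E. rewrite <- E.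
  - apply cint_le_01.
    + intros. apply rcont_mult; [apply rcont_const|apply rcont_cexp, rcont_scal_id].
    + intros t Ht. rewrite Cmod_mult, Cmod_cexp. apply Rmult_le_compat_l; [apply Cmod_ge_0|].
      apply cexp_line_le; exact Ht.
  - intros. apply is_derive_cexp_Re.
  - intros. apply is_derive_cexp_Im.
  - intros. apply rcont_mult; [apply rcont_const|apply rcont_cexp, rcont_scal_id].
Qed.

Lemma cexp_taylor2 (h : C) : Cmod (cexp h - 1 - h) <= Cmod h ^ 2 * exp (Cmod h).
Proof.
  assert (E := cint_FTC (fun s => cexp (RtoC s * h) - RtoC s * h)%C
     (fun s => h * (cexp (RtoC s * h) - 1))%C 0 1 ltac:(lra)).
  cbv beta in E.
  rewrite !Cmult_1_l, !Cmult_0_l, cexp_0 in E.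
  replace (cexp h - 1 - h)%C with (cexp h - h - (1 - 0))%C by ring. rewrite <- E.
  - apply cint_le_01.
    + intros. apply rcont_mult; [apply rcont_const|apply rcont_minus; [apply rcont_cexp, rcont_scal_id|apply rcont_const]].
    + intros t Ht. rewrite Cmod_mult. replace (Cmod h ^ 2 * exp (Cmod h)) with (Cmod h * (Cmod h * exp (Cmod h))) by ring.
      apply Rmult_le_compat_l; [apply Cmod_ge_0|].
      eapply Rle_trans; [apply cexp_taylor1|].
      apply Rmult_le_compat; [apply Cmod_ge_0|left; apply exp_pos|apply Cmod_scal_le; exact Ht|].
      apply exp_le, Cmod_scal_le, Ht.
  - intros t _. replace (Re (h * (cexp (t * h) - 1))) with (Re (h * cexp (RtoC t * h)) - Re h).
    2:{ rewrite <- Re_minus. f_equal. ring. }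
    apply (is_derive_minus (V := R_NormedModule) (fun s => Re (cexp (RtoC s * h))) (fun s => Re (RtoC s * h))).
    + apply is_derive_cexp_Re.
    + destruct h as [x y]; simpl. auto_derive; [tauto|]. ring.
  - intros t _. replace (Im (h * (cexp (t * h) - 1))) with (Im (h * cexp (RtoC t * h)) - Im h).
    2:{ rewrite <- Im_minus. f_equal. ring. }
    apply (is_derive_minus (V := R_NormedModule) (fun s => Im (cexp (RtoC s * h))) (fun s => Im (RtoC s * h))).
    + apply is_derive_cexp_Im.
    + destruct h as [x y]; simpl. auto_derive; [tauto|]. ring.
  - intros. apply rcont_mult; [apply rcont_const|apply rcont_minus; [apply rcont_cexp, rcont_scal_id|apply rcont_const]].
Qed.

Lemma cexp_taylor3 (h : C) : Cmod (cexp h - 1 - h - h * h / 2) <= Cmod h ^ 3 * exp (Cmod h).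
Proof.
  assert (E := cint_FTC (fun s => cexp (RtoC s * h) - RtoC s * h - RtoC (s * s / 2) * (h * h))%C
     (fun s => h * (cexp (RtoC s * h) - 1 - RtoC s * h))%C 0 1 ltac:(lra)).
  cbv beta in E.
  rewrite !Cmult_1_l, !Cmult_0_l, cexp_0 in E.
  replace (1 * 1 / 2) with (/ 2) in E by field. replace (0 * 0 / 2) with 0 in E by field.
  replace (cexp h - 1 - h - h * h / 2)%C with (cexp h - h - RtoC (/ 2) * (h * h) - (1 - 0 - 0 * (h * h)))%C.
  2:{ rewrite RtoC_inv by lra. field. }
  rewrite <- E.
  - apply cint_le_01.
    + intros. apply rcont_mult; [apply rcont_const|apply rcont_minus; [apply rcont_minus; [apply rcont_cexp, rcont_scal_id|apply rcont_const]|apply rcont_scal_id]].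
    + intros t Ht. rewrite Cmod_mult. replace (Cmod h ^ 3 * exp (Cmod h)) with (Cmod h * (Cmod h ^ 2 * exp (Cmod h))) by ring.
      apply Rmult_le_compat_l; [apply Cmod_ge_0|].
      eapply Rle_trans; [apply cexp_taylor2|].
      apply Rmult_le_compat; [apply pow_le, Cmod_ge_0|left; apply exp_pos| |].
      * apply pow_incr; split; [apply Cmod_ge_0|apply Cmod_scal_le; exact Ht].
      * apply exp_le, Cmod_scal_le, Ht.
  - intros t _. replace (Re (h * (cexp (t * h) - 1 - t * h)))
      with (Re (h * cexp (RtoC t * h)) - Re (h + RtoC t * (h * h))).
    2:{ rewrite <- Re_minus. f_equal. ring. }
    apply (is_derive_ext (fun s => Re (cexp (RtoC s * h)) - Re (RtoC s * h + RtoC (s * s / 2) * (h * h)))).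
    { intros s. rewrite <- Re_minus. f_equal. ring. }
    apply (is_derive_minus (V := R_NormedModule) (fun s => Re (cexp (RtoC s * h)))
       (fun s => Re (RtoC s * h + RtoC (s * s / 2) * (h * h)))).
    + apply is_derive_cexp_Re.
    + destruct h as [x y]; simpl. auto_derive; [tauto|]. field.
  - intros t _. replace (Im (h * (cexp (t * h) - 1 - t * h)))
      with (Im (h * cexp (RtoC t * h)) - Im (h + RtoC t * (h * h))).
    2:{ rewrite <- Im_minus. f_equal. ring. }
    apply (is_derive_ext (fun s => Im (cexp (RtoC s * h)) - Im (RtoC s * h + RtoC (s * s / 2) * (h * h)))).
    { intros s. rewrite <- Im_minus. f_equal. ring. }
    apply (is_derive_minus (V := R_NormedModule) (fun s => Im (cexp (RtoC s * h)))
       (fun s => Im (RtoC s * h + RtoC (s * s / 2) * (h * h)))).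
    + apply is_derive_cexp_Im.
    + destruct h as [x y]; simpl. auto_derive; [tauto|]. field.
  - intros. apply rcont_mult; [apply rcont_const|apply rcont_minus; [apply rcont_minus; [apply rcont_cexp, rcont_scal_id|apply rcont_const]|apply rcont_scal_id]].
Qed.

(** The form in which derivatives of exponentials, integrals and series are certified: a quadratic
    remainder with a uniform [M] survives summation and integration. *)
Lemma cdiff_second_order (f : C -> C) (z l : C) (M d : R) : 0 < d ->
  (forall h, Cmod h < d -> Cmod (f (z + h) - f z - l * h)%C <= M * Cmod h ^ 2) -> cdiff f z l.
Proof.
  intros Hd H eps He.
  assert (HM : 0 < Rabs M + 1) by (assert (H0 := Rabs_pos M); lra).
  exists (Rmin d (eps / (Rabs M + 1))). split.
  { apply Rmin_pos; [exact Hd|]. apply Rdiv_lt_0_compat; assumption. }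
  intros h Hh. assert (H1 := Rmin_l d (eps / (Rabs M + 1))). assert (H2 := Rmin_r d (eps / (Rabs M + 1))).
  eapply Rle_trans; [apply H; lra|].
  assert (H3 : (Rabs M + 1) * Cmod h <= eps).
  { replace eps with ((Rabs M + 1) * (eps / (Rabs M + 1))) by (field; lra).
    apply Rmult_le_compat_l; lra. }
  assert (H4 := Cmod_ge_0 h). assert (H5 := Rle_abs M). nra.
Qed.

Lemma holo_cont (f : C -> C) (z : C) : holo f z ->
  forall eps, 0 < eps -> exists d, 0 < d /\ forall w, Cmod (w - z) < d -> Cmod (f w - f z) <= eps.
Proof.
  intros [l H] eps He. destruct (H 1 Rlt_0_1) as [d [Hd H1]].
  assert (Hl := Cmod_ge_0 l).
  exists (Rmin d (eps / (Cmod l + 1))). split.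
  { apply Rmin_pos; [exact Hd|]. apply Rdiv_lt_0_compat; lra. }
  intros w Hw. assert (H2 := Rmin_l d (eps / (Cmod l + 1))). assert (H3 := Rmin_r d (eps / (Cmod l + 1))).
  specialize (H1 (w - z)%C ltac:(lra)). replace (z + (w - z))%C with w in H1 by ring.
  assert (H4 := Cmod_triangle (f w - f z - l * (w - z)) (l * (w - z))).
  replace (f w - f z - l * (w - z) + l * (w - z))%C with (f w - f z)%C in H4 by ring.
  rewrite Cmod_mult in H4.
  assert (H5 : (Cmod l + 1) * Cmod (w - z) <= eps).
  { replace eps with ((Cmod l + 1) * (eps / (Cmod l + 1))) by (field; lra).
    apply Rmult_le_compat_l; lra. }
  lra.
Qed.

Lemma holo_ext_loc (f g : C -> C) (z : C) (d : R) : 0 < d ->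
  (forall w, Cmod (w - z) < d -> f w = g w) -> holo f z -> holo g z.
Proof.
  intros Hd H [l Hl]. exists l. intros eps He. destruct (Hl eps He) as [d' [Hd' H']].
  exists (Rmin d d'). split; [apply Rmin_pos; assumption|].
  intros h Hh. assert (H1 := Rmin_l d d'). assert (H2 := Rmin_r d d').
  rewrite <- !H; [apply H'; lra| |].
  - replace (z - z)%C with (RtoC 0) by ring. rewrite Cmod_0. exact Hd.
  - replace (z + h - z)%C with h by ring. lra.
Qed.

Lemma holo_ext (f g : C -> C) (z : C) : (forall w, f w = g w) -> holo f z -> holo g z.
Proof. intros H. apply holo_ext_loc with 1; [lra|]. intros; apply H. Qed.

Lemma holo_const (c z : C) : holo (fun _ => c) z.
Proof.
  exists (RtoC 0). apply cdiff_second_order with 0 1; [lra|]. intros h _.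
  replace (c - c - 0 * h)%C with (RtoC 0) by ring. rewrite Cmod_0. lra.
Qed.

Lemma holo_id (z : C) : holo (fun w => w) z.
Proof.
  exists (RtoC 1). apply cdiff_second_order with 0 1; [lra|]. intros h _.
  replace (z + h - z - 1 * h)%C with (RtoC 0) by ring. rewrite Cmod_0. lra.
Qed.

Lemma holo_plus (f g : C -> C) (z : C) : holo f z -> holo g z -> holo (fun w => f w + g w)%C z.
Proof.
  intros [l H] [m K]. exists (l + m)%C. intros eps He.
  destruct (H (eps / 2)) as [d [Hd H1]]; [lra|]. destruct (K (eps / 2)) as [e [Hee K1]]; [lra|].
  exists (Rmin d e). split; [apply Rmin_pos; assumption|].
  intros h Hh. assert (H2 := Rmin_l d e). assert (H3 := Rmin_r d e).
  specialize (H1 h ltac:(lra)). specialize (K1 h ltac:(lra)).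
  replace (f (z + h) + g (z + h) - (f z + g z) - (l + m) * h)%C
    with ((f (z + h) - f z - l * h) + (g (z + h) - g z - m * h))%C by ring.
  eapply Rle_trans; [apply Cmod_triangle|]. lra.
Qed.

Lemma holo_comp (f g : C -> C) (z : C) : holo g z -> holo f (g z) -> holo (fun w => f (g w)) z.
Proof.
  intros Hg [l H]. assert (Hc := holo_cont g z Hg). destruct Hg as [m K].
  exists (l * m)%C. intros eps He.
  assert (Hm := Cmod_ge_0 m). assert (Hl := Cmod_ge_0 l).
  destruct (H (eps / (2 * (Cmod m + 1)))) as [d [Hd H1]].
  { apply Rdiv_lt_0_compat; lra. }
  destruct (K (Rmin 1 (eps / (2 * (Cmod l + 1))))) as [e [Hee K1]].
  { apply Rmin_pos; [lra|]. apply Rdiv_lt_0_compat; lra. }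
  destruct (Hc (d / 2)) as [e' [He' Hc1]]; [lra|].
  exists (Rmin e e'). split; [apply Rmin_pos; assumption|].
  intros h Hh. assert (H2 := Rmin_l e e'). assert (H3 := Rmin_r e e').
  specialize (K1 h ltac:(lra)). specialize (Hc1 (z + h)%C).
  replace (z + h - z)%C with h in Hc1 by ring. specialize (Hc1 ltac:(lra)).
  specialize (H1 (g (z + h)%C - g z)%C ltac:(lra)).
  replace (g z + (g (z + h)%C - g z))%C with (g (z + h)%C)%C in H1 by ring.
  assert (Hh0 := Cmod_ge_0 h).
  assert (H4 := Rmin_l 1 (eps / (2 * (Cmod l + 1)))). assert (H5 := Rmin_r 1 (eps / (2 * (Cmod l + 1)))).
  assert (K2 : Cmod (g (z + h)%C - g z) <= (Cmod m + 1) * Cmod h).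
  { assert (T := Cmod_triangle (g (z + h)%C - g z - m * h) (m * h)).
    replace (g (z + h)%C - g z - m * h + m * h)%C with (g (z + h)%C - g z)%C in T by ring.
    rewrite Cmod_mult in T. nra. }
  replace (f (g (z + h)%C) - f (g z) - l * m * h)%C with
    ((f (g (z + h)%C) - f (g z) - l * (g (z + h)%C - g z)) + l * (g (z + h)%C - g z - m * h))%C by ring.
  eapply Rle_trans; [apply Cmod_triangle|]. rewrite Cmod_mult.
  assert (H6 : eps / (2 * (Cmod m + 1)) * Cmod (g (z + h)%C - g z) <= eps / 2 * Cmod h).
  { replace (eps / 2 * Cmod h) with (eps / (2 * (Cmod m + 1)) * ((Cmod m + 1) * Cmod h)) by (field; lra).
    apply Rmult_le_compat_l; [|exact K2]. left. apply Rdiv_lt_0_compat; lra. }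
  assert (H7 : Cmod l * Cmod (g (z + h)%C - g z - m * h) <= eps / 2 * Cmod h).
  { replace (eps / 2 * Cmod h) with ((Cmod l + 1) * (eps / (2 * (Cmod l + 1)) * Cmod h)) by (field; lra).
    apply Rmult_le_compat; [exact Hl|apply Cmod_ge_0|lra|].
    eapply Rle_trans; [exact K1|]. apply Rmult_le_compat_r; [exact Hh0|exact H5]. }
  lra.
Qed.

Lemma holo_scal (c : C) (f : C -> C) (z : C) : holo f z -> holo (fun w => c * f w)%C z.
Proof.
  intros Hf. apply (holo_comp (fun w => c * w)%C f); [exact Hf|].
  exists c. apply cdiff_second_order with 0 1; [lra|]. intros h _.
  replace (c * (f z + h) - c * f z - c * h)%C with (RtoC 0) by ring. rewrite Cmod_0. lra.
Qed.

Lemma holo_minus (f g : C -> C) (z : C) : holo f z -> holo g z -> holo (fun w => f w - g w)%C z.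
Proof.
  intros Hf Hg. apply (holo_ext (fun w => f w + RtoC (-1) * g w)%C); [intros; ring|].
  apply holo_plus; [exact Hf|]. apply holo_scal, Hg.
Qed.

(** Polarisation [f g = ((f + g)^2 - (f - g)^2) / 4] reduces products to composition with the
    square. *)
Lemma holo_mult (f g : C -> C) (z : C) : holo f z -> holo g z -> holo (fun w => f w * g w)%C z.
Proof.
  intros Hf Hg.
  assert (Hsq : forall u, holo (fun w => w * w)%C u).
  { intros u. exists (2 * u)%C. apply cdiff_second_order with 1 1; [lra|]. intros h _.
    replace ((u + h) * (u + h) - u * u - 2 * u * h)%C with (h * h)%C by ring. rewrite Cmod_mult. lra. }
  apply (holo_ext (fun w => RtoC (/ 4) * ((f w + g w) * (f w + g w) - (f w - g w) * (f w - g w)))%C).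
  { intros w. rewrite RtoC_inv by lra. field. }
  apply holo_scal, holo_minus.
  - apply (holo_comp (fun w => w * w)%C (fun w => f w + g w)%C); [apply holo_plus; assumption|apply Hsq].
  - apply (holo_comp (fun w => w * w)%C (fun w => f w - g w)%C); [apply holo_minus; assumption|apply Hsq].
Qed.

Lemma holo_inv (f : C -> C) (z : C) : holo f z -> f z <> RtoC 0 -> holo (fun w => / f w)%C z.
Proof.
  intros Hf Hz. apply (holo_comp Cinv f); [exact Hf|].
  set (u := f z) in *. assert (Hu : 0 < Cmod u) by (apply Cmod_gt_0; exact Hz).
  exists (- / (u * u))%C. apply cdiff_second_order with (/ (Cmod u ^ 2 * (Cmod u / 2))) (Cmod u / 2); [lra|].
  intros h Hh.
  assert (H1 : Cmod u / 2 <= Cmod (u + h)).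
  { assert (T := Cmod_triangle (u + h) (- h)). rewrite Cmod_opp in T.
    replace (u + h + - h)%C with u in T by ring. lra. }
  assert (Huh : (u + h)%C <> RtoC 0) by (apply Cmod_gt_0; lra).
  replace (/ (u + h) - / u - - / (u * u) * h)%C with (h * h * / (u * u * (u + h)))%C by (field; auto).
  rewrite Cmod_mult, Cmod_inv, !Cmod_mult by (repeat apply Cmult_neq_0; assumption).
  replace (Cmod h * Cmod h * / (Cmod u * Cmod u * Cmod (u + h)))
    with (/ (Cmod u * Cmod u * Cmod (u + h)) * Cmod h ^ 2) by ring.
  apply Rmult_le_compat_r; [apply pow2_ge_0|].
  apply Rinv_le_contravar; [|simpl; rewrite Rmult_1_r; apply Rmult_le_compat_l; [|exact H1]].
  - apply Rmult_lt_0_compat; [apply pow_lt; exact Hu|lra].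
  - apply Rmult_le_pos; lra.
Qed.

Lemma holo_cexp (f : C -> C) (z : C) : holo f z -> holo (fun w => cexp (f w)) z.
Proof.
  intros Hf. apply (holo_comp cexp f); [exact Hf|]. set (u := f z).
  exists (cexp u). apply cdiff_second_order with (exp (Re u) * exp 1) 1; [lra|].
  intros h Hh. rewrite cexp_add.
  replace (cexp u * cexp h - cexp u - cexp u * h)%C with (cexp u * (cexp h - 1 - h))%C by ring.
  rewrite Cmod_mult, Cmod_cexp, Rmult_assoc. apply Rmult_le_compat_l; [left; apply exp_pos|].
  eapply Rle_trans; [apply cexp_taylor2|]. rewrite Rmult_comm.
  apply Rmult_le_compat_r; [apply pow2_ge_0|]. apply exp_le. lra.
Qed.

Lemma holo_cpow (x : R) (f : C -> C) (z : C) : holo f z -> holo (fun w => cpow x (f w)) z.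
Proof.
  intros Hf. apply holo_cexp. apply holo_mult; [exact Hf|apply holo_const].
Qed.

Lemma holo_csin (f : C -> C) (z : C) : holo f z -> holo (fun w => csin (f w)) z.
Proof.
  intros Hf. unfold csin, Cdiv. apply holo_mult; [|apply holo_const].
  apply holo_minus; apply holo_cexp.
  - apply holo_scal, Hf.
  - apply (holo_ext (fun w => (- Ci) * f w)%C); [intros; ring|]. apply holo_scal, Hf.
Qed.

Lemma holo_ccos (f : C -> C) (z : C) : holo f z -> holo (fun w => ccos (f w)) z.
Proof.
  intros Hf. unfold ccos, Cdiv. apply holo_mult; [|apply holo_const].
  apply holo_plus; apply holo_cexp.
  - apply holo_scal, Hf.
  - apply (holo_ext (fun w => (- Ci) * f w)%C); [intros; ring|]. apply holo_scal, Hf.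
Qed.

Lemma rcont_holo_comp (f : C -> C) (g : R -> C) (t : R) :
  holo f (g t) -> rcont g t -> rcont (fun s => f (g s)) t.
Proof.
  intros Hf Hg. apply rcont_eps. intros eps He.
  destruct (holo_cont f _ Hf eps He) as [d [Hd H]].
  destruct (proj1 (rcont_eps g t) Hg (d / 2)) as [e [Hee H1]]; [lra|].
  exists e; split; [exact Hee|]. intros s Hs. apply H. specialize (H1 s Hs). lra.
Qed.

(** * Cauchy theory and the identity theorem *)

Section Bisection.

Variable P : R -> R -> R -> Prop.
Variables x0 y0 s0 : R.
Hypothesis s0_pos : 0 < s0.

Let sub x y s := x0 <= x /\ x + s <= x0 + s0 /\ y0 <= y /\ y + s <= y0 + s0.

Hypothesis quarters : forall x y s, 0 < s -> sub x y s ->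
  P x y (s / 2) -> P (x + s / 2) y (s / 2) -> P x (y + s / 2) (s / 2) ->
  P (x + s / 2) (y + s / 2) (s / 2) -> P x y s.

Hypothesis small : forall px py, x0 <= px <= x0 + s0 -> y0 <= py <= y0 + s0 ->
  exists d, 0 < d /\ forall x y s, 0 < s < d -> sub x y s ->
    x <= px <= x + s -> y <= py <= y + s -> P x y s.

(** Corner of a quarter of side [s] on which [P] fails. The upper right one is the default: if the
    other three are good and the whole square is bad, it must be bad. *)
Let quarter (p : R * R) (s : R) : R * R :=
  let (x, y) := p in
  if excluded_middle_informative (P x y s) then
    if excluded_middle_informative (P (x + s) y s) then
      if excluded_middle_informative (P x (y + s) s) then (x + s, y + s) else (x, y + s)
    else (x + s, y)
  else (x, y).

Fixpoint bad_corner (n : nat) : R * R :=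
  match n with O => (x0, y0) | S n => quarter (bad_corner n) (s0 / 2 ^ S n) end.

(** Were [P] false on the large square, some quarter would be bad at every stage; the nested bad
    squares share a point, and finally one of them fits into the neighbourhood that [small] provides
    there. *)
Lemma square_bisection : P x0 y0 s0.
Proof.
  apply NNPP. intros Hbad.
  set (s := fun n : nat => s0 / 2 ^ n).
  assert (Hs : forall n, 0 < s n).
  { intros n. apply Rdiv_lt_0_compat; [exact s0_pos|]. apply pow_lt. lra. }
  assert (Hs2 : forall n, s (S n) = s n / 2).
  { intros n. unfold s. simpl. field. apply pow_nonzero. lra. }
  set (X := fun n => fst (bad_corner n)). set (Y := fun n => snd (bad_corner n)).
  assert (Hstep : forall n, (X (S n) = X n \/ X (S n) = X n + s (S n)) /\
     (Y (S n) = Y n \/ Y (S n) = Y n + s (S n))).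
  { intros n. unfold X, Y. cbn [bad_corner]. fold (s (S n)). destruct (bad_corner n) as [x y].
    unfold quarter. repeat destruct excluded_middle_informative; simpl; tauto. }
  assert (Hinv : forall n, sub (X n) (Y n) (s n) /\ ~ P (X n) (Y n) (s n)).
  { induction n as [|n [IH1 IH2]].
    - unfold X, Y, s, sub. simpl. replace (s0 / 1) with s0 by field. repeat split; try lra. exact Hbad.
    - split.
      + destruct (Hstep n) as [Hx Hy]. specialize (Hs2 n). assert (H := Hs (S n)).
        unfold sub in *. destruct Hx as [-> | ->], Hy as [-> | ->]; lra.
      + assert (Q := quarters (X n) (Y n) (s n) (Hs n) IH1). rewrite <- Hs2 in Q.
        unfold X, Y in *. cbn [bad_corner]. fold (s (S n)). destruct (bad_corner n) as [x y].
        unfold quarter. cbn [fst snd] in *.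
        repeat destruct excluded_middle_informative; simpl; auto. }
  assert (Hnest : forall n m, X n <= X (n + m)%nat /\ X (n + m)%nat + s (n + m)%nat <= X n + s n /\
      Y n <= Y (n + m)%nat /\ Y (n + m)%nat + s (n + m)%nat <= Y n + s n).
  { intros n m. induction m as [|m IH].
    - rewrite Nat.add_0_r. lra.
    - rewrite Nat.add_succ_r. destruct (Hstep (n + m)%nat) as [Hx Hy].
      specialize (Hs2 (n + m)%nat). assert (H := Hs (S (n + m))).
      destruct Hx as [-> | ->], Hy as [-> | ->]; lra. }
  assert (Hcross : forall n m, X n <= X m + s m /\ Y n <= Y m + s m).
  { intros n m. assert (H1 := Hnest n m). assert (H2 := Hnest m n). rewrite Nat.add_comm in H2.
    assert (H3 := Hs (n + m)%nat). lra. }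
  (* The common point is the supremum of the lower left corners, coordinate by coordinate. *)
  assert (Hlub : forall Z : nat -> R, (forall n m, Z n <= Z m + s m) ->
      exists p, forall n, Z n <= p <= Z n + s n).
  { intros Z HZ. destruct (completeness (fun v => exists n, v = Z n)) as [p [Hp1 Hp2]].
    - exists (Z 0%nat + s 0%nat). intros v [n ->]. apply HZ.
    - exists (Z 0%nat), 0%nat. reflexivity.
    - exists p. intros n; split; [apply Hp1; exists n; reflexivity|].
      apply Hp2. intros v [m ->]. apply HZ. }
  destruct (Hlub X) as [px Hpx]; [intros; apply Hcross|].
  destruct (Hlub Y) as [py Hpy]; [intros; apply Hcross|].
  destruct (small px py) as [d [Hd Hsm]].
  { assert (H := Hpx 0%nat). unfold X, s in H. simpl in H. lra. }
  { assert (H := Hpy 0%nat). unfold Y, s in H. simpl in H. lra. }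
  destruct (pow_lt_1_zero (/ 2)) with (y := d / s0) as [n Hn].
  { rewrite Rabs_pos_eq; lra. }
  { apply Rdiv_lt_0_compat; assumption. }
  specialize (Hn n (Nat.le_refl n)).
  destruct (Hinv n) as [H1 H2]. apply H2. apply Hsm; [split; [apply Hs|]|exact H1|apply Hpx|apply Hpy].
  rewrite Rabs_pos_eq, pow_inv in Hn by (apply pow_le; lra).
  unfold s, Rdiv. apply Rmult_lt_reg_r with (/ s0); [apply Rinv_0_lt_compat; exact s0_pos|].
  replace (s0 * / 2 ^ n * / s0) with (/ 2 ^ n) by (field; split; [lra|apply pow_nonzero; lra]).
  exact Hn.
Qed.

End Bisection.

(** Integral of [H] along the positively oriented boundary of [[a, b] x [c, d]]. *)
Definition boundary (H : C -> C) (a b c d : R) : C :=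
  (cint (fun x => H (x, c)) a b + Ci * cint (fun y => H (b, y)) c d
   - cint (fun x => H (x, d)) a b - Ci * cint (fun y => H (a, y)) c d)%C.

Definition cont_on (H : C -> C) (a b c d : R) : Prop :=
  (forall y, c <= y <= d -> forall x, a <= x <= b -> rcont (fun x => H (x, y)) x) /\
  (forall x, a <= x <= b -> forall y, c <= y <= d -> rcont (fun y => H (x, y)) y).

Lemma cont_on_sub (H : C -> C) (a b c d a' b' c' d' : R) :
  a <= a' -> b' <= b -> c <= c' -> d' <= d -> cont_on H a b c d -> cont_on H a' b' c' d'.
Proof. intros ? ? ? ? [H1 H2]; split; intros; [apply H1|apply H2]; lra. Qed.

Lemma boundary_split_h (H : C -> C) (a m b c d : R) : a <= m <= b -> c <= d -> cont_on H a b c d ->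
  boundary H a b c d = (boundary H a m c d + boundary H m b c d)%C.
Proof.
  intros Hm Hcd [H1 H2]. unfold boundary.
  rewrite <- (cint_Chasles (fun x => H (x, c)) a m b), <- (cint_Chasles (fun x => H (x, d)) a m b);
    try lra; try (apply H1; lra). ring.
Qed.

Lemma boundary_split_v (H : C -> C) (a b c m d : R) : c <= m <= d -> a <= b -> cont_on H a b c d ->
  boundary H a b c d = (boundary H a b c m + boundary H a b m d)%C.
Proof.
  intros Hm Hab [H1 H2]. unfold boundary.
  rewrite <- (cint_Chasles (fun y => H (a, y)) c m d), <- (cint_Chasles (fun y => H (b, y)) c m d);
    try lra; try (apply H2; lra). ring.
Qed.

Lemma boundary_minus (H A : C -> C) (a b c d : R) : a <= b -> c <= d ->
  cont_on H a b c d -> cont_on A a b c d ->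
  boundary (fun z => H z - A z)%C a b c d = (boundary H a b c d - boundary A a b c d)%C.
Proof.
  intros Hab Hcd [H1 H2] [A1 A2]. unfold boundary.
  rewrite !cint_minus; try lra; try (apply H1; lra); try (apply H2; lra); try (apply A1; lra); try (apply A2; lra).
  ring.
Qed.

(** Affine functions have the primitive [al z + be z^2 / 2], whose corner values cancel around the
    rectangle. *)
Lemma boundary_affine (al be : C) (a b c d : R) : a <= b -> c <= d ->
  boundary (fun z => al + be * z)%C a b c d = RtoC 0.
Proof.
  intros Hab Hcd.
  set (G := fun z : C => (al * z + be * (z * z * RtoC (/ 2)))%C).
  assert (Hh : forall y, cint (fun x => al + be * (x, y))%C a b = (G (b, y) - G (a, y))%C).
  { intros y. apply (cint_FTC (fun x => G (x, y))); [exact Hab| | |].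
    - intros t _. unfold G. destruct al, be; simpl. auto_derive; [tauto|]. field.
    - intros t _. unfold G. destruct al, be; simpl. auto_derive; [tauto|]. field.
    - intros t _. apply rcont_plus; [apply rcont_const|]. apply rcont_mult; [apply rcont_const|].
      apply rcont_pair; [apply continuous_id|apply continuous_const]. }
  assert (Hv : forall x, (Ci * cint (fun y => al + be * (x, y)) c d)%C = (G (x, d) - G (x, c))%C).
  { intros x.
    assert (Hc : forall t, rcont (fun y => al + be * (x, y))%C t).
    { intros t. apply rcont_plus; [apply rcont_const|]. apply rcont_mult; [apply rcont_const|].
      apply rcont_pair; [apply continuous_const|apply continuous_id]. }
    rewrite <- cint_scal by auto.
    apply (cint_FTC (fun y => G (x, y))); [exact Hcd| | |].
    - intros t _. unfold G. destruct al, be; simpl. auto_derive; [tauto|]. field.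
    - intros t _. unfold G. destruct al, be; simpl. auto_derive; [tauto|]. field.
    - intros t _. apply rcont_mult; [apply rcont_const|apply Hc]. }
  unfold boundary. rewrite !Hh, !Hv. ring.
Qed.

Lemma boundary_le (H : C -> C) (M a b c d : R) : a <= b -> c <= d -> cont_on H a b c d ->
  (forall x y, a <= x <= b -> c <= y <= d -> Cmod (H (x, y)) <= M) ->
  Cmod (boundary H a b c d) <= 2 * ((b - a) + (d - c)) * M.
Proof.
  intros Hab Hcd [H1 H2] HM. unfold boundary.
  assert (E1 : Cmod (cint (fun x => H (x, c)) a b) <= (b - a) * M).
  { apply cint_le_const; [exact Hab|apply H1; lra|]. intros; apply HM; lra. }
  assert (E2 : Cmod (cint (fun y => H (b, y)) c d) <= (d - c) * M).
  { apply cint_le_const; [exact Hcd|apply H2; lra|]. intros; apply HM; lra. }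
  assert (E3 : Cmod (cint (fun x => H (x, d)) a b) <= (b - a) * M).
  { apply cint_le_const; [exact Hab|apply H1; lra|]. intros; apply HM; lra. }
  assert (E4 : Cmod (cint (fun y => H (a, y)) c d) <= (d - c) * M).
  { apply cint_le_const; [exact Hcd|apply H2; lra|]. intros; apply HM; lra. }
  assert (Hi : Cmod Ci = 1) by exact Cmod_Ci.
  eapply Rle_trans; [apply Cmod_triangle_minus|].
  eapply Rle_trans; [apply Rplus_le_compat_r, Cmod_triangle_minus|].
  eapply Rle_trans; [apply Rplus_le_compat_r, Rplus_le_compat_r, Cmod_triangle|].
  rewrite !Cmod_mult, Hi. lra.
Qed.

Lemma holo_cont_on (H : C -> C) (a b c d : R) :
  (forall x y, a <= x <= b -> c <= y <= d -> holo H (x, y)) -> cont_on H a b c d.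
Proof.
  intros Hh; split; intros.
  - apply (rcont_holo_comp H (fun x => (x, y))); [apply Hh; assumption|].
    apply rcont_pair; [apply continuous_id|apply continuous_const].
  - apply (rcont_holo_comp H (fun y => (x, y))); [apply Hh; assumption|].
    apply rcont_pair; [apply continuous_const|apply continuous_id].
Qed.

(** Goursat's subdivision. The rectangle is parametrised by the unit square, so that all pieces keep
    its proportions and the bisection of squares applies; the bound [eps * s ^ 2] is additive over
    the four quarters, and near a point [H] differs from an affine function by a small multiple of
    the diameter. *)
Lemma goursat (H : C -> C) (a b c d : R) : a <= b -> c <= d ->
  (forall x y, a <= x <= b -> c <= y <= d -> holo H (x, y)) -> boundary H a b c d = RtoC 0.
Proof.
  intros Hab Hcd Hh. assert (Hc := holo_cont_on H a b c d Hh).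
  set (W := b - a). set (V := d - c).
  set (X := fun s => a + W * s). set (Y := fun s => c + V * s).
  assert (HW : 0 <= W) by (unfold W; lra). assert (HV : 0 <= V) by (unfold V; lra).
  apply Cmod_zero_le. intros eps He.
  assert (G : Cmod (boundary H (X 0) (X (0 + 1)) (Y 0) (Y (0 + 1))) <= eps * 1 ^ 2).
  2:{ unfold X, Y, W, V in G. replace (a + (b - a) * 0) with a in G by ring.
      replace (a + (b - a) * (0 + 1)) with b in G by ring.
      replace (c + (d - c) * 0) with c in G by ring.
      replace (c + (d - c) * (0 + 1)) with d in G by ring. lra. }
  apply (square_bisection
    (fun x y s => Cmod (boundary H (X x) (X (x + s)) (Y y) (Y (y + s))) <= eps * s ^ 2) 0 0 1); [lra| |].
  - intros x y s Hs [S1 [S2 [S3 S4]]] Q1 Q2 Q3 Q4.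
    replace (x + s / 2 + s / 2) with (x + s) in * by field.
    replace (y + s / 2 + s / 2) with (y + s) in * by field.
    assert (X1 : a <= X x) by (unfold X; nra).
    assert (X2 : X x <= X (x + s / 2)) by (unfold X; nra).
    assert (X3 : X (x + s / 2) <= X (x + s)) by (unfold X; nra).
    assert (X4 : X (x + s) <= b) by (unfold X, W in *; nra).
    assert (Y1 : c <= Y y) by (unfold Y; nra).
    assert (Y2 : Y y <= Y (y + s / 2)) by (unfold Y; nra).
    assert (Y3 : Y (y + s / 2) <= Y (y + s)) by (unfold Y; nra).
    assert (Y4 : Y (y + s) <= d) by (unfold Y, V in *; nra).
    rewrite (boundary_split_h H _ (X (x + s / 2))), (boundary_split_v H _ _ _ (Y (y + s / 2))),
      (boundary_split_v H (X (x + s / 2)) _ _ (Y (y + s / 2))); try lra;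
      try (apply (cont_on_sub H a b c d); try lra; exact Hc).
    eapply Rle_trans; [apply Cmod_triangle|].
    eapply Rle_trans; [apply Rplus_le_compat; apply Cmod_triangle|].
    replace (eps * s ^ 2) with (4 * (eps * (s / 2) ^ 2)) by field. lra.
  - intros px py Hpx Hpy.
    assert (Hp : a <= X px <= b) by (unfold X, W in *; nra).
    assert (Hq : c <= Y py <= d) by (unfold Y, V in *; nra).
    destruct (Hh (X px) (Y py) Hp Hq) as [l Hl]. set (p := (X px, Y py) : C) in *.
    (* Perimeter [2 (W + V) s] times error [eta (W + V) s] must not exceed [eps s^2]; the [+ 1]
       covers degenerate rectangles. *)
    set (eta := eps / (2 * (W + V) ^ 2 + 1)).
    assert (Hden : 0 < 2 * (W + V) ^ 2 + 1) by (assert (T := pow2_ge_0 (W + V)); lra).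
    assert (Heta : 0 < eta) by (apply Rdiv_lt_0_compat; lra).
    destruct (Hl eta Heta) as [dl [Hdl Hb]].
    exists (dl / (W + V + 1)). split; [apply Rdiv_lt_0_compat; lra|].
    intros x y s [Hs1 Hs2] [S1 [S2 [S3 S4]]] Ix Iy.
    set (A := fun z : C => ((H p - l * p) + l * z)%C).
    assert (X1 : a <= X x) by (unfold X; nra).
    assert (X2 : X x <= X (x + s)) by (unfold X; nra).
    assert (X4 : X (x + s) <= b) by (unfold X, W in *; nra).
    assert (Y1 : c <= Y y) by (unfold Y; nra).
    assert (Y2 : Y y <= Y (y + s)) by (unfold Y; nra).
    assert (Y4 : Y (y + s) <= d) by (unfold Y, V in *; nra).
    assert (HcA : cont_on A (X x) (X (x + s)) (Y y) (Y (y + s))).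
    { apply holo_cont_on. intros. unfold A. apply holo_plus; [apply holo_const|apply holo_scal, holo_id]. }
    assert (HcH : cont_on H (X x) (X (x + s)) (Y y) (Y (y + s))).
    { apply (cont_on_sub H a b c d); try lra. exact Hc. }
    assert (E := boundary_minus H A _ _ _ _ X2 Y2 HcH HcA).
    unfold A in E at 2. rewrite boundary_affine in E by assumption.
    replace (boundary H (X x) (X (x + s)) (Y y) (Y (y + s)))
      with (boundary (fun z => H z - A z)%C (X x) (X (x + s)) (Y y) (Y (y + s))) by (rewrite E; ring).
    assert (Hlt : (W + V) * s < dl).
    { apply Rle_lt_trans with ((W + V + 1) * s); [nra|].
      replace dl with ((W + V + 1) * (dl / (W + V + 1))) by (field; lra).
      apply Rmult_lt_compat_l; lra. }
    eapply Rle_trans; [apply (boundary_le _ (eta * ((W + V) * s)))|]; try assumption.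
    + apply holo_cont_on. intros. apply holo_minus.
      * apply Hh; lra.
      * apply holo_plus; [apply holo_const|apply holo_scal, holo_id].
    + intros u v Hu Hv. unfold A. set (w := (u, v) : C).
      assert (D : Cmod ((u, v) - p) <= (W + V) * s).
      { eapply Rle_trans; [apply Cmod_le_abs|]. unfold p. simpl. change (u + - X px) with (u - X px).
        change (v + - Y py) with (v - Y py).
        assert (Rabs (u - X px) <= W * s) by (apply Rabs_le; unfold X in *; nra).
        assert (Rabs (v - Y py) <= V * s) by (apply Rabs_le; unfold Y in *; nra). lra. }
      change ((u, v) : C) with w in D. change (Cmod (H w - (H p - l * p + l * w)) <= eta * ((W + V) * s)).
      specialize (Hb (w - p)%C ltac:(lra)).
      replace (p + (w - p))%C with w in Hb by ring.
      replace (H w - (H p - l * p + l * w))%C with (H w - H p - l * (w - p))%C by ring.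
      eapply Rle_trans; [exact Hb|]. apply Rmult_le_compat_l; lra.
    + replace (X (x + s) - X x + (Y (y + s) - Y y)) with ((W + V) * s) by (unfold X, Y; ring).
      replace eps with (eta * (2 * (W + V) ^ 2 + 1)) by (unfold eta; field; lra).
      assert (0 <= eta * s ^ 2) by (apply Rmult_le_pos; [lra|apply pow2_ge_0]). nra.
Qed.

Lemma Cmult_integral (z w : C) : (z * w)%C = RtoC 0 -> z = RtoC 0 \/ w = RtoC 0.
Proof.
  intros H. destruct (classic (z = RtoC 0)) as [Hz|Hz]; [tauto|].
  destruct (classic (w = RtoC 0)) as [Hw|Hw]; [tauto|].
  exfalso. exact (Cmult_neq_0 z w Hz Hw H).
Qed.

Lemma cexp_2PI (z : C) : cexp (z + (0, 2 * PI)) = cexp z.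
Proof.
  rewrite cexp_add. replace (cexp (0, 2 * PI)) with (RtoC 1); [ring|].
  unfold cexp; cbn [Re Im fst snd]. rewrite exp_0, cos_2PI, sin_2PI. apply C_ext; simpl; ring.
Qed.

Lemma cexp_polar (r t : R) : 0 < r -> cexp (ln r, t) = (RtoC r * cexp (0, t))%C.
Proof.
  intros Hr. unfold cexp; cbn [Re Im fst snd]. rewrite exp_ln, exp_0 by exact Hr. apply C_ext; simpl; ring.
Qed.

Lemma Cmod_cexp_imag (t : R) : Cmod (cexp (0, t)) = 1.
Proof. rewrite Cmod_cexp. cbn. apply exp_0. Qed.

Lemma rcont_circle (c : C) (r t : R) : rcont (fun t => c + RtoC r * cexp (0, t))%C t.
Proof.
  apply rcont_plus; [apply rcont_const|]. apply rcont_mult; [apply rcont_const|].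
  apply rcont_cexp, rcont_pair; [apply continuous_const|apply continuous_id].
Qed.

(* In logarithmic coordinates [z = c + exp w] an annulus becomes a rectangle of height [2 PI], on
   which the two horizontal sides of the boundary integral cancel by periodicity. *)
Lemma circle_mean_const (F : C -> C) (c : C) (R0 r1 r2 : R) : 0 < r1 <= r2 -> r2 < R0 ->
  (forall z, Cmod (z - c) < R0 -> holo F z) ->
  cint (fun t => F (c + RtoC r1 * cexp (0, t))%C) 0 (2 * PI) =
  cint (fun t => F (c + RtoC r2 * cexp (0, t))%C) 0 (2 * PI).
Proof.
  intros Hr HR HF. assert (Hpi := PI_RGT_0).
  assert (Hln : ln r1 <= ln r2) by (apply ln_le; lra).
  assert (G := goursat (fun w => F (c + cexp w)%C) (ln r1) (ln r2) 0 (2 * PI) Hln ltac:(lra)).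
  rewrite (cint_ext _ (fun t => F (c + cexp (ln r1, t))%C)) by
    (try lra; intros; rewrite cexp_polar by lra; reflexivity).
  rewrite (cint_ext (fun t => F (c + RtoC r2 * cexp (0, t))%C) (fun t => F (c + cexp (ln r2, t))%C)) by
    (try lra; intros; rewrite cexp_polar by lra; reflexivity).
  unfold boundary in G.
  rewrite (cint_ext (fun x => F (c + cexp (x, (2 * PI)%R))%C) (fun x => F (c + cexp (x, 0))%C)) in G; [|exact Hln|].
  2:{ intros t _. f_equal. f_equal. rewrite <- (cexp_2PI (t, 0)). f_equal.
      apply C_ext; simpl; ring. }
  assert (Hi : Ci <> RtoC 0) by exact Ci_nz.
  match type of G with _ -> (?A + Ci * ?B - ?A' - Ci * ?D)%C = _ => 
    assert (E : (Ci * (B - D))%C = RtoC 0); [rewrite <- G; [ring|]|] end.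
  - intros x y Hx Hy. apply (holo_comp F (fun w => c + cexp w)%C).
    + apply holo_plus; [apply holo_const|apply holo_cexp, holo_id].
    + apply HF. replace (c + cexp (x, y) - c)%C with (cexp (x, y)) by ring.
      rewrite Cmod_cexp. cbn. apply Rle_lt_trans with r2; [|exact HR].
      rewrite <- (exp_ln r2) by lra. apply exp_le. lra.
  - apply Cmult_integral in E. destruct E as [E|E]; [contradiction|].
    symmetry. apply Ceq_minus. exact E.
Qed.

(** The circle integral does not depend on the radius; as the radius shrinks, continuity at [c]
    gives the value. *)
Lemma mean_value (F : C -> C) (c : C) (R0 r : R) : 0 < r < R0 ->
  (forall z, Cmod (z - c) < R0 -> holo F z) ->
  cint (fun t => F (c + RtoC r * cexp (0, t))%C) 0 (2 * PI) = (RtoC (2 * PI) * F c)%C.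
Proof.
  intros Hr HF. assert (Hpi := PI_RGT_0).
  apply Ceq_minus. apply Cmod_zero_le. intros eps He.
  assert (Hc : holo F c).
  { apply HF. replace (c - c)%C with (RtoC 0) by ring. rewrite Cmod_0. lra. }
  destruct (holo_cont F c Hc (eps / (2 * PI))) as [d [Hd H]]; [apply Rdiv_lt_0_compat; lra|].
  set (r' := Rmin r (d / 2)).
  assert (Hr' : 0 < r' <= r) by (split; [apply Rmin_pos; lra|apply Rmin_l]).
  assert (Hr'd : r' < d) by (assert (T := Rmin_r r (d / 2)); unfold r'; lra).
  rewrite <- (circle_mean_const F c R0 r' r) by (try lra; assumption).
  replace (RtoC (2 * PI) * F c)%C with (cint (fun _ => F c) 0 (2 * PI)) by (rewrite cint_const; f_equal; f_equal; ring).
  assert (Hdist : forall t, Cmod (c + RtoC r' * cexp (0, t) - c) = r').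
  { intros t. replace (c + RtoC r' * cexp (0, t) - c)%C with (RtoC r' * cexp (0, t))%C by ring.
    rewrite Cmod_mult, Cmod_cexp_imag, Cmod_R, Rabs_pos_eq; lra. }
  assert (Hcont : forall t, rcont (fun t => F (c + RtoC r' * cexp (0, t))%C) t).
  { intros t. apply (rcont_holo_comp F (fun t => c + RtoC r' * cexp (0, t))%C); [|apply rcont_circle].
    apply HF. rewrite Hdist. lra. }
  rewrite <- cint_minus; try lra; auto; [|intros; apply rcont_const].
  replace eps with ((2 * PI - 0) * (eps / (2 * PI))) by (field; lra).
  apply cint_le_const; [lra| |].
  - intros. apply rcont_minus; [apply Hcont|apply rcont_const].
  - intros t _. apply H. rewrite Hdist. exact Hr'd.
Qed.

(** * Compactness of the disc and the maximum principle *)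

Definition ucont (u : C -> R) (z : C) : Prop :=
  forall eps, 0 < eps -> exists d, 0 < d /\ forall w, Cmod (w - z) < d -> Rabs (u w - u z) <= eps.

(** Compactness of the disc, as induction over sets: bisecting the circumscribed square leaves
    pieces so small that the local hypothesis applies, and unions glue them back. *)
Lemma disc_bisection (c : C) (r : R) (Q : (C -> Prop) -> Prop) : 0 < r ->
  (forall A B : C -> Prop, (forall z, A z -> B z) -> Q B -> Q A) ->
  (forall A B, Q A -> Q B -> Q (fun z => A z \/ B z)) ->
  (forall p, exists d, 0 < d /\ Q (fun z => Cmod (z - p) < d /\ Cmod (z - c) <= r)) ->
  Q (fun z => Cmod (z - c) <= r).
Proof.
  intros Hr Hmono Hun Hloc.
  set (sq := fun x y s (z : C) => x <= Re z <= x + s /\ y <= Im z <= y + s /\ Cmod (z - c) <= r).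
  apply Hmono with (sq (Re c - r) (Im c - r) (2 * r)).
  { intros z Hz. assert (H1 := re_le_Cmod (z - c)). assert (H2 := im_le_Cmod (z - c)).
    rewrite Re_minus in H1. rewrite Im_minus in H2. apply Rabs_le_between in H1. 
    apply Rabs_le_between in H2. unfold sq. lra. }
  apply (square_bisection (fun x y s => Q (sq x y s)) (Re c - r) (Im c - r) (2 * r)); [lra| |].
  - intros x y s Hs _ Q1 Q2 Q3 Q4.
    apply Hmono with (2 := Hun _ _ (Hun _ _ Q1 Q2) (Hun _ _ Q3 Q4)).
    intros z [H1 [H2 H3]]. unfold sq.
    destruct (Rle_dec (Re z) (x + s / 2)); destruct (Rle_dec (Im z) (y + s / 2)); 
      [left; left|right; left|left; right|right; right]; repeat split; lra.
  - intros px py _ _. destruct (Hloc (px, py)) as [d [Hd HQ]].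
    exists (d / 2). split; [lra|]. intros x y s Hs _ Hx Hy.
    apply Hmono with (2 := HQ). intros z [H1 [H2 H3]]. split; [|exact H3].
    eapply Rle_lt_trans; [apply Cmod_le_abs|]. rewrite Re_minus, Im_minus. cbn [Re Im fst snd].
    assert (Rabs (Re z - px) <= s) by (apply Rabs_le; lra).
    assert (Rabs (Im z - py) <= s) by (apply Rabs_le; lra). lra.
Qed.

(** Compactness is used twice: for a bound on [u], then, if the supremum [S] were not attained, for
    a bound strictly below [S]. *)
Lemma disc_max (u : C -> R) (c : C) (r : R) : 0 < r ->
  (forall z, Cmod (z - c) <= r -> ucont u z) ->
  exists z0, Cmod (z0 - c) <= r /\ forall z, Cmod (z - c) <= r -> u z <= u z0.
Proof.
  intros Hr Hu.
  assert (Hcc : Cmod (c - c) <= r).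
  { replace (c - c)%C with (RtoC 0) by ring. rewrite Cmod_0. lra. }
  assert (Hout : forall p, r < Cmod (p - c) -> exists d, 0 < d /\ forall z, Cmod (z - p) < d -> r < Cmod (z - c)).
  { intros p Hp. exists (Cmod (p - c) - r). split; [lra|]. intros z Hz.
    assert (T := Cmod_triangle (z - c) (p - z)). replace (z - c + (p - z))%C with (p - c)%C in T by ring.
    rewrite (Cmod_sub_sym p z) in T. lra. }
  assert (HB : exists m, forall z, Cmod (z - c) <= r -> u z <= m).
  { apply (disc_bisection c r (fun A => exists m, forall z, A z -> u z <= m)); [exact Hr| | |].
    - intros A B HAB [m Hm]. exists m. auto.
    - intros A B [m Hm] [m' Hm']. exists (Rmax m m'). intros z [Hz|Hz].
      + eapply Rle_trans; [apply Hm, Hz|apply Rmax_l].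
      + eapply Rle_trans; [apply Hm', Hz|apply Rmax_r].
    - intros p. destruct (Rle_dec (Cmod (p - c)) r) as [Hp|Hp].
      + destruct (Hu p Hp 1 Rlt_0_1) as [d [Hd H]]. exists d. split; [exact Hd|].
        exists (u p + 1). intros z [Hz _]. specialize (H z Hz). apply Rabs_le_between in H. lra.
      + destruct (Hout p) as [d [Hd H]]; [lra|]. exists d. split; [exact Hd|]. exists 0.
        intros z [Hz Hz']. specialize (H z Hz). lra. }
  destruct (completeness (fun v => exists z, Cmod (z - c) <= r /\ v = u z)) as [S [HS1 HS2]].
  { destruct HB as [m Hm]. exists m. intros v [z [Hz ->]]. auto. }
  { exists (u c), c. auto. }
  destruct (classic (exists z0, Cmod (z0 - c) <= r /\ u z0 = S)) as [[z0 [Hz0 E]]|Hno].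
  { exists z0. split; [exact Hz0|]. intros z Hz. rewrite E. apply HS1. exists z. auto. }
  exfalso.
  assert (Hlt : forall z, Cmod (z - c) <= r -> u z < S).
  { intros z Hz. destruct (Rle_lt_or_eq_dec (u z) S) as [H|H]; [apply HS1; exists z; auto|exact H|].
    exfalso. apply Hno. exists z. auto. }
  assert (Hm : exists m, m < S /\ forall z, Cmod (z - c) <= r -> u z <= m).
  { apply (disc_bisection c r (fun A => exists m, m < S /\ forall z, A z -> u z <= m)); [exact Hr| | |].
    - intros A B HAB [m Hm]. exists m. split; [tauto|]. intros; apply Hm; auto.
    - intros A B [m [Hm1 Hm]] [m' [Hm1' Hm']]. exists (Rmax m m'). split; [apply Rmax_lub_lt; assumption|]. intros z [Hz|Hz].
      + eapply Rle_trans; [apply Hm, Hz|apply Rmax_l].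
      + eapply Rle_trans; [apply Hm', Hz|apply Rmax_r].
    - intros p. destruct (Rle_dec (Cmod (p - c)) r) as [Hp|Hp].
      + assert (Hl := Hlt p Hp).
        destruct (Hu p Hp ((S - u p) / 2)) as [d [Hd H]]; [lra|]. exists d. split; [exact Hd|].
        exists ((S + u p) / 2). split; [lra|]. intros z [Hz _]. specialize (H z Hz).
        apply Rabs_le_between in H. lra.
      + destruct (Hout p) as [d [Hd H]]; [lra|]. exists d. split; [exact Hd|]. exists (S - 1).
        split; [lra|]. intros z [Hz Hz']. specialize (H z Hz). lra. }
  destruct Hm as [m [Hm1 Hm2]].
  assert (S <= m); [|lra]. apply HS2. intros v [z [Hz ->]]. auto.
Qed.

Lemma Cmod_sq (z : C) : Cmod z ^ 2 = Re z ^ 2 + Im z ^ 2.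
Proof. unfold Cmod. rewrite pow2_sqrt; [reflexivity|]. assert (H1 := pow2_ge_0 (fst z)). assert (H2 := pow2_ge_0 (snd z)). lra. Qed.

Lemma ucont_Cmod_holo (F : C -> C) (z : C) : holo F z -> ucont (fun w => Cmod (F w)) z.
Proof.
  intros HF eps He. destruct (holo_cont F z HF eps He) as [d [Hd H]].
  exists d. split; [exact Hd|]. intros w Hw. eapply Rle_trans; [|apply (H w Hw)].
  apply Rabs_le. assert (H1 := Cmod_triangle_inv (F w) (F z)). assert (H2 := Cmod_triangle_inv (F z) (F w)).
  rewrite (Cmod_sub_sym (F z) (F w)) in H2. lra.
Qed.

Lemma RInt_circle_average (K m p q : R) :
  RInt (fun t => K - m * (p * cos t + q * sin t)) 0 (2 * PI) = 2 * PI * K.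
Proof.
  apply is_RInt_unique.
  replace (2 * PI * K) with
    ((K * (2 * PI) - m * (p * sin (2 * PI) - q * cos (2 * PI))) - (K * 0 - m * (p * sin 0 - q * cos 0))).
  2:{ rewrite sin_2PI, cos_2PI, sin_0, cos_0. ring. }
  apply (is_RInt_derive (V := R_CompleteNormedModule) (fun t => K * t - m * (p * sin t - q * cos t))).
  - intros t _. auto_derive; [tauto|]. ring.
  - intros t _. apply (ex_derive_continuous (V := R_NormedModule)). auto_derive. tauto.
Qed.

(* Adding [e |z - c|^2] makes [|H|] strictly subharmonic, so that the maximum cannot be interior. *)
Lemma max_principle (H : C -> C) (c : C) (r R0 B : R) : 0 < r < R0 ->
  (forall z, Cmod (z - c) < R0 -> holo H z) ->
  (forall z, Cmod (z - c) = r -> Cmod (H z) <= B) ->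
  forall z, Cmod (z - c) <= r -> Cmod (H z) <= B.
Proof.
  intros Hr HH HB z Hz. apply Rnot_lt_le. intros Hlt.
  (* Makes [e * r ^ 2] half of the excess over [B], so that on the circle [u] stays below [u z]. *)
  set (e := (Cmod (H z) - B) / (2 * r ^ 2)).
  assert (Hr2 : 0 < r ^ 2) by (apply pow_lt; lra).
  assert (He : 0 < e) by (apply Rdiv_lt_0_compat; lra).
  set (u := fun w => Cmod (H w) + e * Cmod (w - c) ^ 2).
  destruct (disc_max u c r) as [z0 [Hz0 Hmax]]; [lra| |].
  { intros w Hw eps Heps.
    destruct (ucont_Cmod_holo H w) with (eps := eps / 2) as [d [Hd H1]]; [apply HH; lra|lra|].
    destruct (ucont_Cmod_holo (fun w => (w - c) * (w - c))%C w) with (eps := eps / (2 * e)) as [d' [Hd' H2]].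
    { apply holo_mult; apply holo_minus; (apply holo_id || apply holo_const). }
    { apply Rdiv_lt_0_compat; lra. }
    exists (Rmin d d'). split; [apply Rmin_pos; assumption|]. intros v Hv.
    assert (T1 := Rmin_l d d'). assert (T2 := Rmin_r d d').
    specialize (H1 v ltac:(lra)). specialize (H2 v ltac:(lra)). rewrite !Cmod_mult in H2.
    unfold u. replace (Cmod (H v) + e * Cmod (v - c) ^ 2 - (Cmod (H w) + e * Cmod (w - c) ^ 2))
      with ((Cmod (H v) - Cmod (H w)) + e * (Cmod (v - c) * Cmod (v - c) - Cmod (w - c) * Cmod (w - c))) by ring.
    eapply Rle_trans; [apply Rabs_triang|]. rewrite Rabs_mult, (Rabs_pos_eq e) by lra.
    assert (e * Rabs (Cmod (v - c) * Cmod (v - c) - Cmod (w - c) * Cmod (w - c)) <= eps / 2).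
    { replace (eps / 2) with (e * (eps / (2 * e))) by (field; lra). apply Rmult_le_compat_l; lra. }
    lra. }
  destruct (Rle_lt_or_eq_dec _ _ Hz0) as [Hin|Hbd].
  2:{ specialize (Hmax z Hz). specialize (HB z0 Hbd). unfold u in Hmax. rewrite Hbd in Hmax.
      assert (E : e * r ^ 2 = (Cmod (H z) - B) / 2) by (unfold e; field; lra).
      assert (0 <= e * Cmod (z - c) ^ 2) by (apply Rmult_le_pos; [lra|apply pow2_ge_0]). lra. }
  set (a := (z0 - c)%C). set (rho := (r - Cmod a) / 2). fold a in Hin, Hz0.
  assert (Hrho : 0 < rho) by (unfold rho; lra).
  assert (Hpi := PI_RGT_0).
  assert (Hin2 : forall w, Cmod (w - z0) < 2 * rho -> Cmod (w - c) < r).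
  { intros w Hw. assert (T := Cmod_triangle (w - z0) a). unfold a in T.
    replace (w - z0 + (z0 - c))%C with (w - c)%C in T by ring. unfold rho, a in *. lra. }
  assert (MV := mean_value H z0 (2 * rho) rho ltac:(lra)).
  assert (Hdist : forall t, Cmod (z0 + RtoC rho * cexp (0, t) - z0) < 2 * rho).
  { intros t. replace (z0 + RtoC rho * cexp (0, t) - z0)%C with (RtoC rho * cexp (0, t))%C by ring.
    rewrite Cmod_mult, Cmod_cexp_imag, Cmod_R, Rabs_pos_eq; lra. }
  (* On the circle of radius [rho] about [z0], maximality of [u] bounds the modulus of [H] by [g],
     whose mean [K] equals [Cmod (H z0) - e * rho ^ 2]; this contradicts the mean value property. *)
  set (K := u z0 - e * (Cmod a ^ 2 + rho ^ 2)).
  set (g := fun t => K - 2 * e * rho * (Re a * cos t + Im a * sin t)).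
  assert (Hg : forall t, continuous g t).
  { intros t. apply (ex_derive_continuous g). unfold g. auto_derive. tauto. }
  assert (HI : RInt g 0 (2 * PI) = 2 * PI * K).
  { apply RInt_circle_average. }
  assert (Hle : Cmod (cint (fun t => H (z0 + RtoC rho * cexp (0, t))%C) 0 (2 * PI)) <= RInt g 0 (2 * PI)).
  { apply cint_le; [lra| |auto|].
    - intros t _. apply (rcont_holo_comp H (fun t => z0 + RtoC rho * cexp (0, t))%C); [|apply rcont_circle].
      apply HH. assert (T := Hin2 _ (Hdist t)). lra.
    - intros t _. assert (T := Hin2 _ (Hdist t)). specialize (Hmax (z0 + RtoC rho * cexp (0, t))%C ltac:(lra)).
      unfold g, K. unfold u in Hmax at 1.
      assert (E : Cmod (z0 + RtoC rho * cexp (0, t) - c) ^ 2 =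
         Cmod a ^ 2 + rho ^ 2 + 2 * rho * (Re a * cos t + Im a * sin t)).
      { replace (z0 + RtoC rho * cexp (0, t) - c)%C with (a + RtoC rho * cexp (0, t))%C by (unfold a; ring).
        rewrite !Cmod_sq, Re_plus, Im_plus, re_scal_l, im_scal_l. unfold cexp; cbn [Re Im fst snd].
        rewrite exp_0. assert (S := sin2_cos2 t). unfold Rsqr in S.
        replace (rho ^ 2) with (rho ^ 2 * (sin t * sin t + cos t * cos t)) by (rewrite S; ring). ring. }
      rewrite E in Hmax. lra. }
  rewrite MV in Hle.
  2:{ intros w Hw. apply HH. assert (T := Hin2 w Hw). lra. }
  rewrite HI, Cmod_mult, Cmod_R, Rabs_pos_eq in Hle by lra.
  apply Rmult_le_reg_l in Hle; [|lra]. unfold K, u in Hle. fold a in Hle.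
  assert (0 < e * rho ^ 2) by (apply Rmult_lt_0_compat; [exact He|apply pow_lt; exact Hrho]). lra.
Qed.

Lemma holo_pow (f : C -> C) (n : nat) (z : C) : holo f z -> holo (fun w => Cpow (f w) n) z.
Proof.
  intros Hf. induction n; simpl; [apply holo_const|]. apply holo_mult; assumption.
Qed.

(* Dividing by [(z - c)^k] keeps the function holomorphic; the maximum principle then gives
   [|F z| <= M (|z - c| / r)^k] for every [k]. *)
Lemma vanish_on_disc (F : C -> C) (c : C) (R0 rho : R) : 0 < rho ->
  (forall z, Cmod (z - c) < R0 -> holo F z) ->
  (forall z, Cmod (z - c) < rho -> F z = RtoC 0) ->
  forall z, Cmod (z - c) < R0 -> F z = RtoC 0.
Proof.
  intros Hrho HF H0 z Hz.
  destruct (Rlt_dec (Cmod (z - c)) rho) as [Hs|Hs]; [apply H0; exact Hs|].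
  set (r := (Cmod (z - c) + R0) / 2).
  assert (Hzc : 0 < Cmod (z - c)) by lra.
  assert (Hr : Cmod (z - c) < r < R0) by (unfold r; lra).
  destruct (disc_max (fun w => Cmod (F w)) c r) as [z0 [_ HM]]; [lra| |].
  { intros w Hw. apply ucont_Cmod_holo, HF. lra. }
  set (M := Cmod (F z0)) in *.
  assert (Hk : forall k, Cmod (F z) <= M * (Cmod (z - c) / r) ^ k).
  { intros k.
    assert (Hp : 0 < Cmod (z - c) ^ k) by (apply pow_lt; lra).
    assert (Hpr : 0 < r ^ k) by (apply pow_lt; lra).
    assert (Hnz : forall w, 0 < Cmod (w - c) -> Cpow (w - c) k <> RtoC 0).
    { intros w Hw. apply Cpow_nz. apply Cmod_gt_0. exact Hw. }
    assert (MP := max_principle (fun w => F w * / Cpow (w - c) k)%C c r R0 (M / r ^ k) ltac:(lra)).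
    assert (G : Cmod (F z * / Cpow (z - c) k) <= M / r ^ k).
    { apply MP; [| |lra].
      (* Where [F] vanishes the quotient is identically [0], including at [c], so the pole of the
         inverse power does no harm. *)
      - intros w Hw. destruct (Rlt_dec (Cmod (w - c)) rho) as [Hs'|Hs'].
        + apply holo_ext_loc with (fun _ => RtoC 0) (rho - Cmod (w - c)); [lra| |apply holo_const].
          intros v Hv. rewrite H0; [ring|].
          assert (T := Cmod_triangle (v - w) (w - c)). replace (v - w + (w - c))%C with (v - c)%C in T by ring. lra.
        + apply holo_mult; [apply HF, Hw|]. apply holo_inv; [|apply Hnz; lra].
          apply holo_pow, holo_minus; [apply holo_id|apply holo_const].
      - intros w Hw. rewrite Cmod_mult, Cmod_inv, Cmod_pow, Hw by (apply Hnz; lra).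
        apply Rmult_le_compat_r; [left; apply Rinv_0_lt_compat, Hpr|]. apply HM. lra. }
    rewrite Cmod_mult, Cmod_inv, Cmod_pow in G by (apply Hnz; lra).
    unfold Rdiv. rewrite Rpow_mult_distr, pow_inv.
    apply Rmult_le_reg_r with (/ Cmod (z - c) ^ k); [apply Rinv_0_lt_compat, Hp|].
    replace (M * (Cmod (z - c) ^ k * / r ^ k) * / Cmod (z - c) ^ k) with (M / r ^ k) by (field; lra).
    exact G. }
  apply Cmod_zero_le. intros eps He.
  assert (HM0 : 0 <= M) by apply Cmod_ge_0.
  assert (Hq : 0 <= Cmod (z - c) / r < 1).
  { split; [apply Rdiv_le_0_compat; lra|]. apply Rmult_lt_reg_r with r; [lra|].
    unfold Rdiv. rewrite Rmult_assoc, Rinv_l by lra. lra. }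
  destruct (pow_lt_1_zero (Cmod (z - c) / r)) with (y := eps / (M + 1)) as [k Hkk].
  { rewrite Rabs_pos_eq; lra. }
  { apply Rdiv_lt_0_compat; lra. }
  specialize (Hkk k (Nat.le_refl k)). rewrite Rabs_pos_eq in Hkk by (apply pow_le; lra).
  eapply Rle_trans; [apply (Hk k)|].
  replace eps with ((M + 1) * (eps / (M + 1))) by (field; lra).
  apply Rmult_le_compat; [lra|apply pow_le; lra|lra|lra].
Qed.

(** Continuation along the segment: [T] is the supremum of the parameters up to which [F] vanishes
    locally. A disc about a point slightly before [T], on which [F] vanishes near the centre and
    hence everywhere, reaches beyond [T]. *)
Lemma identity_segment (F : C -> C) (z0 z1 : C) (rho : R) : 0 < rho ->
  (forall t, 0 <= t <= 1 -> exists d, 0 < d /\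
     forall w, Cmod (w - (z0 + RtoC t * (z1 - z0))) < d -> holo F w) ->
  (forall w, Cmod (w - z0) < rho -> F w = RtoC 0) -> F z1 = RtoC 0.
Proof.
  intros Hrho HF H0. set (g := fun t => (z0 + RtoC t * (z1 - z0))%C).
  set (D := Cmod (z1 - z0) + 1). assert (HD : 0 < D) by (unfold D; assert (T := Cmod_ge_0 (z1 - z0)); lra).
  assert (Hg : forall s t, Cmod (g s - g t) <= D * Rabs (s - t)).
  { intros s t. replace (g s - g t)%C with (RtoC (s - t) * (z1 - z0))%C by (unfold g; rewrite RtoC_minus; ring).
    rewrite Cmod_mult, Cmod_R. assert (T := Rabs_pos (s - t)). unfold D. nra. }
  set (good := fun s => exists d, 0 < d /\ forall w, Cmod (w - g s) < d -> F w = RtoC 0).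
  set (E := fun t => 0 <= t <= 1 /\ forall s, 0 <= s <= t -> good s).
  assert (E0 : E 0).
  { split; [lra|]. intros s Hs. replace s with 0 by lra. exists rho. split; [exact Hrho|]. intros w Hw. apply H0.
    replace z0 with (g 0); [exact Hw|]. unfold g. ring. }
  destruct (completeness E) as [T [HT1 HT2]].
  { exists 1. intros t [Ht _]. lra. }
  { exists 0. exact E0. }
  assert (HT : 0 <= T <= 1).
  { split; [apply HT1, E0|]. apply HT2. intros t [Ht _]. lra. }
  destruct (HF T HT) as [d [Hd Hd1]]. fold (g T) in Hd1.
  (* [D] is a Lipschitz constant of [g], so parameters [eta] apart give points at most [d / 4]
     apart. *)
  set (eta := d / (4 * D)). assert (Heta : 0 < eta) by (apply Rdiv_lt_0_compat; lra).
  assert (HDe : D * eta = d / 4) by (unfold eta; field; lra).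
  assert (Hex : exists t, E t /\ T - eta < t).
  { apply NNPP. intros Hn. assert (T <= T - eta); [|lra]. apply HT2. intros t Ht.
    apply Rnot_lt_le. intros Hlt. apply Hn. exists t. auto. }
  destruct Hex as [t [Ht1 Ht2]]. assert (Ht3 : t <= T) by (apply HT1, Ht1).
  destruct Ht1 as [Ht0 Htg].
  assert (HgT : Cmod (g t - g T) <= d / 4).
  { eapply Rle_trans; [apply Hg|]. rewrite <- HDe. apply Rmult_le_compat_l; [lra|]. apply Rabs_le; lra. }
  destruct (Htg t ltac:(lra)) as [d' [Hd' Hz]].
  assert (Hball : forall w, Cmod (w - g t) < d / 2 -> F w = RtoC 0).
  { apply vanish_on_disc with d'; [exact Hd'| |exact Hz]. intros w Hw. apply Hd1.
    assert (S := Cmod_triangle (w - g t) (g t - g T)). replace (w - g t + (g t - g T))%C with (w - g T)%C in S by ring. lra. }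
  (* The reach [3 / 2 * eta] beyond [t] exceeds the gap [T - t < eta], and the distance [3 / 8 d]
     plus the radius [d / 8] is the radius [d / 2] of the known disc. *)
  assert (Hnear : forall s, Rabs (s - t) <= 3 / 2 * eta -> good s).
  { intros s Hs. exists (d / 8). split; [lra|]. intros w Hw. apply Hball.
    assert (S := Cmod_triangle (w - g s) (g s - g t)). replace (w - g s + (g s - g t))%C with (w - g t)%C in S by ring.
    assert (Cmod (g s - g t) <= D * (3 / 2 * eta)).
    { eapply Rle_trans; [apply Hg|]. apply Rmult_le_compat_l; lra. }
    replace (D * (3 / 2 * eta)) with (3 / 2 * (D * eta)) in H by ring. lra. }
  assert (Hgood1 : good 1).
  { destruct (Rle_dec 1 (t + 3 / 2 * eta)) as [H1|H1].
    - apply Hnear. apply Rabs_le. lra.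
    - exfalso. assert (E (t + 3 / 2 * eta)).
      { split; [lra|]. intros s Hs. destruct (Rle_dec s t) as [Hst|Hst]; [apply Htg; lra|].
        apply Hnear. apply Rabs_le. lra. }
      apply HT1 in H. lra. }
  destruct Hgood1 as [d1 [Hd1' H1]]. apply H1.
  replace (z1 - g 1)%C with (RtoC 0) by (unfold g; ring). rewrite Cmod_0. exact Hd1'.
Qed.

(** * Identity theorem in vertical strips without the integers *)

Definition nonint (z : C) : Prop := forall k : Z, z <> RtoC (IZR k).

Lemma nonint_ball (z : C) : nonint z -> exists d, 0 < d /\ forall w, Cmod (w - z) < d -> nonint w.
Proof.
  intros Hz. destruct (Req_dec (Im z) 0) as [Hi|Hi].
  - set (n := Int_part (Re z)).
    destruct (base_Int_part (Re z)) as [H1 H2]. fold n in H1, H2.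
    assert (H3 : IZR n < Re z).
    { destruct H1 as [H1|H1]; [exact H1|]. exfalso. apply (Hz n). apply C_ext; simpl; lra. }
    exists (Rmin (Re z - IZR n) (IZR n + 1 - Re z)). split; [apply Rmin_pos; lra|].
    intros w Hw k E. assert (T1 := Rmin_l (Re z - IZR n) (IZR n + 1 - Re z)).
    assert (T2 := Rmin_r (Re z - IZR n) (IZR n + 1 - Re z)).
    subst w. assert (T3 := re_le_Cmod (RtoC (IZR k) - z)). rewrite Re_minus in T3.
    change (Re (RtoC (IZR k))) with (IZR k) in T3.
    assert (T4 : Rabs (IZR k - Re z) < Rmin (Re z - IZR n) (IZR n + 1 - Re z)) by lra.
    apply Rabs_def2 in T4. destruct T4 as [T4 T5].
    assert (n < k)%Z by (apply lt_IZR; lra).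
    assert (k < n + 1)%Z by (apply lt_IZR; rewrite plus_IZR; lra). lia.
  - exists (Rabs (Im z)). split; [apply Rabs_pos_lt, Hi|]. intros w Hw k E.
    assert (T := im_le_Cmod (w - z)). rewrite Im_minus in T.
    rewrite E in T at 1. cbn [Im RtoC snd] in T. rewrite Rminus_0_l, Rabs_Ropp in T. lra.
Qed.

(** The starting point [z0] is put at the height of [z], or at height [1] when [z] is real, so that
    the segment to [z] meets the real axis at most at [z] itself and avoids the integers. *)
Lemma identity_strip (F : C -> C) (a b a' b' : R) : a <= a' -> a' < b' -> b' <= b ->
  (forall z, a < Re z < b -> nonint z -> holo F z) ->
  (forall z, a' < Re z < b' -> nonint z -> F z = RtoC 0) ->
  forall z, a < Re z < b -> nonint z -> F z = RtoC 0.
Proof.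
  intros Ha Hab Hb HF H0 z Hz Hni.
  set (y := if Req_EM_T (Im z) 0 then 1 else Im z).
  set (z0 := ((a' + b') / 2, y) : C).
  assert (Hy : y <> 0) by (unfold y; destruct Req_EM_T; lra).
  assert (Hnz : forall w, Im w <> 0 -> nonint w).
  { intros w Hw k E. apply Hw. rewrite E. reflexivity. }
  assert (Hopen : forall w a b, a < Re w < b -> nonint w -> exists d, 0 < d /\
     forall v, Cmod (v - w) < d -> a < Re v < b /\ nonint v).
  { intros w a0 b0 Hw Hn. destruct (nonint_ball w Hn) as [d [Hd H]].
    exists (Rmin d (Rmin (Re w - a0) (b0 - Re w))). split.
    { apply Rmin_pos; [exact Hd|apply Rmin_pos; lra]. }
    intros v Hv. assert (T1 := Rmin_l d (Rmin (Re w - a0) (b0 - Re w))).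
    assert (T2 := Rmin_r d (Rmin (Re w - a0) (b0 - Re w))).
    assert (T3 := Rmin_l (Re w - a0) (b0 - Re w)). assert (T4 := Rmin_r (Re w - a0) (b0 - Re w)).
    assert (T := re_le_Cmod (v - w)). rewrite Re_minus in T.
    assert (T5 : Rabs (Re v - Re w) < Rmin (Re w - a0) (b0 - Re w)) by lra. apply Rabs_def2 in T5.
    split; [lra|]. apply H. lra. }
  destruct (Hopen z0 a' b') as [rho [Hrho Hr]]; [unfold z0; cbn; lra|apply Hnz; exact Hy|].
  apply (identity_segment F z0 z rho); [exact Hrho| |].
  - intros t Ht. set (w := (z0 + RtoC t * (z - z0))%C).
    assert (Hre : Re w = (1 - t) * ((a' + b') / 2) + t * Re z).
    { unfold w. rewrite Re_plus, re_scal_l, Re_minus. unfold z0. cbn [Re fst]. ring. }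
    assert (Him : Im w = (1 - t) * y + t * Im z).
    { unfold w. rewrite Im_plus, im_scal_l, Im_minus. unfold z0. cbn [Im snd]. ring. }
    destruct (Hopen w a b) as [d [Hd H]].
    + rewrite Hre. assert (Hm : a < (a' + b') / 2 < b) by lra. revert Hm.
      generalize ((a' + b') / 2) (Re z) Hz. intros m x Hx Hm.
      split; destruct (Rle_dec t (1 / 2)); nra.
    + destruct (Req_dec t 1) as [->|Ht1].
      * replace w with z; [exact Hni|]. unfold w. ring.
      * apply Hnz. rewrite Him. unfold y in *. destruct (Req_EM_T (Im z) 0) as [E|E]; [rewrite E; lra|].
        intros K. apply E. lra.
    + exists d. split; [exact Hd|]. intros v Hv. apply HF; apply H; exact Hv.
  - intros w Hw. apply H0; apply Hr; exact Hw.
Qed.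

(** * Integrals over the whole line of exponentially decaying functions *)

(** [K] and [d] stay explicit because termwise integration sums the constants [K] at a common rate
    [d]. *)
Definition edec (f : R -> C) (K d : R) : Prop :=
  0 < d /\ (forall v, rcont f v) /\ forall v, Cmod (f v) <= K * exp (- d * Rabs v).

(** The integral over the line as a limit over [[- n, n]], total through [Lim_seq]; [IR_spec] gives
    it its meaning for [edec] functions, however the two ends go to infinity. *)
Definition IR (f : R -> C) : C :=
  (real (Lim_seq (fun n => Re (cint f (- INR n) (INR n)))),
   real (Lim_seq (fun n => Im (cint f (- INR n) (INR n))))).

Lemma edec_K_nonneg f K d : edec f K d -> 0 <= K.
Proof.
  intros [_ [_ H]]. specialize (H 0). rewrite Rabs_R0, Rmult_0_r, exp_0, Rmult_1_r in H.
  eapply Rle_trans; [apply Cmod_ge_0|exact H].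
Qed.

Lemma RInt_exp_tail (K d A b : R) : 0 < d -> 0 <= K -> A <= b ->
  RInt (fun t => K * exp (- d * t)) A b <= K / d * exp (- d * A).
Proof.
  intros Hd HK HAb.
  assert (E : RInt (fun t => K * exp (- d * t)) A b = - (K / d) * exp (- d * b) - - (K / d) * exp (- d * A)).
  { apply is_RInt_unique.
    apply (is_RInt_derive (V := R_CompleteNormedModule) (fun t => - (K / d) * exp (- d * t))).
    - intros t _. auto_derive; [tauto|]. field. lra.
    - intros t _. apply (ex_derive_continuous (V := R_NormedModule)). auto_derive. tauto. }
  rewrite E. assert (0 <= K / d * exp (- d * b)).
  { apply Rmult_le_pos; [apply Rdiv_le_0_compat; lra|left; apply exp_pos]. } lra.
Qed.

Lemma edec_tail_r f K d A b : edec f K d -> 0 <= A <= b -> Cmod (cint f A b) <= K / d * exp (- d * A).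
Proof.
  intros He HA. assert (HK := edec_K_nonneg f K d He). destruct He as [Hd [Hc H]].
  eapply Rle_trans; [apply (cint_le f (fun t => K * exp (- d * t))); [lra|auto| |]|].
  - intros t _. apply (ex_derive_continuous (V := R_NormedModule)). auto_derive. tauto.
  - intros t Ht. specialize (H t). rewrite Rabs_pos_eq in H by lra. exact H.
  - apply RInt_exp_tail; lra.
Qed.

Lemma continuous_Ropp (t : R) : continuous (fun s => - s) t.
Proof. apply (ex_derive_continuous (V := R_NormedModule) (fun s => - s)). auto_derive. tauto. Qed.

Lemma edec_reflect f K d : edec f K d -> edec (fun v => f (- v)) K d.
Proof.
  intros [Hd [Hc H]]. split; [exact Hd|split].
  - intros v. apply (rcont_comp f (fun s => - s)); [|apply Hc]. apply continuous_Ropp.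
  - intros v. rewrite <- (Rabs_Ropp v). apply H.
Qed.

Lemma edec_tail_l f K d A b : edec f K d -> 0 <= A <= b ->
  Cmod (cint f (- b) (- A)) <= K / d * exp (- d * A).
Proof.
  intros He HA. rewrite <- cint_reflect by (try lra; intros; apply He).
  apply edec_tail_r; [apply edec_reflect; exact He|exact HA].
Qed.

Lemma edec_center f K d A a b : edec f K d -> 0 <= A -> A <= a -> A <= b ->
  Cmod (cint f (- a) b - cint f (- A) A) <= 2 * K / d * exp (- d * A).
Proof.
  intros He HA Ha Hb.
  rewrite <- (cint_Chasles f (- a) (- A) b) by (try lra; intros; apply He).
  rewrite <- (cint_Chasles f (- A) A b) by (try lra; intros; apply He).
  replace (cint f (- a) (- A) + (cint f (- A) A + cint f A b) - cint f (- A) A)%C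
    with (cint f (- a) (- A) + cint f A b)%C by ring.
  eapply Rle_trans; [apply Cmod_triangle|].
  assert (H1 := edec_tail_l f K d A a He ltac:(lra)).
  assert (H2 := edec_tail_r f K d A b He ltac:(lra)).
  replace (2 * K / d * exp (- d * A)) with (K / d * exp (- d * A) + K / d * exp (- d * A)) by (unfold Rdiv; ring).
  lra.
Qed.

Lemma exp_small (d C0 eps : R) : 0 < d -> 0 < eps -> exists A, 0 <= A /\ forall a, A <= a -> C0 * exp (- d * a) <= eps.
Proof.
  intros Hd He. set (C1 := Rabs C0 + 1). assert (HC : 0 < C1) by (assert (H := Rabs_pos C0); unfold C1; lra).
  exists (Rmax 0 (- ln (eps / C1) / d)). split; [apply Rmax_l|]. intros a Ha.
  apply Rle_trans with (C1 * exp (- d * a)).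
  { apply Rmult_le_compat_r; [left; apply exp_pos|]. assert (H := Rle_abs C0). unfold C1. lra. }
  replace eps with (C1 * (eps / C1)) at 1 by (field; lra).
  apply Rmult_le_compat_l; [lra|]. rewrite <- (exp_ln (eps / C1)) by (apply Rdiv_lt_0_compat; lra).
  apply exp_le. assert (H := Rmax_r 0 (- ln (eps / C1) / d)).
  assert (H1 : - ln (eps / C1) / d <= a) by lra.
  apply (Rmult_le_compat_l d) in H1; [|lra]. replace (d * (- ln (eps / C1) / d)) with (- ln (eps / C1)) in H1 by (field; lra).
  lra.
Qed.

Lemma INR_unbounded (A : R) : exists N, forall n, (N <= n)%nat -> A <= INR n.
Proof.
  destruct (nfloor_ex (Rmax 0 A)) as [N [H1 H2]]; [apply Rmax_l|].
  exists (S N). intros n Hn. apply le_INR in Hn. rewrite S_INR in Hn.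
  assert (H := Rmax_r 0 A). lra.
Qed.

(** Abstract Cauchy argument for one component: [c A] is the integral over [[- A, A]], [T A] the
    bound for what lies outside. *)
Lemma Lim_seq_dist (u : nat -> R) (c : R -> R) (T : R -> R) :
  (forall A n, 0 <= A <= INR n -> Rabs (u n - c A) <= T A) ->
  (forall eps, 0 < eps -> exists A, 0 <= A /\ T A <= eps) ->
  forall A, 0 <= A -> Rabs (real (Lim_seq u) - c A) <= T A.
Proof.
  intros H HT.
  assert (Hex : ex_finite_lim_seq u).
  { apply ex_lim_seq_cauchy_corr. intros eps.
    destruct (HT (eps / 3)) as [A [HA Hs]]. { assert (T0 := cond_pos eps). lra. }
    destruct (INR_unbounded A) as [N HN]. exists N. intros n m Hn Hm.
    assert (H1 := H A n (conj HA (HN n Hn))). assert (H2 := H A m (conj HA (HN m Hm))).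
    assert (T0 := cond_pos eps). apply Rabs_le_between in H1. apply Rabs_le_between in H2.
    apply Rabs_def1; lra. }
  destruct Hex as [l Hl]. rewrite (is_lim_seq_unique u l Hl). simpl.
  intros A HA. apply Rnot_lt_le. intros Hlt.
  apply is_lim_seq_spec in Hl.
  assert (Hp : 0 < (Rabs (l - c A) - T A) / 2) by lra.
  destruct (Hl (mkposreal _ Hp)) as [N HN]. simpl in HN.
  destruct (INR_unbounded A) as [N' HN'].
  specialize (HN (max N N') (Nat.le_max_l _ _)). specialize (HN' (max N N') (Nat.le_max_r _ _)).
  assert (H1 := H A _ (conj HA HN')).
  assert (H2 := Rabs_triang (l - u (max N N')) (u (max N N') - c A)).
  replace (l - u (max N N') + (u (max N N') - c A)) with (l - c A) in H2 by ring.
  rewrite (Rabs_minus_sym l (u (max N N'))) in H2. lra.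
Qed.

(** The two tails give [2 * K / d]; the factor [3] accounts for separate estimates of real part,
    imaginary part and the asymmetric interval. *)
Lemma IR_spec f K d A a b : edec f K d -> 0 <= A -> A <= a -> A <= b ->
  Cmod (cint f (- a) b - IR f) <= 6 * K / d * exp (- d * A).
Proof.
  intros He HA Ha Hb. assert (HK := edec_K_nonneg f K d He). assert (Hd := proj1 He).
  set (T := fun A => 2 * K / d * exp (- d * A)).
  assert (HT : forall eps, 0 < eps -> exists A, 0 <= A /\ T A <= eps).
  { intros eps Heps. destruct (exp_small d (2 * K / d) eps Hd Heps) as [A0 [H0 H1]]. exists A0. split; [exact H0|].
    apply H1. lra. }
  assert (Hu : forall A n, 0 <= A <= INR n -> Cmod (cint f (- INR n) (INR n) - cint f (- A) A) <= T A).
  { intros A0 n Hn. apply edec_center; try lra. exact He. }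
  assert (H1 := Lim_seq_dist (fun n => Re (cint f (- INR n) (INR n))) (fun A => Re (cint f (- A) A)) T).
  assert (H2 := Lim_seq_dist (fun n => Im (cint f (- INR n) (INR n))) (fun A => Im (cint f (- A) A)) T).
  assert (E1 : Rabs (Re (IR f - cint f (- A) A)) <= T A).
  { rewrite Re_minus. apply H1; [|exact HT|exact HA]. intros A0 n Hn. rewrite <- Re_minus.
    eapply Rle_trans; [apply re_le_Cmod|]. apply Hu, Hn. }
  assert (E2 : Rabs (Im (IR f - cint f (- A) A)) <= T A).
  { rewrite Im_minus. apply H2; [|exact HT|exact HA]. intros A0 n Hn. rewrite <- Im_minus.
    eapply Rle_trans; [apply im_le_Cmod|]. apply Hu, Hn. }
  assert (E3 := edec_center f K d A a b He HA Ha Hb). fold (T A) in E3.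
  assert (E4 := Cmod_le_abs (IR f - cint f (- A) A)).
  assert (E5 := Cmod_triangle_minus (cint f (- a) b - cint f (- A) A) (IR f - cint f (- A) A)).
  replace (cint f (- a) b - cint f (- A) A - (IR f - cint f (- A) A))%C with (cint f (- a) b - IR f)%C in E5 by ring.
  replace (6 * K / d * exp (- d * A)) with (3 * T A) by (unfold T; field; lra). lra.
Qed.

Lemma IR_unique f K d l : edec f K d ->
  (forall eps, 0 < eps -> exists A0, forall A, A0 <= A -> Cmod (cint f (- A) A - l) <= eps) -> IR f = l.
Proof.
  intros He H. apply Ceq_minus, Cmod_zero_le. intros eps Heps.
  destruct (H (eps / 2)) as [A0 HA0]; [lra|].
  destruct (exp_small d (6 * K / d) (eps / 2) (proj1 He)) as [A1 [H1 H2]]; [lra|].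
  set (A := Rmax A0 A1). specialize (HA0 A (Rmax_l _ _)). specialize (H2 A (Rmax_r _ _)).
  assert (HA : 0 <= A) by (assert (T := Rmax_r A0 A1); fold A in T; lra).
  assert (H3 := IR_spec f K d A A A He HA (Rle_refl _) (Rle_refl _)).
  assert (T := Cmod_triangle_minus (cint f (- A) A - l) (cint f (- A) A - IR f)).
  replace (cint f (- A) A - l - (cint f (- A) A - IR f))%C with (IR f - l)%C in T by ring. lra.
Qed.

Lemma IR_lim f K d : edec f K d ->
  forall eps, 0 < eps -> exists A0, 0 <= A0 /\ forall a b, A0 <= a -> A0 <= b -> Cmod (cint f (- a) b - IR f) <= eps.
Proof.
  intros He eps Heps. destruct (exp_small d (6 * K / d) eps (proj1 He) Heps) as [A1 [H1 H2]].
  exists A1. split; [exact H1|]. intros a b Ha Hb.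
  eapply Rle_trans; [apply (IR_spec f K d A1 a b He H1 Ha Hb)|]. apply H2. lra.
Qed.

Lemma IR_bound f K d : edec f K d -> Cmod (IR f) <= 6 * K / d.
Proof.
  intros He. assert (H := IR_spec f K d 0 0 0 He (Rle_refl _) (Rle_refl _) (Rle_refl _)).
  rewrite Rmult_0_r, exp_0, Rmult_1_r, Ropp_0 in H.
  replace (cint f 0 0) with (RtoC 0) in H.
  2:{ unfold cint. rewrite !RInt_point. reflexivity. }
  rewrite Cmod_sub_sym in H. replace (IR f - 0)%C with (IR f) in H by ring. exact H.
Qed.

Lemma IR_ext f g : (forall v, f v = g v) -> IR f = IR g.
Proof. intros H. f_equal. apply functional_extensionality. exact H. Qed.

Lemma edec_ext f g K d : (forall v, f v = g v) -> edec f K d -> edec g K d.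
Proof. intros H. replace g with f; [tauto|]. apply functional_extensionality. exact H. Qed.

Lemma edec_weaken f K d K' d' : edec f K d -> K <= K' -> 0 < d' <= d -> edec f K' d'.
Proof.
  intros He HK Hd. assert (H0 := edec_K_nonneg f K d He). destruct He as [_ [Hc H]].
  split; [lra|split; [exact Hc|]]. intros v. eapply Rle_trans; [apply H|].
  apply Rmult_le_compat; [exact H0|left; apply exp_pos|exact HK|]. apply exp_le.
  assert (T := Rabs_pos v). nra.
Qed.

Lemma edec_scal (c : C) f K d : edec f K d -> edec (fun v => c * f v)%C (Cmod c * K) d.
Proof.
  intros [Hd [Hc H]]. split; [exact Hd|split].
  - intros v. apply rcont_mult; [apply rcont_const|apply Hc].
  - intros v. rewrite Cmod_mult, Rmult_assoc. apply Rmult_le_compat_l; [apply Cmod_ge_0|apply H].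
Qed.

Lemma edec_plus f g K K' d d' : edec f K d -> edec g K' d' -> edec (fun v => f v + g v)%C (K + K') (Rmin d d').
Proof.
  intros Hf Hg. assert (Hd := Rmin_pos _ _ (proj1 Hf) (proj1 Hg)).
  assert (Hf' := edec_weaken f K d K (Rmin d d') Hf (Rle_refl _) (conj Hd (Rmin_l _ _))).
  assert (Hg' := edec_weaken g K' d' K' (Rmin d d') Hg (Rle_refl _) (conj Hd (Rmin_r _ _))).
  destruct Hf' as [_ [Hc1 H1]], Hg' as [_ [Hc2 H2]]. split; [exact Hd|split].
  - intros v. apply rcont_plus; auto.
  - intros v. eapply Rle_trans; [apply Cmod_triangle|]. rewrite Rmult_plus_distr_r. apply Rplus_le_compat; auto.
Qed.

Lemma IR_scal (c : C) f K d : edec f K d -> IR (fun v => c * f v)%C = (c * IR f)%C.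
Proof.
  intros He. apply (IR_unique _ _ _ _ (edec_scal c f K d He)). intros eps Heps.
  assert (Hc := Cmod_ge_0 c).
  destruct (IR_lim f K d He (eps / (Cmod c + 1))) as [A0 [H0 H]]; [apply Rdiv_lt_0_compat; lra|].
  exists A0. intros A HA. rewrite cint_scal by (try lra; intros; apply He).
  replace (c * cint f (- A) A - c * IR f)%C with (c * (cint f (- A) A - IR f))%C by ring.
  rewrite Cmod_mult. specialize (H A A HA HA).
  replace eps with ((Cmod c + 1) * (eps / (Cmod c + 1))) by (field; lra).
  apply Rmult_le_compat; [exact Hc|apply Cmod_ge_0|lra|exact H].
Qed.

Lemma IR_plus f g K K' d d' : edec f K d -> edec g K' d' -> IR (fun v => f v + g v)%C = (IR f + IR g)%C.
Proof.
  intros Hf Hg. apply (IR_unique _ _ _ _ (edec_plus f g K K' d d' Hf Hg)). intros eps Heps.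
  destruct (IR_lim f K d Hf (eps / 2)) as [A0 [H0 H]]; [lra|].
  destruct (IR_lim g K' d' Hg (eps / 2)) as [A1 [H1 H']]; [lra|].
  exists (Rmax A0 A1). intros A HA.
  assert (T0 := Rmax_l A0 A1). assert (T1 := Rmax_r A0 A1).
  rewrite cint_plus by (try lra; intros; (apply Hf || apply Hg)).
  specialize (H A A ltac:(lra) ltac:(lra)). specialize (H' A A ltac:(lra) ltac:(lra)).
  replace (cint f (- A) A + cint g (- A) A - (IR f + IR g))%C
    with ((cint f (- A) A - IR f) + (cint g (- A) A - IR g))%C by ring.
  eapply Rle_trans; [apply Cmod_triangle|]. lra.
Qed.

Lemma edec_minus f g K K' d d' : edec f K d -> edec g K' d' -> edec (fun v => f v - g v)%C (K + K') (Rmin d d').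
Proof.
  intros Hf Hg. apply (edec_ext (fun v => f v + RtoC (-1) * g v)%C); [intros; ring|].
  apply edec_plus; [exact Hf|]. assert (T := edec_scal (RtoC (-1)) g K' d' Hg).
  replace (Cmod (RtoC (-1)) * K') with K' in T; [exact T|]. rewrite Cmod_R, Rabs_left by lra. ring.
Qed.

Lemma IR_minus f g K K' d d' : edec f K d -> edec g K' d' -> IR (fun v => f v - g v)%C = (IR f - IR g)%C.
Proof.
  intros Hf Hg. rewrite (IR_ext _ (fun v => f v + RtoC (-1) * g v)%C) by (intros; ring).
  rewrite (IR_plus _ _ _ _ _ _ Hf (edec_scal _ _ _ _ Hg)), (IR_scal _ _ _ _ Hg). ring.
Qed.

Lemma edec_shift f K d c : edec f K d -> edec (fun v => f (v + c)) (K * exp (d * Rabs c)) d.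
Proof.
  intros He. assert (HK := edec_K_nonneg _ _ _ He). destruct He as [Hd [Hc H]]. split; [exact Hd|split].
  - intros v. apply (rcont_comp f (fun s => s + c)); [|apply Hc].
    apply (ex_derive_continuous (V := R_NormedModule) (fun s => s + c)). auto_derive. tauto.
  - intros v. eapply Rle_trans; [apply H|]. rewrite Rmult_assoc, <- exp_plus.
    apply Rmult_le_compat_l; [exact HK|]. apply exp_le.
    assert (T := Rabs_triang (v + c) (- c)). rewrite Rabs_Ropp in T.
    replace (v + c + - c) with v in T by ring. nra.
Qed.

Lemma IR_shift f K d c : edec f K d -> IR (fun v => f (v + c)) = IR f.
Proof.
  intros He. apply (IR_unique _ _ _ _ (edec_shift f K d c He)). intros eps Heps.
  destruct (IR_lim f K d He eps Heps) as [A0 [H0 H]].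
  exists (A0 + Rabs c). intros A HA. assert (T := Rle_abs c). assert (T' := Rle_abs (- c)). rewrite Rabs_Ropp in T'.
  rewrite cint_shift by (try lra; intros; apply He).
  replace (- A + c) with (- (A - c)) by ring. apply H; lra.
Qed.

Lemma IR_reflect f K d : edec f K d -> IR (fun v => f (- v)) = IR f.
Proof.
  intros He. apply (IR_unique _ _ _ _ (edec_reflect f K d He)). intros eps Heps.
  destruct (IR_lim f K d He eps Heps) as [A0 [H0 H]].
  exists A0. intros A HA. rewrite cint_reflect by (try lra; intros; apply He).
  rewrite Ropp_involutive. apply H; lra.
Qed.

Lemma edec_psum (f : nat -> R -> C) (M : nat -> R) (d : R) (n : nat) :
  0 < d -> (forall k, edec (f k) (M k) d) -> edec (fun v => psum (fun k => f k v) n) (rsum M n) d /\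
  IR (fun v => psum (fun k => f k v) n) = psum (fun k => IR (f k)) n.
Proof.
  intros Hd H. induction n as [|n [IH1 IH2]]; simpl.
  - assert (E : edec (fun _ => RtoC 0) 0 d).
    { split; [exact Hd|split]; [intros; apply rcont_const|]. intros v. rewrite Cmod_0. lra. }
    split; [exact E|]. apply (IR_unique _ _ _ _ E). intros eps Heps. exists 0. intros A HA.
    rewrite cint_const, Cmult_0_r. replace (0 - 0)%C with (RtoC 0) by ring. rewrite Cmod_0. lra.
  - split.
    + assert (T := edec_plus _ _ _ _ _ _ IH1 (H n)). rewrite Rmin_left in T by lra. exact T.
    + rewrite (IR_plus _ _ _ _ _ _ IH1 (H n)), IH2. reflexivity.
Qed.

(** Dominated convergence with explicit remainders: the error after [n] terms is itself an [edec]
    function with constant [Series M - rsum M n], so [IR_bound] makes its integral tend to [0]. The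
    same estimate gives the continuity of [F]. *)
Lemma IR_series (f : nat -> R -> C) (M : nat -> R) (d : R) (F : R -> C) :
  0 < d -> (forall k, edec (f k) (M k) d) -> ex_series M ->
  (forall v, CS (fun k => f k v) (F v)) ->
  edec F (Series M) d /\ CS (fun k => IR (f k)) (IR F).
Proof.
  intros Hd H HM HF.
  assert (Hp : forall n, 0 <= M n) by (intros n; apply (edec_K_nonneg _ _ _ (H n))).
  assert (Hexp1 : forall v, exp (- d * Rabs v) <= 1).
  { intros v. rewrite <- exp_0. apply exp_le. assert (T := Rabs_pos v). nra. }
  assert (Htail : forall n v, Cmod (F v - psum (fun k => f k v) n) <= (Series M - rsum M n) * exp (- d * Rabs v)).
  { intros n v. set (x := exp (- d * Rabs v)).
    assert (Hx : ex_series (fun k => M k * x)) by (apply ex_series_scal_r; exact HM).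
    assert (T := CS_tail (fun k => f k v) (fun k => M k * x) (F v) n (fun k => proj2 (proj2 (H k)) v) Hx (HF v)).
    rewrite Series_scal_r in T.
    assert (E : rsum (fun k => M k * x) n = rsum M n * x).
    { clear. induction n; simpl; [ring|rewrite IHn; ring]. }
    rewrite E in T. eapply Rle_trans; [exact T|]. right. ring. }
  assert (Hsmall : forall eps, 0 < eps -> exists N, forall n, (N <= n)%nat -> 0 <= Series M - rsum M n <= eps).
  { intros eps He. destruct (rsum_lim M HM eps He) as [N HN]. exists N. intros n Hn.
    specialize (HN n Hn). apply Rabs_le_between in HN. assert (T := rsum_le_Series M n Hp HM). lra. }
  assert (HcF : forall v, rcont F v).
  { intros v. apply rcont_eps. intros eps He.
    destruct (Hsmall (eps / 3)) as [N HN]; [lra|]. specialize (HN N (Nat.le_refl N)).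
    assert (HS : rcont (fun s => psum (fun k => f k s) N) v) by (apply rcont_psum; intros; apply H).
    destruct (proj1 (rcont_eps _ _) HS (eps / 3)) as [dl [Hdl HS1]]; [lra|].
    exists dl. split; [exact Hdl|]. intros s Hs. specialize (HS1 s Hs).
    assert (Hb : forall s, Cmod (F s - psum (fun k => f k s) N) <= eps / 3).
    { intros w. eapply Rle_trans; [apply Htail|]. assert (T1 := Hexp1 w). assert (T2 := exp_pos (- d * Rabs w)). nra. }
    assert (B1 := Hb s). assert (B2 := Hb v).
    replace (F s - F v)%C with ((F s - psum (fun k => f k s) N) + (psum (fun k => f k s) N - psum (fun k => f k v) N)
       - (F v - psum (fun k => f k v) N))%C by ring.
    eapply Rle_trans; [apply Cmod_triangle_minus|].
    eapply Rle_trans; [apply Rplus_le_compat_r, Cmod_triangle|]. lra. }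
  assert (HeF : edec F (Series M) d).
  { split; [exact Hd|split; [exact HcF|]]. intros v. assert (T := Htail 0%nat v). simpl in T.
    replace (F v - 0)%C with (F v) in T by ring. rewrite Rminus_0_r in T. exact T. }
  split; [exact HeF|].
  apply CS_eps. intros eps He. destruct (Hsmall (eps * d / 6)) as [N HN]; [apply Rdiv_lt_0_compat; [apply Rmult_lt_0_compat|]; lra|].
  exists N. intros n Hn. specialize (HN n Hn). destruct (edec_psum f M d n Hd H) as [E1 E2].
  rewrite <- E2, Cmod_sub_sym, <- (IR_minus _ _ _ _ _ _ HeF E1).
  assert (E3 : edec (fun v => F v - psum (fun k => f k v) n)%C (Series M - rsum M n) d).
  { split; [exact Hd|split].
    - intros v. apply rcont_minus; [apply HcF|apply E1].
    - intros v. apply Htail. }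
  eapply Rle_trans; [apply (IR_bound _ _ _ E3)|].
  apply Rle_trans with (6 * (eps * d / 6) / d); [|right; field; lra].
  apply Rmult_le_compat_r; [left; apply Rinv_0_lt_compat, Hd|]. lra.
Qed.

Lemma exp_ge_sq (y : R) : 0 <= y -> y ^ 2 / 4 <= exp y.
Proof.
  intros Hy. assert (H := exp_ineq1_le (y / 2)).
  replace (exp y) with (exp (y / 2) * exp (y / 2)) by (rewrite <- exp_plus; f_equal; field). nra.
Qed.

Lemma exp_ge_id (y : R) : y <= exp y.
Proof. assert (H := exp_ineq1_le y). lra. Qed.

(** Differentiation under the integral. Half of the rate [d] is spent on the factor [v], on
    [exp (h v)] and on its quadratic remainder: each is at most a multiple of [exp (2 dl |v|)] with
    [dl = d / 4]. *)
Lemma IR_holo (f : R -> C) (z : C) (K d : R) :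
  edec (fun v => cexp (z * RtoC v) * f v)%C K d -> (forall v, rcont f v) ->
  holo (fun w => IR (fun v => cexp (w * RtoC v) * f v)%C) z.
Proof.
  intros He Hcf. assert (HK := edec_K_nonneg _ _ _ He). assert (Hd := proj1 He).
  set (g := fun v => (cexp (z * RtoC v) * f v)%C) in *.
  assert (Hc : forall v, rcont g v) by apply He.
  assert (Hcid : forall v, rcont (fun s => RtoC s) v) by (intros; apply rcont_RtoC, continuous_id).
  set (dl := d / 4). assert (Hdl : 0 < dl) by (unfold dl; lra).
  assert (Hdom : forall (h : R -> C) (B : R), 0 <= B -> (forall v, rcont h v) -> (forall v, Cmod (h v) <= B * exp (2 * dl * Rabs v)) ->
     edec (fun v => h v * g v)%C (B * K) (d / 2)).
  { intros h B HB Hch Hb. split; [lra|split].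
    - intros v. apply rcont_mult; auto.
    - intros v. rewrite Cmod_mult.
      replace (- (d / 2) * Rabs v) with (2 * dl * Rabs v + - d * Rabs v) by (unfold dl; field).
      rewrite exp_plus. replace (B * K * (exp (2 * dl * Rabs v) * exp (- d * Rabs v)))
        with (B * exp (2 * dl * Rabs v) * (K * exp (- d * Rabs v))) by ring.
      apply Rmult_le_compat; [apply Cmod_ge_0|apply Cmod_ge_0|apply Hb|apply He]. }
  assert (Hhv : forall h v, Cmod (h * RtoC v) = Cmod h * Rabs v).
  { intros h v. rewrite Cmod_mult, Cmod_R. reflexivity. }
  assert (E1 : edec (fun v => RtoC v * g v)%C (/ dl * K) (d / 2)).
  { apply Hdom; [left; apply Rinv_0_lt_compat, Hdl|exact Hcid|]. intros v. rewrite Cmod_R.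
    apply Rmult_le_reg_l with dl; [exact Hdl|]. rewrite <- Rmult_assoc, Rinv_r, Rmult_1_l by lra.
    eapply Rle_trans; [apply exp_ge_id|]. apply exp_le. assert (T := Rabs_pos v). nra. }
  exists (IR (fun v => RtoC v * g v)%C).
  apply cdiff_second_order with (6 * (4 / dl ^ 2 * K) / (d / 2)) dl; [exact Hdl|].
  intros h Hh. assert (Hh0 := Cmod_ge_0 h).
  assert (E2 : edec (fun v => cexp (h * RtoC v) * g v)%C (1 * K) (d / 2)).
  { apply Hdom; [lra| |].
    - intros v. apply rcont_cexp, rcont_mult; [apply rcont_const|apply Hcid].
    - intros v. rewrite Cmod_cexp, Rmult_1_l. apply exp_le. eapply Rle_trans; [apply Re_le_Cmod|].
      rewrite Hhv. assert (T := Rabs_pos v). nra. }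
  rewrite (IR_ext (fun v => cexp ((z + h) * RtoC v) * f v)%C (fun v => cexp (h * RtoC v) * g v)%C).
  2:{ intros v. unfold g. rewrite Cmult_assoc, <- cexp_add. do 2 f_equal. ring. }
  change (fun v => cexp (z * RtoC v) * f v)%C with g.
  rewrite <- (IR_minus _ _ _ _ _ _ E2 He), Cmult_comm, <- (IR_scal h _ _ _ E1).
  assert (E3 := edec_minus _ _ _ _ _ _ E2 He). assert (E4 := edec_scal h _ _ _ E1).
  rewrite <- (IR_minus _ _ _ _ _ _ E3 E4).
  assert (E5 : edec (fun v => (cexp (h * RtoC v) - 1 - h * RtoC v) * g v)%C (Cmod h ^ 2 * (4 / dl ^ 2) * K) (d / 2)).
  { apply Hdom.
    - apply Rmult_le_pos; [apply pow2_ge_0|]. apply Rdiv_le_0_compat; [lra|apply pow_lt, Hdl].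
    - intros v. apply rcont_minus; [apply rcont_minus; [apply rcont_cexp|apply rcont_const]|];
        (apply rcont_mult; [apply rcont_const|apply Hcid]).
    - intros v. eapply Rle_trans; [apply cexp_taylor2|]. rewrite Hhv, Rpow_mult_distr.
      rewrite !Rmult_assoc. apply Rmult_le_compat_l; [apply pow2_ge_0|].
      replace (2 * (dl * Rabs v)) with (dl * Rabs v + dl * Rabs v) by ring. rewrite exp_plus.
      assert (T := Rabs_pos v).
      assert (T1 := exp_ge_sq (dl * Rabs v) ltac:(nra)).
      rewrite <- Rmult_assoc. apply Rmult_le_compat; [apply pow2_ge_0|left; apply exp_pos| |].
      + rewrite Rpow_mult_distr in T1. 
        replace (Rabs v ^ 2) with (4 / dl ^ 2 * (dl ^ 2 * Rabs v ^ 2 / 4)) by (field; lra).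
        apply Rmult_le_compat_l; [|exact T1]. apply Rdiv_le_0_compat; [lra|apply pow_lt, Hdl].
      + apply exp_le. nra. }
  rewrite (IR_ext _ (fun v => (cexp (h * RtoC v) - 1 - h * RtoC v) * g v)%C) by (intros; ring).
  eapply Rle_trans; [apply (IR_bound _ _ _ E5)|]. right. field. unfold dl in *. lra.
Qed.

(** * Partial fractions of the hyperbolic cotangent *)

Definition cder (f : R -> C) (t : R) (l : C) : Prop :=
  is_derive (fun s => Re (f s)) t (Re l) /\ is_derive (fun s => Im (f s)) t (Im l).

Lemma cder_FTC (f f' : R -> C) (a b : R) : a <= b ->
  (forall t, a <= t <= b -> cder f t (f' t)) -> (forall t, a <= t <= b -> rcont f' t) ->
  cint f' a b = (f b - f a)%C.
Proof. intros Hab H Hc. apply cint_FTC; [exact Hab| | |exact Hc]; intros; apply H; assumption. Qed.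

Lemma cder_plus f g t l m : cder f t l -> cder g t m -> cder (fun s => f s + g s)%C t (l + m)%C.
Proof.
  intros [H1 H2] [H3 H4]; split.
  - exact (is_derive_plus (V := R_NormedModule) _ _ t _ _ H1 H3).
  - exact (is_derive_plus (V := R_NormedModule) _ _ t _ _ H2 H4).
Qed.

Lemma cder_scal (c : C) f t l : cder f t l -> cder (fun s => c * f s)%C t (c * l)%C.
Proof.
  intros [H1 H2]. split; rewrite ?Re_mult, ?Im_mult.
  - apply (is_derive_minus (V := R_NormedModule) (fun s => Re c * Re (f s)) (fun s => Im c * Im (f s)));
      apply is_derive_scal; assumption.
  - apply (is_derive_plus (V := R_NormedModule) (fun s => Re c * Im (f s)) (fun s => Im c * Re (f s)));
      apply is_derive_scal; assumption.
Qed.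

Lemma cder_RtoC_cexp (p : R -> R) (b : C) (t p' : R) : is_derive p t p' ->
  cder (fun s => RtoC (p s) * cexp (RtoC s * b))%C t ((RtoC p' + RtoC (p t) * b) * cexp (RtoC t * b))%C.
Proof.
  intros Hp.
  assert (E : ((RtoC p' + RtoC (p t) * b) * cexp (RtoC t * b))%C =
     (RtoC p' * cexp (RtoC t * b) + RtoC (p t) * (b * cexp (RtoC t * b)))%C) by ring.
  rewrite E. split.
  - rewrite Re_plus, !re_scal_l. apply (is_derive_ext (fun s => p s * Re (cexp (RtoC s * b)))).
    { intros s. rewrite re_scal_l. reflexivity. }
    apply (is_derive_mult (K := R_AbsRing) p (fun s => Re (cexp (RtoC s * b)))); 
      [exact Hp|apply is_derive_cexp_Re|exact Rmult_comm].
  - rewrite Im_plus, !im_scal_l. apply (is_derive_ext (fun s => p s * Im (cexp (RtoC s * b)))).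
    { intros s. rewrite im_scal_l. reflexivity. }
    apply (is_derive_mult (K := R_AbsRing) p (fun s => Im (cexp (RtoC s * b)))); 
      [exact Hp|apply is_derive_cexp_Im|exact Rmult_comm].
Qed.

Lemma cont_deriv (f : R -> R) (t : R) : ex_derive f t -> continuous f t.
Proof. exact (ex_derive_continuous (V := R_NormedModule) f t). Qed.

Lemma is_derive_eq (f : R -> R) (t l l' : R) : is_derive f t l -> l = l' -> is_derive f t l'.
Proof. intros H <-. exact H. Qed.

Lemma is_derive_cos_pow (k : nat) (t : R) :
  is_derive (fun s => cos s ^ S k) t (- (INR (S k) * cos t ^ k * sin t)).
Proof.
  eapply is_derive_eq; [apply (is_derive_pow cos (S k) t (- sin t)), is_derive_cos|].
  cbn [pred]. ring.
Qed.

Lemma is_derive_mul (f g : R -> R) (t l m : R) : is_derive f t l -> is_derive g t m ->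
  is_derive (fun s => f s * g s) t (l * g t + f t * m).
Proof. intros Hf Hg. apply (is_derive_mult (K := R_AbsRing) f g t l m Hf Hg Rmult_comm). Qed.

Lemma is_derive_cos_pow_sin (k : nat) (n t : R) : INR (S k) = n - 1 ->
  is_derive (fun s => n * cos s ^ S k * sin s) t
    (n * cos t ^ S (S k) - n * (n - 1) * cos t ^ k * (1 - cos t * cos t)).
Proof.
  intros Hn. eapply is_derive_eq.
  - apply (is_derive_mul (fun s => n * cos s ^ S k) sin); [|apply is_derive_sin].
    apply (is_derive_scal (fun s => cos s ^ S k)). apply is_derive_cos_pow.
  - rewrite Hn. assert (S2 := sin2_cos2 t). unfold Rsqr in S2.
    replace (1 - cos t * cos t) with (sin t * sin t) by lra. simpl. ring.
Qed.

(** [cosF n] is the derivative of [cosE n] in [b]. The logarithmic derivative [cosF / cosE] is the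
    quantity that telescopes to the hyperbolic cotangent. *)
Definition cosE (n : nat) (b : C) : C := cint (fun t => RtoC (cos t ^ n) * cexp (RtoC t * b))%C (- (PI / 2)) (PI / 2).
Definition cosF (n : nat) (b : C) : C := cint (fun t => RtoC (t * cos t ^ n) * cexp (RtoC t * b))%C (- (PI / 2)) (PI / 2).

Lemma rcont_RtoC_cexp (p : R -> R) (b : C) (t : R) : continuous p t ->
  rcont (fun s => RtoC (p s) * cexp (RtoC s * b))%C t.
Proof.
  intros H. apply rcont_mult; [apply rcont_RtoC; exact H|]. apply rcont_cexp, rcont_scal_id.
Qed.

Lemma half_PI_le : - (PI / 2) <= PI / 2.
Proof. assert (H := PI_RGT_0). lra. Qed.

(** Two integrations by parts, packed into the single primitive [(b cos^n t + n cos^(n - 1) t sin t)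
    exp (b t)] with [n = m + 2], which vanishes at both ends. *)
Lemma cosE_rec (m : nat) (b : C) :
  ((RtoC (INR (S (S m)) ^ 2) + b * b) * cosE (S (S m)) b)%C = (RtoC (INR (S (S m)) * INR (S m)) * cosE m b)%C.
Proof.
  set (n := INR (S (S m))). assert (Hn : INR (S m) = n - 1) by (unfold n; rewrite (S_INR (S m)); ring).
  rewrite Hn.
  assert (Hpow : forall t k, continuous (fun s => cos s ^ k) t).
  { intros t k. apply cont_deriv. auto_derive. tauto. }
  assert (HF := cder_FTC
    (fun t => b * (RtoC (cos t ^ S (S m)) * cexp (RtoC t * b)) + RtoC (n * cos t ^ S m * sin t) * cexp (RtoC t * b))%C
    (fun t => (RtoC (n ^ 2) + b * b) * (RtoC (cos t ^ S (S m)) * cexp (RtoC t * b))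
       - RtoC (n * (n - 1)) * (RtoC (cos t ^ m) * cexp (RtoC t * b)))%C (- (PI / 2)) (PI / 2) half_PI_le).
  cbv beta in HF.
  rewrite cint_minus, !cint_scal in HF;
    try apply half_PI_le; try (intros; apply rcont_mult; [apply rcont_const|]; apply rcont_RtoC_cexp, Hpow);
    try (intros; apply rcont_RtoC_cexp, Hpow).
  fold (cosE (S (S m)) b) in HF. fold (cosE m b) in HF.
  apply Ceq_minus. rewrite HF.
  - rewrite cos_neg, cos_PI2. rewrite !pow_i by lia. rewrite Rmult_0_r, !Rmult_0_l. ring.
  - intros t _.
    assert (D1 := cder_RtoC_cexp (fun t => cos t ^ S (S m)) b t (- (n * cos t ^ S m * sin t))).
    assert (D2 := cder_RtoC_cexp (fun t => n * cos t ^ S m * sin t) b t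
       (n * cos t ^ S (S m) - n * (n - 1) * cos t ^ m * (1 - cos t * cos t))).
    cbv beta in D1, D2.
    match goal with |- cder _ _ ?r => replace r with
     (b * ((RtoC (- (n * cos t ^ S m * sin t)) + RtoC (cos t ^ S (S m)) * b) * cexp (RtoC t * b)) +
      (RtoC (n * cos t ^ S (S m) - n * (n - 1) * cos t ^ m * (1 - cos t * cos t)) + RtoC (n * cos t ^ S m * sin t) * b) * cexp (RtoC t * b))%C end.
    + apply cder_plus; [apply cder_scal|].
      * apply D1, is_derive_cos_pow.
      * apply D2, is_derive_cos_pow_sin, Hn.
    + rewrite !RtoC_opp, !RtoC_minus, !RtoC_mult, !RtoC_minus, !RtoC_mult.
      replace (RtoC (cos t ^ S (S m))) with (RtoC (cos t) * RtoC (cos t) * RtoC (cos t ^ m))%C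
        by (rewrite <- !RtoC_mult; f_equal; simpl; ring).
      replace (RtoC (n ^ 2)) with (RtoC n * RtoC n)%C by (rewrite <- RtoC_mult; f_equal; ring).
      ring.
  - intros t _. apply rcont_minus; (apply rcont_mult; [apply rcont_const|]; apply rcont_RtoC_cexp, Hpow).
Qed.

(** The derivative in [b] of [cosE_rec], obtained from the derivative in [b] of the primitive used
    there. *)
Lemma cosF_rec (m : nat) (b : C) :
  ((RtoC (INR (S (S m)) ^ 2) + b * b) * cosF (S (S m)) b + 2 * b * cosE (S (S m)) b)%C
   = (RtoC (INR (S (S m)) * INR (S m)) * cosF m b)%C.
Proof.
  set (n := INR (S (S m))). assert (Hn : INR (S m) = n - 1) by (unfold n; rewrite (S_INR (S m)); ring).
  rewrite Hn.
  assert (Hpow : forall t k, continuous (fun s => cos s ^ k) t).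
  { intros t k. apply cont_deriv. auto_derive. tauto. }
  assert (Hpow' : forall t k, continuous (fun s => s * cos s ^ k) t).
  { intros t k. apply cont_deriv. auto_derive. tauto. }
  assert (HF := cder_FTC
    (fun t => b * (RtoC (t * cos t ^ S (S m)) * cexp (RtoC t * b))
       + RtoC (cos t ^ S (S m) + t * (n * cos t ^ S m * sin t)) * cexp (RtoC t * b))%C
    (fun t => (RtoC (n ^ 2) + b * b) * (RtoC (t * cos t ^ S (S m)) * cexp (RtoC t * b))
       + 2 * b * (RtoC (cos t ^ S (S m)) * cexp (RtoC t * b))
       - RtoC (n * (n - 1)) * (RtoC (t * cos t ^ m) * cexp (RtoC t * b)))%C (- (PI / 2)) (PI / 2) half_PI_le).
  cbv beta in HF.
  rewrite cint_minus, cint_plus, !cint_scal in HF;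
    try apply half_PI_le;
    try (intros; apply rcont_plus);
    try (intros; apply rcont_mult; [apply rcont_const|]; apply rcont_RtoC_cexp; (apply Hpow || apply Hpow'));
    try (intros; apply rcont_RtoC_cexp; (apply Hpow || apply Hpow')).
  fold (cosE (S (S m)) b) in HF. fold (cosF (S (S m)) b) in HF. fold (cosF m b) in HF.
  apply Ceq_minus. rewrite HF.
  - rewrite cos_neg, cos_PI2. rewrite !pow_i by lia. rewrite !Rmult_0_r, !Rmult_0_l, !Rmult_0_r, !Rplus_0_r. ring.
  - intros t _.
    assert (D1 := cder_RtoC_cexp (fun t => t * cos t ^ S (S m)) b t (cos t ^ S (S m) - t * (n * cos t ^ S m * sin t))).
    assert (D2 := cder_RtoC_cexp (fun t => cos t ^ S (S m) + t * (n * cos t ^ S m * sin t)) b t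
       (t * (n * cos t ^ S (S m) - n * (n - 1) * cos t ^ m * (1 - cos t * cos t)))).
    cbv beta in D1, D2.
    match goal with |- cder _ _ ?r => replace r with
     (b * ((RtoC (cos t ^ S (S m) - t * (n * cos t ^ S m * sin t)) + RtoC (t * cos t ^ S (S m)) * b) * cexp (RtoC t * b)) +
      (RtoC (t * (n * cos t ^ S (S m) - n * (n - 1) * cos t ^ m * (1 - cos t * cos t)))
        + RtoC (cos t ^ S (S m) + t * (n * cos t ^ S m * sin t)) * b) * cexp (RtoC t * b))%C end.
    + apply cder_plus; [apply cder_scal|].
      * apply D1. eapply is_derive_eq; [apply (is_derive_mul (fun s => s)); [apply (is_derive_id (K := R_AbsRing))|apply is_derive_cos_pow]|].
        fold n. change (one (K := R_AbsRing)) with 1. change (@one R_AbsRing) with 1. simpl. ring.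
      * apply D2. eapply is_derive_eq; [apply (is_derive_plus (V := R_NormedModule));
          [apply is_derive_cos_pow|apply (is_derive_mul (fun s => s)); [apply (is_derive_id (K := R_AbsRing))|apply is_derive_cos_pow_sin, Hn]]|].
        fold n. change (@one R_AbsRing) with 1. change (@plus R_NormedModule) with Rplus. cbv beta. simpl. ring.
    + rewrite ?RtoC_plus, ?RtoC_minus, ?RtoC_mult, ?RtoC_minus, ?RtoC_mult, ?RtoC_minus, ?RtoC_mult.
      replace (RtoC (cos t ^ S (S m))) with (RtoC (cos t) * RtoC (cos t) * RtoC (cos t ^ m))%C
        by (rewrite <- !RtoC_mult; f_equal; simpl; ring).
      replace (RtoC (n ^ 2)) with (RtoC n * RtoC n)%C by (rewrite <- RtoC_mult; f_equal; ring).
      ring.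
  - intros t _. apply rcont_minus; [apply rcont_plus|]; (apply rcont_mult; [apply rcont_const|]; apply rcont_RtoC_cexp; (apply Hpow || apply Hpow')).
Qed.

Lemma cosE_0 (b : C) : (b * cosE 0 b)%C = (cexp (RtoC (PI / 2) * b) - cexp (- (RtoC (PI / 2) * b)))%C.
Proof.
  unfold cosE. rewrite <- cint_scal; [|apply half_PI_le|].
  - rewrite (cder_FTC (fun t => RtoC 1 * cexp (RtoC t * b))%C).
    + rewrite RtoC_opp. replace (- RtoC (PI / 2) * b)%C with (- (RtoC (PI / 2) * b))%C by ring. ring.
    + apply half_PI_le.
    + intros t _. simpl pow. replace (b * (RtoC 1 * cexp (RtoC t * b)))%C with
        ((RtoC 0 + RtoC 1 * b) * cexp (RtoC t * b))%C by ring.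
      apply (cder_RtoC_cexp (fun _ => 1)). apply (is_derive_const (V := R_NormedModule)).
    + intros t _. simpl pow. apply rcont_mult; [apply rcont_const|].
      apply rcont_RtoC_cexp, continuous_const.
  - intros t _. apply rcont_RtoC_cexp. simpl pow. apply continuous_const.
Qed.

Lemma cosF_0 (b : C) : (b * cosF 0 b + cosE 0 b)%C =
  (RtoC (PI / 2) * (cexp (RtoC (PI / 2) * b) + cexp (- (RtoC (PI / 2) * b))))%C.
Proof.
  unfold cosF, cosE.
  assert (Hc : forall t, continuous (fun s => s * cos s ^ 0) t).
  { intros t. apply cont_deriv. auto_derive. tauto. }
  assert (Hc' : forall t, continuous (fun s => cos s ^ 0) t).
  { intros t. apply cont_deriv. auto_derive. tauto. }
  rewrite <- cint_scal by (try apply half_PI_le; intros; apply rcont_RtoC_cexp, Hc).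
  rewrite <- cint_plus; try apply half_PI_le;
    try (intros; apply rcont_RtoC_cexp; apply Hc');
    try (intros; apply rcont_mult; [apply rcont_const|apply rcont_RtoC_cexp; apply Hc]).
  rewrite (cder_FTC (fun t => RtoC t * cexp (RtoC t * b))%C).
  - rewrite RtoC_opp. replace (- RtoC (PI / 2) * b)%C with (- (RtoC (PI / 2) * b))%C by ring. ring.
  - apply half_PI_le.
  - intros t _. simpl pow. rewrite Rmult_1_r.
    replace (b * (RtoC t * cexp (RtoC t * b)) + RtoC 1 * cexp (RtoC t * b))%C
      with ((RtoC 1 + RtoC t * b) * cexp (RtoC t * b))%C by ring.
    apply (cder_RtoC_cexp (fun s => s)). apply (is_derive_id (K := R_AbsRing)).
  - intros t _. apply rcont_plus; [apply rcont_mult; [apply rcont_const|]|]; apply rcont_RtoC_cexp; (apply Hc || apply Hc').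
Qed.

(** [s cos s <= sin s] by the mean value theorem, since the cosine decreases; parity covers negative
    [t]. *)
Lemma t_cos_le_sin (t : R) : - (PI / 2) <= t <= PI / 2 -> t ^ 2 * cos t <= t * sin t.
Proof.
  assert (Hpi := PI_RGT_0).
  assert (H : forall s, 0 <= s <= PI / 2 -> s * cos s <= sin s).
  { intros s Hs. destruct (Req_dec s 0) as [->|Hs0]; [rewrite sin_0; lra|].
    destruct (MVT_cor2 sin cos 0 s) as [c [Hc1 Hc2]]; [lra|intros; apply derivable_pt_lim_sin|].
    rewrite sin_0 in Hc1. assert (cos s <= cos c) by (apply cos_decr_1; lra). nra. }
  intros Ht. destruct (Rle_dec 0 t) as [H0|H0].
  - specialize (H t ltac:(lra)). nra.
  - specialize (H (- t) ltac:(lra)). rewrite cos_neg, sin_neg in H. nra.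
Qed.

(** Mass and second moment of [cos^n] on [[- PI / 2, PI / 2]]; the ratio of [cosV] to [cosW]
    measures the concentration at [0]. *)
Definition cosW (n : nat) : R := RInt (fun t => cos t ^ n) (- (PI / 2)) (PI / 2).
Definition cosV (n : nat) : R := RInt (fun t => t ^ 2 * cos t ^ n) (- (PI / 2)) (PI / 2).

(** Integrating the derivative of [t cos^(n + 1) t] equates [cosW (S n)] with [n + 1] times the
    integral of [t sin t cos^n t], and [t sin t >= t^2 cos t]. *)
Lemma cosV_le (n : nat) : INR (S n) * cosV (S n) <= cosW (S n).
Proof.
  unfold cosV, cosW. assert (Hpi := half_PI_le).
  assert (Hex : forall f : R -> R, (forall t, ex_derive f t) -> ex_RInt f (- (PI / 2)) (PI / 2)).
  { intros f Hf. apply ex_RInt_cont_le; [exact Hpi|]. intros; apply cont_deriv, Hf. }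
  assert (E : RInt (fun t => cos t ^ S n - INR (S n) * (t * sin t * cos t ^ n)) (- (PI / 2)) (PI / 2) = 0).
  { apply is_RInt_unique. replace 0 with (PI / 2 * cos (PI / 2) ^ S n - - (PI / 2) * cos (- (PI / 2)) ^ S n).
    2:{ rewrite cos_neg, cos_PI2, pow_i by lia. ring. }
    apply (is_RInt_derive (V := R_CompleteNormedModule) (fun t => t * cos t ^ S n)).
    - intros t _. eapply is_derive_eq; [apply (is_derive_mul (fun s => s)); [apply (is_derive_id (K := R_AbsRing))|apply is_derive_cos_pow]|].
      change (@one R_AbsRing) with 1. simpl. ring.
    - intros t _. apply cont_deriv. auto_derive. tauto. }
  rewrite (RInt_minus (V := R_CompleteNormedModule) (fun t => cos t ^ S n)) in E;
    [|apply Hex; intros; auto_derive; tauto|apply Hex; intros; auto_derive; tauto].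
  rewrite (RInt_scal (V := R_CompleteNormedModule)) in E; [|apply Hex; intros; auto_derive; tauto].
  change (RInt (fun t => cos t ^ S n) (- (PI / 2)) (PI / 2) -
    INR (S n) * RInt (fun t => t * sin t * cos t ^ n) (- (PI / 2)) (PI / 2) = 0) in E.
  apply Rle_trans with (INR (S n) * RInt (fun t => t * sin t * cos t ^ n) (- (PI / 2)) (PI / 2)); [|lra].
  apply Rmult_le_compat_l; [apply pos_INR|].
  apply RInt_le; [exact Hpi|apply Hex; intros; auto_derive; tauto|apply Hex; intros; auto_derive; tauto|].
  intros t Ht. assert (T := t_cos_le_sin t ltac:(lra)).
  assert (0 <= cos t) by (apply cos_ge_0; lra). assert (0 <= cos t ^ n) by (apply pow_le; assumption).
  simpl. simpl in T. nra.
Qed.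

Lemma cosW_cosE (n : nat) : RtoC (cosW n) = cosE n 0.
Proof.
  unfold cosE. rewrite (cint_ext _ (fun t => RtoC (cos t ^ n))).
  - unfold cint, cosW, RtoC. cbn [Re Im fst snd].
    rewrite RInt_const. apply C_ext; [reflexivity|]. symmetry. apply Rmult_0_r.
  - apply half_PI_le.
  - intros t _. rewrite Cmult_0_r, cexp_0. ring.
Qed.

(** At [b = 0] the recurrence [cosE_rec] is the Wallis recursion. *)
Lemma cosW_pos (k : nat) : 0 < cosW (2 * k).
Proof.
  induction k as [|k IH].
  - unfold cosW. simpl pow. rewrite RInt_const. change (0 < (PI / 2 - - (PI / 2)) * 1). assert (H := PI_RGT_0). lra.
  - replace (2 * S k)%nat with (S (S (2 * k))) by lia.
    assert (H := cosE_rec (2 * k) 0). rewrite <- !cosW_cosE in H.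
    replace ((RtoC (INR (S (S (2 * k))) ^ 2) + 0 * 0) * RtoC (cosW (S (S (2 * k)))))%C
      with (RtoC (INR (S (S (2 * k))) ^ 2 * cosW (S (S (2 * k))))) in H by (rewrite RtoC_mult; ring).
    rewrite <- RtoC_mult in H. apply (f_equal Re) in H. cbn [Re RtoC fst] in H.
    assert (H1 : 0 < INR (S (S (2 * k)))) by (apply lt_0_INR; lia).
    assert (H2 : 0 < INR (S (2 * k))) by (apply lt_0_INR; lia).
    assert (H3 : 0 < INR (S (S (2 * k))) * INR (S (2 * k)) * cosW (2 * k)) by (repeat apply Rmult_lt_0_compat; assumption).
    apply Rmult_lt_reg_l with (INR (S (S (2 * k))) ^ 2); [apply pow_lt, H1|]. rewrite Rmult_0_r, H. exact H3.
Qed.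

Lemma odd_cint_0 (p : R -> R) : (forall t, continuous p t) -> (forall t, p (- t) = - p t) ->
  cint (fun t => RtoC (p t)) (- (PI / 2)) (PI / 2) = RtoC 0.
Proof.
  intros Hc Ho. set (I := cint (fun t => RtoC (p t)) (- (PI / 2)) (PI / 2)).
  assert (E : I = (RtoC (-1) * I)%C).
  { unfold I at 1. rewrite <- (Ropp_involutive (PI / 2)) at 2.
    rewrite <- (cint_reflect (fun t => RtoC (p t))) by (try apply half_PI_le; intros; apply rcont_RtoC, Hc).
    unfold I. rewrite <- cint_scal by (try apply half_PI_le; intros; apply rcont_RtoC, Hc).
    apply cint_ext; [apply half_PI_le|]. intros t _. rewrite Ho, <- RtoC_mult. f_equal. ring. }
  assert (E2 : (2 * I)%C = RtoC 0).
  { replace (2 * I)%C with (I - RtoC (-1) * I)%C by ring. rewrite <- E. ring. }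
  apply Cmult_integral in E2. destruct E2 as [E2|E2]; [|exact E2].
  apply (f_equal Re) in E2. simpl in E2. lra.
Qed.

Lemma cos_kernel_le (h : R -> C) (p : R -> R) (B : R) (n : nat) : 0 <= B ->
  (forall t, rcont h t) -> (forall t, continuous p t) ->
  (forall t, - (PI / 2) <= t <= PI / 2 -> Rabs (p t) * Cmod (h t) <= B * t ^ 2) ->
  Cmod (cint (fun t => RtoC (p t * cos t ^ n) * h t)%C (- (PI / 2)) (PI / 2)) <= B * cosV n.
Proof.
  intros HB Hh Hp Hb.
  assert (Hc : forall t, continuous (fun s => cos s ^ n) t) by (intros; apply cont_deriv; auto_derive; tauto).
  apply Rle_trans with (RInt (fun t => B * (t ^ 2 * cos t ^ n)) (- (PI / 2)) (PI / 2)).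
  - apply cint_le; [apply half_PI_le| | |].
    + intros t _. apply rcont_mult; [|apply Hh]. apply rcont_RtoC. apply (continuous_mult (K := R_AbsRing) p); auto.
    + intros t _. apply cont_deriv. auto_derive. tauto.
    + intros t Ht. rewrite Cmod_mult, Cmod_R, Rabs_mult.
      assert (0 <= cos t) by (apply cos_ge_0; lra). rewrite (Rabs_pos_eq (cos t ^ n)) by (apply pow_le; assumption).
      replace (Rabs (p t) * cos t ^ n * Cmod (h t)) with (Rabs (p t) * Cmod (h t) * cos t ^ n) by ring.
      rewrite <- Rmult_assoc. apply Rmult_le_compat_r; [apply pow_le; assumption|]. apply Hb, Ht.
  - right. apply (RInt_scal (V := R_CompleteNormedModule)). apply ex_RInt_cont_le; [apply half_PI_le|].
    intros t _. apply cont_deriv. auto_derive. tauto.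
Qed.

(** Since [t cos^n t] is odd, [exp (b t)] may be replaced by [exp (b t) - 1], which brings in the
    second factor [t] of [cosV]. *)
Lemma cosF_bound (b : C) (n : nat) : Cmod (cosF n b) <= Cmod b * exp (2 * Cmod b) * cosV n.
Proof.
  assert (Hc : forall t, continuous (fun s => s * cos s ^ n) t) by (intros; apply cont_deriv; auto_derive; tauto).
  assert (Hid : forall t, rcont (fun t => cexp (RtoC t * b) - 1)%C t).
  { intros. apply rcont_minus; [apply rcont_cexp, rcont_scal_id|apply rcont_const]. }
  assert (E : cosF n b = cint (fun t => RtoC (t * cos t ^ n) * (cexp (RtoC t * b) - 1))%C (- (PI / 2)) (PI / 2)).
  { rewrite (cint_ext (fun t => RtoC (t * cos t ^ n) * (cexp (RtoC t * b) - 1))%C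
      (fun t => RtoC (t * cos t ^ n) * cexp (RtoC t * b) - RtoC (t * cos t ^ n))%C) by (try apply half_PI_le; intros; ring).
    rewrite cint_minus, (odd_cint_0 (fun t => t * cos t ^ n)); try apply half_PI_le; auto.
    - unfold cosF. ring.
    - intros t. rewrite cos_neg. ring.
    - intros. apply rcont_RtoC_cexp, Hc.
    - intros. apply rcont_RtoC, Hc. }
  rewrite E. apply (cos_kernel_le (fun t => cexp (RtoC t * b) - 1)%C (fun t => t)).
  - apply Rmult_le_pos; [apply Cmod_ge_0|left; apply exp_pos].
  - exact Hid.
  - intros. apply continuous_id.
  - intros t Ht. assert (T := cexp_taylor1 (RtoC t * b)). rewrite Cmod_mult, Cmod_R in T.
    assert (Hp4 := PI_4). assert (Ha : Rabs t <= 2) by (apply Rabs_le; lra).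
    assert (Hb := Cmod_ge_0 b). assert (Ht0 := Rabs_pos t).
    assert (Hexp : exp (Rabs t * Cmod b) <= exp (2 * Cmod b)) by (apply exp_le; nra).
    rewrite <- (pow2_abs t). assert (Hep := exp_pos (Rabs t * Cmod b)).
    apply Rle_trans with (Rabs t * (Rabs t * Cmod b * exp (Rabs t * Cmod b))); [apply Rmult_le_compat_l; assumption|].
    replace (Cmod b * exp (2 * Cmod b) * Rabs t ^ 2) with (Rabs t * (Rabs t * Cmod b * exp (2 * Cmod b))) by ring.
    apply Rmult_le_compat_l; [assumption|]. apply Rmult_le_compat_l; [nra|assumption].
Qed.

(** Oddness again: the linear term of the exponential drops out and the remainder is quadratic in
    [t]. *)
Lemma cosE_bound (b : C) (n : nat) : Cmod (cosE n b - RtoC (cosW n)) <= Cmod b ^ 2 * exp (2 * Cmod b) * cosV n.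
Proof.
  assert (Hc : forall t, continuous (fun s => s * cos s ^ n) t) by (intros; apply cont_deriv; auto_derive; tauto).
  assert (Hc' : forall t, continuous (fun s => cos s ^ n) t) by (intros; apply cont_deriv; auto_derive; tauto).
  assert (E : (cosE n b - RtoC (cosW n))%C =
     cint (fun t => RtoC (1 * cos t ^ n) * (cexp (RtoC t * b) - 1 - RtoC t * b))%C (- (PI / 2)) (PI / 2)).
  { rewrite (cint_ext _
      (fun t => RtoC (cos t ^ n) * cexp (RtoC t * b) - RtoC (cos t ^ n) * cexp (RtoC t * 0) - b * RtoC (t * cos t ^ n))%C).
    2:{ apply half_PI_le. }
    2:{ intros. rewrite Rmult_1_l, Cmult_0_r, cexp_0, RtoC_mult. ring. }
    rewrite !cint_minus, cint_scal, (odd_cint_0 (fun t => t * cos t ^ n)); try apply half_PI_le; auto.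
    - rewrite cosW_cosE. unfold cosE. ring.
    - intros t. rewrite cos_neg. ring.
    - intros. apply rcont_RtoC, Hc.
    - intros. apply rcont_RtoC_cexp, Hc'.
    - intros. apply rcont_RtoC_cexp, Hc'.
    - intros. apply rcont_minus; apply rcont_RtoC_cexp, Hc'.
    - intros. apply rcont_mult; [apply rcont_const|apply rcont_RtoC, Hc]. }
  rewrite E. apply (cos_kernel_le (fun t => cexp (RtoC t * b) - 1 - RtoC t * b)%C (fun _ => 1)).
  - apply Rmult_le_pos; [apply pow2_ge_0|left; apply exp_pos].
  - intros. apply rcont_minus; [apply rcont_minus; [apply rcont_cexp, rcont_scal_id|apply rcont_const]|apply rcont_scal_id].
  - intros. apply continuous_const.
  - intros t Ht. assert (T := cexp_taylor2 (RtoC t * b)). rewrite Cmod_mult, Cmod_R in T.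
    assert (Hp4 := PI_4). assert (Ha : Rabs t <= 2) by (apply Rabs_le; lra).
    assert (Hb := Cmod_ge_0 b). assert (Ht0 := Rabs_pos t).
    assert (Hexp : exp (Rabs t * Cmod b) <= exp (2 * Cmod b)) by (apply exp_le; nra).
    rewrite <- (pow2_abs t), Rabs_R1, Rmult_1_l. eapply Rle_trans; [exact T|].
    replace (Cmod b ^ 2 * exp (2 * Cmod b) * Rabs t ^ 2) with ((Rabs t * Cmod b) ^ 2 * exp (2 * Cmod b)) by ring.
    apply Rmult_le_compat_l; [apply pow2_ge_0|assumption].
Qed.

(* Both [cosE] and [cosF] are dominated by the concentration of [cos^n] at [0], so that
   [cosF (2 k) / cosE (2 k)] tends to [0]; the two recurrences telescope this quotient. *)
Lemma coth_partial_fractions (w : C) : w <> RtoC 0 ->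
  (forall k : nat, (w * w + RtoC (INR (S k) ^ 2))%C <> RtoC 0) -> cexp (2 * RtoC PI * w) <> RtoC 1 ->
  CS (fun k => w / (w * w + RtoC (INR (S k) ^ 2)))%C
     (RtoC (PI / 2) * (cexp (2 * RtoC PI * w) + 1) / (cexp (2 * RtoC PI * w) - 1) - / (2 * w))%C.
Proof.
  intros Hw Hk HX. set (b := (2 * w)%C).
  assert (H2 : RtoC 2 <> RtoC 0) by (intros H; apply (f_equal Re) in H; simpl in H; lra).
  assert (Hb : b <> RtoC 0) by (apply Cmult_neq_0; assumption).
  set (P := cexp (RtoC (PI / 2) * b)). set (Q := cexp (- (RtoC (PI / 2) * b))).
  assert (HQ : Q <> RtoC 0) by apply cexp_nz.
  assert (HPX : (P = cexp (2 * RtoC PI * w) * Q)%C).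
  { unfold P, Q. rewrite <- cexp_add. f_equal. unfold b. rewrite RtoC_div by lra. field. }
  assert (HE0 : cosE 0 b <> RtoC 0).
  { intros H. assert (T := cosE_0 b). rewrite H, Cmult_0_r in T. fold P Q in T. rewrite HPX in T.
    apply HX. assert (T2 : ((cexp (2 * RtoC PI * w) - 1) * Q)%C = RtoC 0) by (rewrite T; ring).
    apply Cmult_integral in T2. destruct T2 as [T2|T2]; [|contradiction]. apply Ceq_minus. exact T2. }
  assert (Hden : forall k, (RtoC (INR (S (S (2 * k))) ^ 2) + b * b)%C <> RtoC 0).
  { intros k H. apply (Hk k). replace (INR (S (S (2 * k)))) with (2 * INR (S k)) in H.
    2:{ rewrite !S_INR, mult_INR. simpl. ring. }
    assert (E : (4 * (w * w + RtoC (INR (S k) ^ 2)))%C = RtoC 0).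
    { rewrite <- H. unfold b. replace ((2 * INR (S k)) ^ 2) with (4 * INR (S k) ^ 2) by ring. rewrite RtoC_mult. ring. }
    apply Cmult_integral in E. destruct E as [E|E]; [|exact E]. apply (f_equal Re) in E. simpl in E. lra. }
  assert (HE : forall k, cosE (2 * k) b <> RtoC 0).
  { induction k as [|k IH]; [exact HE0|]. replace (2 * S k)%nat with (S (S (2 * k))) by lia.
    intros H. assert (T := cosE_rec (2 * k) b). rewrite H, Cmult_0_r in T. symmetry in T.
    apply Cmult_integral in T. destruct T as [T|T]; [|contradiction].
    apply (f_equal Re) in T. cbn [Re RtoC fst] in T.
    apply Rmult_integral in T. destruct T as [T|T]; apply INR_eq in T || (assert (T' := lt_0_INR (S (S (2 * k))) ltac:(lia)); assert (T'' := lt_0_INR (S (2 * k)) ltac:(lia)); lra). }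
  set (rho := fun k => (cosF (2 * k) b / cosE (2 * k) b)%C).
  (* Dividing [cosF_rec] by [cosE_rec] leaves [rho k - rho (k + 1) = 2 b / D] with
     [D = 4 (w^2 + (k + 1)^2)]. *)
  assert (Hstep : forall k, (w / (w * w + RtoC (INR (S k) ^ 2)))%C = (rho k - rho (S k))%C).
  { intros k. unfold rho. replace (2 * S k)%nat with (S (S (2 * k))) by lia.
    assert (T1 := cosE_rec (2 * k) b). assert (T2 := cosF_rec (2 * k) b).
    assert (N1 := HE k). assert (N2 := HE (S k)). replace (2 * S k)%nat with (S (S (2 * k))) in N2 by lia.
    assert (N3 := Hden k).
    set (c := RtoC (INR (S (S (2 * k))) * INR (S (2 * k)))) in *.
    set (D := (RtoC (INR (S (S (2 * k))) ^ 2) + b * b)%C) in *.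
    set (E1 := cosE (S (S (2 * k))) b) in *. set (F1 := cosF (S (S (2 * k))) b) in *.
    assert (N4 : c <> RtoC 0).
    { intros H. rewrite H, Cmult_0_l in T1. apply Cmult_integral in T1. tauto. }
    assert (EE : cosE (2 * k) b = (D * E1 / c)%C) by (rewrite T1; field; exact N4).
    assert (EF : cosF (2 * k) b = ((D * F1 + 2 * b * E1) / c)%C) by (rewrite T2; field; exact N4).
    rewrite EE, EF.
    replace (w * w + RtoC (INR (S k) ^ 2))%C with (D / 4)%C.
    2:{ unfold D, b. replace (INR (S (S (2 * k)))) with (2 * INR (S k)).
        2:{ rewrite !S_INR, mult_INR. simpl. ring. }
        replace ((2 * INR (S k)) ^ 2) with (4 * INR (S k) ^ 2) by ring. rewrite RtoC_mult. field. }
    unfold b. field. repeat split; try assumption. }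
  assert (Hps : forall n, psum (fun k => w / (w * w + RtoC (INR (S k) ^ 2)))%C n = (rho 0%nat - rho n)%C).
  { induction n as [|n IH]; cbn [psum]; [ring|]. rewrite IH, Hstep. ring. }
  assert (Hval : rho 0%nat = (RtoC (PI / 2) * (cexp (2 * RtoC PI * w) + 1) / (cexp (2 * RtoC PI * w) - 1) - / b)%C).
  { unfold rho. simpl Nat.mul. assert (T1 := cosE_0 b). assert (T2 := cosF_0 b).
    fold P Q in T1, T2. fold b. set (X := cexp (2 * RtoC PI * w)) in *.
    assert (HX1 : (X - 1)%C <> RtoC 0) by (intros H; apply HX, Ceq_minus; exact H).
    assert (EE : cosE 0 b = ((P - Q) / b)%C) by (rewrite <- T1; field; exact Hb).
    assert (EF : cosF 0 b = ((RtoC (PI / 2) * (P + Q) - cosE 0 b) / b)%C) by (rewrite <- T2; field; exact Hb).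
    rewrite EF, EE, HPX. field. repeat split; try assumption.
    intros H. replace (X * Q - Q)%C with ((X - 1) * Q)%C in H by ring.
    apply Cmult_integral in H. tauto. }
  rewrite <- Hval. apply CS_eps. intros eps Heps.
  set (B1 := Cmod b * exp (2 * Cmod b)). set (B2 := Cmod b ^ 2 * exp (2 * Cmod b)).
  assert (HB1 : 0 <= B1) by (apply Rmult_le_pos; [apply Cmod_ge_0|left; apply exp_pos]).
  assert (HB2 : 0 <= B2) by (apply Rmult_le_pos; [apply pow2_ge_0|left; apply exp_pos]).
  (* As [nn * V <= W], the summand [2 * B2] keeps [cosE] at least [W / 2] in modulus, and
     [2 * B1 / eps] makes [cosF] at most [eps * W / 2]. *)
  destruct (INR_unbounded (2 * B2 + 2 * B1 / eps + 1)) as [N HN]. exists (S N). intros n Hn.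
  rewrite Hps. replace (rho 0%nat - rho n - rho 0%nat)%C with (- rho n)%C by ring. rewrite Cmod_opp.
  destruct n as [|n]; [lia|]. unfold rho. rewrite Cmod_div by apply HE.
  assert (HW := cosW_pos (S n)).
  assert (Hbig : 2 * B2 + 2 * B1 / eps + 1 <= INR (2 * S n)).
  { eapply Rle_trans; [apply (HN (S n)); lia|]. apply le_INR. lia. }
  assert (HV : INR (2 * S n) * cosV (2 * S n) <= cosW (2 * S n)).
  { replace (2 * S n)%nat with (S (2 * n + 1)) by lia. apply cosV_le. }
  assert (HF := cosF_bound b (2 * S n)). assert (HEb := cosE_bound b (2 * S n)).
  fold B1 in HF. fold B2 in HEb.
  set (W := cosW (2 * S n)) in *. set (V := cosV (2 * S n)) in *. set (nn := INR (2 * S n)) in *.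
  assert (HB1e : 0 <= 2 * B1 / eps) by (apply Rdiv_le_0_compat; lra).
  assert (HV0 : 0 <= V).
  { unfold V, cosV. apply RInt_ge_0; [apply half_PI_le| |].
    - apply ex_RInt_cont_le; [apply half_PI_le|]. intros; apply cont_deriv; auto_derive; tauto.
    - intros t Ht. apply Rmult_le_pos; [apply pow2_ge_0|apply pow_le, cos_ge_0; lra]. }
  assert (H1 : 2 * (B2 * V) <= W) by nra.
  assert (H3 : 2 * (B1 * V) <= eps * W).
  { assert (E : 2 * B1 = eps * (2 * B1 / eps)) by (field; lra).
    assert ((2 * B1 / eps) * V <= W) by nra. nra. }
  assert (H4 : W / 2 <= Cmod (cosE (2 * S n) b)).
  { assert (T := Cmod_triangle_inv (RtoC W) (cosE (2 * S n) b)). rewrite Cmod_sub_sym, Cmod_R, Rabs_pos_eq in T by lra. lra. }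
  apply Rmult_le_reg_r with (Cmod (cosE (2 * S n) b)); [lra|].
  unfold Rdiv. rewrite Rmult_assoc, Rinv_l, Rmult_1_r by lra. nra.
Qed.

(** * The Mellin transform of [1 / (1 + exp (- 2 v))] *)

Lemma cexp_eq_1 (z : C) : cexp z = RtoC 1 -> Re z = 0 /\ exists k : Z, Im z = 2 * IZR k * PI.
Proof.
  intros H. assert (Hm := Cmod_cexp z). rewrite H, Cmod_1 in Hm.
  assert (Hre : Re z = 0) by (rewrite <- exp_0 in Hm; apply exp_inv; symmetry; exact Hm).
  split; [exact Hre|]. apply (f_equal Re) in H. change (exp (Re z) * cos (Im z) = 1) in H.
  rewrite Hre, exp_0, Rmult_1_l in H. replace (Im z) with (2 * (Im z / 2)) in H by field. rewrite cos_2a_sin in H.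
  assert (Hs : sin (Im z / 2) = 0) by (apply Rsqr_0_uniq; unfold Rsqr; lra).
  apply sin_eq_0_0 in Hs. destruct Hs as [k Hk]. exists k. lra.
Qed.

Lemma nonint_cexp (z : C) : nonint z -> cexp (2 * RtoC PI * (Ci * z)) <> RtoC 1.
Proof.
  intros Hz H. apply cexp_eq_1 in H. destruct H as [H1 [k H2]].
  assert (Hp := PI_RGT_0). destruct z as [x y].
  unfold Ci in H1, H2. simpl in H1, H2.
  assert (E1 : PI * y = 0) by lra. assert (E2 : PI * x = IZR k * PI) by lra.
  apply (Hz k). apply C_ext; simpl.
  - apply Rmult_eq_reg_l with PI; lra.
  - apply Rmult_integral in E1. lra.
Qed.

(** A zero forces [Y^2 = 1] for [Y = exp (i PI z / 2)], hence [exp (2 PI i z) = Y^4 = 1], which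
    [nonint_cexp] excludes. *)
Lemma nonint_csin (z : C) : nonint z -> csin (RtoC PI * z / 2) <> RtoC 0.
Proof.
  intros Hz H. unfold csin in H. set (Y := cexp (Ci * (RtoC PI * z / 2))) in *.
  rewrite cexp_opp in H. fold Y in H. assert (HY : Y <> RtoC 0) by apply cexp_nz.
  assert (Hi : Ci <> RtoC 0) by exact Ci_nz.
  assert (H2 : RtoC 2 <> RtoC 0) by (intros E; apply (f_equal Re) in E; simpl in E; lra).
  assert (E : (Y * Y)%C = RtoC 1).
  { apply Ceq_minus. replace (Y * Y - 1)%C with ((Y - / Y) / (2 * Ci) * (Y * (2 * Ci)))%C by (field; auto).
    rewrite H. ring. }
  apply (nonint_cexp z Hz).
  replace (2 * RtoC PI * (Ci * z))%C with
    (Ci * (RtoC PI * z / 2) + Ci * (RtoC PI * z / 2) + (Ci * (RtoC PI * z / 2) + Ci * (RtoC PI * z / 2)))%C by field.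
  rewrite !cexp_add. fold Y. rewrite E. ring.
Qed.

Lemma nonint_ccos (z : C) : nonint z -> ccos (RtoC PI * z / 2) <> RtoC 0.
Proof.
  intros Hz H. unfold ccos in H. set (Y := cexp (Ci * (RtoC PI * z / 2))) in *.
  rewrite cexp_opp in H. fold Y in H. assert (HY : Y <> RtoC 0) by apply cexp_nz.
  assert (E : (Y * Y)%C = RtoC (-1)).
  { apply Ceq_minus. replace (Y * Y - RtoC (-1))%C with ((Y + / Y) / 2 * (Y * 2))%C by (field; auto).
    rewrite H. ring. }
  apply (nonint_cexp z Hz).
  replace (2 * RtoC PI * (Ci * z))%C with
    (Ci * (RtoC PI * z / 2) + Ci * (RtoC PI * z / 2) + (Ci * (RtoC PI * z / 2) + Ci * (RtoC PI * z / 2)))%C by field.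
  rewrite !cexp_add. fold Y. rewrite E. ring.
Qed.

(** [exp (- al v)] for [v >= 0] and [exp (be v)] for [v <= 0]. One formula through the positive and
    negative parts of [v] makes it continuous by construction and turns products with exponentials
    into addition of exponents. *)
Definition sexp (al be : C) (v : R) : C :=
  cexp (- (al * RtoC ((Rabs v + v) / 2) + be * RtoC ((Rabs v - v) / 2))).

Lemma sexp_pos al be v : 0 <= v -> sexp al be v = cexp (RtoC v * - al).
Proof.
  intros Hv. unfold sexp. rewrite Rabs_pos_eq by exact Hv. f_equal.
  replace ((v + v) / 2) with v by field. replace ((v - v) / 2) with 0 by field. ring.
Qed.

Lemma sexp_neg al be v : v <= 0 -> sexp al be v = cexp (RtoC v * be).
Proof.
  intros Hv. unfold sexp. rewrite Rabs_left1 by exact Hv. f_equal.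
  replace ((- v + v) / 2) with 0 by field. replace ((- v - v) / 2) with (- v) by field. rewrite RtoC_opp. ring.
Qed.

Lemma rcont_sexp al be v : rcont (sexp al be) v.
Proof.
  assert (Ha : continuous (fun s => Rabs s) v) by (apply continuous_Rabs_comp, continuous_id).
  assert (Hi : continuous (fun s : R => s) v) by apply continuous_id.
  apply rcont_cexp, rcont_opp, rcont_plus; (apply rcont_mult; [apply rcont_const|apply rcont_RtoC]).
  - apply (continuous_scal_l (V := R_NormedModule) (fun s => Rabs s + s) (/ 2)).
    apply (continuous_plus (V := R_NormedModule)); assumption.
  - apply (continuous_scal_l (V := R_NormedModule) (fun s => Rabs s - s) (/ 2)).
    apply (continuous_minus (V := R_NormedModule)); assumption.
Qed.

Lemma edec_sexp al be d : 0 < d -> d <= Re al -> d <= Re be -> edec (sexp al be) 1 d.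
Proof.
  intros Hd Ha Hb. split; [exact Hd|split; [apply rcont_sexp|]]. intros v. rewrite Rmult_1_l.
  destruct (Rle_dec 0 v) as [Hv|Hv].
  - rewrite sexp_pos, Cmod_cexp, re_scal_l, Re_opp, Rabs_pos_eq by lra. apply exp_le. nra.
  - rewrite sexp_neg, Cmod_cexp, re_scal_l, Rabs_left by lra. apply exp_le. nra.
Qed.

Lemma cint_cexp (c : C) (a b : R) : a <= b -> c <> RtoC 0 ->
  cint (fun v => cexp (RtoC v * c)) a b = ((cexp (RtoC b * c) - cexp (RtoC a * c)) / c)%C.
Proof.
  intros Hab Hc. rewrite (cder_FTC (fun v => / c * (RtoC 1 * cexp (RtoC v * c)))%C); [field; exact Hc|exact Hab| |].
  - intros t _. replace (cexp (RtoC t * c)) with (/ c * ((RtoC 0 + RtoC 1 * c) * cexp (RtoC t * c)))%C by (field; exact Hc).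
    apply cder_scal, (cder_RtoC_cexp (fun _ => 1)). apply (is_derive_const (V := R_NormedModule)).
  - intros t _. apply rcont_cexp, rcont_scal_id.
Qed.

Lemma Re_pos_nz (z : C) : 0 < Re z -> z <> RtoC 0.
Proof. intros H E. rewrite E in H. simpl in H. lra. Qed.

Lemma IR_sexp al be : 0 < Re al -> 0 < Re be -> IR (sexp al be) = (/ al + / be)%C.
Proof.
  intros Ha Hb. set (d := Rmin (Re al) (Re be)). assert (Hd : 0 < d) by (apply Rmin_pos; assumption).
  assert (Hna := Re_pos_nz al Ha). assert (Hnb := Re_pos_nz be Hb).
  apply (IR_unique _ 1 d); [apply edec_sexp; [exact Hd|apply Rmin_l|apply Rmin_r]|].
  intros eps He. destruct (exp_small d (/ Cmod al + / Cmod be) eps Hd He) as [A0 [HA0 H]].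
  exists A0. intros A HA.
  rewrite <- (cint_Chasles _ (- A) 0 A) by (try lra; intros; apply rcont_sexp).
  rewrite (cint_ext _ (fun v => cexp (RtoC v * be)) (- A) 0) by (try lra; intros; apply sexp_neg; lra).
  rewrite (cint_ext _ (fun v => cexp (RtoC v * - al)) 0 A) by (try lra; intros; apply sexp_pos; lra).
  assert (Hna' : (- al)%C <> RtoC 0).
  { intros E. apply Hna. replace al with (- - al)%C by ring. rewrite E. ring. }
  rewrite !cint_cexp by (try lra; assumption). rewrite !Cmult_0_l, cexp_0.
  replace ((1 - cexp (RtoC (- A) * be)) / be + (cexp (RtoC A * - al) - 1) / - al - (/ al + / be))%C
    with (- (cexp (RtoC A * - al) * / al + cexp (RtoC (- A) * be) * / be))%C by (field; auto).
  rewrite Cmod_opp. eapply Rle_trans; [apply Cmod_triangle|].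
  rewrite !Cmod_mult, !Cmod_inv, !Cmod_cexp, !re_scal_l, Re_opp by assumption.
  eapply Rle_trans; [|apply (H A HA)]. rewrite Rmult_plus_distr_r, !(Rmult_comm (/ _)).
  assert (T1 := Rmin_l (Re al) (Re be)). assert (T2 := Rmin_r (Re al) (Re be)). fold d in T1, T2.
  apply Rplus_le_compat; (apply Rmult_le_compat_r; [left; apply Rinv_0_lt_compat, Cmod_gt_0; assumption|]);
    apply exp_le; nra.
Qed.

Definition logis (v : R) : R := / (1 + exp (- 2 * v)).

Lemma logis_pos v : 0 < logis v.
Proof. apply Rinv_0_lt_compat. assert (H := exp_pos (- 2 * v)). lra. Qed.

Lemma logis_le_1 v : logis v <= 1.
Proof.
  rewrite <- Rinv_1. apply Rinv_le_contravar; [lra|]. assert (H := exp_pos (- 2 * v)). lra.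
Qed.

Lemma logis_le_exp v : logis v <= exp (2 * v).
Proof.
  replace (2 * v) with (- (- 2 * v)) by ring. rewrite exp_Ropp.
  assert (H := exp_pos (- 2 * v)). apply Rinv_le_contravar; lra.
Qed.

Lemma continuous_logis v : continuous logis v.
Proof.
  apply cont_deriv. unfold logis. auto_derive. assert (H := exp_pos (- 2 * v)). lra.
Qed.

Lemma logis_log (y : R) (v : R) : 0 < y -> logis (v - ln y) = exp (2 * v) / (exp (2 * v) + y ^ 2).
Proof.
  intros Hy. unfold logis. replace (- 2 * (v - ln y)) with (- (2 * v) + (ln y + ln y)) by ring.
  rewrite !exp_plus, exp_Ropp, exp_ln by exact Hy. assert (H := exp_pos (2 * v)).
  field. split; nra.
Qed.

Lemma logis_log_r (y : R) (v : R) : 0 < y -> logis (ln y - v) = y ^ 2 / (exp (2 * v) + y ^ 2).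
Proof.
  intros Hy. unfold logis. replace (- 2 * (ln y - v)) with (2 * v + - (ln y + ln y)) by ring.
  rewrite !exp_plus, exp_Ropp, exp_plus, exp_ln by exact Hy. assert (H := exp_pos (2 * v)).
  field. split; nra.
Qed.

(** The case [n = 0] is the integrand of the transform of [logis]; the damping [exp (- 2 n |v|)] is
    what remains after [n] splittings. *)
Definition mel_kernel (w : C) (n : nat) (v : R) : C :=
  (cexp (- w * RtoC v) * RtoC (exp (- 2 * INR n * Rabs v) * logis v))%C.

Lemma rcont_cexp_lin (w : C) (v : R) : rcont (fun s => cexp (w * RtoC s)) v.
Proof. apply rcont_cexp, rcont_mult; [apply rcont_const|]. apply rcont_RtoC, continuous_id. Qed.

Lemma edec_mel_kernel (w : C) (n : nat) (d : R) : 0 < d -> d <= Re w -> d <= 2 - Re w ->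
  edec (mel_kernel w n) 1 (2 * INR n + d).
Proof.
  intros Hd H1 H2. assert (Hn := pos_INR n). split; [lra|split].
  - intros v. apply rcont_mult; [apply rcont_cexp_lin|]. apply rcont_RtoC.
    apply (continuous_mult (K := R_AbsRing)); [|apply continuous_logis].
    apply continuous_exp_comp. apply (continuous_scal_r (V := R_NormedModule) (- 2 * INR n)).
    apply continuous_Rabs_comp, continuous_id.
  - intros v. unfold mel_kernel. rewrite Cmod_mult, Cmod_cexp, Cmod_R, Re_mult, Re_opp. cbn [Re Im RtoC fst snd].
    assert (Hl := logis_pos v). assert (He := exp_pos (- 2 * INR n * Rabs v)).
    rewrite Rabs_pos_eq by nra. rewrite Rmult_1_l.
    replace (- (2 * INR n + d) * Rabs v) with (- 2 * INR n * Rabs v + - d * Rabs v) by ring. rewrite exp_plus.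
    replace (exp (- Re w * v - Im (- w) * 0) * (exp (- 2 * INR n * Rabs v) * logis v))
      with (exp (- 2 * INR n * Rabs v) * (exp (- Re w * v) * logis v)).
    2:{ replace (- Re w * v - Im (- w) * 0) with (- Re w * v) by ring. ring. }
    apply Rmult_le_compat_l; [lra|]. destruct (Rle_dec 0 v) as [Hv|Hv].
    + apply Rle_trans with (exp (- Re w * v) * 1).
      * apply Rmult_le_compat_l; [left; apply exp_pos|apply logis_le_1].
      * rewrite Rmult_1_r, Rabs_pos_eq by lra. apply exp_le. nra.
    + apply Rle_trans with (exp (- Re w * v) * exp (2 * v)).
      * apply Rmult_le_compat_l; [left; apply exp_pos|apply logis_le_exp].
      * rewrite <- exp_plus, Rabs_left by lra. apply exp_le. nra.
Qed.

(** Two consecutive dampings add up to a multiple of [1 + exp (- 2 |v|)], which cancels the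
    denominator of [logis]: the product is [1] for [v >= 0] and [exp (2 v)] for [v < 0]. *)
Lemma mel_kernel_split (w : C) (n : nat) (v : R) :
  mel_kernel w n v = (sexp (w + RtoC (2 * INR n)) (RtoC (2 * INR n + 2) - w) v - mel_kernel w (S n) v)%C.
Proof.
  assert (E : exp (- 2 * INR n * Rabs v) * logis v + exp (- 2 * INR (S n) * Rabs v) * logis v =
     exp (- (2 * INR n * ((Rabs v + v) / 2) + (2 * INR n + 2) * ((Rabs v - v) / 2)))).
  { rewrite S_INR. unfold logis. destruct (Rle_dec 0 v) as [Hv|Hv].
    - rewrite Rabs_pos_eq by exact Hv. 
      replace (- 2 * (INR n + 1) * v) with (- 2 * INR n * v + - 2 * v) by ring. rewrite exp_plus.
      replace (- (2 * INR n * ((v + v) / 2) + (2 * INR n + 2) * ((v - v) / 2))) with (- 2 * INR n * v) by field.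
      assert (H := exp_pos (- 2 * v)). field. lra.
    - rewrite Rabs_left by lra.
      replace (- 2 * (INR n + 1) * - v) with (2 * INR n * v + 2 * v) by ring. rewrite exp_plus.
      replace (- (2 * INR n * ((- v + v) / 2) + (2 * INR n + 2) * ((- v - v) / 2))) with (2 * INR n * v + 2 * v) by field.
      rewrite exp_plus. replace (- 2 * INR n * - v) with (2 * INR n * v) by ring.
      replace (- 2 * v) with (- (2 * v)) by ring. rewrite exp_Ropp.
      assert (H := exp_pos (2 * v)). field. lra. }
  unfold mel_kernel, sexp.
  replace (- ((w + RtoC (2 * INR n)) * RtoC ((Rabs v + v) / 2) + (RtoC (2 * INR n + 2) - w) * RtoC ((Rabs v - v) / 2)))%C
    with (- w * RtoC v + RtoC (- (2 * INR n * ((Rabs v + v) / 2) + (2 * INR n + 2) * ((Rabs v - v) / 2))))%C.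
  - rewrite cexp_add, cexp_RtoC, <- E, RtoC_plus. ring.
  - rewrite RtoC_opp, !RtoC_plus, !RtoC_mult, !RtoC_div, !RtoC_minus, !RtoC_plus, RtoC_mult by lra. field.
Qed.

(** The integral of the two-sided exponential split off at stage [n]. *)
Definition alt_term (w : C) (n : nat) : C :=
  (/ (w + RtoC (2 * INR n)) + / (RtoC (2 * INR n + 2) - w))%C.

Lemma IR_mel_split (w : C) (n : nat) : 0 < Re w < 2 ->
  IR (mel_kernel w n) = (alt_term w n - IR (mel_kernel w (S n)))%C.
Proof.
  intros Hw. set (d := Rmin (Re w) (2 - Re w)). assert (Hd : 0 < d) by (apply Rmin_pos; lra).
  assert (H1 := Rmin_l (Re w) (2 - Re w)). assert (H2 := Rmin_r (Re w) (2 - Re w)). fold d in H1, H2.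
  assert (Hn := pos_INR n).
  assert (Ra : Re (w + RtoC (2 * INR n)) = Re w + 2 * INR n) by reflexivity.
  assert (Rb : Re (RtoC (2 * INR n + 2) - w) = 2 * INR n + 2 - Re w) by reflexivity.
  rewrite (IR_ext _ _ (mel_kernel_split w n)).
  rewrite (IR_minus _ _ 1 1 d (2 * INR (S n) + d)).
  - rewrite IR_sexp by lra. reflexivity.
  - apply edec_sexp; lra.
  - apply edec_mel_kernel; lra.
Qed.

(** Terms of the expansion of [PI / 2 * cot (PI w / 2) - 1 / w]. *)
Definition cot_term (w : C) (k : nat) : C := (2 * w / (w * w - 4 * RtoC (INR (S k) ^ 2)))%C.

Lemma nonint_half (w : C) : 0 < Re w < 2 -> nonint (w / 2).
Proof.
  intros Hw k E. assert (H : Re (w / 2) = Re w / 2) by (destruct w; simpl; field).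
  rewrite E in H. cbn [Re RtoC fst] in H.
  assert (0 < k)%Z by (apply lt_IZR; lra). assert (k < 1)%Z by (apply lt_IZR; lra). lia.
Qed.

(** The expansion of [coth] at [u = i w / 2], multiplied by [i]. *)
Lemma cot_term_sum (w : C) : w <> RtoC 0 -> nonint (w / 2) ->
  CS (cot_term w) (Ci * (RtoC (PI / 2) * (cexp (RtoC PI * (Ci * w)) + 1) / (cexp (RtoC PI * (Ci * w)) - 1)) - / w)%C.
Proof.
  intros Hw Hni.
  assert (Hi : Ci <> RtoC 0) by exact Ci_nz.
  assert (Hii : (Ci * Ci)%C = RtoC (-1)) by (apply C_ext; simpl; ring).
  set (u := (Ci * (w / 2))%C).
  assert (Huu : (u * u)%C = (- (w * w / 4))%C).
  { unfold u. replace (Ci * (w / 2) * (Ci * (w / 2)))%C with (Ci * Ci * (w * w / 4))%C by field. rewrite Hii. ring. }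
  assert (Hu : u <> RtoC 0).
  { intros E. apply Hw. replace w with (2 * (u / Ci))%C by (unfold u; field; exact Hi). rewrite E. field. exact Hi. }
  assert (H4 : RtoC 4 <> RtoC 0) by (intros E; apply (f_equal Re) in E; simpl in E; lra).
  assert (Hk : forall k : nat, (u * u + RtoC (INR (S k) ^ 2))%C <> RtoC 0).
  { intros k E. rewrite Huu in E.
    assert (E2 : ((w / 2 - RtoC (INR (S k))) * (w / 2 + RtoC (INR (S k))))%C = RtoC 0).
    { replace (RtoC (INR (S k) ^ 2)) with (RtoC (INR (S k)) * RtoC (INR (S k)))%C in E by (rewrite <- RtoC_mult; f_equal; ring).
      rewrite <- (Copp_0). rewrite <- E. field. }
    apply Cmult_integral in E2. destruct E2 as [E2|E2].
    - apply (Hni (Z.of_nat (S k))). rewrite <- INR_IZR_INZ. apply Ceq_minus. exact E2.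
    - apply (Hni (- Z.of_nat (S k))%Z). rewrite opp_IZR, <- INR_IZR_INZ, RtoC_opp.
      replace (w / 2)%C with (w / 2 + RtoC (INR (S k)) - RtoC (INR (S k)))%C by ring. rewrite E2. ring. }
  assert (HX := nonint_cexp (w / 2) Hni). fold u in HX.
  assert (T := coth_partial_fractions u Hu Hk HX).
  apply (CS_scal Ci) in T.
  replace (2 * RtoC PI * u)%C with (RtoC PI * (Ci * w))%C in T, HX by (unfold u; field).
  match goal with |- CS _ ?r => match type of T with CS _ ?l => replace r with l end end.
  - eapply CS_ext; [|exact T]. intros k. unfold cot_term. cbv beta.
    assert (N := Hk k). rewrite Huu. rewrite Huu in N.
    set (D := (- (w * w / 4) + RtoC (INR (S k) ^ 2))%C) in *.
    replace (w * w - 4 * RtoC (INR (S k) ^ 2))%C with (- 4 * D)%C by (unfold D; field).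
    replace (Ci * (u / D))%C with (Ci * Ci * (w / 2) / D)%C by (unfold u, Cdiv; ring).
    rewrite Hii. field. exact N.
  - unfold u. field. repeat split; try assumption. intros E. apply HX. apply Ceq_minus. exact E.
Qed.

(** Finite form of [1 / sin z = cot (z / 2) - cot z]: [cot_term (w / 2)] counts the multiples of [4]
    twice, which reverses their sign, and [1 / (w + 4 N)] is left unpaired. *)
Lemma alt_cot (w : C) (N : nat) : 0 < Re w < 2 ->
  psum (fun n => (if Nat.even n then alt_term w n else - alt_term w n))%C (2 * N) =
  (/ w + psum (cot_term (w / 2)) N - psum (cot_term w) (2 * N) - / (w + RtoC (4 * INR N)))%C.
Proof.
  intros Hw.
  assert (Hp : forall r, 0 <= r -> (w + RtoC r)%C <> RtoC 0).
  { intros r Hr. apply Re_pos_nz. simpl. unfold Re in Hw. lra. }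
  assert (Hm : forall r, 2 <= r -> (RtoC r - w)%C <> RtoC 0).
  { intros r Hr. apply Re_pos_nz. simpl. unfold Re in Hw. lra. }
  induction N as [|N IH].
  - change (2 * 0)%nat with 0%nat. cbn [psum INR]. rewrite Rmult_0_r.
    replace (w + 0)%C with w by ring. ring.
  - replace (2 * S N)%nat with (S (S (2 * N))) by lia. cbn [psum]. rewrite IH.
    assert (Ev : Nat.even (2 * N) = true) by (rewrite Nat.even_mul; reflexivity).
    rewrite Nat.even_succ, <- Nat.negb_even, Ev. cbn [negb].
    assert (HN := pos_INR N).
    unfold alt_term, cot_term.
    replace (INR (S (S (2 * N)))) with (2 * INR N + 2) by (rewrite !S_INR, mult_INR; simpl; ring).
    replace (INR (S (2 * N))) with (2 * INR N + 1) by (rewrite !S_INR, mult_INR; simpl; ring).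
    replace (INR (2 * N)) with (2 * INR N) by (rewrite mult_INR; simpl; ring).
    rewrite S_INR. set (m := INR N) in *.
    assert (N1 := Hp (4 * m) ltac:(lra)). assert (N2 := Hp (4 * m + 2) ltac:(lra)).
    assert (N3 := Hp (4 * m + 4) ltac:(lra)). assert (N4 := Hm (4 * m + 2) ltac:(lra)).
    assert (N5 := Hm (4 * m + 4) ltac:(lra)).
    replace (2 * (2 * m)) with (4 * m) by ring. replace (2 * (2 * m + 1)) with (4 * m + 2) by ring.
    replace (4 * m + 2 + 2) with (4 * m + 4) by ring. replace (4 * (m + 1)) with (4 * m + 4) by ring.
    rewrite !RtoC_pow, !RtoC_plus, !RtoC_mult in *. set (M := RtoC m) in *.
    replace (2 * (w / 2) / (w / 2 * (w / 2) - 4 * (M + 1) ^ 2))%C with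
      (2 / (w + (4 * M + 4)) - 2 / (4 * M + 4 - w))%C.
    2:{ field. repeat split; try assumption. intros E. 
        assert (E2 : ((w + (4 * M + 4)) * (4 * M + 4 - w))%C = RtoC 0) by (rewrite <- Copp_0; rewrite <- E; ring).
        apply Cmult_integral in E2. tauto. }
    replace (2 * w / (w * w - 4 * (2 * M + 1) ^ 2))%C with (/ (w + (4 * M + 2)) - / (4 * M + 2 - w))%C.
    2:{ field. repeat split; try assumption. intros E. 
        assert (E2 : ((w + (4 * M + 2)) * (4 * M + 2 - w))%C = RtoC 0) by (rewrite <- Copp_0; rewrite <- E; ring).
        apply Cmult_integral in E2. tauto. }
    replace (2 * w / (w * w - 4 * (2 * M + 2) ^ 2))%C with (/ (w + (4 * M + 4)) - / (4 * M + 4 - w))%C.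
    2:{ field. repeat split; try assumption. intros E. 
        assert (E2 : ((w + (4 * M + 4)) * (4 * M + 4 - w))%C = RtoC 0) by (rewrite <- Copp_0; rewrite <- E; ring).
        apply Cmult_integral in E2. tauto. }
    field. repeat split; try assumption. apply Re_pos_nz; lra.
Qed.

Lemma psum_even_lim (a : nat -> C) (l : C) : CS a l ->
  forall eps, 0 < eps -> exists N, forall n, (N <= n)%nat -> Cmod (psum a (2 * n) - l) <= eps.
Proof.
  intros H eps He. destruct (proj1 (CS_eps a l) H eps He) as [N HN]. exists N. intros n Hn. apply HN. lia.
Qed.

(** Iterating [IR_mel_split] expands the transform into the alternating series of the cosecant;
    after [n] steps the remainder is at most [6 / (2 n + d)] by [IR_bound]. *)
Lemma mellin_logis (w : C) : 0 < Re w < 2 ->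
  IR (fun v => cexp (- w * RtoC v) * RtoC (logis v))%C = (RtoC PI / (2 * csin (RtoC PI * w / 2)))%C.
Proof.
  intros Hw. set (d := Rmin (Re w) (2 - Re w)). assert (Hd : 0 < d) by (apply Rmin_pos; lra).
  assert (Hd1 := Rmin_l (Re w) (2 - Re w)). assert (Hd2 := Rmin_r (Re w) (2 - Re w)). fold d in Hd1, Hd2.
  rewrite (IR_ext _ (mel_kernel w 0)).
  2:{ intros v. unfold mel_kernel. simpl INR. rewrite Rmult_0_r, Rmult_0_l, exp_0, Rmult_1_l. reflexivity. }
  assert (Hfin : forall n, IR (mel_kernel w 0) =
    (psum (fun n => (if Nat.even n then alt_term w n else - alt_term w n))%C n
      + (if Nat.even n then IR (mel_kernel w n) else - IR (mel_kernel w n)))%C).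
  { induction n as [|n IH]; [simpl; ring|]. cbn [psum]. rewrite IH, (IR_mel_split w n Hw).
    rewrite Nat.even_succ, <- Nat.negb_even. destruct (Nat.even n); cbn [negb]; ring. }
  assert (Hwnz : w <> RtoC 0) by (apply Re_pos_nz; lra).
  assert (Hre2 : Re (w / 2) = Re w / 2) by (destruct w; simpl; field).
  assert (H2nz : (w / 2)%C <> RtoC 0) by (apply Re_pos_nz; rewrite Hre2; lra).
  assert (S1 := cot_term_sum w Hwnz (nonint_half w Hw)).
  assert (S2 := cot_term_sum (w / 2) H2nz (nonint_half (w / 2) ltac:(rewrite Hre2; lra))).
  assert (HX := nonint_cexp (w / 2) (nonint_half w Hw)).
  replace (2 * RtoC PI * (Ci * (w / 2)))%C with (RtoC PI * (Ci * w))%C in HX by field.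
  assert (HY := nonint_cexp (w / 2 / 2) (nonint_half (w / 2) ltac:(rewrite Hre2; lra))).
  replace (2 * RtoC PI * (Ci * (w / 2 / 2)))%C with (RtoC PI * (Ci * (w / 2)))%C in HY by field.
  set (Y := cexp (RtoC PI * (Ci * (w / 2)))) in *.
  assert (EX : cexp (RtoC PI * (Ci * w)) = (Y * Y)%C) by (unfold Y; rewrite <- cexp_add; f_equal; field).
  rewrite EX in S1, HX.
  assert (HY0 : Y <> RtoC 0) by apply cexp_nz.
  assert (HX1 : (Y * Y - 1)%C <> RtoC 0) by (intros E; apply HX, Ceq_minus; exact E).
  assert (HY1 : (Y - 1)%C <> RtoC 0) by (intros E; apply HY, Ceq_minus; exact E).
  assert (Hi : Ci <> RtoC 0) by exact Ci_nz.
  assert (Hii : (Ci * Ci)%C = RtoC (-1)) by (apply C_ext; simpl; ring).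
  assert (Hval : (RtoC PI / (2 * csin (RtoC PI * w / 2)))%C =
     (/ w + (Ci * (RtoC (PI / 2) * (Y + 1) / (Y - 1)) - / (w / 2))
       - (Ci * (RtoC (PI / 2) * (Y * Y + 1) / (Y * Y - 1)) - / w))%C).
  { unfold csin. replace (Ci * (RtoC PI * w / 2))%C with (RtoC PI * (Ci * (w / 2)))%C by (unfold Cdiv; ring).
    rewrite cexp_opp. fold Y. rewrite RtoC_div by lra.
    replace (Y - / Y)%C with ((Y * Y - 1) / Y)%C by (field; exact HY0).
    field. repeat split; try assumption. }
  rewrite Hval. apply Ceq_minus, Cmod_zero_le. intros eps He.
  destruct (proj1 (CS_eps _ _) S2 (eps / 5)) as [N1 HN1]; [lra|].
  destruct (psum_even_lim _ _ S1 (eps / 5)) as [N2 HN2]; [lra|].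
  (* [30 / eps] makes [6 / n] at most [eps / 5], one of the four shares in the final estimate. *)
  destruct (INR_unbounded (30 / eps + 1)) as [N3 HN3].
  set (n := max N1 (max N2 N3)). specialize (HN1 n ltac:(lia)). specialize (HN2 n ltac:(lia)). specialize (HN3 n ltac:(lia)).
  assert (He30 : 0 < 30 / eps) by (apply Rdiv_lt_0_compat; lra).
  rewrite (Hfin (2 * n)%nat), alt_cot by exact Hw.
  replace (Nat.even (2 * n)) with true by (rewrite Nat.even_mul; reflexivity).
  assert (B1 := IR_bound _ _ _ (edec_mel_kernel w (2 * n) d Hd Hd1 Hd2)).
  assert (Hinv : / INR n <= eps / 30).
  { replace (eps / 30) with (/ (30 / eps)) by (field; lra). apply Rinv_le_contravar; lra. }
  assert (B1' : Cmod (IR (mel_kernel w (2 * n))) <= eps / 5).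
  { eapply Rle_trans; [exact B1|]. rewrite mult_INR. simpl (INR 2).
    apply Rle_trans with (6 * / INR n); [|lra]. unfold Rdiv. rewrite Rmult_1_r.
    apply Rmult_le_compat_l; [lra|]. apply Rinv_le_contravar; lra. }
  assert (B2 : Cmod (/ (w + RtoC (4 * INR n))) <= eps / 5).
  { assert (Hge : INR n <= Cmod (w + RtoC (4 * INR n))).
    { eapply Rle_trans; [|apply Re_le_Cmod]. rewrite Re_plus. cbn [Re RtoC fst]. unfold Re in Hw. lra. }
    rewrite Cmod_inv by (apply Cmod_gt_0; lra).
    apply Rle_trans with (/ INR n); [apply Rinv_le_contravar; lra|lra]. }
  match goal with |- Cmod ?e <= _ => replace e with
    ((psum (cot_term (w / 2)) n - (Ci * (RtoC (PI / 2) * (Y + 1) / (Y - 1)) - / (w / 2)))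
     - (psum (cot_term w) (2 * n) - (Ci * (RtoC (PI / 2) * (Y * Y + 1) / (Y * Y - 1)) - / w))
     - / (w + RtoC (4 * INR n)) + IR (mel_kernel w (2 * n)))%C by ring end.
  eapply Rle_trans; [apply Cmod_triangle|].
  eapply Rle_trans; [apply Rplus_le_compat_r, Cmod_triangle_minus|].
  eapply Rle_trans; [apply Rplus_le_compat_r, Rplus_le_compat_r, Cmod_triangle_minus|]. lra.
Qed.

Lemma edec_logis (w : C) (d : R) : 0 < d -> d <= Re w -> d <= 2 - Re w ->
  edec (fun v => cexp (- w * RtoC v) * RtoC (logis v))%C 1 d.
Proof.
  intros H H1 H2. apply (edec_ext (mel_kernel w 0)).
  - intros v. unfold mel_kernel. simpl INR. rewrite Rmult_0_r, Rmult_0_l, exp_0, Rmult_1_l. reflexivity.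
  - assert (T := edec_mel_kernel w 0 d H H1 H2). simpl INR in T. rewrite Rmult_0_r, Rplus_0_l in T. exact T.
Qed.

(** * Dirichlet convolution of absolutely convergent series *)

Lemma psum_ext (a b : nat -> C) (n : nat) : (forall k, (k < n)%nat -> a k = b k) -> psum a n = psum b n.
Proof.
  induction n as [|n IH]; intros H; [reflexivity|]. cbn [psum]. rewrite IH, H; auto.
Qed.

Lemma psum_plus (a b : nat -> C) (n : nat) : psum (fun k => a k + b k)%C n = (psum a n + psum b n)%C.
Proof. induction n as [|n IH]; cbn [psum]; [ring|rewrite IH; ring]. Qed.

Lemma psum_scal (c : C) (a : nat -> C) (n : nat) : psum (fun k => c * a k)%C n = (c * psum a n)%C.
Proof. induction n as [|n IH]; cbn [psum]; [ring|rewrite IH; ring]. Qed.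

Lemma psum_scal_r (c : C) (a : nat -> C) (n : nat) : psum (fun k => a k * c)%C n = (psum a n * c)%C.
Proof. induction n as [|n IH]; cbn [psum]; [ring|rewrite IH; ring]. Qed.

Lemma psum_zero (a : nat -> C) (n : nat) : (forall k, (k < n)%nat -> a k = RtoC 0) -> psum a n = RtoC 0.
Proof. induction n as [|n IH]; intros H; [reflexivity|]. cbn [psum]. rewrite IH, H; auto. ring. Qed.

Lemma psum_head (a : nat -> C) (n : nat) : psum a (S n) = (a O + psum (fun k => a (S k)) n)%C.
Proof. induction n as [|n IH]; [cbn [psum]; ring|]. cbn [psum] in *. rewrite IH. ring. Qed.

Lemma psum_single (a : nat -> C) (j n : nat) : (j < n)%nat ->
  (forall k, k <> j -> a k = RtoC 0) -> psum a n = a j.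
Proof.
  intros Hj H. induction n as [|n IH]; [lia|]. cbn [psum].
  destruct (Nat.eq_dec n j) as [->|Hn].
  - rewrite psum_zero; [ring|]. intros k Hk. apply H. lia.
  - rewrite IH, (H n Hn) by lia. ring.
Qed.

Lemma psum_extend (a : nat -> C) (n m : nat) : (n <= m)%nat ->
  (forall k, (n <= k)%nat -> a k = RtoC 0) -> psum a m = psum a n.
Proof.
  intros Hnm H. induction Hnm as [|m Hnm IH]; [reflexivity|]. cbn [psum]. rewrite IH, H by lia. ring.
Qed.

Lemma psum_le (a : nat -> C) (M : nat -> R) (n : nat) :
  (forall k, Cmod (a k) <= M k) -> Cmod (psum a n) <= rsum M n.
Proof.
  intros H. assert (T := psum_diff_le a M 0 n H (Nat.le_0_l n)). simpl in T.
  replace (psum a n - 0)%C with (psum a n) in T by ring. lra.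
Qed.

Lemma psum_RtoC (u : nat -> R) (n : nat) : psum (fun k => RtoC (u k)) n = RtoC (rsum u n).
Proof. induction n as [|n IH]; simpl; [reflexivity|]. rewrite IH, RtoC_plus. reflexivity. Qed.

Lemma rsum_ext (a b : nat -> R) (n : nat) : (forall k, (k < n)%nat -> a k = b k) -> rsum a n = rsum b n.
Proof.
  induction n as [|n IH]; intros H; [reflexivity|]. cbn [rsum]. rewrite IH, H; auto.
Qed.

Lemma rsum_scal (c : R) (a : nat -> R) (n : nat) : rsum (fun k => c * a k) n = c * rsum a n.
Proof. induction n as [|n IH]; simpl; [ring|rewrite IH; ring]. Qed.

Lemma rsum_scal_r (c : R) (a : nat -> R) (n : nat) : rsum (fun k => a k * c) n = rsum a n * c.
Proof. induction n as [|n IH]; simpl; [ring|rewrite IH; ring]. Qed.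

Lemma rsum_minus (a b : nat -> R) (n : nat) : rsum (fun k => a k - b k) n = rsum a n - rsum b n.
Proof. induction n as [|n IH]; simpl; [ring|rewrite IH; ring]. Qed.

Lemma rsum_trunc (M : nat -> R) (r n : nat) : (r <= n)%nat ->
  rsum (fun k => if (k <? r)%nat then M k else 0) n = rsum M r.
Proof.
  intros H. induction H as [|n Hn IH].
  - apply rsum_ext. intros k Hk. rewrite (proj2 (Nat.ltb_lt k r) Hk). reflexivity.
  - simpl. rewrite IH, (proj2 (Nat.ltb_ge n r) Hn). ring.
Qed.

Lemma csum_psum (f : nat -> C) (a n : nat) : csum a n f = psum (fun k => f (a + k)%nat) n.
Proof.
  revert a. induction n as [|n IH]; intros a; [reflexivity|].
  rewrite psum_head. unfold csum in *. cbn [seq map fold_right]. rewrite IH, Nat.add_0_r. f_equal.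
  apply psum_ext. intros k _. f_equal. lia.
Qed.

Lemma divsum_psum (f : nat -> C) (n K : nat) : (S n <= K)%nat ->
  divsum (S n) f = psum (fun d => if (S n mod S d =? 0)%nat then f (S d) else RtoC 0) K.
Proof.
  intros HK. rewrite (psum_extend _ (S n) K HK).
  2:{ intros k Hk. rewrite Nat.mod_small by lia. reflexivity. }
  unfold divsum.
  assert (G : forall p len a, fold_right Cplus (RtoC 0) (map f (filter p (seq a len))) =
     csum a len (fun d => if p d then f d else RtoC 0)).
  { intros p len. induction len as [|len IH]; intros a; [reflexivity|].
    unfold csum in *. cbn [seq filter map fold_right]. destruct (p a); cbn [map fold_right]; rewrite IH; [reflexivity|ring]. }
  rewrite G, csum_psum. apply psum_ext. intros k _. reflexivity.
Qed.

Lemma divsum_ext (f g : nat -> C) (n : nat) : (forall d, (1 <= d)%nat -> (n mod d = 0)%nat -> f d = g d) ->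
  divsum n f = divsum n g.
Proof.
  intros H. unfold divsum. f_equal. apply map_ext_in. intros d Hd.
  apply filter_In in Hd. destruct Hd as [H1 H2]. apply in_seq in H1. apply Nat.eqb_eq in H2. apply H; [lia|exact H2].
Qed.

Lemma divsum_scal (c : C) (f : nat -> C) (n : nat) : divsum n (fun d => c * f d)%C = (c * divsum n f)%C.
Proof.
  unfold divsum. induction (filter _ _) as [|d l IH]; simpl; [ring|]. rewrite IH. ring.
Qed.

Lemma divsum_scal_r (c : C) (f : nat -> C) (n : nat) : divsum n (fun d => f d * c)%C = (divsum n f * c)%C.
Proof.
  unfold divsum. induction (filter _ _) as [|d l IH]; simpl; [ring|]. rewrite IH. ring.
Qed.

Lemma divsum_IR (f : nat -> R -> C) (M : nat -> R) (d : R) (n : nat) : 0 < d ->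
  (forall k, (1 <= k)%nat -> (n mod k = 0)%nat -> edec (f k) (M k) d) ->
  edec (fun v => divsum n (fun k => f k v)) (Re (divsum n (fun k => RtoC (M k)))) d /\
  IR (fun v => divsum n (fun k => f k v)) = divsum n (fun k => IR (f k)).
Proof.
  intros Hd H. unfold divsum.
  assert (Hl : forall k, In k (filter (fun d => (n mod d =? 0)%nat) (seq 1 n)) -> edec (f k) (M k) d).
  { intros k Hk. apply filter_In in Hk. destruct Hk as [H1 H2]. apply in_seq in H1.
    apply Nat.eqb_eq in H2. apply H; [lia|exact H2]. }
  revert Hl. induction (filter _ _) as [|k l IH]; intros Hl; simpl map; simpl fold_right.
  - apply (edec_psum (fun _ _ => RtoC 0) (fun _ => 0) d 0 Hd). intros _.
    split; [exact Hd|split]; [intros; apply rcont_const|]. intros v. rewrite Cmod_0. lra.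
  - destruct IH as [IH1 IH2]; [intros; apply Hl; right; assumption|].
    assert (Hk : edec (f k) (M k) d) by (apply Hl; left; reflexivity). split.
    + rewrite Re_plus. assert (T := edec_plus _ _ _ _ _ _ Hk IH1). rewrite Rmin_left in T by lra. exact T.
    + rewrite (IR_plus _ _ _ _ _ _ Hk IH1), IH2. reflexivity.
Qed.

Lemma divsum_le (f : nat -> C) (M : nat -> R) (n : nat) :
  (forall d, (1 <= d)%nat -> (n mod d = 0)%nat -> Cmod (f d) <= M d) ->
  Cmod (divsum n f) <= Re (divsum n (fun d => RtoC (M d))).
Proof.
  intros H. unfold divsum.
  assert (Hl : forall k, In k (filter (fun d => (n mod d =? 0)%nat) (seq 1 n)) -> Cmod (f k) <= M k).
  { intros k Hk. apply filter_In in Hk. destruct Hk as [H1 H2]. apply in_seq in H1.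
    apply Nat.eqb_eq in H2. apply H; [lia|exact H2]. }
  revert Hl. induction (filter _ _) as [|k l IH]; intros Hl; simpl map; simpl fold_right.
  - rewrite Cmod_0. simpl. lra.
  - eapply Rle_trans; [apply Cmod_triangle|]. rewrite Re_plus. apply Rplus_le_compat.
    + apply Hl. left. reflexivity.
    + apply IH. intros; apply Hl; right; assumption.
Qed.

Section Convolution.

Variables (a b : nat -> C) (Ma Mb : nat -> R) (A B : C).
Hypothesis Ha : CS (fun n => a (S n)) A.
Hypothesis Hb : CS (fun n => b (S n)) B.
Hypothesis HMa : forall n, Cmod (a (S n)) <= Ma (S n).
Hypothesis HMb : forall n, Cmod (b (S n)) <= Mb (S n).
Hypothesis HsMa : ex_series (fun n => Ma (S n)).
Hypothesis HsMb : ex_series (fun n => Mb (S n)).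

(** Pairs under the hyperbola; [K] is only a common range for both indices, large enough once
    [K >= N]. *)
Let hyper (K N : nat) : C :=
  psum (fun d => psum (fun m => if (S d * S m <=? N)%nat then (a (S d) * b (S m))%C else RtoC 0) K) K.

(** Passing from [N] to [N + 1] adds the pairs of product [N + 1], one for each divisor. *)
Lemma hyper_divsum (K N : nat) : (N <= K)%nat ->
  hyper K N = psum (fun n => divsum (S n) (fun d => a d * b (S n / d))%C) N.
Proof.
  induction N as [|N IH]; intros HN.
  - simpl. apply psum_zero. intros d _. apply psum_zero. intros m _. reflexivity.
  - cbn [psum]. rewrite <- IH by lia. rewrite (divsum_psum _ N K HN). unfold hyper.
    rewrite <- psum_plus. apply psum_ext. intros d Hd.
    destruct (Nat.eqb_spec (S N mod S d) 0) as [E|E].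
    + assert (Hdiv : (S N = S d * (S N / S d))%nat) by (apply Nat.div_exact; [lia|exact E]).
      destruct (S N / S d)%nat as [|m0] eqn:Hq; [lia|].
      assert (Es : psum (fun m => if (m =? m0)%nat then (a (S d) * b (S m0))%C else RtoC 0) K = (a (S d) * b (S m0))%C).
      { rewrite (psum_single _ m0 K); [rewrite Nat.eqb_refl; reflexivity|nia|].
        intros k Hk. rewrite (proj2 (Nat.eqb_neq k m0) Hk). reflexivity. }
      rewrite <- Es.
      rewrite <- psum_plus. apply psum_ext. intros m _.
      destruct (Nat.leb_spec (S d * S m) (S N)), (Nat.leb_spec (S d * S m) N), (Nat.eqb_spec m m0); try subst m; try nia; try ring.
    + rewrite Cplus_0_r. apply psum_ext. intros m _.
      destruct (Nat.leb_spec (S d * S m) (S N)), (Nat.leb_spec (S d * S m) N); try lia; try reflexivity.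
      exfalso. apply E. replace (S N) with (S m * S d)%nat by lia. apply Nat.Div0.mod_mul.
Qed.

Lemma psum_prod (K : nat) : psum (fun d => psum (fun m => a (S d) * b (S m))%C K) K =
  (psum (fun n => a (S n)) K * psum (fun n => b (S n)) K)%C.
Proof.
  rewrite <- psum_scal_r. apply psum_ext. intros d _. apply psum_scal.
Qed.

(** A pair missing from the hyperbolic region has product above [K >= r^2], so it lies outside the
    square of side [r]; the majorants over the pairs outside that square sum to the difference of
    the two products. *)
Lemma hyper_close (K r : nat) : (r * r <= K)%nat ->
  Cmod (hyper K K - psum (fun n => a (S n)) K * psum (fun n => b (S n)) K) <=
  rsum (fun n => Ma (S n)) K * rsum (fun n => Mb (S n)) K - rsum (fun n => Ma (S n)) r * rsum (fun n => Mb (S n)) r.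
Proof.
  intros Hr. assert (HrK : (r <= K)%nat) by nia.
  assert (Pa : forall n, 0 <= Ma (S n)) by (intros n; eapply Rle_trans; [apply Cmod_ge_0|apply HMa]).
  assert (Pb : forall n, 0 <= Mb (S n)) by (intros n; eapply Rle_trans; [apply Cmod_ge_0|apply HMb]).
  rewrite <- psum_prod. unfold hyper.
  set (t := fun (r k : nat) (M : nat -> R) => if (k <? r)%nat then M (S k) else 0).
  replace (rsum (fun n => Ma (S n)) K * rsum (fun n => Mb (S n)) K - rsum (fun n => Ma (S n)) r * rsum (fun n => Mb (S n)) r)
    with (rsum (fun d => rsum (fun m => Ma (S d) * Mb (S m) - t r d Ma * t r m Mb) K) K).
  2:{ rewrite <- (rsum_trunc _ r K HrK), <- (rsum_trunc (fun n => Mb (S n)) r K HrK).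
      rewrite <- !rsum_scal_r, <- rsum_minus. apply rsum_ext. intros d _.
      rewrite <- !rsum_scal, <- rsum_minus. reflexivity. }
  replace (psum (fun d => psum (fun m => if (S d * S m <=? K)%nat then (a (S d) * b (S m))%C else RtoC 0) K) K
     - psum (fun d => psum (fun m => a (S d) * b (S m))%C K) K)%C
    with (psum (fun d => psum (fun m => (if (S d * S m <=? K)%nat then (a (S d) * b (S m))%C else RtoC 0) + RtoC (-1) * (a (S d) * b (S m)))%C K) K).
  2:{ rewrite (psum_ext _ (fun d => psum (fun m => if (S d * S m <=? K)%nat then (a (S d) * b (S m))%C else RtoC 0) K
         + RtoC (-1) * psum (fun m => a (S d) * b (S m))%C K)%C).
      - rewrite psum_plus, psum_scal. ring.
      - intros d _. rewrite psum_plus, psum_scal. reflexivity. }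
  apply psum_le. intros d. apply psum_le. intros m.
  assert (Hab : Cmod (a (S d) * b (S m)) <= Ma (S d) * Mb (S m)).
  { rewrite Cmod_mult. apply Rmult_le_compat; try apply Cmod_ge_0; auto. }
  assert (P := Rmult_le_pos _ _ (Pa d) (Pb m)).
  unfold t. destruct (Nat.leb_spec (S d * S m) K) as [H|H].
  - replace (a (S d) * b (S m) + RtoC (-1) * (a (S d) * b (S m)))%C with (RtoC 0) by ring. rewrite Cmod_0.
    destruct (d <? r)%nat, (m <? r)%nat; lra.
  - assert (E : (if (d <? r)%nat then Ma (S d) else 0) * (if (m <? r)%nat then Mb (S m) else 0) = 0).
    { destruct (Nat.ltb_spec d r), (Nat.ltb_spec m r); try ring. exfalso. nia. }
    rewrite E, Rminus_0_r.
    replace (0 + RtoC (-1) * (a (S d) * b (S m)))%C with (- (a (S d) * b (S m)))%C by ring.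
    rewrite Cmod_opp. exact Hab.
Qed.

Lemma dirichlet_convolution :
  CS (fun n => divsum (S n) (fun d => a d * b (S n / d))%C) (A * B)%C.
Proof.
  assert (Pa : forall n, 0 <= Ma (S n)) by (intros n; eapply Rle_trans; [apply Cmod_ge_0|apply HMa]).
  assert (Pb : forall n, 0 <= Mb (S n)) by (intros n; eapply Rle_trans; [apply Cmod_ge_0|apply HMb]).
  set (SA := Series (fun n => Ma (S n))). set (SB := Series (fun n => Mb (S n))).
  assert (HSA : forall n, 0 <= rsum (fun n => Ma (S n)) n <= SA).
  { intros n. split; [|apply rsum_le_Series; assumption]. induction n; simpl; [lra|]. specialize (Pa n). lra. }
  assert (HSB : forall n, 0 <= rsum (fun n => Mb (S n)) n <= SB).
  { intros n. split; [|apply rsum_le_Series; assumption]. induction n; simpl; [lra|]. specialize (Pb n). lra. }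
  assert (HSA0 := HSA O). assert (HSB0 := HSB O).
  assert (HB := CS_bound _ _ _ HMb HsMb Hb). fold SB in HB.
  (* The error terms add up to at most [2 e (SA + SB)]; the [+ 1] keeps the denominator positive. *)
  apply CS_eps. intros eps He. set (e := eps / (4 * (SA + SB + 1))).
  assert (Hee : 0 < e) by (apply Rdiv_lt_0_compat; lra).
  assert (Ee : e * (4 * (SA + SB + 1)) = eps) by (unfold e; field; lra).
  destruct (rsum_lim _ HsMa e Hee) as [N1 HN1]. destruct (rsum_lim _ HsMb e Hee) as [N2 HN2].
  destruct (proj1 (CS_eps _ _) Ha e Hee) as [N3 HN3]. destruct (proj1 (CS_eps _ _) Hb e Hee) as [N4 HN4].
  set (r := max (max N1 N2) (max N3 N4)). exists (r * r)%nat. intros n Hn.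
  assert (Hrn : (r <= n)%nat) by nia.
  assert (H1 := HN1 r ltac:(lia)). assert (H2 := HN2 r ltac:(lia)).
  specialize (HN3 n ltac:(lia)). specialize (HN4 n ltac:(lia)). fold SA in H1. fold SB in H2.
  apply Rabs_le_between in H1. apply Rabs_le_between in H2.
  rewrite <- (hyper_divsum n n (Nat.le_refl n)).
  assert (H3 := hyper_close n r Hn).
  set (An := psum (fun n => a (S n)) n) in *. set (Bn := psum (fun n => b (S n)) n) in *.
  assert (HAn : Cmod An <= SA).
  { eapply Rle_trans; [apply psum_le, HMa|]. apply HSA. }
  replace (hyper n n - A * B)%C with ((hyper n n - An * Bn) + (An * (Bn - B) + (An - A) * B))%C by ring.
  eapply Rle_trans; [apply Cmod_triangle|].
  eapply Rle_trans; [apply Rplus_le_compat_l, Cmod_triangle|]. rewrite !Cmod_mult.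
  assert (HSAn := HSA n). assert (HSBn := HSB n). assert (HSAr := HSA r). assert (HSBr := HSB r).
  assert (T1 : Cmod An * Cmod (Bn - B) <= SA * e) by (apply Rmult_le_compat; try apply Cmod_ge_0; assumption).
  assert (T2 : Cmod (An - A) * Cmod B <= e * SB) by (apply Rmult_le_compat; try apply Cmod_ge_0; assumption).
  assert (T3 : rsum (fun n => Ma (S n)) n * rsum (fun n => Mb (S n)) n - rsum (fun n => Ma (S n)) r * rsum (fun n => Mb (S n)) r
     <= SA * e + SB * e).
  { set (x := rsum (fun n => Ma (S n)) n) in *. set (y := rsum (fun n => Mb (S n)) n) in *.
    set (x' := rsum (fun n => Ma (S n)) r) in *. set (y' := rsum (fun n => Mb (S n)) r) in *.
    assert (x * y <= SA * SB) by (apply Rmult_le_compat; lra).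
    assert (SA * SB - x' * y' <= SA * e + SB * e); [|lra].
    replace (SA * SB - x' * y') with (SA * (SB - y') + (SA - x') * y') by ring.
    apply Rplus_le_compat; [apply Rmult_le_compat_l; lra|]. rewrite (Rmult_comm SB). apply Rmult_le_compat; lra. }
  nra.
Qed.

End Convolution.

Lemma CS_RtoC_ex_series (u : nat -> R) (l : C) : CS (fun n => RtoC (u n)) l -> ex_series u.
Proof.
  intros H. exists (Re l). apply is_series_Reals. intros eps He.
  destruct (proj1 (CS_eps _ _) H (eps / 2)) as [N HN]; [lra|]. exists N. intros n Hn.
  specialize (HN (S n) ltac:(lia)). rewrite psum_RtoC in HN.
  rewrite <- sum_n_Reals, rsum_sum_n. unfold Rdist.
  assert (T := re_le_Cmod (RtoC (rsum u (S n)) - l)). rewrite Re_minus in T.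
  change (Re (RtoC (rsum u (S n)))) with (rsum u (S n)) in T. lra.
Qed.

Lemma CS_RtoC (u : nat -> R) : ex_series u -> CS (fun n => RtoC (u n)) (RtoC (Series u)).
Proof.
  intros H. apply CS_eps. intros eps He. destruct (rsum_lim u H eps He) as [N HN]. exists N. intros n Hn.
  rewrite psum_RtoC, <- RtoC_minus, Cmod_R. apply HN, Hn.
Qed.

(** Majorant of a convolution; [Re] only undoes the complex typing of [divsum]. *)
Definition rconv (Ma Mb : nat -> R) (n : nat) : R := Re (divsum n (fun d => RtoC (Ma d * Mb (n / d)%nat))).

Lemma ex_series_rconv (Ma Mb : nat -> R) :
  (forall n, 0 <= Ma (S n)) -> (forall n, 0 <= Mb (S n)) ->
  ex_series (fun n => Ma (S n)) -> ex_series (fun n => Mb (S n)) -> ex_series (fun n => rconv Ma Mb (S n)).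
Proof.
  intros Pa Pb Ha Hb.
  assert (T := dirichlet_convolution (fun n => RtoC (Ma n)) (fun n => RtoC (Mb n)) Ma Mb _ _ (CS_RtoC _ Ha) (CS_RtoC _ Hb)).
  eapply CS_RtoC_ex_series. eapply CS_ext; [|apply T; try assumption].
  - intros n. cbv beta. unfold rconv. rewrite (divsum_ext _ (fun d => RtoC (Ma d * Mb (S n / d)%nat))).
    2:{ intros d _ _. rewrite RtoC_mult. reflexivity. }
    set (f := fun d => RtoC (Ma d * Mb (S n / d)%nat)).
    assert (E : Im (divsum (S n) f) = 0).
    { unfold divsum. induction (filter _ _) as [|d l IH]; simpl; [reflexivity|]. unfold Im in IH. rewrite IH. ring. }
    apply C_ext; [reflexivity|]. rewrite E. reflexivity.
  - intros n. rewrite Cmod_R, Rabs_pos_eq; auto. lra.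
  - intros n. rewrite Cmod_R, Rabs_pos_eq; auto. lra.
Qed.

(** * Gauss sums *)

Section Characters.

Variables (q : nat) (chi : Z -> C).
Hypothesis Hchi : dirichlet_character q chi.

Lemma chi_q_pos : (1 <= q)%nat.
Proof. apply Hchi. Qed.

Lemma chi_1 : chi 1 = RtoC 1.
Proof. apply Hchi. Qed.

Lemma chi_mul m n : chi (m * n) = (chi m * chi n)%C.
Proof. apply Hchi. Qed.

Lemma chi_coprime n : Z.gcd n (Z.of_nat q) = 1%Z <-> chi n <> RtoC 0.
Proof. apply Hchi. Qed.

Lemma chi_period n k : chi (n + k * Z.of_nat q) = chi n.
Proof.
  assert (Hp : forall n, chi (n + Z.of_nat q) = chi n) by apply Hchi.
  assert (Hnat : forall (j : nat) n, chi (n + Z.of_nat j * Z.of_nat q) = chi n).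
  { induction j as [|j IH]; intros m; [f_equal; lia|].
    rewrite Nat2Z.inj_succ. replace (m + Z.succ (Z.of_nat j) * Z.of_nat q)%Z
      with (m + Z.of_nat j * Z.of_nat q + Z.of_nat q)%Z by lia. rewrite Hp. apply IH. }
  destruct (Z_le_gt_dec 0 k) as [Hk|Hk].
  - rewrite <- (Z2Nat.id k Hk). apply Hnat.
  - rewrite <- (Hnat (Z.to_nat (- k)) (n + k * Z.of_nat q)%Z). rewrite Z2Nat.id by lia. f_equal. lia.
Qed.

Lemma chi_mod n : chi (n mod Z.of_nat q) = chi n.
Proof.
  assert (Hq := chi_q_pos).
  rewrite <- (chi_period (n mod Z.of_nat q) (n / Z.of_nat q)). f_equal.
  rewrite (Z.div_mod n (Z.of_nat q)) at 3 by lia. lia.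
Qed.

(** Periodicity bounds the values by some [B]; a value of modulus above [1] would have powers, again
    values of [chi], beyond every bound. *)
Lemma chi_le_1 n : Cmod (chi n) <= 1.
Proof.
  assert (Hq := chi_q_pos).
  set (B := rsum (fun h => Cmod (chi (Z.of_nat h))) q).
  assert (HB : forall m, Cmod (chi m) <= B).
  { intros m. rewrite <- chi_mod. assert (Hm := Z.mod_pos_bound m (Z.of_nat q) ltac:(lia)).
    rewrite <- (Z2Nat.id (m mod Z.of_nat q)) by lia.
    assert (Hlt : (Z.to_nat (m mod Z.of_nat q) < q)%nat) by lia. revert Hlt. generalize (Z.to_nat (m mod Z.of_nat q)).
    unfold B. generalize q. clear. intros n h Hh. induction n as [|n IH]; [lia|]. simpl.
    assert (P : forall n, 0 <= rsum (fun h => Cmod (chi (Z.of_nat h))) n).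
    { induction n0; simpl; [lra|]. assert (T := Cmod_ge_0 (chi (Z.of_nat n0))). lra. }
    destruct (Nat.eq_dec h n) as [->|Hn]; [specialize (P n); lra|].
    assert (T := Cmod_ge_0 (chi (Z.of_nat n))). specialize (IH ltac:(lia)). lra. }
  apply Rnot_lt_le. intros Hlt. set (x := Cmod (chi n) - 1).
  assert (Hpow : forall k : nat, Cmod (chi n) ^ k <= B).
  { intros k. apply Rle_trans with (Cmod (chi (n ^ Z.of_nat k))); [|apply HB]. right.
    induction k as [|k IH]; [simpl; rewrite chi_1, Cmod_1; reflexivity|].
    rewrite Nat2Z.inj_succ, Z.pow_succ_r, chi_mul, Cmod_mult, <- IH by lia. reflexivity. }
  assert (Hx : 0 < x) by (unfold x; lra).
  destruct (INR_unbounded (B / x + 1)) as [N HN]. specialize (HN N (Nat.le_refl N)).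
  assert (T := poly N x Hx). replace (1 + x) with (Cmod (chi n)) in T by (unfold x; ring).
  specialize (Hpow N). assert (B = B / x * x) by (field; lra). nra.
Qed.

(** Bezout gives the inverse [a]; as [chi a * chi j = 1] with both moduli at most [1], the moduli
    equal [1] and [chi a] is the conjugate of [chi j]. *)
Lemma chi_inverse j : Z.gcd j (Z.of_nat q) = 1%Z ->
  exists a, Z.gcd a (Z.of_nat q) = 1%Z /\ chi a = Cconj (chi j) /\ exists k, (j * a = 1 + k * Z.of_nat q)%Z.
Proof.
  intros Hj. destruct (Z.gcd_bezout j (Z.of_nat q) 1 Hj) as [a [b Hab]].
  exists a. 
  assert (Hprod : (chi a * chi j)%C = RtoC 1).
  { rewrite <- chi_mul. replace (a * j)%Z with (1 + - b * Z.of_nat q)%Z by lia. rewrite chi_period. apply chi_1. }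
  assert (Ha : chi a <> RtoC 0).
  { intros E. rewrite E, Cmult_0_l in Hprod. apply (f_equal Re) in Hprod. simpl in Hprod. lra. }
  split; [apply chi_coprime, Ha|]. split; [|exists (- b)%Z; lia].
  assert (Hm := f_equal Cmod Hprod). rewrite Cmod_mult, Cmod_1 in Hm.
  assert (H1 := chi_le_1 a). assert (H2 := chi_le_1 j). assert (H3 := Cmod_ge_0 (chi a)). assert (H4 := Cmod_ge_0 (chi j)).
  assert (E : Cmod (chi j) = 1) by nra.
  assert (E2 := Cmod2_conj (chi j)). rewrite E in E2. replace (1 ^ 2) with 1 in E2 by ring.
  replace (chi a) with (chi a * (chi j * Cconj (chi j)))%C by (rewrite <- E2; ring).
  rewrite Cmult_assoc, Hprod. ring.
Qed.

Definition psum_list (f : nat -> C) (l : list nat) : C := fold_right Cplus (RtoC 0) (map f l).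

Lemma psum_list_perm (f : nat -> C) (l l' : list nat) : Permutation l l' -> psum_list f l = psum_list f l'.
Proof.
  unfold psum_list. induction 1; simpl; [reflexivity|rewrite IHPermutation; reflexivity|ring|congruence].
Qed.

(** Multiplication by a unit is injective on residues, hence a permutation of [seq 0 q]. *)
Lemma psum_reindex (f : Z -> C) (a : Z) : (forall n k, f (n + k * Z.of_nat q)%Z = f n) ->
  Z.gcd a (Z.of_nat q) = 1%Z ->
  psum (fun h => f (a * Z.of_nat h)%Z) q = psum (fun h => f (Z.of_nat h)) q.
Proof.
  intros Hf Ha. assert (Hq := chi_q_pos).
  set (s := fun h : nat => Z.to_nat ((a * Z.of_nat h) mod Z.of_nat q)).
  assert (Hmod : forall z, (0 <= z mod Z.of_nat q < Z.of_nat q)%Z) by (intros; apply Z.mod_pos_bound; lia).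
  assert (Hs : forall h, Z.of_nat (s h) = ((a * Z.of_nat h) mod Z.of_nat q)%Z).
  { intros h. unfold s. rewrite Z2Nat.id; [reflexivity|apply Hmod]. }
  assert (Hps : forall g, psum g q = psum_list g (seq 0 q)).
  { intros g. change (psum_list g (seq 0 q)) with (csum 0 q g). rewrite csum_psum. reflexivity. }
  rewrite !Hps. rewrite <- (psum_list_perm (fun h => f (Z.of_nat h)) (map s (seq 0 q)) (seq 0 q)).
  - unfold psum_list. rewrite map_map. f_equal. apply map_ext. intros h. rewrite Hs.
    rewrite (Z.div_mod (a * Z.of_nat h) (Z.of_nat q)) at 1 by lia.
    replace (Z.of_nat q * (a * Z.of_nat h / Z.of_nat q) + (a * Z.of_nat h) mod Z.of_nat q)%Z
      with ((a * Z.of_nat h) mod Z.of_nat q + (a * Z.of_nat h / Z.of_nat q) * Z.of_nat q)%Z by ring. apply Hf.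
  - apply NoDup_Permutation_bis.
    + apply NoDup_map_NoDup_ForallPairs; [|apply seq_NoDup].
      intros x y Hx Hy E. apply in_seq in Hx, Hy. apply (f_equal Z.of_nat) in E. rewrite !Hs in E.
      assert (D : (Z.of_nat q | a * (Z.of_nat x - Z.of_nat y))%Z).
      { apply Z.mod_divide; [lia|]. rewrite Z.mul_sub_distr_l, Zminus_mod, E, Z.sub_diag. apply Z.mod_0_l. lia. }
      apply Z.gauss in D; [|rewrite Z.gcd_comm; exact Ha]. destruct D as [k Hk].
      assert (k = 0)%Z by nia. lia.
    + rewrite length_map. lia.
    + intros y Hy. apply in_map_iff in Hy. destruct Hy as [x [<- Hx]]. apply in_seq.
      assert (T := Hmod (a * Z.of_nat x)%Z). unfold s. lia.
Qed.

Definition addchar (j : Z) : C := cexp (Ci * RtoC (2 * PI * IZR j / INR q)).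

Lemma INR_q_pos : 0 < INR q.
Proof. apply lt_0_INR. assert (H := chi_q_pos). lia. Qed.

Lemma addchar_plus j k : addchar (j + k) = (addchar j * addchar k)%C.
Proof.
  assert (Hq := INR_q_pos). unfold addchar. rewrite <- cexp_add, plus_IZR. f_equal.
  replace (2 * PI * (IZR j + IZR k) / INR q) with (2 * PI * IZR j / INR q + 2 * PI * IZR k / INR q) by (field; lra).
  rewrite RtoC_plus. ring.
Qed.

Lemma addchar_eq_1 j : addchar j = RtoC 1 <-> (Z.of_nat q | j)%Z.
Proof.
  assert (Hq := INR_q_pos). assert (Hpi := PI_RGT_0). split.
  - intros H. apply cexp_eq_1 in H. destruct H as [_ [k Hk]].
    unfold Ci in Hk. simpl in Hk. exists k. apply eq_IZR. rewrite mult_IZR, <- INR_IZR_INZ.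
    assert (E : 2 * PI * IZR j / INR q = 2 * IZR k * PI) by lra.
    apply (f_equal (fun t => t * INR q / (2 * PI))) in E.
    replace (2 * PI * IZR j / INR q * INR q / (2 * PI)) with (IZR j) in E by (field; lra).
    replace (2 * IZR k * PI * INR q / (2 * PI)) with (IZR k * INR q) in E by (field; lra). exact E.
  - intros [k ->]. unfold addchar. rewrite mult_IZR, <- INR_IZR_INZ.
    replace (2 * PI * (IZR k * INR q) / INR q) with (2 * IZR k * PI) by (field; lra).
    unfold cexp, Ci. simpl.
    replace (0 * (2 * IZR k * PI) - 1 * 0) with 0 by ring. replace (0 * 0 + 1 * (2 * IZR k * PI)) with (2 * (IZR k * PI)) by ring.
    rewrite exp_0, cos_2a_sin, sin_2a. assert (S : sin (IZR k * PI) = 0) by (apply sin_eq_0_1; exists k; reflexivity).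
    rewrite S. apply C_ext; simpl; ring.
Qed.

Lemma addchar_period j k : addchar (j + k * Z.of_nat q) = addchar j.
Proof.
  rewrite addchar_plus. replace (addchar (k * Z.of_nat q)) with (RtoC 1); [ring|].
  symmetry. apply addchar_eq_1. exists k. reflexivity.
Qed.

(** Summed over the residues [0 .. q - 1], with a frequency [j]; the value at [1] agrees with
    [gauss_sum], which runs over [1 .. q]. *)
Definition gauss (j : Z) : C := psum (fun h => chi (Z.of_nat h) * addchar (j * Z.of_nat h))%C q.

Lemma gauss_period j k : gauss (j + k * Z.of_nat q) = gauss j.
Proof.
  unfold gauss. apply psum_ext. intros h _. f_equal.
  replace ((j + k * Z.of_nat q) * Z.of_nat h)%Z with (j * Z.of_nat h + (k * Z.of_nat h) * Z.of_nat q)%Z by ring.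
  apply addchar_period.
Qed.

Lemma gauss_mul a j : Z.gcd a (Z.of_nat q) = 1%Z -> gauss j = (chi a * gauss (j * a))%C.
Proof.
  intros Ha. unfold gauss. rewrite <- psum_scal.
  rewrite <- (psum_reindex (fun h => chi h * addchar (j * h))%C a).
  - apply psum_ext. intros h _. rewrite chi_mul. replace (j * (a * Z.of_nat h))%Z with (j * a * Z.of_nat h)%Z by ring. ring.
  - intros n k. rewrite chi_period. f_equal.
    replace (j * (n + k * Z.of_nat q))%Z with (j * n + (j * k) * Z.of_nat q)%Z by ring. apply addchar_period.
  - exact Ha.
Qed.

Hypothesis Hprim : primitive_character q chi.

(** For [j] prime to [q], substitute [h -> a h] with [a] the inverse of [j]. Otherwise put
    [d = q / gcd (j, q)]: primitivity provides a unit [a], congruent to [1] modulo [d], with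
    [chi a <> 1]; then [j a] is congruent to [j] modulo [q], and [gauss_mul] reads
    [gauss j = chi a * gauss j], so both sides vanish. *)
Lemma gauss_separable j : gauss j = (Cconj (chi j) * gauss 1)%C.
Proof.
  assert (Hq := chi_q_pos).
  destruct (Z.eq_dec (Z.gcd j (Z.of_nat q)) 1) as [Hj|Hj].
  - destruct (chi_inverse j Hj) as [a [Ha [Ea [k Hk]]]].
    rewrite (gauss_mul a j Ha), Hk, gauss_period, Ea. reflexivity.
  - assert (Hz : chi j = RtoC 0) by (apply NNPP; intros E; apply Hj, chi_coprime, E).
    rewrite Hz. replace (Cconj 0 * gauss 1)%C with (RtoC 0) by (apply C_ext; simpl; ring).
    set (g := Z.gcd j (Z.of_nat q)) in *.
    assert (Hg0 : (0 <= g)%Z) by apply Z.gcd_nonneg.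
    destruct (Z.gcd_divide_r j (Z.of_nat q)) as [d Hd]. fold g in Hd.
    destruct (Z.gcd_divide_l j (Z.of_nat q)) as [j' Hj']. fold g in Hj'.
    assert (Hg00 : g <> 0%Z) by (intros E; rewrite E in Hd; lia).
    assert (Hg1 : (1 < g)%Z) by lia. clearbody g.
    assert (Hdp : (0 < d)%Z) by nia.
    assert (Hdq : (d < Z.of_nat q)%Z) by nia.
    assert (Hni := Hprim (Z.to_nat d) ltac:(lia)).
    assert (Hex : exists a, Z.gcd a (Z.of_nat q) = 1%Z /\ (a mod d = 1 mod d)%Z /\ chi a <> RtoC 1).
    { apply NNPP. intros Hn. apply Hni. split; [lia|split].
      - exists (Z.to_nat g). apply Nat2Z.inj. rewrite Nat2Z.inj_mul, !Z2Nat.id by lia. rewrite Z.mul_comm. exact Hd.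
      - intros a Ha Hm. rewrite Z2Nat.id in Hm by lia. apply NNPP. intros E. apply Hn. exists a. auto. }
    destruct Hex as [a [Ha [Hm Hne]]].
    assert (Hda : (d | a - 1)%Z).
    { apply Z.mod_divide; [lia|]. rewrite Zminus_mod, Hm, Z.sub_diag. apply Z.mod_0_l. lia. }
    destruct Hda as [m Hma].
    assert (E := gauss_mul a j Ha).
    replace (j * a)%Z with (j + (j' * m) * Z.of_nat q)%Z in E.
    2:{ rewrite Hd. replace a with (1 + m * d)%Z by lia. rewrite Hj' at 2. rewrite Hj' at 1. ring. }
    rewrite gauss_period in E.
    assert (E2 : ((chi a - 1) * gauss j)%C = RtoC 0) by (replace ((chi a - 1) * gauss j)%C with (chi a * gauss j - gauss j)%C by ring; rewrite <- E; ring).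
    apply Cmult_integral in E2. destruct E2 as [E2|E2]; [|exact E2].
    exfalso. apply Hne, Ceq_minus. exact E2.
Qed.

Lemma psum_cexp_geom (z : C) (n : nat) :
  ((z - 1) * psum (fun j => Cpow z j) n)%C = (Cpow z n - 1)%C.
Proof. induction n as [|n IH]; cbn [psum]; [simpl; ring|]. rewrite Cmult_plus_distr_l, IH. simpl. ring. Qed.

Lemma addchar_pow k n : addchar (k * Z.of_nat n) = Cpow (addchar k) n.
Proof.
  induction n as [|n IH].
  - rewrite Z.mul_0_r. simpl. apply addchar_eq_1. exists 0%Z. reflexivity.
  - rewrite Nat2Z.inj_succ. replace (k * Z.succ (Z.of_nat n))%Z with (k + k * Z.of_nat n)%Z by lia.
    rewrite addchar_plus, IH. reflexivity.
Qed.

Lemma addchar_orth k : psum (fun j => addchar (k * Z.of_nat j)) q =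
  if excluded_middle_informative (Z.of_nat q | k)%Z then RtoC (INR q) else RtoC 0.
Proof.
  rewrite (psum_ext _ (fun j => Cpow (addchar k) j)) by (intros; apply addchar_pow).
  destruct excluded_middle_informative as [H|H].
  - rewrite (proj2 (addchar_eq_1 k) H). rewrite (psum_ext _ (fun _ => RtoC 1)) by (intros; apply Cpow_1_l).
    rewrite psum_RtoC. f_equal. generalize q. intros n. induction n as [|n IH]; [reflexivity|]. cbn [rsum]. rewrite S_INR, IH. reflexivity.
  - assert (E := psum_cexp_geom (addchar k) q).
    rewrite <- addchar_pow, (proj2 (addchar_eq_1 (k * Z.of_nat q))) in E by (exists k; reflexivity).
    replace (1 - 1)%C with (RtoC 0) in E by ring. apply Cmult_integral in E. destruct E as [E|E]; [|exact E].
    exfalso. apply H, addchar_eq_1, Ceq_minus. exact E.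
Qed.

Lemma psum_exchange (f : nat -> nat -> C) (n m : nat) :
  psum (fun i => psum (fun j => f i j) m) n = psum (fun j => psum (fun i => f i j) n) m.
Proof.
  induction n as [|n IH]; cbn [psum].
  - symmetry. apply psum_zero. reflexivity.
  - rewrite IH, <- psum_plus. reflexivity.
Qed.

Hypothesis Hq2 : (2 <= q)%nat.

(** Fourier inversion at [1]: the sum of [gauss j] against [addchar (- j)] equals [q * chi 1], while
    separability would make every [gauss j] vanish with [gauss 1]. *)
Lemma gauss_nz : gauss 1 <> RtoC 0.
Proof.
  intros H0.
  assert (E : psum (fun j => gauss (Z.of_nat j) * addchar (-1 * Z.of_nat j))%C q = RtoC (INR q)).
  { unfold gauss.
    rewrite (psum_ext _ (fun j => psum (fun h => chi (Z.of_nat h) * addchar ((Z.of_nat h - 1) * Z.of_nat j))%C q)).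
    2:{ intros j _. rewrite <- psum_scal_r. apply psum_ext. intros h _. rewrite <- Cmult_assoc, <- addchar_plus. do 2 f_equal. ring. }
    rewrite psum_exchange.
    rewrite (psum_ext _ (fun h => chi (Z.of_nat h) * (if excluded_middle_informative (Z.of_nat q | Z.of_nat h - 1)%Z then RtoC (INR q) else RtoC 0))%C).
    2:{ intros h _. rewrite psum_scal, addchar_orth. reflexivity. }
    rewrite (psum_ext _ (fun h => if (h =? 1)%nat then RtoC (INR q) else RtoC 0)).
    - rewrite (psum_single _ 1 q); [reflexivity|lia|]. intros k Hk. rewrite (proj2 (Nat.eqb_neq k 1) Hk). reflexivity.
    - intros h Hh. destruct (Nat.eqb_spec h 1) as [->|Hn].
      + destruct excluded_middle_informative as [D|D]; [change (Z.of_nat 1) with 1%Z; rewrite chi_1; ring|].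
        exfalso. apply D. exists 0%Z. reflexivity.
      + destruct excluded_middle_informative as [D|D]; [|ring]. exfalso. destruct D as [k Hk]. assert (k = 0)%Z by nia. lia. }
  rewrite psum_zero in E.
  - assert (Hq := INR_q_pos). apply (f_equal Re) in E. cbn [Re RtoC fst] in E. lra.
  - intros j _. rewrite gauss_separable, H0. ring.
Qed.

Lemma chi_0 : chi 0 = RtoC 0.
Proof.
  apply NNPP. intros E. apply chi_coprime in E. rewrite Z.gcd_0_l, Z.abs_eq in E by lia. lia.
Qed.

(** The sum is [gauss 0], which separability makes a multiple of the conjugate of [chi 0 = 0]. *)
Lemma chi_sum_0 : psum (fun h => chi (Z.of_nat h)) q = RtoC 0.
Proof.
  replace (psum (fun h => chi (Z.of_nat h)) q) with (gauss 0).
  - rewrite gauss_separable, chi_0. replace (Cconj 0) with (RtoC 0) by (apply C_ext; simpl; ring). ring.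
  - unfold gauss. apply psum_ext. intros h _. rewrite Z.mul_0_l.
    rewrite (proj2 (addchar_eq_1 0)); [ring|exists 0%Z; reflexivity].
Qed.

Lemma gauss_sum_gauss : gauss_sum q chi = gauss 1.
Proof.
  unfold gauss_sum, gauss. rewrite csum_psum. 
  set (f := fun h => (chi (Z.of_nat h) * addchar (1 * Z.of_nat h))%C).
  assert (E : forall h, (chi (Z.of_nat (1 + h)) * cexp (Ci * RtoC (2 * PI * INR (1 + h) / INR q)))%C = f (S h)).
  { intros h. unfold f, addchar. rewrite Z.mul_1_l, <- INR_IZR_INZ. reflexivity. }
  rewrite (psum_ext _ (fun h => f (S h))) by (intros; apply E).
  assert (T := psum_head f q). cbn [psum] in T.
  assert (E0 : f q = f 0%nat).
  { unfold f. replace (Z.of_nat q) with (0 + 1 * Z.of_nat q)%Z by lia. rewrite chi_period, Z.mul_1_l, addchar_period. reflexivity. }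
  rewrite E0 in T. replace (psum f q) with (psum f q + f 0%nat - f 0%nat)%C by ring. rewrite T. ring.
Qed.

End Characters.

Lemma nonprincipal_modulus (q : nat) (chi : Z -> C) :
  dirichlet_character q chi -> ~ principal_character q chi -> (2 <= q)%nat.
Proof.
  intros H Hn. assert (Hq := chi_q_pos q chi H). destruct (Nat.eq_dec q 1) as [->|]; [|lia].
  exfalso. apply Hn. intros n _. rewrite <- (chi_mod 1 chi H), Z.mod_1_r.
  rewrite <- (chi_1 1 chi H), <- (chi_mod 1 chi H 1), Z.mod_1_r. reflexivity.
Qed.

Lemma even_character_opp (q : nat) (chi : Z -> C) (n : Z) :
  dirichlet_character q chi -> even_character chi -> chi (- n)%Z = chi n.
Proof.
  intros H He. replace (- n)%Z with (-1 * n)%Z by ring. rewrite (chi_mul q chi H), He. ring.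
Qed.

(** * Theta series *)

Lemma CS_geom (z : C) : Cmod z < 1 -> CS (fun n => Cpow z (S n)) (z / (1 - z))%C.
Proof.
  intros Hz.
  assert (H1 : (1 - z)%C <> RtoC 0).
  { intros E. replace z with (RtoC 1) in Hz by (apply Ceq_minus; exact E). rewrite Cmod_1 in Hz. lra. }
  assert (Hm : 0 < Cmod (1 - z)) by (apply Cmod_gt_0; exact H1).
  apply CS_eps. intros eps He.
  destruct (pow_lt_1_zero (Cmod z)) with (y := eps * Cmod (1 - z)) as [N HN].
  { rewrite Rabs_pos_eq; [exact Hz|apply Cmod_ge_0]. }
  { apply Rmult_lt_0_compat; assumption. }
  exists N. intros n Hn.
  assert (E : psum (fun n => Cpow z (S n)) n = (z * (1 - Cpow z n) / (1 - z))%C).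
  { assert (G := psum_cexp_geom z n). cbn [Cpow]. rewrite (psum_scal z (fun j => Cpow z j)).
    assert (E : psum (fun j => Cpow z j) n = ((Cpow z n - 1) / (z - 1))%C).
    { rewrite <- G. field. intros E. apply H1. replace (1 - z)%C with (- (z - 1))%C by ring. rewrite E. ring. }
    rewrite E. field. split; [exact H1|]. intros E'. apply H1. replace (1 - z)%C with (- (z - 1))%C by ring. rewrite E'. ring. }
  rewrite E. replace (z * (1 - Cpow z n) / (1 - z) - z / (1 - z))%C with (- (z * Cpow z n / (1 - z)))%C by (field; exact H1).
  rewrite Cmod_opp, Cmod_div, Cmod_mult, Cmod_pow by exact H1.
  specialize (HN n Hn). rewrite Rabs_pos_eq in HN by (apply pow_le, Cmod_ge_0).
  apply Rmult_le_reg_r with (Cmod (1 - z)); [exact Hm|].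
  unfold Rdiv. rewrite Rmult_assoc, Rinv_l, Rmult_1_r by lra.
  assert (T := Cmod_ge_0 z). assert (T2 := pow_le _ n T). nra.
Qed.

Definition bose (w : C) : C := (/ (cexp (2 * RtoC PI * w) - 1))%C.

Lemma cexp_2PI_right (w : C) : 0 < Re w -> cexp (2 * RtoC PI * w) <> RtoC 1.
Proof.
  intros Hw E. apply cexp_eq_1 in E. destruct E as [E _]. assert (Hpi := PI_RGT_0).
  destruct w as [x y]. simpl in Hw, E. unfold Re in *. simpl in *. nra.
Qed.

Lemma cexp_mult_nat (z : C) (n : nat) : cexp (RtoC (INR n) * z) = Cpow (cexp z) n.
Proof.
  induction n as [|n IH]; [simpl; rewrite Cmult_0_l; apply cexp_0|].
  rewrite S_INR, RtoC_plus. replace ((RtoC (INR n) + 1) * z)%C with (z + RtoC (INR n) * z)%C by ring.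
  rewrite cexp_add, IH. reflexivity.
Qed.

Lemma bose_series (w : C) : 0 < Re w ->
  CS (fun n => cexp (- (2 * RtoC PI * RtoC (INR (S n)) * w)))%C (bose w).
Proof.
  intros Hw. assert (Hpi := PI_RGT_0). set (X := cexp (2 * RtoC PI * w)).
  assert (HX0 : X <> RtoC 0) by apply cexp_nz.
  assert (HX1 : (X - 1)%C <> RtoC 0) by (intros E; apply (cexp_2PI_right w Hw), Ceq_minus; exact E).
  assert (HX2 : (1 - / X)%C <> RtoC 0).
  { intros E. apply HX1. replace (X - 1)%C with (X * (1 - / X))%C by (field; exact HX0). rewrite E. ring. }
  replace (bose w) with (/ X / (1 - / X))%C.
  - eapply CS_ext; [|apply CS_geom].
    + intros n. cbv beta. unfold X. rewrite <- cexp_opp, <- cexp_mult_nat. f_equal. ring.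
    + unfold X. rewrite <- cexp_opp, Cmod_cexp, <- exp_0. apply exp_increasing.
      destruct w as [x y]. simpl in Hw |- *. unfold Re in *. simpl in *. nra.
  - unfold bose. fold X. field. repeat split; assumption.
Qed.

(** [coth] written as [1 + 2 bose], which isolates its exponentially small part. *)
Lemma coth_right (w : C) : 0 < Re w ->
  CS (fun k => w / (w * w + RtoC (INR (S k) ^ 2)))%C (RtoC (PI / 2) + RtoC PI * bose w - / (2 * w))%C.
Proof.
  intros Hw. assert (HX := cexp_2PI_right w Hw).
  assert (Hnz : w <> RtoC 0) by (apply Re_pos_nz; exact Hw).
  assert (Hk : forall k : nat, (w * w + RtoC (INR (S k) ^ 2))%C <> RtoC 0).
  { intros k E. set (n := INR (S k)) in *.
    assert (E2 : ((w + Ci * RtoC n) * (w - Ci * RtoC n))%C = RtoC 0).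
    { replace ((w + Ci * RtoC n) * (w - Ci * RtoC n))%C with (w * w - Ci * Ci * (RtoC n * RtoC n))%C by ring.
      replace (Ci * Ci)%C with (RtoC (-1)) by (apply C_ext; simpl; ring).
      rewrite <- E, RtoC_pow. simpl. ring. }
    apply Cmult_integral in E2. destruct E2 as [E2|E2]; revert E2; apply Re_pos_nz; destruct w as [x y];
      unfold Ci, Re in *; simpl in *; lra. }
  assert (T := coth_partial_fractions w Hnz Hk HX).
  match goal with |- CS _ ?r => match type of T with CS _ ?l => replace r with l; [exact T|] end end.
  unfold bose. set (X := cexp (2 * RtoC PI * w)) in *. rewrite RtoC_div by lra. field.
  split; [exact Hnz|]. intros E. apply HX, Ceq_minus. exact E.
Qed.

(** The Poisson kernel of the half plane without its numerator. *)
Definition pk (u x : R) : R := / (u ^ 2 + x ^ 2).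

Lemma pk_den (u x : R) : 0 < u -> 0 < u ^ 2 + x ^ 2.
Proof. intros Hu. assert (H := pow_lt u 2 Hu). assert (H2 := pow2_ge_0 x). lra. Qed.

(** [w / (w^2 + n^2)] is half of [1 / (w + i n) + 1 / (w - i n)]; at the conjugate points [u - i al]
    and [u + i al] the imaginary parts cancel. *)
Lemma pk_pair_term (u al n : R) : 0 < u ->
  (((u, (- al)%R) : C) / ((u, (- al)%R) * (u, (- al)%R) + RtoC (n ^ 2)) + ((u, al) : C) / ((u, al) * (u, al) + RtoC (n ^ 2)))%C
  = RtoC (u * (pk u (n + al) + pk u (n - al))).
Proof.
  intros Hu.
  assert (Hfac : forall w : C, Re w = u -> (w / (w * w + RtoC (n ^ 2)))%C = (/ 2 * (/ (w + Ci * RtoC n) + / (w - Ci * RtoC n)))%C).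
  { intros w Hw.
    assert (N1 : (w + Ci * RtoC n)%C <> RtoC 0) by (apply Re_pos_nz; destruct w; unfold Ci, Re in *; simpl in *; lra).
    assert (N2 : (w - Ci * RtoC n)%C <> RtoC 0) by (apply Re_pos_nz; destruct w; unfold Ci, Re in *; simpl in *; lra).
    replace (w * w + RtoC (n ^ 2))%C with ((w + Ci * RtoC n) * (w - Ci * RtoC n))%C.
    - field. split; assumption.
    - replace ((w + Ci * RtoC n) * (w - Ci * RtoC n))%C with (w * w - Ci * Ci * (RtoC n * RtoC n))%C by ring.
      replace (Ci * Ci)%C with (RtoC (-1)) by (apply C_ext; simpl; ring). rewrite RtoC_pow. simpl. ring. }
  rewrite (Hfac (u, (- al)%R)), (Hfac (u, al)) by reflexivity.
  assert (Hin : forall y, (/ ((u, y) : C))%C = (u * pk u y, - y * pk u y)).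
  { intros y. assert (H := pk_den u y Hu). unfold pk, Cinv. simpl in H |- *. apply C_ext; simpl; field; lra. }
  replace ((u, (- al)%R) + Ci * RtoC n)%C with ((u, (n - al)%R) : C) by (apply C_ext; simpl; ring).
  replace ((u, (- al)%R) - Ci * RtoC n)%C with ((u, (- (n + al))%R) : C) by (apply C_ext; simpl; ring).
  replace ((u, al) + Ci * RtoC n)%C with ((u, (n + al)%R) : C) by (apply C_ext; simpl; ring).
  replace ((u, al) - Ci * RtoC n)%C with ((u, (- (n - al))%R) : C) by (apply C_ext; simpl; ring).
  rewrite !Hin.
  assert (Ho : forall y, pk u (- y) = pk u y) by (intros y; unfold pk; f_equal; ring).
  rewrite !Ho. rewrite <- RtoC_inv by lra. apply C_ext; simpl; field.
Qed.

(** The Poisson kernel summed over all integer shifts of [al], from [coth] at [u - i al] and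
    [u + i al]. The expansion pairs [n + al] with [n - al] for [n >= 1]; regrouping as [n + al] with
    [n + 1 - al] adds [pk u al] in front, which cancels the terms [- 1 / (2 w)], and drops a term
    tending to [0]. *)
Lemma theta_pair (u al : R) : 0 < u -> 0 < al < 1 ->
  CS (fun n => RtoC (pk u (INR n + al) + pk u (INR n + 1 - al)))
     (RtoC (PI / u) * (1 + bose (u, (- al)%R) + bose (u, al)))%C.
Proof.
  intros Hu Hal. assert (Hpi := PI_RGT_0).
  assert (T := CS_plus _ _ _ _ (coth_right (u, (- al)%R) Hu) (coth_right (u, al) Hu)).
  apply (CS_ext _ (fun k => RtoC (u * (pk u (INR (S k) + al) + pk u (INR (S k) - al))))) in T.
  2:{ intros k. apply pk_pair_term, Hu. }
  set (L := (RtoC (PI / 2) + RtoC PI * bose (u, (- al)%R) - / (2 * (u, (- al)%R)) +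
     (RtoC (PI / 2) + RtoC PI * bose (u, al) - / (2 * (u, al))))%C) in T.
  assert (EL : L = (RtoC PI * (1 + bose (u, (- al)%R) + bose (u, al)) - RtoC (u * pk u al))%C).
  { unfold L. assert (H := pk_den u al Hu).
    assert (E : (/ (2 * (u, (- al)%R)) + / (2 * (u, al)))%C = RtoC (u * pk u al)).
    { unfold pk, Cinv. apply C_ext; simpl; field; simpl in H; nra. }
    rewrite <- E, RtoC_div by lra. field.
    split; apply Re_pos_nz; exact Hu. }
  apply (CS_scal (RtoC (/ u))) in T. rewrite EL in T.
  apply CS_eps. intros eps He.
  destruct (proj1 (CS_eps _ _) T (eps / 2)) as [N1 HN1]; [lra|].
  destruct (INR_unbounded (2 / eps + 1)) as [N2 HN2].
  exists (max N1 N2). intros n Hn. specialize (HN1 n ltac:(lia)). specialize (HN2 n ltac:(lia)).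
  assert (Ep : psum (fun n => RtoC (pk u (INR n + al) + pk u (INR n + 1 - al))) n =
     (psum (fun n => RtoC (/ u) * RtoC (u * (pk u (INR (S n) + al) + pk u (INR (S n) - al))))%C n
       + RtoC (pk u al) - RtoC (pk u (INR n + al)))%C).
  { clear - Hu. induction n as [|n IH].
    - simpl. rewrite Rplus_0_l. ring.
    - cbn [psum]. rewrite IH. rewrite S_INR, !RtoC_plus, !RtoC_mult, !RtoC_plus, RtoC_inv by lra. field.
      intros E. apply (f_equal Re) in E. cbn in E. lra. }
  rewrite Ep.
  match goal with |- Cmod ?e <= _ => replace e with
    ((psum (fun n => RtoC (/ u) * RtoC (u * (pk u (INR (S n) + al) + pk u (INR (S n) - al))))%C n -
       RtoC (/ u) * (RtoC PI * (1 + bose (u, (- al)%R) + bose (u, al)) - RtoC (u * pk u al))) - RtoC (pk u (INR n + al)))%C end.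
  2:{ rewrite RtoC_div, RtoC_mult, RtoC_inv by lra. field. intros E. apply (f_equal Re) in E. cbn in E. lra. }
  eapply Rle_trans; [apply Cmod_triangle_minus|].
  assert (Hp : Cmod (RtoC (pk u (INR n + al))) <= eps / 2).
  { rewrite Cmod_R, Rabs_pos_eq.
    2:{ left. apply Rinv_0_lt_compat, pk_den, Hu. }
    unfold pk. replace (eps / 2) with (/ (2 / eps)) by (field; lra).
    assert (0 < 2 / eps) by (apply Rdiv_lt_0_compat; lra).
    apply Rinv_le_contravar; [lra|]. assert (T1 := pow2_ge_0 u). nra. }
  lra.
Qed.

Lemma CS_finite (f : nat -> nat -> C) (l : nat -> C) (q : nat) :
  (forall h, (h < q)%nat -> CS (fun n => f h n) (l h)) -> CS (fun n => psum (fun h => f h n) q) (psum l q).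
Proof.
  induction q as [|q IH]; intros H; cbn [psum].
  - apply CS_eps. intros eps He. exists O. intros n _. rewrite psum_zero by reflexivity.
    replace (0 - 0)%C with (RtoC 0) by ring. rewrite Cmod_0. lra.
  - apply CS_plus; auto.
Qed.

Lemma psum_rev (f : nat -> C) (n : nat) : psum f n = psum (fun k => f (n - 1 - k)%nat) n.
Proof.
  induction n as [|n IH]; [reflexivity|]. change (psum f (S n)) with (psum f n + f n)%C.
  rewrite psum_head. replace (S n - 1 - 0)%nat with n by lia. rewrite IH, Cplus_comm. f_equal.
  apply psum_ext. intros k Hk. f_equal. lia.
Qed.

Lemma psum_blocks (f : nat -> C) (q N : nat) : psum f (N * q) = psum (fun n => psum (fun h => f (n * q + h)%nat) q) N.
Proof.
  induction N as [|N IH]; [reflexivity|]. cbn [psum]. rewrite <- IH.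
  replace (S N * q)%nat with (N * q + q)%nat by lia. generalize (N * q)%nat. intros m. clear.
  induction q as [|q IH]; [rewrite Nat.add_0_r; simpl; ring|].
  rewrite Nat.add_succ_r. cbn [psum]. rewrite IH. ring.
Qed.

Section Theta.

Variables (q : nat) (chi : Z -> C).
Hypothesis Hchi : dirichlet_character q chi.
Hypothesis Hprim : primitive_character q chi.
Hypothesis Heven : even_character chi.
Hypothesis Hq2 : (2 <= q)%nat.

Let tau := gauss q chi 1.

(** Expand [bose] as a geometric series and sum over [h] first: the coefficient at [n] is
    [gauss n + gauss (- n)], which separability and evenness turn into [2 * tau] times the conjugate
    of [chi n]. *)
Lemma theta_bose (u : R) (th : C) : 0 < u ->
  CS (fun m => Cconj (chi (Z.of_nat (S m))) * RtoC (exp (- (2 * PI * INR (S m) * u))))%C th ->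
  psum (fun h => chi (Z.of_nat h) * (bose (u, (- (INR h / INR q))%R) + bose (u, (INR h / INR q)%R)))%C q = (2 * tau * th)%C.
Proof.
  intros Hu Hth. assert (Hq := INR_q_pos q chi Hchi).
  eapply CS_unique.
  - apply CS_finite. intros h _. apply CS_scal, CS_plus; apply bose_series; exact Hu.
  - cbv beta. apply (CS_scal (2 * tau)%C) in Hth. eapply CS_ext; [|exact Hth]. intros m. cbv beta.
    set (n := S m). set (E := RtoC (exp (- (2 * PI * INR n * u)))).
    assert (Hw : forall (y : R) (k : Z), IZR k = INR n * (y * INR q) -> 
      cexp (- (2 * RtoC PI * RtoC (INR n) * (u, y))) = (E * addchar q (- k))%C).
    { intros y k Hk. unfold E, addchar. rewrite <- cexp_RtoC, <- cexp_add. f_equal. unfold Ci.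
      rewrite opp_IZR, Hk. apply C_ext; simpl; field; lra. }
    rewrite (psum_ext _ (fun h => E * (chi (Z.of_nat h) * addchar q (Z.of_nat n * Z.of_nat h))
       + E * (chi (Z.of_nat h) * addchar q (- Z.of_nat n * Z.of_nat h)))%C).
    2:{ intros h _. rewrite (Hw (- (INR h / INR q)) (- (Z.of_nat n * Z.of_nat h))%Z), (Hw (INR h / INR q) (Z.of_nat n * Z.of_nat h)%Z).
        - rewrite Z.opp_involutive, Z.mul_opp_l. ring.
        - rewrite mult_IZR, <- !INR_IZR_INZ. field. lra.
        - rewrite opp_IZR, mult_IZR, <- !INR_IZR_INZ. field. lra. }
    rewrite psum_plus, !psum_scal. fold (gauss q chi (Z.of_nat n)). fold (gauss q chi (- Z.of_nat n)).
    rewrite (gauss_separable q chi Hchi Hprim (Z.of_nat n)), (gauss_separable q chi Hchi Hprim (- Z.of_nat n)), (even_character_opp q chi _ Hchi Heven). fold tau. ring.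
Qed.

(* The terms [k = n q + h] and [k = n q + (q - h)] are paired by the evenness of [chi]. *)
Lemma theta_transform (u : R) (th L : C) : 0 < u ->
  CS (fun m => Cconj (chi (Z.of_nat (S m))) * RtoC (exp (- (2 * PI * INR (S m) * u))))%C th ->
  CS (fun k => chi (Z.of_nat (S k)) * RtoC ((INR q * u) ^ 2 / ((INR q * u) ^ 2 + INR (S k) ^ 2)))%C L ->
  L = (RtoC (PI * u) * tau * th)%C.
Proof.
  intros Hu Hth HL. assert (Hq := INR_q_pos q chi Hchi). assert (Hpi := PI_RGT_0).
  assert (Hc0 := chi_0 q chi Hchi Hq2).
  set (c := fun k => (chi (Z.of_nat k) * RtoC ((INR q * u) ^ 2 / ((INR q * u) ^ 2 + INR k ^ 2)))%C).
  assert (HL' : CS c L).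
  { replace L with (c O + L)%C; [apply CS_incr; exact HL|]. unfold c. change (Z.of_nat 0) with 0%Z. rewrite Hc0. ring. }
  assert (Hc : forall n h, c (n * q + h)%nat = (RtoC (u ^ 2) * (chi (Z.of_nat h) * RtoC (pk u (INR n + INR h / INR q))))%C).
  { intros n h. unfold c. rewrite Nat2Z.inj_add, Nat2Z.inj_mul, Z.add_comm, (chi_period q chi Hchi).
    rewrite plus_INR, mult_INR. unfold pk.
    replace (RtoC (u ^ 2) * (chi (Z.of_nat h) * RtoC (/ (u ^ 2 + (INR n + INR h / INR q) ^ 2))))%C
      with (chi (Z.of_nat h) * (RtoC (u ^ 2) * RtoC (/ (u ^ 2 + (INR n + INR h / INR q) ^ 2))))%C by ring.
    rewrite <- RtoC_mult. f_equal. f_equal.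
    assert (D1 := pk_den u (INR n + INR h / INR q) Hu).
    assert (D2 := pk_den (INR q * u) (INR n * INR q + INR h) ltac:(nra)).
    replace (u ^ 2 + (INR n + INR h / INR q) ^ 2) with (((INR q * u) ^ 2 + (INR n * INR q + INR h) ^ 2) / INR q ^ 2) by (field; lra).
    field. split; lra. }
  assert (Hsym : forall n, psum (fun h => chi (Z.of_nat h) * RtoC (pk u (INR n + INR h / INR q)))%C q =
     psum (fun h => chi (Z.of_nat h) * RtoC (pk u (INR n + 1 - INR h / INR q)))%C q).
  { intros n. destruct q as [|p] eqn:Ep; [lia|]. rewrite !psum_head. change (Z.of_nat 0) with 0%Z. rewrite Hc0, !Cmult_0_l.
    f_equal. rewrite psum_rev. apply psum_ext. intros k Hk.
    replace (Z.of_nat (S (p - 1 - k))) with (- Z.of_nat (S k) + 1 * Z.of_nat (S p))%Z by lia.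
    rewrite (chi_period (S p) chi Hchi), (even_character_opp (S p) chi _ Hchi Heven). do 3 f_equal.
    replace (INR (S (p - 1 - k))) with (INR (S p) - INR (S k)); [field; lra|].
    rewrite <- minus_INR by lia. f_equal. lia. }
  assert (Hsum := CS_finite (fun h n => chi (Z.of_nat h) * RtoC (pk u (INR n + INR h / INR q) + pk u (INR n + 1 - INR h / INR q)))%C
     (fun h => chi (Z.of_nat h) * (RtoC (PI / u) * (1 + bose (u, (- (INR h / INR q))%R) + bose (u, (INR h / INR q)%R))))%C q).
  assert (Hval : psum (fun h => chi (Z.of_nat h) * (RtoC (PI / u) * (1 + bose (u, (- (INR h / INR q))%R) + bose (u, (INR h / INR q)%R))))%C q
     = (RtoC (PI / u) * (2 * tau * th))%C).
  { rewrite <- (theta_bose u th Hu Hth).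
    rewrite (psum_ext _ (fun h => RtoC (PI / u) * chi (Z.of_nat h) +
       RtoC (PI / u) * (chi (Z.of_nat h) * (bose (u, (- (INR h / INR q))%R) + bose (u, (INR h / INR q)%R))))%C) by (intros; ring).
    rewrite psum_plus, !psum_scal, (chi_sum_0 q chi Hchi Hprim Hq2). ring. }
  rewrite Hval in Hsum.
  (* Pairing counts every residue class twice, hence [u ^ 2 / 2] rather than [u ^ 2]. *)
  match type of Hsum with ?A -> _ => assert (HA : A) end; [|assert (HS := CS_scal (RtoC (u ^ 2 / 2)) _ _ (Hsum HA))].
  - intros h Hh. destruct h as [|h].
    + change (Z.of_nat 0) with 0%Z. rewrite Hc0. rewrite Cmult_0_l.
      eapply CS_ext; [|apply (CS_finite (fun _ _ => RtoC 0) (fun _ => RtoC 0) 0)]; [|lia].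
      intros n. cbn. ring.
    + apply CS_scal. apply theta_pair; [exact Hu|].
      assert (0 < INR (S h)) by (apply lt_0_INR; lia). assert (INR (S h) < INR q) by (apply lt_INR; exact Hh).
      split; [apply Rdiv_lt_0_compat; lra|]. apply Rmult_lt_reg_r with (INR q); [lra|].
      unfold Rdiv. rewrite Rmult_assoc, Rinv_l; lra.
  - apply Ceq_minus, Cmod_zero_le. intros eps He.
    destruct (proj1 (CS_eps _ _) HS (eps / 2)) as [N1 HN1]; [lra|].
    destruct (proj1 (CS_eps _ _) HL' (eps / 2)) as [N2 HN2]; [lra|].
    (* The series in [k] is read along multiples of [q], where its partial sums consist of complete
       blocks. *)
    set (N := max N1 N2). specialize (HN1 N ltac:(lia)). specialize (HN2 (N * q)%nat ltac:(nia)).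
    assert (E : psum c (N * q) = psum (fun n => RtoC (u ^ 2 / 2) * psum (fun h => chi (Z.of_nat h) *
        RtoC (pk u (INR n + INR h / INR q) + pk u (INR n + 1 - INR h / INR q)))%C q)%C N).
    { rewrite psum_blocks. apply psum_ext. intros n _.
      rewrite (psum_ext (fun h => c (n * q + h)%nat) _ q (fun h _ => Hc n h)), psum_scal.
      rewrite (psum_ext (fun h => chi (Z.of_nat h) * RtoC (pk u (INR n + INR h / INR q) + pk u (INR n + 1 - INR h / INR q)))%C
         (fun h => chi (Z.of_nat h) * RtoC (pk u (INR n + INR h / INR q)) +
         chi (Z.of_nat h) * RtoC (pk u (INR n + 1 - INR h / INR q)))%C) by (intros; rewrite RtoC_plus; ring).
      rewrite psum_plus, <- Hsym, RtoC_div by lra. field. }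
    rewrite E in HN2.
    match type of HN1 with Cmod (?p - ?l) <= _ =>
      assert (T := Cmod_triangle_minus (p - l) (p - L));
      replace (p - l - (p - L))%C with (L - l)%C in T by ring;
      replace (RtoC (PI * u) * tau * th)%C with l end.
    + lra.
    + rewrite !RtoC_div, !RtoC_mult, RtoC_pow by lra. simpl. field. intros E'. apply (f_equal Re) in E'. cbn in E'. lra.
Qed.

End Theta.

(** * Analytic continuation of Dirichlet series *)

(** A total sum, so that a series becomes a function of its parameter; [CS_CSum] identifies it with
    the limit when there is one. *)
Definition CSum (a : nat -> C) : C := (Series (fun n => Re (a n)), Series (fun n => Im (a n))).

Lemma CS_CSum (a : nat -> C) (l : C) : CS a l -> CSum a = l.
Proof.
  intros H.
  assert (HP : forall n, Re (psum a n) = rsum (fun k => Re (a k)) n /\ Im (psum a n) = rsum (fun k => Im (a k)) n).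
  { induction n as [|n [IH1 IH2]]; [split; reflexivity|]. cbn [psum rsum]. rewrite Re_plus, Im_plus, IH1, IH2. split; reflexivity. }
  apply C_ext; cbn [CSum Re Im fst snd]; apply is_series_unique, is_series_Reals; intros eps He;
    destruct (proj1 (CS_eps a l) H (eps / 2)) as [N HN]; try lra; exists N; intros n Hn;
    rewrite <- sum_n_Reals, rsum_sum_n; unfold Rdist; specialize (HN (S n) ltac:(lia)).
  - rewrite <- (proj1 (HP (S n))), <- Re_minus. eapply Rle_lt_trans; [apply re_le_Cmod|]. lra.
  - rewrite <- (proj2 (HP (S n))), <- Im_minus. eapply Rle_lt_trans; [apply im_le_Cmod|]. lra.
Qed.

Lemma CSum_dom (a : nat -> C) (M : nat -> R) :
  (forall n, Cmod (a n) <= M n) -> ex_series M -> CS a (CSum a).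
Proof.
  intros H HM. destruct (CS_dom_ex a M H HM) as [l Hl]. rewrite (CS_CSum a l Hl). exact Hl.
Qed.

(** Termwise differentiation by summing the quadratic remainders; a majorant uniform in [h] takes
    the place of locally uniform convergence. *)
Lemma series_holo (f : nat -> C -> C) (F : C -> C) (l : nat -> C) (M : nat -> R) (z : C) (d : R) :
  0 < d -> ex_series M -> (forall n, Cmod (l n) <= M n) ->
  (forall n h, Cmod h < d -> Cmod (f n (z + h)%C - f n z - l n * h) <= M n * Cmod h ^ 2) ->
  (forall h, Cmod h < d -> CS (fun n => f n (z + h)%C) (F (z + h)%C)) -> holo F z.
Proof.
  intros Hd HM Hl Hf HF. exists (CSum l). assert (HL := CSum_dom l M Hl HM).
  apply cdiff_second_order with (Series M) d; [exact Hd|]. intros h Hh.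
  assert (H0 : CS (fun n => f n z) (F z)).
  { assert (T := HF (RtoC 0) ltac:(rewrite Cmod_0; exact Hd)). rewrite Cplus_0_r in T. exact T. }
  assert (T := CS_minus _ _ _ _ (CS_minus _ _ _ _ (HF h Hh) H0) (CS_scal h _ _ HL)).
  replace (F (z + h) - F z - CSum l * h)%C with (F (z + h)%C - F z - h * CSum l)%C by ring.
  rewrite <- Series_scal_r. apply (CS_bound _ (fun n => M n * Cmod h ^ 2) _) in T; [exact T| |].
  - intros n. rewrite (Cmult_comm h). apply Hf, Hh.
  - apply ex_series_scal_r, HM.
Qed.

(** A factor [|lam|], or [|lam|^2] from the remainder, costs [exp (del |lam|)], and the increment
    [h] costs another, whence [2 * del]. One constant serves both claims so that they share a
    majorant. *)
Lemma cexp_second_order (lam del : R) (c z h : C) : 0 < del -> Cmod h < del ->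
  Cmod (c * (RtoC lam * cexp (RtoC lam * z))) <=
    (/ del + 4 / del ^ 2) * (Cmod c * exp (lam * Re z + 2 * del * Rabs lam)) /\
  Cmod (c * cexp (RtoC lam * (z + h)) - c * cexp (RtoC lam * z) - c * (RtoC lam * cexp (RtoC lam * z)) * h) <=
    (/ del + 4 / del ^ 2) * (Cmod c * exp (lam * Re z + 2 * del * Rabs lam)) * Cmod h ^ 2.
Proof.
  intros Hd Hh. assert (Hl := Rabs_pos lam). assert (Hc := Cmod_ge_0 c). assert (Hh0 := Cmod_ge_0 h).
  assert (Hd1 : 0 < / del) by (apply Rinv_0_lt_compat; exact Hd).
  assert (Hd2 : 0 < 4 / del ^ 2) by (apply Rdiv_lt_0_compat; [lra|apply pow_lt, Hd]).
  assert (E0 := exp_pos (lam * Re z)). assert (E1 := exp_pos (del * Rabs lam)).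
  assert (Ee : exp (lam * Re z + 2 * del * Rabs lam) = exp (lam * Re z) * (exp (del * Rabs lam) * exp (del * Rabs lam))).
  { rewrite <- !exp_plus. f_equal. ring. }
  assert (E2 : 1 <= exp (del * Rabs lam)) by (rewrite <- exp_0; apply exp_le; nra).
  assert (B1 : Rabs lam <= / del * exp (del * Rabs lam)).
  { apply Rmult_le_reg_l with del; [exact Hd|]. rewrite <- Rmult_assoc, Rinv_r, Rmult_1_l by lra. apply exp_ge_id. }
  assert (B2 : Rabs lam ^ 2 <= 4 / del ^ 2 * exp (del * Rabs lam)).
  { assert (T := exp_ge_sq (del * Rabs lam) ltac:(nra)). rewrite Rpow_mult_distr in T.
    replace (Rabs lam ^ 2) with (4 / del ^ 2 * (del ^ 2 * Rabs lam ^ 2 / 4)) by (field; lra).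
    apply Rmult_le_compat_l; lra. }
  set (x := exp (del * Rabs lam)) in *. rewrite Ee. split.
  - rewrite !Cmod_mult, Cmod_R, Cmod_cexp, re_scal_l.
    replace (Cmod c * (Rabs lam * exp (lam * Re z))) with (Cmod c * exp (lam * Re z) * Rabs lam) by ring.
    replace ((/ del + 4 / del ^ 2) * (Cmod c * (exp (lam * Re z) * (x * x))))
      with (Cmod c * exp (lam * Re z) * ((/ del + 4 / del ^ 2) * (x * x))) by ring.
    apply Rmult_le_compat_l; [nra|]. nra.
  - replace (RtoC lam * (z + h))%C with (RtoC lam * z + RtoC lam * h)%C by ring. rewrite cexp_add.
    replace (c * (cexp (RtoC lam * z) * cexp (RtoC lam * h)) - c * cexp (RtoC lam * z) - c * (RtoC lam * cexp (RtoC lam * z)) * h)%C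
      with (c * cexp (RtoC lam * z) * (cexp (RtoC lam * h) - 1 - RtoC lam * h))%C by ring.
    rewrite !Cmod_mult, Cmod_cexp, re_scal_l.
    assert (T := cexp_taylor2 (RtoC lam * h)). rewrite Cmod_mult, Cmod_R, Rpow_mult_distr in T.
    assert (E3 : exp (Rabs lam * Cmod h) <= x) by (apply exp_le; nra).
    assert (E4 := exp_pos (Rabs lam * Cmod h)).
    assert (P2 := pow2_ge_0 (Cmod h)). assert (P3 := pow2_ge_0 (Rabs lam)).
    replace ((/ del + 4 / del ^ 2) * (Cmod c * (exp (lam * Re z) * (x * x))) * Cmod h ^ 2)
      with (Cmod c * exp (lam * Re z) * ((/ del + 4 / del ^ 2) * (x * x) * Cmod h ^ 2)) by ring.
    apply Rmult_le_compat_l; [nra|]. eapply Rle_trans; [exact T|].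
    replace (Rabs lam ^ 2 * Cmod h ^ 2 * exp (Rabs lam * Cmod h)) with (Rabs lam ^ 2 * exp (Rabs lam * Cmod h) * Cmod h ^ 2) by ring.
    apply Rmult_le_compat_r; [exact P2|].
    apply Rle_trans with (4 / del ^ 2 * x * x); [apply Rmult_le_compat; lra|]. nra.
Qed.

Lemma cpow_line (n : R) (z : C) : cpow n (- z) = cexp (RtoC (- ln n) * z).
Proof. unfold cpow. f_equal. rewrite RtoC_opp. ring. Qed.

Lemma ln_INR_nonneg (n : nat) : 0 <= ln (INR (S n)).
Proof.
  rewrite <- ln_1. apply ln_le; [lra|]. rewrite S_INR. assert (H := pos_INR n). lra.
Qed.

Lemma INR_S_pos (n : nat) : 0 < INR (S n).
Proof. apply lt_0_INR. lia. Qed.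

Lemma dirichlet_dom (a : nat -> C) (z : C) (n : nat) : (forall n, Cmod (a (S n)) <= 1) ->
  Cmod (a (S n) * cpow (INR (S n)) (- z)) <= exp (- Re z * ln (INR (S n))).
Proof.
  intros H. rewrite Cmod_mult, Cmod_cpow, Re_opp. rewrite <- (Rmult_1_l (exp _)) at 2.
  apply Rmult_le_compat_r; [left; apply exp_pos|apply H].
Qed.

Lemma dirichlet_CSum (a : nat -> C) (z : C) : (forall n, Cmod (a (S n)) <= 1) -> 1 < Re z ->
  CS (fun n => a (S n) * cpow (INR (S n)) (- z))%C (CSum (fun n => a (S n) * cpow (INR (S n)) (- z))%C).
Proof.
  intros Ha Hz. eapply CSum_dom; [intros n; apply dirichlet_dom, Ha|].
  eapply ex_series_ext; [|apply (ex_series_power (Re z - 1)); lra]. intros n. cbv beta. apply (f_equal exp). ring.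
Qed.

Lemma dirichlet_holo (a : nat -> C) (z : C) : (forall n, Cmod (a (S n)) <= 1) -> 1 < Re z ->
  holo (fun w => CSum (fun n => a (S n) * cpow (INR (S n)) (- w))%C) z.
Proof.
  intros Ha Hz. set (del := (Re z - 1) / 4). assert (Hd : 0 < del) by (unfold del; lra).
  set (K := / del + 4 / del ^ 2).
  apply (series_holo (fun n w => a (S n) * cpow (INR (S n)) (- w))%C _
     (fun n => a (S n) * (RtoC (- ln (INR (S n))) * cexp (RtoC (- ln (INR (S n))) * z)))%C
     (fun n => K * exp (- (1 + (Re z - 1) / 2) * ln (INR (S n)))) z del Hd).
  - apply (ex_series_scal (V := R_NormedModule) K). apply ex_series_power. lra.
  - intros n. assert (T := proj1 (cexp_second_order (- ln (INR (S n))) del (a (S n)) z (RtoC 0) Hd ltac:(rewrite Cmod_0; exact Hd))).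
    eapply Rle_trans; [exact T|]. fold K. apply Rmult_le_compat_l.
    + unfold K. assert (0 < / del) by (apply Rinv_0_lt_compat, Hd). assert (0 < 4 / del ^ 2) by (apply Rdiv_lt_0_compat; [lra|apply pow_lt, Hd]). lra.
    + rewrite Rabs_Ropp, Rabs_pos_eq by apply ln_INR_nonneg. rewrite <- (Rmult_1_l (exp (- (1 + _) * _))).
      apply Rmult_le_compat; [apply Cmod_ge_0|left; apply exp_pos|apply Ha|].
      right. f_equal. unfold del. field.
  - intros n h Hh. assert (T := proj2 (cexp_second_order (- ln (INR (S n))) del (a (S n)) z h Hd Hh)).
    rewrite !cpow_line. eapply Rle_trans; [exact T|]. fold K. apply Rmult_le_compat_r; [apply pow2_ge_0|]. apply Rmult_le_compat_l.
    + unfold K. assert (0 < / del) by (apply Rinv_0_lt_compat, Hd). assert (0 < 4 / del ^ 2) by (apply Rdiv_lt_0_compat; [lra|apply pow_lt, Hd]). lra.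
    + rewrite Rabs_Ropp, Rabs_pos_eq by apply ln_INR_nonneg. rewrite <- (Rmult_1_l (exp (- (1 + _) * _))).
      apply Rmult_le_compat; [apply Cmod_ge_0|left; apply exp_pos|apply Ha|].
      right. f_equal. unfold del. field.
  - intros h Hh. apply dirichlet_CSum; [exact Ha|]. rewrite Re_plus.
    assert (T := re_le_Cmod h). apply Rabs_le_between in T. unfold del in *. lra.
Qed.

(** The epsilon in [dirichlet_cont] only needs a witness: the series itself to the right of [1],
    glued to [H] on the left. Agreement on [1 < Re w < 2] gives differentiability across the line
    [Re w = 1]. *)
Lemma dirichlet_continuation_glue (a : nat -> C) (H : C -> C) :
  (forall n, Cmod (a (S n)) <= 1) ->
  (forall w, Re w < 2 -> w <> RtoC 1 -> holo H w) ->
  (forall w, 1 < Re w < 2 -> CS (fun n => a (S n) * cpow (INR (S n)) (- w))%C (H w)) ->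
  is_dirichlet_continuation a (dirichlet_cont a).
Proof.
  intros Ha HH Hs. unfold dirichlet_cont. apply epsilon_spec.
  set (D := fun w => CSum (fun n => a (S n) * cpow (INR (S n)) (- w))%C).
  exists (fun w => if Rlt_dec 1 (Re w) then D w else H w). split.
  - intros z Hz. apply holo_ex_derive. destruct (Rlt_dec 1 (Re z)) as [H1|H1].
    + apply holo_ext_loc with D (Re z - 1); [lra| |apply dirichlet_holo; assumption].
      intros w Hw. assert (T := re_le_Cmod (w - z)). rewrite Re_minus in T. 
      destruct (Rlt_dec 1 (Re w)) as [Hl|Hl]; [reflexivity|]. exfalso. apply Rabs_le_between in T. lra.
    + apply holo_ext_loc with H (2 - Re z); [lra| |apply HH; [lra|exact Hz]].
      intros w Hw. assert (T := re_le_Cmod (w - z)). rewrite Re_minus in T. apply Rabs_le_between in T.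
      destruct (Rlt_dec 1 (Re w)) as [Hl|Hl]; [|reflexivity].
      eapply CS_unique; [apply Hs; lra|]. apply dirichlet_CSum; assumption.
  - intros z Hz. destruct (Rlt_dec 1 (Re z)) as [H1|H1]; [|contradiction]. apply dirichlet_CSum; assumption.
Qed.

(** Interpolation between [1] and [exp (2 x)]; the free exponent [th] distributes decay between the
    variable and the index of summation. *)
Lemma logis_theta (th x : R) : 0 <= th <= 2 -> logis x <= exp (th * x).
Proof.
  intros Ht. destruct (Rle_dec 0 x) as [Hx|Hx].
  - eapply Rle_trans; [apply logis_le_1|]. rewrite <- exp_0. apply exp_le. nra.
  - eapply Rle_trans; [apply logis_le_exp|]. apply exp_le. nra.
Qed.

Definition logis_sum (a : nat -> C) (v : R) : C := CSum (fun k => a (S k) * RtoC (logis (v - ln (INR (S k)))))%C.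

Lemma logis_term_le (a : nat -> C) (th v : R) (k : nat) : (forall n, Cmod (a (S n)) <= 1) -> 0 <= th <= 2 ->
  Cmod (a (S k) * RtoC (logis (v - ln (INR (S k))))) <= exp (th * v) * exp (- th * ln (INR (S k))).
Proof.
  intros Ha Ht. rewrite Cmod_mult, Cmod_R, Rabs_pos_eq by (left; apply logis_pos).
  rewrite <- (Rmult_1_l (exp (th * v) * _)). apply Rmult_le_compat; [apply Cmod_ge_0|left; apply logis_pos|apply Ha|].
  rewrite <- exp_plus. replace (th * v + - th * ln (INR (S k))) with (th * (v - ln (INR (S k)))) by ring.
  apply logis_theta, Ht.
Qed.

Lemma logis_sum_CS (a : nat -> C) (v : R) : (forall n, Cmod (a (S n)) <= 1) ->
  CS (fun k => a (S k) * RtoC (logis (v - ln (INR (S k)))))%C (logis_sum a v).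
Proof.
  intros Ha. eapply CSum_dom; [intros k; apply (logis_term_le a 2 v k Ha); lra|].
  apply (ex_series_scal (V := R_NormedModule) (exp (2 * v))).
  eapply ex_series_ext; [|apply (ex_series_power 1); lra]. intros n. cbv beta. apply (f_equal exp). ring.
Qed.

Lemma logis_sum_le (a : nat -> C) (v : R) : (forall n, Cmod (a (S n)) <= 1) ->
  Cmod (logis_sum a v) <= exp (2 * v) * Series (fun n => exp (- 2 * ln (INR (S n)))).
Proof.
  intros Ha. rewrite <- Series_scal_l.
  assert (E : ex_series (fun n => exp (- 2 * ln (INR (S n))))).
  { eapply ex_series_ext; [|apply (ex_series_power 1); lra]. intros n. cbv beta. apply (f_equal exp). ring. }
  eapply CS_bound; [| |apply logis_sum_CS, Ha].
  - intros k. apply (logis_term_le a 2 v k Ha). lra.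
  - apply (ex_series_scal (V := R_NormedModule)), E.
Qed.

Lemma logis_shift_mellin (w : C) (y v : R) : 0 < y ->
  (cexp (- w * RtoC v) * RtoC (logis (v - ln y)))%C =
  (cpow y (- w) * (cexp (- w * RtoC (v + - ln y)) * RtoC (logis (v + - ln y))))%C.
Proof.
  intros Hy. unfold cpow. rewrite Cmult_assoc, <- cexp_add. f_equal. f_equal.
  rewrite RtoC_plus, RtoC_opp. ring.
Qed.

(** Term by term, shifting by [ln k] pulls [k^(- w)] out of the transform of [logis], and the factor
    in front is the inverse of the value in [mellin_logis]. *)
Lemma logis_sum_mellin (a : nat -> C) (w : C) : (forall n, Cmod (a (S n)) <= 1) -> 1 < Re w < 2 ->
  (exists K d, edec (fun v => cexp (- w * RtoC v) * logis_sum a v)%C K d) /\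
  CS (fun k => a (S k) * cpow (INR (S k)) (- w))%C
     (2 / RtoC PI * csin (RtoC PI * w / 2) * IR (fun v => cexp (- w * RtoC v) * logis_sum a v))%C.
Proof.
  intros Ha Hw. assert (Hpi := PI_RGT_0). set (s := Re w) in *.
  set (d := Rmin ((2 - s) / 2) ((s - 1) / 2)). assert (Hd : 0 < d) by (apply Rmin_pos; lra).
  assert (Hd1 := Rmin_l ((2 - s) / 2) ((s - 1) / 2)). assert (Hd2 := Rmin_r ((2 - s) / 2) ((s - 1) / 2)). fold d in Hd1, Hd2.
  set (M := fun k => exp (- (1 + (s - 1) / 2) * ln (INR (S k)))).
  set (f := fun k v => (cexp (- w * RtoC v) * (a (S k) * RtoC (logis (v - ln (INR (S k))))))%C).
  assert (Hf : forall k, edec (f k) (M k) d).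
  { intros k. split; [exact Hd|split].
    - intros v. apply rcont_mult; [apply rcont_cexp_lin|]. apply rcont_mult; [apply rcont_const|].
      apply (rcont_comp (fun x => RtoC (logis x)) (fun v => v - ln (INR (S k)))).
      + apply cont_deriv. auto_derive. tauto.
      + apply rcont_RtoC, continuous_logis.
    - intros v. unfold f. rewrite Cmod_mult, Cmod_cexp, re_scal_r, Re_opp. fold s.
      assert (Hln := ln_INR_nonneg k).
      destruct (Rle_dec 0 v) as [Hv|Hv].
      (* Exponents on the two sides of [s]: [(1 + s) / 2 < s] forces decay for [v >= 0] and
         [1 + s / 2 > s] for [v < 0]; both exceed [1], so the series over [k] converges. *)
      + eapply Rle_trans; [apply Rmult_le_compat_l; [left; apply exp_pos|]; apply (logis_term_le a (1 + (s - 1) / 2) v k Ha); lra|].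
        unfold M. rewrite <- !exp_plus. apply exp_le. rewrite Rabs_pos_eq by lra. nra.
      + eapply Rle_trans; [apply Rmult_le_compat_l; [left; apply exp_pos|]; apply (logis_term_le a (1 + s / 2) v k Ha); lra|].
        unfold M. rewrite <- !exp_plus. apply exp_le. rewrite Rabs_left by lra. nra. }
  assert (HM : ex_series M) by (apply ex_series_power; lra).
  destruct (IR_series f M d (fun v => cexp (- w * RtoC v) * logis_sum a v)%C Hd Hf HM) as [HE HS].
  { intros v. apply CS_scal, logis_sum_CS, Ha. }
  split; [exists (Series M), d; exact HE|].
  apply (CS_scal (2 / RtoC PI * csin (RtoC PI * w / 2))%C) in HS.
  eapply CS_ext; [|exact HS]. intros k. cbv beta.
  set (dd := Rmin s (2 - s)). assert (Hdd : 0 < dd) by (apply Rmin_pos; lra).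
  assert (Eg := edec_logis w dd Hdd (Rmin_l _ _) (Rmin_r _ _)).
  assert (Hsn : csin (RtoC PI * w / 2) <> RtoC 0).
  { apply nonint_csin. intros j E. unfold s in Hw. rewrite E in Hw. cbn [Re RtoC fst] in Hw.
    assert (1 < j)%Z by (apply lt_IZR; lra). assert (j < 2)%Z by (apply lt_IZR; lra). lia. }
  assert (HPI : RtoC PI <> RtoC 0) by (intros E; apply (f_equal Re) in E; cbn in E; lra).
  rewrite (IR_ext (f k) (fun v => a (S k) * cpow (INR (S k)) (- w) *
     (cexp (- w * RtoC (v + - ln (INR (S k)))) * RtoC (logis (v + - ln (INR (S k))))))%C).
  2:{ intros v. unfold f. replace (cexp (- w * RtoC v) * (a (S k) * RtoC (logis (v - ln (INR (S k))))))%C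
       with (a (S k) * (cexp (- w * RtoC v) * RtoC (logis (v - ln (INR (S k))))))%C by ring.
      rewrite logis_shift_mellin by apply INR_S_pos. ring. }
  rewrite (IR_scal _ _ _ _ (edec_shift _ _ _ (- ln (INR (S k))) Eg)), (IR_shift _ _ _ _ Eg), mellin_logis by (fold s; lra).
  field. split; assumption.
Qed.

(** Continuity is a by-product of termwise integration; [3 / 2] is just a point of the strip, and
    the exponential factor is divided out. *)
Lemma rcont_logis_sum (a : nat -> C) (v : R) : (forall n, Cmod (a (S n)) <= 1) -> rcont (logis_sum a) v.
Proof.
  intros Ha. destruct (logis_sum_mellin a (RtoC (3 / 2)) Ha) as [[K [d H]] _]; [simpl; lra|].
  apply (rcont_ext (fun v => cexp (RtoC (3 / 2) * RtoC v) * (cexp (- RtoC (3 / 2) * RtoC v) * logis_sum a v))%C).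
  - intros s. rewrite Cmult_assoc, <- cexp_add.
    replace (RtoC (3 / 2) * RtoC s + - RtoC (3 / 2) * RtoC s)%C with (RtoC 0) by ring. rewrite cexp_0. ring.
  - apply rcont_mult; [apply rcont_cexp_lin|apply H].
Qed.

(** The tangent line bound [exp y >= 1 + y] at [y = v + ln (c / A)]. *)
Lemma exp_exp_decay (c A : R) : 0 < c -> 0 < A -> exists K, 0 < K /\ forall v, exp (- c * exp v) <= K * exp (- A * v).
Proof.
  intros Hc HA. exists (exp (- A - A * ln (c / A))). split; [apply exp_pos|]. intros v.
  rewrite <- exp_plus. apply exp_le.
  assert (T := exp_ineq1_le (v + ln (c / A))). rewrite exp_plus, exp_ln in T by (apply Rdiv_lt_0_compat; assumption).
  assert (E : c * exp v = A * (exp v * (c / A))) by (field; lra). nra.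
Qed.

Lemma bose_R (t : R) : bose (RtoC t) = RtoC (/ (exp (2 * PI * t) - 1)) /\ (0 < t -> 0 < / (exp (2 * PI * t) - 1) <= exp (- PI * t) / (PI * t)).
Proof.
  assert (Hpi := PI_RGT_0).
  assert (E : cexp (2 * RtoC PI * RtoC t) = RtoC (exp (2 * PI * t))) by (rewrite <- !RtoC_mult; apply cexp_RtoC).
  split.
  - unfold bose. rewrite E, <- RtoC_minus. unfold RtoC at 1 2. unfold Cinv. cbn [fst snd].
    set (y := exp (2 * PI * t) - 1).
    destruct (Req_dec y 0) as [->|Hy].
    + rewrite Rinv_0. apply C_ext; simpl; unfold Rdiv; ring.
    + apply C_ext; simpl; field; lra.
  - intros Ht. set (x := PI * t). assert (Hx : 0 < x) by (apply Rmult_lt_0_compat; assumption).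
    replace (2 * PI * t) with (x + x) by (unfold x; ring). replace (- PI * t) with (- x) by (unfold x; ring).
    rewrite exp_plus, exp_Ropp. assert (T := exp_ineq1_le x). set (y := exp x) in *.
    assert (Hd : 0 < y * x) by (apply Rmult_lt_0_compat; lra).
    assert (Hge : y * x <= y * y - 1) by nra.
    split; [apply Rinv_0_lt_compat; lra|].
    replace (/ y / x) with (/ (y * x)) by (field; lra). apply Rinv_le_contravar; lra.
Qed.

Section LFunction.

Variables (q : nat) (chi : Z -> C).
Hypothesis Hchi : dirichlet_character q chi.
Hypothesis Hprim : primitive_character q chi.
Hypothesis Heven : even_character chi.
Hypothesis Hq2 : (2 <= q)%nat.

Let tau := gauss q chi 1.
Let achi (n : nat) : C := chi (Z.of_nat n).

Definition theta (u : R) : C :=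
  CSum (fun m => Cconj (chi (Z.of_nat (S m))) * RtoC (exp (- (2 * PI * INR (S m) * u))))%C.

Lemma achi_le n : Cmod (achi (S n)) <= 1.
Proof. apply (chi_le_1 q chi Hchi). Qed.

Lemma theta_dom (u : R) (m : nat) :
  Cmod (Cconj (chi (Z.of_nat (S m))) * RtoC (exp (- (2 * PI * INR (S m) * u)))) <= exp (- (2 * PI * INR (S m) * u)).
Proof.
  rewrite Cmod_mult, Cmod_conj, Cmod_R, Rabs_pos_eq by (left; apply exp_pos).
  rewrite <- (Rmult_1_l (exp _)) at 2. apply Rmult_le_compat_r; [left; apply exp_pos|apply (chi_le_1 q chi Hchi)].
Qed.

Lemma bose_series_R (u : R) : 0 < u ->
  CS (fun n => RtoC (exp (- (2 * PI * INR (S n) * u)))) (RtoC (/ (exp (2 * PI * u) - 1))).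
Proof.
  intros Hu. rewrite <- (proj1 (bose_R u)). eapply CS_ext; [|apply bose_series; exact Hu].
  intros n. cbv beta. rewrite <- cexp_RtoC. f_equal. rewrite RtoC_opp, !RtoC_mult. reflexivity.
Qed.

Lemma theta_CS (u : R) : 0 < u ->
  CS (fun m => Cconj (chi (Z.of_nat (S m))) * RtoC (exp (- (2 * PI * INR (S m) * u))))%C (theta u) /\
  Cmod (theta u) <= exp (- PI * u) / (PI * u).
Proof.
  intros Hu. assert (Hs := bose_series_R u Hu). assert (He := CS_RtoC_ex_series _ _ Hs).
  assert (T : CS (fun m => Cconj (chi (Z.of_nat (S m))) * RtoC (exp (- (2 * PI * INR (S m) * u))))%C (theta u)).
  { eapply CSum_dom; [apply theta_dom|exact He]. }
  split; [exact T|].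
  eapply Rle_trans; [apply (CS_bound _ _ _ (theta_dom u) He T)|].
  assert (E : RtoC (Series (fun m => exp (- (2 * PI * INR (S m) * u)))) = RtoC (/ (exp (2 * PI * u) - 1))).
  { eapply CS_unique; [apply CS_RtoC, He|exact Hs]. }
  apply (f_equal Re) in E. cbn [Re RtoC fst] in E. rewrite E. apply bose_R, Hu.
Qed.

(** [theta_transform] at [u = exp v / q], since [logis (v - ln k) = t^2 / (t^2 + k^2)] with
    [t = exp v]. *)
Lemma logis_sum_theta (v : R) :
  logis_sum achi v = (RtoC (PI * (exp v / INR q)) * tau * theta (exp v / INR q))%C.
Proof.
  assert (Hq := INR_q_pos q chi Hchi). assert (He := exp_pos v).
  assert (Hu : 0 < exp v / INR q) by (apply Rdiv_lt_0_compat; assumption).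
  apply (theta_transform q chi Hchi Hprim Heven Hq2 _ _ _ Hu (proj1 (theta_CS _ Hu))).
  eapply CS_ext; [|apply logis_sum_CS, achi_le]. intros k. cbv beta. unfold achi. f_equal. f_equal.
  rewrite logis_log by apply INR_S_pos. replace (INR q * (exp v / INR q)) with (exp v) by (field; lra).
  replace (exp (2 * v)) with (exp v ^ 2); [reflexivity|]. simpl. rewrite Rmult_1_r, <- exp_plus. f_equal. ring.
Qed.

(** In the transformed form the sum is at most a multiple of [exp (- PI u)] with [u = exp v / q],
    doubly exponential in [v]; the termwise bounds on [logis] would give no decay at plus
    infinity. *)
Lemma logis_sum_chi_decay (A : R) : 0 < A -> exists K, 0 < K /\ forall v, Cmod (logis_sum achi v) <= K * exp (- A * v).
Proof.
  intros HA. assert (Hq := INR_q_pos q chi Hchi). assert (Hpi := PI_RGT_0).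
  destruct (exp_exp_decay (PI / INR q) A) as [K [HK H]]; [apply Rdiv_lt_0_compat; lra|exact HA|].
  assert (Ht := Cmod_ge_0 tau).
  exists ((Cmod tau + 1) * K). split; [nra|]. intros v. assert (He := exp_pos v).
  assert (Hu : 0 < exp v / INR q) by (apply Rdiv_lt_0_compat; assumption).
  rewrite logis_sum_theta, !Cmod_mult, Cmod_R, Rabs_pos_eq by nra.
  assert (B := proj2 (theta_CS _ Hu)). specialize (H v).
  replace (- (PI / INR q) * exp v) with (- PI * (exp v / INR q)) in H by (field; lra).
  set (u := exp v / INR q) in *.
  assert (Hpu : 0 < PI * u) by (apply Rmult_lt_0_compat; lra).
  apply Rle_trans with (Cmod tau * exp (- PI * u)).
  - replace (Cmod tau * exp (- PI * u)) with (PI * u * Cmod tau * (exp (- PI * u) / (PI * u))) by (field; lra).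
    apply Rmult_le_compat_l; [nra|exact B].
  - rewrite Rmult_assoc. apply Rmult_le_compat; [lra|left; apply exp_pos|lra|exact H].
Qed.

(** On the right, decay of order [|s| + 1] beats [exp (- s v)] whatever the sign of [s]; on the left
    only [exp (2 v)] is available, which is where [s < 2] enters. *)
Lemma edec_chi_mellin (w : C) : Re w < 2 -> exists K d, edec (fun v => cexp (- w * RtoC v) * logis_sum achi v)%C K d.
Proof.
  intros Hw. set (s := Re w) in *.
  destruct (logis_sum_chi_decay (Rabs s + 1)) as [K [HK H]]; [assert (T := Rabs_pos s); lra|].
  set (S2 := Series (fun n => exp (- 2 * ln (INR (S n))))).
  assert (HS2 : 0 <= S2).
  { assert (T := logis_sum_le achi 0 achi_le). fold S2 in T. rewrite Rmult_0_r, exp_0, Rmult_1_l in T.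
    eapply Rle_trans; [apply Cmod_ge_0|exact T]. }
  set (d := Rmin 1 (2 - s)). assert (Hd : 0 < d) by (apply Rmin_pos; lra).
  assert (Hd1 := Rmin_l 1 (2 - s)). assert (Hd2 := Rmin_r 1 (2 - s)). fold d in Hd1, Hd2.
  exists (K + S2), d. split; [exact Hd|split].
  - intros v. apply rcont_mult; [apply rcont_cexp_lin|apply rcont_logis_sum, achi_le].
  - intros v. rewrite Cmod_mult, Cmod_cexp, re_scal_r, Re_opp. fold s.
    destruct (Rle_dec 0 v) as [Hv|Hv].
    + apply Rle_trans with (exp (- s * v) * (K * exp (- (Rabs s + 1) * v))).
      * apply Rmult_le_compat_l; [left; apply exp_pos|apply H].
      * replace (exp (- s * v) * (K * exp (- (Rabs s + 1) * v))) with (K * exp (- s * v + - (Rabs s + 1) * v)) by (rewrite exp_plus; ring).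
        apply Rmult_le_compat; [lra|left; apply exp_pos|lra|]. apply exp_le. rewrite (Rabs_pos_eq v) by lra.
        assert (T := Rle_abs (- s)). rewrite Rabs_Ropp in T. nra.
    + apply Rle_trans with (exp (- s * v) * (exp (2 * v) * S2)).
      * apply Rmult_le_compat_l; [left; apply exp_pos|apply logis_sum_le, achi_le].
      * replace (exp (- s * v) * (exp (2 * v) * S2)) with (S2 * exp (- s * v + 2 * v)) by (rewrite exp_plus; ring).
        apply Rmult_le_compat; [lra|left; apply exp_pos|lra|]. apply exp_le. rewrite Rabs_left by lra. nra.
Qed.

(** The value of the series in [1 < Re w < 2], in a form that converges for every [Re w < 2]. *)
Definition Lambda (w : C) : C :=
  (2 / RtoC PI * csin (RtoC PI * w / 2) * IR (fun v => cexp (- w * RtoC v) * logis_sum achi v))%C.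

Lemma holo_csin_half (w : C) : holo (fun w => csin (RtoC PI * w / 2)) w.
Proof.
  apply holo_csin. unfold Cdiv. apply holo_mult; [|apply holo_const]. apply holo_scal, holo_id.
Qed.

Lemma holo_Lambda (w : C) : Re w < 2 -> holo Lambda w.
Proof.
  intros Hw. unfold Lambda. apply holo_mult; [apply holo_scal, holo_csin_half|].
  destruct (edec_chi_mellin w Hw) as [K [d H]].
  apply (holo_comp (fun z => IR (fun v => cexp (z * RtoC v) * logis_sum achi v)%C) (fun w => - w)%C).
  - apply (holo_ext (fun w => RtoC (-1) * w)%C); [intros; ring|]. apply holo_scal, holo_id.
  - apply (IR_holo _ _ K d H). intros v. apply rcont_logis_sum, achi_le.
Qed.

Lemma Lfun_continuation : is_dirichlet_continuation achi (Lfun chi).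
Proof.
  apply (dirichlet_continuation_glue achi Lambda).
  - apply achi_le.
  - intros w Hw _. apply holo_Lambda, Hw.
  - intros w Hw. apply logis_sum_mellin; [apply achi_le|exact Hw].
Qed.

(** Both sides are holomorphic off the integers and equal the series for [1 < Re w < 2]. *)
Lemma Lfun_Lambda (w : C) : 0 < Re w < 2 -> nonint w -> Lfun chi w = Lambda w.
Proof.
  intros Hw Hn. destruct Lfun_continuation as [H1 H2]. apply Ceq_minus.
  apply (identity_strip (fun w => Lfun chi w - Lambda w)%C 0 2 1 2); try lra; try assumption.
  - intros z Hz Hnz. apply holo_minus; [|apply holo_Lambda; lra]. apply holo_ex_derive, H1.
    exact (Hnz 1%Z).
  - intros z Hz _. apply (proj1 (Ceq_minus _ _)). eapply CS_unique; [apply H2; lra|].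
    apply logis_sum_mellin; [apply achi_le|exact Hz].
Qed.

End LFunction.

(** * Continuation of the Riemann zeta function *)

Lemma csin_taylor (z : C) : Cmod (csin z - z) <= Cmod z ^ 3 * exp (Cmod z).
Proof.
  assert (Hi : Ci <> RtoC 0) by exact Ci_nz.
  assert (Hm : Cmod Ci = 1) by exact Cmod_Ci.
  set (R3 := fun h => (cexp h - 1 - h - h * h / 2)%C).
  assert (E : (csin z - z)%C = ((R3 (Ci * z) - R3 (- (Ci * z))) * / (2 * Ci))%C).
  { unfold csin, R3. field. exact Hi. }
  assert (H1 := cexp_taylor3 (Ci * z)). assert (H2 := cexp_taylor3 (- (Ci * z))).
  fold (R3 (Ci * z)%C) in H1. fold (R3 (- (Ci * z))%C) in H2.
  rewrite Cmod_opp in H2. rewrite Cmod_mult, Hm, Rmult_1_l in H1, H2.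
  rewrite E, Cmod_mult, Cmod_inv, Cmod_mult, Hm, Cmod_R, Rabs_pos_eq, Rmult_1_r by
    (lra || (apply Cmult_neq_0; [intros K; apply (f_equal Re) in K; simpl in K; lra|exact Hi])).
  assert (T := Cmod_triangle_minus (R3 (Ci * z)%C) (R3 (- (Ci * z))%C)). lra.
Qed.

(* [sin (PI w / 2) / w], with its removable singularity filled in. *)
Definition sinc_half (w : C) : C :=
  if excluded_middle_informative (w = RtoC 0) then RtoC (PI / 2) else (csin (RtoC PI * w / 2) * / w)%C.

(** At the origin the cubic bound of [csin_taylor] leaves a quadratic remainder after division by
    [h], so the derivative there is [0]. *)
Lemma holo_sinc_half (w : C) : holo sinc_half w.
Proof.
  assert (Hpi := PI_RGT_0). destruct (classic (w = RtoC 0)) as [->|Hw].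
  - exists (RtoC 0). apply cdiff_second_order with ((PI / 2) ^ 3 * exp (PI / 2)) 1; [lra|]. intros h Hh.
    rewrite Cplus_0_l. unfold sinc_half at 2. destruct excluded_middle_informative as [_|N]; [|exfalso; apply N; reflexivity].
    unfold sinc_half. destruct excluded_middle_informative as [E|E].
    + rewrite E. replace (RtoC (PI / 2) - RtoC (PI / 2) - 0 * 0)%C with (RtoC 0) by ring. rewrite Cmod_0. simpl. lra.
    + assert (Hm : 0 < Cmod h) by (apply Cmod_gt_0; exact E).
      replace (csin (RtoC PI * h / 2) * / h - RtoC (PI / 2) - 0 * h)%C
        with ((csin (RtoC PI * h / 2) - RtoC PI * h / 2) * / h)%C by (rewrite RtoC_div by lra; field; exact E).
      assert (T := csin_taylor (RtoC PI * h / 2)).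
      assert (Em : Cmod (RtoC PI * h / 2) = PI / 2 * Cmod h).
      { replace (RtoC PI * h / 2)%C with (RtoC (PI / 2) * h)%C by (rewrite RtoC_div by lra; field).
        rewrite Cmod_mult, Cmod_R, Rabs_pos_eq; lra. }
      rewrite Em in T. rewrite Cmod_mult, Cmod_inv by exact E.
      assert (Ee : exp (PI / 2 * Cmod h) <= exp (PI / 2)) by (apply exp_le; nra).
      apply Rle_trans with ((PI / 2 * Cmod h) ^ 3 * exp (PI / 2) * / Cmod h); [|right; field; lra].
      apply Rmult_le_compat_r; [left; apply Rinv_0_lt_compat, Hm|]. eapply Rle_trans; [exact T|].
      apply Rmult_le_compat_l; [apply pow_le; nra|exact Ee].
  - apply holo_ext_loc with (fun w => csin (RtoC PI * w / 2) * / w)%C (Cmod w).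
    + apply Cmod_gt_0, Hw.
    + intros v Hv. unfold sinc_half. destruct excluded_middle_informative as [E|E]; [|reflexivity].
      exfalso. rewrite E in Hv. replace (0 - w)%C with (- w)%C in Hv by ring. rewrite Cmod_opp in Hv. lra.
    + apply holo_mult; [apply holo_csin_half|apply holo_inv; [apply holo_id|exact Hw]].
Qed.

Definition one_coef (n : nat) : C := RtoC 1.

Lemma one_coef_le n : Cmod (one_coef (S n)) <= 1.
Proof. unfold one_coef. rewrite Cmod_1. lra. Qed.

Lemma logis_sum_one (v : R) : logis_sum one_coef v =
  RtoC (PI * exp v * / (exp (2 * PI * exp v) - 1) + PI / 2 * exp v - 1 / 2).
Proof.
  set (t := exp v). assert (Ht : 0 < t) by apply exp_pos.
  assert (Htn : RtoC t <> RtoC 0) by (intros E; apply (f_equal Re) in E; cbn in E; lra).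
  assert (T := CS_scal (RtoC t) _ _ (coth_right (RtoC t) Ht)).
  rewrite (proj1 (bose_R t)) in T.
  eapply CS_unique; [apply logis_sum_CS, one_coef_le|].
  match goal with |- CS _ ?r => match type of T with CS _ ?l => replace r with l end end.
  - eapply CS_ext; [|exact T]. intros k. cbv beta. unfold one_coef.
    rewrite logis_log by apply INR_S_pos. replace (exp (2 * v)) with (t * t) by (unfold t; rewrite <- exp_plus; f_equal; ring).
    assert (Hk := INR_S_pos k). set (n := INR (S k)) in *.
    assert (D : t * t + n ^ 2 <> 0) by nra.
    rewrite RtoC_div, RtoC_plus, RtoC_mult by exact D. field.
    rewrite <- RtoC_mult, <- RtoC_plus. intros E. apply (f_equal Re) in E. cbn [Re RtoC fst] in E. contradiction.
  - rewrite RtoC_minus, RtoC_plus, !RtoC_mult, !RtoC_div by lra. field. exact Htn.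
Qed.

(** For [v >= 0] the subtracted terms are the non-decaying part [PI / 2 * exp v - 1 / 2] of the sum;
    the factor [sexp 0 2], equal to [exp (2 v)] for [v <= 0], keeps the decay at minus infinity, and
    the transforms of these terms are rational in [w]. *)
Definition zreg (v : R) : C :=
  (logis_sum one_coef v - RtoC (PI / 2) * (RtoC (exp v) * sexp 0 2 v) + RtoC (1 / 2) * sexp 0 2 v)%C.

Lemma rcont_zreg v : rcont zreg v.
Proof.
  unfold zreg. apply rcont_plus.
  - apply rcont_minus; [apply rcont_logis_sum, one_coef_le|]. apply rcont_mult; [apply rcont_const|].
    apply rcont_mult; [apply rcont_RtoC, continuous_exp|apply rcont_sexp].
  - apply rcont_mult; [apply rcont_const|apply rcont_sexp].
Qed.

(** For [v >= 0] only the Bose term of [logis_sum_one] remains; for [v < 0] each of the three parts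
    is at most a multiple of [exp (2 v)]. *)
Lemma edec_zreg (w : C) : Re w < 2 -> exists K d, edec (fun v => cexp (- w * RtoC v) * zreg v)%C K d.
Proof.
  intros Hw. assert (Hpi := PI_RGT_0). set (s := Re w) in *.
  assert (Hs0 := Rabs_pos s).
  destruct (exp_exp_decay PI (Rabs s + 1)) as [K [HK H]]; [lra|lra|].
  set (S2 := Series (fun n => exp (- 2 * ln (INR (S n))))).
  assert (HS2 : 0 <= S2).
  { assert (T := logis_sum_le one_coef 0 one_coef_le). fold S2 in T. rewrite Rmult_0_r, exp_0, Rmult_1_l in T.
    eapply Rle_trans; [apply Cmod_ge_0|exact T]. }
  set (d := Rmin 1 (2 - s)). assert (Hd : 0 < d) by (apply Rmin_pos; lra).
  assert (Hd1 := Rmin_l 1 (2 - s)). assert (Hd2 := Rmin_r 1 (2 - s)). fold d in Hd1, Hd2.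
  exists (K + (S2 + PI / 2 + 1 / 2)), d. split; [exact Hd|split].
  - intros v. apply rcont_mult; [apply rcont_cexp_lin|apply rcont_zreg].
  - intros v. rewrite Cmod_mult, Cmod_cexp, re_scal_r, Re_opp. fold s.
    destruct (Rle_dec 0 v) as [Hv|Hv].
    + assert (E : zreg v = RtoC (PI * exp v * / (exp (2 * PI * exp v) - 1))).
      { unfold zreg. rewrite sexp_pos, logis_sum_one by exact Hv.
        replace (RtoC v * - 0)%C with (RtoC 0) by ring. rewrite cexp_0.
        rewrite RtoC_minus, RtoC_plus, (RtoC_mult (PI / 2)). ring. }
      assert (Ht := exp_pos v). assert (B := proj2 (bose_R (exp v)) Ht). specialize (H v).
      assert (Bz : Cmod (zreg v) <= K * exp (- (Rabs s + 1) * v)).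
      { rewrite E, Cmod_R, Rabs_pos_eq.
        2:{ apply Rmult_le_pos; [nra|lra]. }
        eapply Rle_trans; [|exact H].
        replace (exp (- PI * exp v)) with (PI * exp v * (exp (- PI * exp v) / (PI * exp v))) by (field; lra).
        apply Rmult_le_compat_l; [nra|lra]. }
      apply Rle_trans with (exp (- s * v) * (K * exp (- (Rabs s + 1) * v))).
      * apply Rmult_le_compat_l; [left; apply exp_pos|apply Bz].
      * replace (exp (- s * v) * (K * exp (- (Rabs s + 1) * v))) with (K * exp (- s * v + - (Rabs s + 1) * v)) by (rewrite exp_plus; ring).
        apply Rmult_le_compat; [lra|left; apply exp_pos|lra|]. apply exp_le. rewrite (Rabs_pos_eq v) by lra.
        assert (T := Rle_abs (- s)). rewrite Rabs_Ropp in T. nra.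
    + assert (Hs : Cmod (sexp 0 2 v) = exp (2 * v)).
      { rewrite sexp_neg by lra. rewrite Cmod_cexp, re_scal_l. f_equal. simpl. ring. }
      assert (Hev : exp v <= 1) by (rewrite <- exp_0; apply exp_le; lra).
      assert (B := logis_sum_le one_coef v one_coef_le). fold S2 in B.
      assert (E2 := exp_pos (2 * v)). assert (E1 := exp_pos v).
      assert (Bz : Cmod (zreg v) <= (S2 + PI / 2 + 1 / 2) * exp (2 * v)).
      { unfold zreg. eapply Rle_trans; [apply Cmod_triangle|].
        eapply Rle_trans; [apply Rplus_le_compat_r, Cmod_triangle_minus|].
        rewrite !Cmod_mult, Hs, !Cmod_R, !Rabs_pos_eq by lra.
        assert (PI / 2 * (exp v * exp (2 * v)) <= PI / 2 * exp (2 * v)) by (apply Rmult_le_compat_l; nra). lra. }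
      apply Rle_trans with (exp (- s * v) * ((S2 + PI / 2 + 1 / 2) * exp (2 * v))).
      * apply Rmult_le_compat_l; [left; apply exp_pos|exact Bz].
      * replace (exp (- s * v) * ((S2 + PI / 2 + 1 / 2) * exp (2 * v))) with ((S2 + PI / 2 + 1 / 2) * exp (- s * v + 2 * v)) by (rewrite exp_plus; ring).
        apply Rmult_le_compat; [lra|left; apply exp_pos|lra|]. apply exp_le. rewrite Rabs_left by lra. nra.
Qed.

(** The removed part contributes [1 / (w - 1)], the pole of [zeta], and [- 1 / (2 w)], whose pole is
    cancelled by the sine; [sinc_half] stands for that quotient. *)
Definition zeta_left (w : C) : C :=
  (2 / RtoC PI * csin (RtoC PI * w / 2) *
     (IR (fun v => cexp (- w * RtoC v) * zreg v) + RtoC (PI / 2) * (/ (w - 1) + / (3 - w)) - RtoC (1 / 2) * / (2 - w))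
   - / RtoC PI * sinc_half w)%C.

Lemma holo_zeta_left (w : C) : Re w < 2 -> w <> RtoC 1 -> holo zeta_left w.
Proof.
  intros Hw H1. destruct (edec_zreg w Hw) as [K [d H]].
  assert (N1 : (w - 1)%C <> RtoC 0) by (intros E; apply H1, Ceq_minus, E).
  assert (N3 : (3 - w)%C <> RtoC 0) by (apply Re_pos_nz; rewrite Re_minus; simpl; lra).
  assert (N2 : (2 - w)%C <> RtoC 0) by (apply Re_pos_nz; rewrite Re_minus; simpl; lra).
  unfold zeta_left. apply holo_minus; [|apply holo_scal, holo_sinc_half].
  apply holo_mult; [apply holo_scal, holo_csin_half|]. apply holo_minus; [apply holo_plus|].
  - apply (holo_comp (fun z => IR (fun v => cexp (z * RtoC v) * zreg v)%C) (fun w => - w)%C).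
    + apply (holo_ext (fun w => RtoC (-1) * w)%C); [intros; ring|]. apply holo_scal, holo_id.
    + apply (IR_holo _ _ K d H). apply rcont_zreg.
  - apply holo_scal, holo_plus; apply holo_inv; try assumption; apply holo_minus; (apply holo_id || apply holo_const).
  - apply holo_scal, holo_inv; [|assumption]. apply holo_minus; (apply holo_id || apply holo_const).
Qed.

Lemma zeta_continuation : is_dirichlet_continuation one_coef zeta.
Proof.
  apply (dirichlet_continuation_glue one_coef zeta_left).
  - apply one_coef_le.
  - apply holo_zeta_left.
  - intros w Hw. destruct (logis_sum_mellin one_coef w one_coef_le Hw) as [_ T].
    destruct (edec_zreg w ltac:(lra)) as [K [d H]].
    assert (Hpi := PI_RGT_0).
    set (e := Rmin (Re w - 1) (2 - Re w)). assert (He : 0 < e) by (apply Rmin_pos; lra).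
    assert (He1 := Rmin_l (Re w - 1) (2 - Re w)). assert (He2 := Rmin_r (Re w - 1) (2 - Re w)). fold e in He1, He2.
    assert (R1 : Re (w - 1) = Re w - 1) by reflexivity. assert (R2 : Re (3 - w) = 3 - Re w) by reflexivity.
    assert (R3 : Re (2 - w) = 2 - Re w) by reflexivity.
    assert (S1 : edec (sexp (w - 1) (3 - w)) 1 e) by (apply edec_sexp; lra).
    assert (S2 : edec (sexp w (2 - w)) 1 e) by (apply edec_sexp; lra).
    assert (N0 : w <> RtoC 0) by (apply Re_pos_nz; lra).
    assert (E : IR (fun v => cexp (- w * RtoC v) * logis_sum one_coef v)%C =
      (IR (fun v => cexp (- w * RtoC v) * zreg v) + RtoC (PI / 2) * (/ (w - 1) + / (3 - w)) - RtoC (1 / 2) * (/ w + / (2 - w)))%C).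
    { rewrite <- (IR_sexp (w - 1) (3 - w)), <- (IR_sexp w (2 - w)) by lra.
      rewrite <- (IR_scal _ _ _ _ S1), <- (IR_scal _ _ _ _ S2).
      assert (E1 := edec_scal (RtoC (PI / 2)) _ _ _ S1). assert (E2 := edec_scal (RtoC (1 / 2)) _ _ _ S2).
      rewrite <- (IR_plus _ _ _ _ _ _ H E1), <- (IR_minus _ _ _ _ _ _ (edec_plus _ _ _ _ _ _ H E1) E2).
      apply IR_ext. intros v.
      assert (F1 : sexp (w - 1) (3 - w) v = (cexp (- w * RtoC v) * (RtoC (exp v) * sexp 0 2 v))%C).
      { unfold sexp. rewrite <- cexp_RtoC, <- !cexp_add. f_equal.
        rewrite !RtoC_div, RtoC_plus, RtoC_minus by lra. field. }
      assert (F2 : sexp w (2 - w) v = (cexp (- w * RtoC v) * sexp 0 2 v)%C).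
      { unfold sexp. rewrite <- !cexp_add. f_equal. rewrite !RtoC_div, RtoC_plus, RtoC_minus by lra. field. }
      rewrite F1, F2. unfold zreg. ring. }
    rewrite E in T.
    match goal with |- CS _ ?r => match type of T with CS _ ?l => replace r with l; [exact T|] end end.
    unfold zeta_left, sinc_half. destruct excluded_middle_informative as [E0|_]; [contradiction|].
    assert (N1 : (w - 1)%C <> RtoC 0) by (apply Re_pos_nz; lra).
    assert (N3 : (3 - w)%C <> RtoC 0) by (apply Re_pos_nz; lra).
    assert (N2 : (2 - w)%C <> RtoC 0) by (apply Re_pos_nz; lra).
    rewrite !RtoC_div by lra. field. repeat split; try assumption.
    intros K'. apply (f_equal Re) in K'. cbn in K'. lra.
Qed.

(** * The Bessel series *)

Lemma edec_bessel (nu : C) (a b : R) : 0 < a -> 0 < b ->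
  exists K, 0 < K /\ edec (fun v => cexp (nu * RtoC v) * RtoC (exp (- (a * exp v + b * exp (- v)))))%C K 1.
Proof.
  intros Ha Hb. set (s := Re nu). assert (Hs := Rabs_pos s).
  destruct (exp_exp_decay a (Rabs s + 1) Ha ltac:(lra)) as [K1 [HK1 H1]].
  destruct (exp_exp_decay b (Rabs s + 1) Hb ltac:(lra)) as [K2 [HK2 H2]].
  exists (K1 + K2). split; [lra|]. split; [lra|split].
  - intros v. apply rcont_mult; [apply rcont_cexp_lin|]. apply rcont_RtoC, cont_deriv. auto_derive. tauto.
  - intros v. rewrite Cmod_mult, Cmod_cexp, Cmod_R, re_scal_r, Rabs_pos_eq by (left; apply exp_pos). fold s.
    assert (E1 := exp_pos v). assert (E2 := exp_pos (- v)).
    assert (T1 := Rle_abs s). assert (T2 := Rle_abs (- s)). rewrite Rabs_Ropp in T2.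
    replace (- (a * exp v + b * exp (- v))) with (- a * exp v + - b * exp (- v)) by ring. rewrite exp_plus.
    assert (P1 := exp_pos (- a * exp v)). assert (P2 := exp_pos (- b * exp (- v))).
    destruct (Rle_dec 0 v) as [Hv|Hv].
    + specialize (H1 v).
      assert (B : exp (- b * exp (- v)) <= 1) by (rewrite <- exp_0; apply exp_le; nra).
      apply Rle_trans with (exp (s * v) * (K1 * exp (- (Rabs s + 1) * v))).
      * apply Rmult_le_compat_l; [left; apply exp_pos|]. nra.
      * replace (exp (s * v) * (K1 * exp (- (Rabs s + 1) * v))) with (K1 * exp (s * v + - (Rabs s + 1) * v)) by (rewrite exp_plus; ring).
        apply Rmult_le_compat; [lra|left; apply exp_pos|lra|]. apply exp_le. rewrite (Rabs_pos_eq v) by lra. nra.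
    + specialize (H2 (- v)).
      assert (B : exp (- a * exp v) <= 1) by (rewrite <- exp_0; apply exp_le; nra).
      apply Rle_trans with (exp (s * v) * (K2 * exp (- (Rabs s + 1) * - v))).
      * apply Rmult_le_compat_l; [left; apply exp_pos|]. nra.
      * replace (exp (s * v) * (K2 * exp (- (Rabs s + 1) * - v))) with (K2 * exp (s * v + - (Rabs s + 1) * - v)) by (rewrite exp_plus; ring).
        apply Rmult_le_compat; [lra|left; apply exp_pos|lra|]. apply exp_le. rewrite (Rabs_left v) by lra. nra.
Qed.

(** The integrand of [BesselK] is the even part of [g], so the half line carries half of the
    integral. *)
Lemma BesselK_IR_cosh (nu : C) (y : R) : 0 < y ->
  (2 * BesselK nu y)%C = IR (fun v => cexp (nu * RtoC v) * RtoC (exp (- (y / 2 * exp v + y / 2 * exp (- v)))))%C.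
Proof.
  intros Hy. set (g := fun v => (cexp (nu * RtoC v) * RtoC (exp (- (y / 2 * exp v + y / 2 * exp (- v)))))%C).
  destruct (edec_bessel nu (y / 2) (y / 2) ltac:(lra) ltac:(lra)) as [K [HK He]]. fold g in He.
  set (f := fun t : R => (cexp (RtoC (- y * cosh t)) * ccosh (nu * RtoC t))%C).
  assert (Hf : forall t, f t = (RtoC (/ 2) * (g t + g (- t)%R))%C).
  { intros t. unfold f, g, ccosh, cosh. rewrite cexp_RtoC, RtoC_opp, Ropp_involutive.
    replace (y / 2 * exp (- t) + y / 2 * exp t) with (y / 2 * exp t + y / 2 * exp (- t)) by ring.
    replace (- y * ((exp t + exp (- t)) / 2)) with (- (y / 2 * exp t + y / 2 * exp (- t))) by field.
    replace (nu * - RtoC t)%C with (- (nu * RtoC t))%C by ring. rewrite RtoC_inv by lra. field. }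
  assert (Hgc : forall t, rcont g t) by apply He.
  assert (Hgc' : forall t, rcont (fun s => g (- s)) t) by (intros; apply (edec_reflect _ _ _ He)).
  assert (Hfc : forall t, rcont f t).
  { intros t. apply (rcont_ext (fun t => RtoC (/ 2) * (g t + g (- t)%R))%C); [intros; symmetry; apply Hf|].
    apply rcont_mult; [apply rcont_const|]. apply rcont_plus; auto. }
  assert (Hcf : forall b, 0 <= b -> cint f 0 b = (RtoC (/ 2) * cint g (- b) b)%C).
  { intros b Hb. rewrite (cint_ext f (fun t => RtoC (/ 2) * (g t + g (- t)%R))%C) by (try exact Hb; intros; apply Hf).
    rewrite cint_scal, cint_plus, cint_reflect; auto.
    - rewrite Ropp_0, <- (cint_Chasles g (- b) 0 b) by (try lra; auto). ring.
    - intros. apply rcont_plus; auto. }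
  assert (HG : is_RInt_gen (V := C_R_NormedModule) f (at_point 0) (Rbar_locally p_infty) (RtoC (/ 2) * IR g)%C).
  { intros P [eps HP]. destruct (IR_lim g K 1 He eps (cond_pos eps)) as [A0 [HA0 HA]].
    apply (Filter_prod _ _ _ (fun t => t = 0) (fun b => A0 < b)).
    - reflexivity.
    - exists A0. auto.
    - intros t b -> Hb. exists (cint f 0 b). split.
      + apply cint_is; [lra|auto].
      + apply HP. apply C_NormedModule_mixin_compat1. change (Cmod (cint f 0 b - RtoC (/ 2) * IR g) < eps).
        rewrite Hcf by lra. replace (RtoC (/ 2) * cint g (- b) b - RtoC (/ 2) * IR g)%C
          with (RtoC (/ 2) * (cint g (- b) b - IR g))%C by ring.
        rewrite Cmod_mult, Cmod_R, Rabs_pos_eq by lra. specialize (HA b b ltac:(lra) ltac:(lra)).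
        assert (T := cond_pos eps). lra. }
  unfold BesselK. fold f. rewrite (is_RInt_gen_unique (V := C_R_CompleteNormedModule) f _ HG).
  rewrite RtoC_inv by lra. field.
Qed.

(** The shift by [c = ln (b / a) / 2] balances [a exp v] and [b exp (- v)] to the common coefficient
    [sqrt (a * b)], and the exponential factor yields the power of [b / a]. *)
Lemma BesselK_IR (nu : C) (a b : R) : 0 < a -> 0 < b ->
  (2 * cpow (b / a) (nu / 2) * BesselK nu (2 * sqrt (a * b)))%C =
  IR (fun v => cexp (nu * RtoC v) * RtoC (exp (- (a * exp v + b * exp (- v)))))%C.
Proof.
  intros Ha Hb. set (c := ln (b / a) / 2). set (y := 2 * sqrt (a * b)).
  assert (Hab : 0 < a * b) by (apply Rmult_lt_0_compat; assumption).
  assert (Hsq : 0 < sqrt (a * b)) by (apply sqrt_lt_R0; exact Hab).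
  assert (Hba : 0 < b / a) by (apply Rdiv_lt_0_compat; assumption).
  destruct (edec_bessel nu (y / 2) (y / 2) ltac:(unfold y; lra) ltac:(unfold y; lra)) as [K [HK He]].
  assert (E1 : a * exp c = y / 2 /\ b * exp (- c) = y / 2).
  { assert (Ec : exp c * exp c = b / a).
    { rewrite <- exp_plus. replace (c + c) with (ln (b / a)) by (unfold c; field). apply exp_ln, Hba. }
    assert (Hc := exp_pos c).
    assert (E : a * exp c = y / 2).
    { unfold y. replace (2 * sqrt (a * b) / 2) with (sqrt (a * b)) by field.
      symmetry. apply sqrt_lem_1; [lra|nra|].
      replace (a * exp c * (a * exp c)) with (a * a * (exp c * exp c)) by ring. rewrite Ec. field. lra. }
    split; [exact E|]. rewrite <- E. rewrite exp_Ropp.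
    replace b with (a * (exp c * exp c)) by (rewrite Ec; field; lra). field. lra. }
  destruct E1 as [E1 E2].
  replace (2 * cpow (b / a) (nu / 2) * BesselK nu y)%C with (cpow (b / a) (nu / 2) * (2 * BesselK nu y))%C by ring.
  rewrite BesselK_IR_cosh by (unfold y; lra).
  rewrite <- (IR_shift _ _ _ (- c) He), <- (IR_scal _ _ _ _ (edec_shift _ _ _ (- c) He)).
  apply IR_ext. intros v. unfold cpow. rewrite Cmult_assoc, <- cexp_add.
  f_equal; [f_equal|].
  - unfold c. rewrite RtoC_plus, RtoC_opp, RtoC_div by lra. field.
  - do 4 f_equal.
    + rewrite <- E1, exp_plus, exp_Ropp. field. apply Rgt_not_eq, exp_pos.
    + rewrite <- E2. replace (- (v + - c)) with (- v + c) by ring. rewrite exp_plus, (exp_Ropp c). field. apply Rgt_not_eq, exp_pos.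
Qed.

Definition invsq (K : R) (n : nat) : R := K * exp (- 2 * ln (INR n)).

Lemma ex_series_invsq (K : R) : ex_series (fun n => invsq K (S n)).
Proof.
  apply (ex_series_scal (V := R_NormedModule) K).
  eapply ex_series_ext; [|apply (ex_series_power 1); lra]. intros n. cbv beta. apply (f_equal exp). ring.
Qed.

Section BesselSeries.

Variables (q : nat) (chi : Z -> C) (x : R).
Hypothesis Hchi : dirichlet_character q chi.
Hypothesis Hx : 0 < x.

(** The integrand of [BesselK_IR] with [a = 2 PI d] and [b = 2 PI m x], weighted by the conjugate
    character; [d m] is the index in the Bessel series. *)
Let ker (nu : C) (d m : nat) (v : R) : C :=
  (cexp (nu * RtoC v) * (Cconj (chi (Z.of_nat m)) * RtoC (exp (- (2 * PI * INR d * exp v + 2 * PI * INR m * x * exp (- v))))))%C.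

(** Because [d] and [m] are at least [1], half of the exponent dominates a Bessel kernel independent
    of them, and the other half gives [d^(- 2) m^(- 2)]: in the bounds at [v + ln d] and
    [- v + ln m] the factors [exp (- 2 v)] and [exp (2 v)] cancel. *)
Lemma edec_ker (nu : C) : exists K, 0 < K /\ forall d m, (1 <= d)%nat -> (1 <= m)%nat ->
  edec (ker nu d m) (invsq K d * invsq 1 m) 1.
Proof.
  assert (Hpi := PI_RGT_0). assert (Hpx : 0 < PI * x) by (apply Rmult_lt_0_compat; lra).
  destruct (exp_exp_decay PI 2) as [K1 [HK1 H1]]; [lra|lra|].
  destruct (exp_exp_decay (PI * x) 2) as [K2 [HK2 H2]]; [lra|lra|].
  destruct (edec_bessel nu PI (PI * x) Hpi Hpx) as [K3 [HK3 H3]].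
  exists (K1 * K2 * K3). split; [repeat apply Rmult_lt_0_compat; assumption|]. intros d m Hd Hm.
  split; [lra|split].
  - intros v. apply rcont_mult; [apply rcont_cexp_lin|]. apply rcont_mult; [apply rcont_const|].
    apply rcont_RtoC, cont_deriv. auto_derive. tauto.
  - intros v. unfold ker. rewrite Cmod_mult, (Cmod_mult (Cconj _)), Cmod_conj.
    assert (D1 : 1 <= INR d) by (apply (le_INR 1); exact Hd). assert (M1 : 1 <= INR m) by (apply (le_INR 1); exact Hm).
    destruct H3 as [_ [_ H3]]. specialize (H3 v). rewrite Cmod_mult in H3.
    rewrite Cmod_R, Rabs_pos_eq in H3 by (left; apply exp_pos).
    rewrite Cmod_R, Rabs_pos_eq by (left; apply exp_pos).
    specialize (H1 (v + ln (INR d))). rewrite exp_plus, exp_ln in H1 by lra.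
    specialize (H2 (- v + ln (INR m))). rewrite exp_plus, exp_ln in H2 by lra.
    assert (Ev := exp_pos v). assert (Ev' := exp_pos (- v)).
    assert (Hc := chi_le_1 q chi Hchi (Z.of_nat m)). assert (Hc0 := Cmod_ge_0 (chi (Z.of_nat m))).
    set (X := Cmod (cexp (nu * RtoC v))) in *. assert (HX : 0 <= X) by apply Cmod_ge_0.
    set (B := exp (- (PI * exp v + PI * x * exp (- v)))) in *.
    assert (HB : 0 < B) by apply exp_pos.
    assert (Hexp : exp (- (2 * PI * INR d * exp v + 2 * PI * INR m * x * exp (- v))) <=
       exp (- PI * (exp v * INR d)) * exp (- (PI * x) * (exp (- v) * INR m)) * B).
    { unfold B. rewrite <- !exp_plus. apply exp_le.
      assert (0 <= PI * exp v * (INR d - 1)) by (repeat first [lra | apply Rmult_le_pos]).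
      assert (0 <= PI * x * exp (- v) * (INR m - 1)) by (repeat first [lra | apply Rmult_le_pos]). nra. }
    assert (H12 : exp (- PI * (exp v * INR d)) * exp (- (PI * x) * (exp (- v) * INR m)) <=
       K1 * K2 * (exp (- 2 * ln (INR d)) * exp (- 2 * ln (INR m)))).
    { apply Rle_trans with ((K1 * exp (- (2) * (v + ln (INR d)))) * (K2 * exp (- (2) * (- v + ln (INR m))))).
      - apply Rmult_le_compat; try (left; apply exp_pos); assumption.
      - right. replace (K1 * exp (- (2) * (v + ln (INR d))) * (K2 * exp (- (2) * (- v + ln (INR m)))))
          with (K1 * K2 * (exp (- (2) * (v + ln (INR d))) * exp (- (2) * (- v + ln (INR m))))) by ring.
        rewrite <- !exp_plus. do 2 f_equal. ring. }
    unfold invsq. set (Dd := exp (- 2 * ln (INR d))) in *. set (Dm := exp (- 2 * ln (INR m))) in *.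
    assert (P := Rmult_lt_0_compat _ _ (exp_pos (- 2 * ln (INR d))) (exp_pos (- 2 * ln (INR m)))). fold Dd Dm in P.
    assert (P12 : 0 < K1 * K2 * (Dd * Dm)) by (repeat apply Rmult_lt_0_compat; try assumption; apply exp_pos).
    replace (K1 * K2 * K3 * Dd * (1 * Dm) * exp (- (1) * Rabs v)) with (K1 * K2 * (Dd * Dm) * (K3 * exp (- (1) * Rabs v))) by ring.
    apply Rle_trans with (X * (1 * (K1 * K2 * (Dd * Dm) * B))).
    + apply Rmult_le_compat_l; [exact HX|]. apply Rmult_le_compat; [exact Hc0|left; apply exp_pos|exact Hc|].
      eapply Rle_trans; [exact Hexp|]. apply Rmult_le_compat_r; [lra|exact H12].
    + replace (X * (1 * (K1 * K2 * (Dd * Dm) * B))) with (K1 * K2 * (Dd * Dm) * (X * B)) by ring.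
      apply Rmult_le_compat_l; [lra|exact H3].
Qed.

(** Without [exp (nu v)], [ker] factors into a part in [d], which sums to the Bose factor, and a
    part in [m], which sums to [theta]; Dirichlet convolution regroups the product by [n = d m]. *)
Definition bessel_kernel (v : R) : C :=
  (RtoC (/ (exp (2 * PI * exp v) - 1)) * theta chi (x * exp (- v)))%C.

Lemma bessel_kernel_CS (nu : C) (v : R) :
  CS (fun n => divsum (S n) (fun d => ker nu d (S n / d) v)) (cexp (nu * RtoC v) * bessel_kernel v)%C.
Proof.
  assert (Hv := exp_pos v). assert (Hxv : 0 < x * exp (- v)) by (apply Rmult_lt_0_compat; [lra|apply exp_pos]).
  assert (S1 := bose_series_R (exp v) Hv). assert (S2 := proj1 (theta_CS q chi Hchi _ Hxv)).
  assert (T := dirichlet_convolution (fun d => RtoC (exp (- (2 * PI * INR d * exp v))))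
    (fun m => Cconj (chi (Z.of_nat m)) * RtoC (exp (- (2 * PI * INR m * (x * exp (- v))))))%C
    (fun d => exp (- (2 * PI * INR d * exp v))) (fun m => exp (- (2 * PI * INR m * (x * exp (- v)))))
    _ _ S1 S2).
  eapply CS_ext; [|apply CS_scal, T].
  - intros n. cbv beta. rewrite <- divsum_scal. apply divsum_ext. intros d _ _. unfold ker.
    replace (exp (- (2 * PI * INR d * exp v + 2 * PI * INR (S n / d) * x * exp (- v)))) with
      (exp (- (2 * PI * INR d * exp v)) * exp (- (2 * PI * INR (S n / d) * (x * exp (- v))))) by (rewrite <- exp_plus; f_equal; ring).
    rewrite RtoC_mult. ring.
  - intros n. rewrite Cmod_R, Rabs_pos_eq by (left; apply exp_pos). lra.
  - intros n. apply (theta_dom q chi Hchi).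
  - apply (CS_RtoC_ex_series _ _ S1).
  - apply (CS_RtoC_ex_series _ _ (bose_series_R _ Hxv)).
Qed.

Lemma div_exact_facts (n d : nat) : (1 <= d)%nat -> (S n mod d = 0)%nat -> (1 <= S n / d)%nat /\ INR (S n) = INR d * INR (S n / d).
Proof.
  intros Hd Hm. assert (E : (S n = d * (S n / d))%nat) by (apply Nat.div_exact; [lia|exact Hm]).
  split; [destruct (S n / d)%nat; lia|]. rewrite <- mult_INR. f_equal. exact E.
Qed.

(** For [n = d m] the Bessel argument [2 sqrt (a b)] is [4 PI sqrt (n x)], and [(b / a)^(nu / 2) =
    (m x / d)^(nu / 2) = x^(nu / 2) n^(nu / 2) d^(- nu)] produces the weight of [sigmabar_chi]. *)
Lemma bessel_series (nu : C) :
  (exists K, edec (fun v => cexp (nu * RtoC v) * bessel_kernel v)%C K 1) /\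
  CS (fun n => sigmabar_chi (- nu) (cconjchar chi) (S n) * cpow (INR (S n)) (nu / 2)
        * BesselK nu (4 * PI * sqrt (INR (S n) * x)))%C
     (IR (fun v => cexp (nu * RtoC v) * bessel_kernel v) / (2 * cpow x (nu / 2)))%C.
Proof.
  assert (Hpi := PI_RGT_0).
  destruct (edec_ker nu) as [K [HK He]].
  set (f := fun n v => divsum (S n) (fun d => ker nu d (S n / d) v)).
  assert (Hf : forall n, edec (f n) (rconv (invsq K) (invsq 1) (S n)) 1 /\
     IR (f n) = divsum (S n) (fun d => IR (ker nu d (S n / d)))).
  { intros n. apply (divsum_IR (fun d => ker nu d (S n / d)) (fun d => invsq K d * invsq 1 (S n / d)%nat)); [lra|].
    intros d Hd Hm. apply He; [exact Hd|]. apply (div_exact_facts n d Hd Hm). }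
  assert (Hpos : forall K' n, 0 <= K' -> 0 <= invsq K' n).
  { intros K' n HK'. apply Rmult_le_pos; [exact HK'|left; apply exp_pos]. }
  destruct (IR_series f (fun n => rconv (invsq K) (invsq 1) (S n)) 1 (fun v => cexp (nu * RtoC v) * bessel_kernel v)%C) as [HE HS].
  - lra.
  - intros n. apply Hf.
  - apply ex_series_rconv; try (intros; apply Hpos; lra); apply ex_series_invsq.
  - intros v. apply bessel_kernel_CS.
  - split; [exists (Series (fun n => rconv (invsq K) (invsq 1) (S n))); exact HE|].
    assert (Hxn := cpow_nz x (nu / 2)).
    assert (H2 : RtoC 2 <> RtoC 0) by (intros E; apply (f_equal Re) in E; simpl in E; lra).
    replace (IR (fun v => cexp (nu * RtoC v) * bessel_kernel v) / (2 * cpow x (nu / 2)))%C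
      with (/ (2 * cpow x (nu / 2)) * IR (fun v => cexp (nu * RtoC v) * bessel_kernel v))%C by (unfold Cdiv; ring).
    apply (CS_ext (fun n => / (2 * cpow x (nu / 2)) * IR (f n))%C); [|apply CS_scal; exact HS]. intros n.
    rewrite (proj2 (Hf n)).
    rewrite (divsum_ext _ (fun d => 2 * cpow x (nu / 2) * (cpow (INR (S n)) (nu / 2) * BesselK nu (4 * PI * sqrt (INR (S n) * x)))
       * (cpow (INR d) (- nu) * cconjchar chi (Z.of_nat (S n / d))))%C).
    + rewrite divsum_scal. unfold sigmabar_chi. field. assumption.
    + intros d Hd Hm. destruct (div_exact_facts n d Hd Hm) as [Hm1 En]. set (m := (S n / d)%nat) in *.
      assert (Dp : 0 < INR d) by (apply lt_0_INR; lia). assert (Mp : 0 < INR m) by (apply lt_0_INR; lia).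
      assert (Ha : 0 < 2 * PI * INR d) by (repeat first [lra | apply Rmult_lt_0_compat]).
      assert (Hb : 0 < 2 * PI * INR m * x) by (repeat first [lra | apply Rmult_lt_0_compat]).
      assert (B := BesselK_IR nu _ _ Ha Hb).
      destruct (edec_bessel nu _ _ Ha Hb) as [K' [_ HK']].
      unfold ker. rewrite (IR_ext _ (fun v => Cconj (chi (Z.of_nat m)) *
         (cexp (nu * RtoC v) * RtoC (exp (- (2 * PI * INR d * exp v + 2 * PI * INR m * x * exp (- v))))))%C) by (intros; ring).
      rewrite (IR_scal _ _ _ _ HK'), <- B.
      replace (2 * sqrt (2 * PI * INR d * (2 * PI * INR m * x))) with (4 * PI * sqrt (INR (S n) * x)).
      2:{ rewrite En. replace (2 * PI * INR d * (2 * PI * INR m * x)) with ((2 * PI) * (2 * PI) * (INR d * INR m * x)) by ring.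
          rewrite (sqrt_mult (2 * PI * (2 * PI))), sqrt_square; [ring|lra|nra|].
          repeat first [lra | apply Rmult_le_pos]. }
      assert (Ep : cpow (2 * PI * INR m * x / (2 * PI * INR d)) (nu / 2) =
        (cpow x (nu / 2) * cpow (INR (S n)) (nu / 2) * cpow (INR d) (- nu))%C).
      { replace (2 * PI * INR m * x / (2 * PI * INR d)) with (INR m * x / INR d) by (field; lra).
        unfold cpow. rewrite <- !cexp_add. f_equal. rewrite ln_div, ln_mult, En, ln_mult by nra.
        rewrite RtoC_minus, !RtoC_plus. field. }
      rewrite Ep. unfold cconjchar. ring.
Qed.

Lemma rcont_bessel_kernel v : rcont bessel_kernel v.
Proof.
  destruct (bessel_series 0) as [[K H] _].
  apply (rcont_ext (fun v => cexp (0 * RtoC v) * bessel_kernel v)%C); [|apply H].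
  intros s. rewrite Cmult_0_l, cexp_0. ring.
Qed.

Lemma holo_bessel_integral (nu : C) : holo (fun nu => IR (fun v => cexp (nu * RtoC v) * bessel_kernel v)%C) nu.
Proof.
  destruct (bessel_series nu) as [[K H] _]. apply (IR_holo _ _ K 1 H). apply rcont_bessel_kernel.
Qed.

End BesselSeries.

(** * The identity in the strip [0 < Re nu < 1] *)

Lemma csin_shift (z : C) : csin (RtoC PI * (1 + z) / 2) = ccos (RtoC PI * z / 2).
Proof.
  unfold csin, ccos.
  replace (Ci * (RtoC PI * (1 + z) / 2))%C with (Ci * RtoC (PI / 2) + Ci * (RtoC PI * z / 2))%C by (rewrite RtoC_div by lra; field).
  assert (E : cexp (Ci * RtoC (PI / 2)) = Ci).
  { unfold cexp, Ci. simpl. replace (0 * (PI / 2) - 1 * 0) with 0 by ring. replace (0 * 0 + 1 * (PI / 2)) with (PI / 2) by ring.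
    rewrite exp_0, cos_PI2, sin_PI2. apply C_ext; simpl; ring. }
  assert (Hi : Ci <> RtoC 0) by exact Ci_nz.
  assert (Hii : (Ci * Ci)%C = RtoC (-1)) by (apply C_ext; simpl; ring).
  rewrite !cexp_opp, !cexp_add, E. assert (Hz := cexp_nz (Ci * (RtoC PI * z / 2))).
  set (Y := cexp (Ci * (RtoC PI * z / 2))) in *.
  replace (/ (Ci * Y))%C with (- Ci * / Y)%C.
  - field. split; assumption.
  - replace (- Ci * / Y)%C with (- (Ci * Ci) / (Ci * Y))%C by (field; split; assumption). rewrite Hii. field. split; assumption.
Qed.

Lemma RtoC_nz (r : R) : r <> 0 -> RtoC r <> RtoC 0.
Proof. intros H E. apply H. apply (f_equal Re) in E. exact E. Qed.

(** Substitution [v -> c - v], used with [c] equal to [ln X], [ln m] or [ln y]. *)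
Lemma IR_flip (f : R -> C) (w : C) (c K d : R) : edec (fun v => cexp (- w * RtoC v) * f v)%C K d ->
  edec (fun v => cexp (w * RtoC v) * f (c - v)%R)%C (Cmod (cexp (w * RtoC c)) * (K * exp (d * Rabs c))) d /\
  IR (fun v => cexp (w * RtoC v) * f (c - v)%R)%C = (cexp (w * RtoC c) * IR (fun v => cexp (- w * RtoC v) * f v))%C.
Proof.
  intros H. assert (H1 := edec_shift _ _ _ c H). assert (H2 := edec_reflect _ _ _ H1).
  assert (E : forall v, (cexp (w * RtoC c) * (cexp (- w * RtoC (- v + c)) * f (- v + c)%R))%C = (cexp (w * RtoC v) * f (c - v)%R)%C).
  { intros v. rewrite Cmult_assoc, <- cexp_add. replace (- v + c) with (c - v) by ring.
    f_equal. f_equal. rewrite RtoC_minus. ring. }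
  split.
  - apply (edec_ext _ _ _ _ E). exact (edec_scal _ _ _ _ H2).
  - rewrite <- (IR_ext _ _ E), (IR_scal _ _ _ _ H2), (IR_reflect _ _ _ H1), (IR_shift _ _ _ _ H). reflexivity.
Qed.

(** With [E = exp (2 v)] the product is [E y^2 / ((E + m^2) (E + y^2))]; separating the poles
    [- m^2] and [- y^2] leaves a difference of reflected [logis]. *)
Lemma logis_product (m y v : R) : 0 < m -> 0 < y -> m ^ 2 - y ^ 2 <> 0 ->
  logis (v - ln m) * logis (ln y - v) = y ^ 2 / (m ^ 2 - y ^ 2) * (logis (ln m - v) - logis (ln y - v)).
Proof.
  intros Hm Hy Hne. rewrite logis_log, !logis_log_r by assumption.
  assert (He := exp_pos (2 * v)). set (E := exp (2 * v)) in *.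
  field. repeat split; nra.
Qed.

Lemma mellin_logis_product (nu : C) (m y : R) : 0 < Re nu < 2 -> 0 < m -> 0 < y -> m ^ 2 - y ^ 2 <> 0 ->
  IR (fun v => cexp (nu * RtoC v) * RtoC (logis (v - ln m) * logis (ln y - v)))%C =
  (RtoC (y ^ 2 / (m ^ 2 - y ^ 2)) * (RtoC PI / (2 * csin (RtoC PI * nu / 2))) * (cpow m nu - cpow y nu))%C.
Proof.
  intros Hnu Hm Hy Hne. set (d := Rmin (Re nu) (2 - Re nu)). assert (Hd : 0 < d) by (apply Rmin_pos; lra).
  assert (E0 := edec_logis nu d Hd (Rmin_l _ _) (Rmin_r _ _)).
  destruct (IR_flip (fun v => RtoC (logis v)) nu (ln m) 1 d E0) as [Em Im].
  destruct (IR_flip (fun v => RtoC (logis v)) nu (ln y) 1 d E0) as [Ey Iy].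
  rewrite (IR_ext _ (fun v => RtoC (y ^ 2 / (m ^ 2 - y ^ 2)) *
    (cexp (nu * RtoC v) * RtoC (logis (ln m - v)) - cexp (nu * RtoC v) * RtoC (logis (ln y - v))))%C).
  2:{ intros v. rewrite (logis_product m y v Hm Hy Hne), RtoC_mult, RtoC_minus. ring. }
  rewrite (IR_scal _ _ _ _ (edec_minus _ _ _ _ _ _ Em Ey)), (IR_minus _ _ _ _ _ _ Em Ey), Im, Iy, mellin_logis by exact Hnu.
  unfold cpow. ring.
Qed.

Section Strip.

Variables (q : nat) (chi : Z -> C) (x : R).
Hypothesis Hchi : dirichlet_character q chi.
Hypothesis Hprim : primitive_character q chi.
Hypothesis Heven : even_character chi.
Hypothesis Hq2 : (2 <= q)%nat.
Hypothesis Hx : 0 < x.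
Hypothesis HX : forall m : nat, (0 < m)%nat -> INR q * x <> INR m.

Let tau := gauss q chi 1.
Let X := INR q * x.
Let achi (n : nat) : C := chi (Z.of_nat n).

Lemma X_pos : 0 < X.
Proof. apply Rmult_lt_0_compat; [apply (INR_q_pos q chi Hchi)|exact Hx]. Qed.

Lemma X_sq_ne (n : nat) : INR (S n) ^ 2 - X ^ 2 <> 0.
Proof.
  assert (H := X_pos). assert (Hn := INR_S_pos n). intros E.
  apply (HX (S n)); [lia|]. fold X. nra.
Qed.

Lemma chi_mellin_flip (w : C) : 0 < Re w < 2 -> nonint w ->
  (exists K d, edec (fun v => cexp (w * RtoC v) * logis_sum achi (ln X - v))%C K d) /\
  IR (fun v => cexp (w * RtoC v) * logis_sum achi (ln X - v))%C =
    (cpow X w * (RtoC PI * Lfun chi w / (2 * csin (RtoC PI * w / 2))))%C.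
Proof.
  intros Hw Hn. destruct (edec_chi_mellin q chi Hchi Hprim Heven Hq2 w ltac:(lra)) as [K [d He]].
  destruct (IR_flip _ w (ln X) K d He) as [E1 E2]. split; [eauto|]. unfold achi at 1. rewrite E2.
  rewrite (Lfun_Lambda q chi Hchi Hprim Heven Hq2 w Hw Hn). unfold Lambda.
  assert (Hs := nonint_csin w Hn). assert (Hpi : RtoC PI <> RtoC 0) by (apply RtoC_nz, PI_neq0).
  unfold cpow. field. split; assumption.
Qed.

(** Solve [logis_sum_theta] for [theta] and [logis_sum_one] for the Bose factor. The three summands
    in the bracket lead to the double sum, to [L nu] and, through the extra [exp v], to
    [L (1 + nu)]. *)
Lemma bessel_kernel_split (v : R) : bessel_kernel chi x v =
  (/ (RtoC (PI * x) * tau) * ((/ RtoC PI * logis_sum one_coef v + / (2 * RtoC PI) - RtoC (exp v / 2)) * logis_sum achi (ln X - v)))%C.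
Proof.
  assert (Hpi := PI_RGT_0). assert (Hq := INR_q_pos q chi Hchi). assert (HXp := X_pos).
  assert (Ht : tau <> RtoC 0) by (apply (gauss_nz q chi Hchi Hprim Hq2)).
  assert (Hev := exp_pos v).
  assert (E : exp (ln X - v) / INR q = x * exp (- v)).
  { unfold Rminus. rewrite exp_plus, exp_ln by exact HXp. unfold X. field. lra. }
  unfold achi. rewrite (logis_sum_theta q chi Hchi Hprim Heven Hq2), E, logis_sum_one. fold tau. unfold bessel_kernel.
  set (b := / (exp (2 * PI * exp v) - 1)). rewrite exp_Ropp.
  set (th := theta chi _).
  replace (PI * (x * / exp v)) with (PI * x / exp v) by (field; lra).
  assert (N1 : RtoC (exp v) <> RtoC 0) by (apply RtoC_nz; lra).
  assert (N2 : RtoC PI <> RtoC 0) by (apply RtoC_nz; lra).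
  assert (N3 : RtoC x <> RtoC 0) by (apply RtoC_nz; lra).
  rewrite RtoC_minus, RtoC_plus, !RtoC_div, !RtoC_mult, RtoC_div by lra. field. repeat split; assumption.
Qed.

Definition pwr (e : R) (n : nat) : R := exp (- (1 + e) * ln (INR n)).

Let dker (nu : C) (k m : nat) (v : R) : C :=
  (cexp (nu * RtoC v) * (achi k * RtoC (logis (v - ln (INR m)) * logis (ln (X / INR k) - v))))%C.

(** The second [logis] gives [X^2 k^(- 2) exp (- 2 v)]. The first is bounded with exponent [1 + e]
    for [v >= 0], where [Re nu + (1 + e) - 2 <= - e], and with exponent [2] for [v < 0], where the
    total is [exp (Re nu v)]. *)
Lemma edec_dker (nu : C) (e : R) (k m : nat) : 0 < e -> 0 < Re nu -> Re nu + 2 * e <= 1 -> (1 <= k)%nat -> (1 <= m)%nat ->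
  edec (dker nu k m) (invsq (X ^ 2) k * pwr e m) (Rmin (Re nu) e).
Proof.
  intros He Hnu Hs Hk Hm. set (s := Re nu) in *. set (d := Rmin s e). assert (HXp := X_pos).
  assert (Hd : 0 < d) by (apply Rmin_pos; assumption).
  assert (Hd1 := Rmin_l s e). assert (Hd2 := Rmin_r s e). fold d in Hd1, Hd2.
  assert (Kp : 0 < INR k) by (apply lt_0_INR; lia). assert (M1 : 1 <= INR m) by (apply (le_INR 1); exact Hm).
  assert (Hlm : 0 <= ln (INR m)) by (rewrite <- ln_1; apply ln_le; lra).
  split; [exact Hd|split].
  - intros v. apply rcont_mult; [apply rcont_cexp_lin|]. apply rcont_mult; [apply rcont_const|].
    apply rcont_RtoC. apply (continuous_mult (K := R_AbsRing)).
    + apply (continuous_comp (fun v => v - ln (INR m)) logis); [apply cont_deriv; auto_derive; tauto|apply continuous_logis].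
    + apply (continuous_comp (fun v => ln (X / INR k) - v) logis); [apply cont_deriv; auto_derive; tauto|apply continuous_logis].
  - intros v. unfold dker. rewrite Cmod_mult, (Cmod_mult (achi k)), Cmod_cexp, re_scal_r, Cmod_R. fold s.
    assert (L1 := logis_pos (v - ln (INR m))). assert (L2 := logis_pos (ln (X / INR k) - v)).
    rewrite Rabs_pos_eq by nra.
    assert (Hc : Cmod (achi k) <= 1) by apply (chi_le_1 q chi Hchi). assert (Hc0 := Cmod_ge_0 (achi k)).
    assert (B2 := logis_theta 2 (ln (X / INR k) - v) ltac:(lra)).
    assert (E2 : exp (2 * (ln (X / INR k) - v)) = X ^ 2 * exp (- 2 * ln (INR k)) * exp (- 2 * v)).
    { rewrite ln_div by assumption. replace (2 * (ln X - ln (INR k) - v)) with (ln X + ln X + - 2 * ln (INR k) + - 2 * v) by ring.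
      rewrite !exp_plus, exp_ln by exact HXp. ring. }
    rewrite E2 in B2. unfold invsq, pwr.
    assert (Pk := exp_pos (- 2 * ln (INR k))). assert (PX : 0 < X ^ 2) by (apply pow_lt, HXp).
    set (W := X ^ 2 * exp (- 2 * ln (INR k))) in *. assert (HW : 0 < W) by (apply Rmult_lt_0_compat; assumption).
    assert (Hgen : forall th, 0 <= th <= 2 -> exp (s * v) * (Cmod (achi k) * (logis (v - ln (INR m)) * logis (ln (X / INR k) - v))) <=
       W * exp (s * v + th * (v - ln (INR m)) + - 2 * v)).
    { intros th Hth. assert (B1 := logis_theta th (v - ln (INR m)) Hth). rewrite !exp_plus.
      assert (P1 := exp_pos (s * v)). assert (P2 := exp_pos (th * (v - ln (INR m)))). assert (P3 := exp_pos (- 2 * v)).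
      replace (W * (exp (s * v) * exp (th * (v - ln (INR m))) * exp (- 2 * v)))
        with (exp (s * v) * (1 * (exp (th * (v - ln (INR m))) * (W * exp (- 2 * v))))) by ring.
      apply Rmult_le_compat_l; [lra|]. apply Rmult_le_compat; [exact Hc0|nra|exact Hc|].
      apply Rmult_le_compat; lra. }
    destruct (Rle_dec 0 v) as [Hv|Hv].
    + eapply Rle_trans; [apply (Hgen (1 + e)); lra|]. rewrite Rmult_assoc. apply Rmult_le_compat_l; [lra|].
      rewrite <- exp_plus. apply exp_le. rewrite Rabs_pos_eq by lra. nra.
    + eapply Rle_trans; [apply (Hgen 2); lra|]. rewrite Rmult_assoc. apply Rmult_le_compat_l; [lra|].
      rewrite <- exp_plus. apply exp_le. rewrite Rabs_left by lra. nra.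
Qed.

Lemma ex_series_pwr (e : R) : 0 < e -> ex_series (fun n => pwr e (S n)).
Proof. apply ex_series_power. Qed.

Lemma dker_CS (nu : C) (v : R) :
  CS (fun n => divsum (S n) (fun k => dker nu k (S n / k) v))
     (cexp (nu * RtoC v) * (logis_sum one_coef v * logis_sum achi (ln X - v)))%C.
Proof.
  assert (HXp := X_pos).
  assert (S1 := logis_sum_CS achi (ln X - v) (achi_le q chi Hchi)).
  assert (S2 := logis_sum_CS one_coef v one_coef_le).
  assert (T := dirichlet_convolution (fun k => achi k * RtoC (logis (ln X - v - ln (INR k))))%C
    (fun m => one_coef m * RtoC (logis (v - ln (INR m))))%C
    (fun k => exp (2 * (ln X - v)) * exp (- 2 * ln (INR k))) (fun m => exp (2 * v) * exp (- 2 * ln (INR m)))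
    _ _ S1 S2).
  rewrite (Cmult_comm (logis_sum one_coef v)).
  eapply CS_ext; [|apply CS_scal, T].
  - intros n. cbv beta. rewrite <- divsum_scal. apply divsum_ext. intros d Hd _. unfold dker, one_coef.
    rewrite ln_div by (try assumption; apply lt_0_INR; lia).
    replace (ln X - ln (INR d) - v) with (ln X - v - ln (INR d)) by ring. rewrite RtoC_mult. ring.
  - intros n. apply (logis_term_le achi 2); [apply (achi_le q chi Hchi)|lra].
  - intros n. apply (logis_term_le one_coef 2); [apply one_coef_le|lra].
  - apply (ex_series_scal (V := R_NormedModule)), (ex_series_ext (fun n => invsq 1 (S n))); [intros; apply Rmult_1_l|apply ex_series_invsq].
  - apply (ex_series_scal (V := R_NormedModule)), (ex_series_ext (fun n => invsq 1 (S n))); [intros; apply Rmult_1_l|apply ex_series_invsq].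
Qed.

(** [N] is general from the start because continuation proceeds by raising it; the identity in the
    strip uses [N = 0]. *)
Definition tail_term (N : nat) (nu : C) (n : nat) : C :=
  (sigma_chi (- nu) chi n * ((cpow (INR n) (nu - 2 * INR N) - cpow X (nu - 2 * INR N)) / RtoC (INR n ^ 2 - X ^ 2)))%C.

(** Writing [n] for [S n], with [m = n / k] and [y = X / k] one has [m^2 - y^2 = (n^2 - X^2) / k^2]:
    the squares of [k] cancel, and [(n / k)^nu - (X / k)^nu] leaves the divisor weight
    [k^(- nu)]. *)
Lemma dker_IR (nu : C) (k n : nat) : 0 < Re nu < 2 -> (1 <= k)%nat -> (S n mod k = 0)%nat ->
  IR (dker nu k (S n / k)) = (RtoC (X ^ 2) * (RtoC PI / (2 * csin (RtoC PI * nu / 2))) *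
    ((cpow (INR (S n)) nu - cpow X nu) / RtoC (INR (S n) ^ 2 - X ^ 2)) * (cpow (INR k) (- nu) * achi k))%C.
Proof.
  intros Hnu Hk Hm. destruct (div_exact_facts n k Hk Hm) as [Hm1 En]. set (m := (S n / k)%nat) in *.
  assert (HXp := X_pos). assert (Hne := X_sq_ne n).
  assert (Kp : 0 < INR k) by (apply lt_0_INR; lia). assert (Mp : 0 < INR m) by (apply lt_0_INR; lia).
  assert (Yp : 0 < X / INR k) by (apply Rdiv_lt_0_compat; assumption).
  assert (Emy : INR m ^ 2 - (X / INR k) ^ 2 = (INR (S n) ^ 2 - X ^ 2) / INR k ^ 2) by (rewrite En; field; lra).
  assert (Hmy : INR m ^ 2 - (X / INR k) ^ 2 <> 0).
  { rewrite Emy. apply Rmult_integral_contrapositive_currified; [exact Hne|]. apply Rinv_neq_0_compat, pow_nonzero. lra. }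
  assert (P := mellin_logis_product nu (INR m) (X / INR k) Hnu Mp Yp Hmy).
  set (d := Rmin (Re nu) (2 - Re nu)). assert (Hd : 0 < d) by (apply Rmin_pos; lra).
  unfold dker. rewrite (IR_ext _ (fun v => achi k * (cexp (nu * RtoC v) * RtoC (logis (v - ln (INR m)) * logis (ln (X / INR k) - v))))%C) by (intros; ring).
  assert (E0 := edec_logis nu d Hd (Rmin_l _ _) (Rmin_r _ _)).
  assert (Em := proj1 (IR_flip (fun v => RtoC (logis v)) nu (ln (INR m)) 1 d E0)).
  assert (Ey := proj1 (IR_flip (fun v => RtoC (logis v)) nu (ln (X / INR k)) 1 d E0)).
  assert (Ep := edec_scal (RtoC ((X / INR k) ^ 2 / (INR m ^ 2 - (X / INR k) ^ 2))) _ _ _ (edec_minus _ _ _ _ _ _ Em Ey)).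
  assert (Ep' : exists K', edec (fun v => cexp (nu * RtoC v) * RtoC (logis (v - ln (INR m)) * logis (ln (X / INR k) - v)))%C K' (Rmin d d)).
  { eexists. eapply edec_ext; [|exact Ep]. intros v. cbv beta.
    rewrite (logis_product (INR m) (X / INR k) v Mp Yp Hmy), RtoC_mult, RtoC_minus. ring. }
  destruct Ep' as [K' Ep'].
  rewrite (IR_scal _ _ _ _ Ep'), P, Emy.
  assert (C1 : cpow (INR m) nu = (cpow (INR (S n)) nu * cpow (INR k) (- nu))%C).
  { unfold cpow. rewrite <- cexp_add, En, ln_mult, RtoC_plus by assumption. f_equal. ring. }
  assert (C2 : cpow (X / INR k) nu = (cpow X nu * cpow (INR k) (- nu))%C).
  { unfold cpow. rewrite <- cexp_add, ln_div, RtoC_minus by assumption. f_equal. ring. }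
  rewrite C1, C2.
  replace ((X / INR k) ^ 2 / ((INR (S n) ^ 2 - X ^ 2) / INR k ^ 2)) with (X ^ 2 / (INR (S n) ^ 2 - X ^ 2)) by (field; repeat split; (exact Hne || lra)).
  rewrite RtoC_div by exact Hne. unfold Cdiv. ring.
Qed.

(** The prefactor [4 * PI] is what is left of [8 * PI * cpow x (nu / 2)] after the denominator in
    [bessel_series]. [S2] is the integral of the double sum divided by the constant [c] common to
    all values in [dker_IR]. *)
Lemma strip_identity (nu : C) : 0 < Re nu < 1 -> exists S2,
  CS (fun n => tail_term 0 nu (S n)) S2 /\
  (4 * RtoC PI * IR (fun v => cexp (nu * RtoC v) * bessel_kernel chi x v))%C =
  (RtoC (INR q) / tau * (Lfun chi nu / csin (RtoC PI * nu / 2) * cpow X (nu - 1)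
     - RtoC PI * Lfun chi (1 + nu) / ccos (RtoC PI * nu / 2) * cpow X nu
     + 2 / csin (RtoC PI * nu / 2) * RtoC X * S2))%C.
Proof.
  intros Hnu. assert (HXp := X_pos). assert (Hpi := PI_RGT_0). assert (Hq := INR_q_pos q chi Hchi).
  assert (Hni : nonint nu).
  { intros j E. rewrite E in Hnu. cbn [Re RtoC fst] in Hnu.
    assert (0 < j)%Z by (apply lt_IZR; lra). assert (j < 1)%Z by (apply lt_IZR; lra). lia. }
  assert (Hni1 : nonint (1 + nu)).
  { intros j E. apply (Hni (j - 1)%Z). rewrite minus_IZR, RtoC_minus, <- E. ring. }
  assert (Hre1 : Re (1 + nu) = 1 + Re nu) by reflexivity.
  assert (Hs := nonint_csin nu Hni). assert (Hc := nonint_ccos nu Hni).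
  assert (Ht : tau <> RtoC 0) by (apply (gauss_nz q chi Hchi Hprim Hq2)).
  destruct (chi_mellin_flip nu ltac:(lra) Hni) as [[KA [dA EA]] IA].
  destruct (chi_mellin_flip (1 + nu) ltac:(lra) Hni1) as [[KB [dB EB]] IB]. rewrite csin_shift in IB.
  (* The largest [e] allowed by [Re nu + 2 * e <= 1] in [edec_dker]. *)
  set (e := (1 - Re nu) / 2). assert (He : 0 < e) by (unfold e; lra).
  assert (Hd : 0 < Rmin (Re nu) e) by (apply Rmin_pos; lra).
  set (f := fun n v => divsum (S n) (fun k => dker nu k (S n / k) v)).
  assert (Hf : forall n, edec (f n) (rconv (invsq (X ^ 2)) (pwr e) (S n)) (Rmin (Re nu) e) /\
     IR (f n) = divsum (S n) (fun k => IR (dker nu k (S n / k)))).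
  { intros n. apply (divsum_IR (fun k => dker nu k (S n / k)) (fun k => invsq (X ^ 2) k * pwr e (S n / k)%nat)); [exact Hd|].
    intros k Hk Hm. apply edec_dker; try lra; [unfold e; lra|exact Hk|]. apply (div_exact_facts n k Hk Hm). }
  destruct (IR_series f (fun n => rconv (invsq (X ^ 2)) (pwr e) (S n)) (Rmin (Re nu) e)
    (fun v => cexp (nu * RtoC v) * (logis_sum one_coef v * logis_sum achi (ln X - v)))%C Hd) as [EC IC].
  - intros n. apply Hf.
  - apply ex_series_rconv; [| |apply ex_series_invsq|apply ex_series_pwr, He].
    + intros. apply Rmult_le_pos; [apply pow2_ge_0|left; apply exp_pos].
    + intros. left. apply exp_pos.
  - intros v. apply dker_CS.
  - set (J := IR (fun v => cexp (nu * RtoC v) * (logis_sum one_coef v * logis_sum achi (ln X - v)))%C) in *.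
    set (c := (RtoC (X ^ 2) * (RtoC PI / (2 * csin (RtoC PI * nu / 2))))%C).
    assert (HPI : RtoC PI <> RtoC 0) by (apply RtoC_nz; lra).
    assert (HXn : RtoC X <> RtoC 0) by (apply RtoC_nz; lra).
    assert (HX2 : RtoC (X ^ 2) <> RtoC 0) by (apply RtoC_nz; nra).
    assert (Hx0 : RtoC x <> RtoC 0) by (apply RtoC_nz; lra).
    assert (Hq0 : RtoC (INR q) <> RtoC 0) by (apply RtoC_nz; lra).
    assert (H2 : RtoC 2 <> RtoC 0) by (apply RtoC_nz; lra).
    assert (Hcn : c <> RtoC 0).
    { unfold c. intros E. apply Cmult_integral in E. destruct E as [E|E]; [contradiction|].
      apply HPI. replace (RtoC PI) with (RtoC PI / (2 * csin (RtoC PI * nu / 2)) * (2 * csin (RtoC PI * nu / 2)))%C by (field; assumption).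
      rewrite E. ring. }
    exists (/ c * J)%C. split.
    + apply (CS_ext (fun n => / c * IR (f n))%C); [|apply CS_scal; exact IC]. intros n. rewrite (proj2 (Hf n)).
      rewrite (divsum_ext _ (fun k => c * ((cpow (INR (S n)) nu - cpow X nu) / RtoC (INR (S n) ^ 2 - X ^ 2)) * (cpow (INR k) (- nu) * achi k))%C).
      2:{ intros k Hk Hm. apply dker_IR; [lra|exact Hk|exact Hm]. }
      rewrite divsum_scal. unfold tail_term, sigma_chi, achi.
      replace (nu - 2 * INR 0)%C with nu by (simpl INR; ring). field. split; [apply RtoC_nz, X_sq_ne|exact Hcn].
    + rewrite (IR_ext _ (fun v => / (RtoC (PI * x) * tau) *
        (/ RtoC PI * (cexp (nu * RtoC v) * (logis_sum one_coef v * logis_sum achi (ln X - v)))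
         + / (2 * RtoC PI) * (cexp (nu * RtoC v) * logis_sum achi (ln X - v))
         - RtoC (/ 2) * (cexp ((1 + nu) * RtoC v) * logis_sum achi (ln X - v))))%C).
      2:{ intros v. rewrite bessel_kernel_split.
          replace ((1 + nu) * RtoC v)%C with (RtoC v + nu * RtoC v)%C by ring. rewrite cexp_add, cexp_RtoC.
          unfold Rdiv. rewrite (RtoC_mult (exp v)). ring. }
      assert (E1 := edec_scal (/ RtoC PI) _ _ _ EC). assert (E2 := edec_scal (/ (2 * RtoC PI)) _ _ _ EA).
      assert (E3 := edec_scal (RtoC (/ 2)) _ _ _ EB).
      rewrite (IR_scal _ _ _ _ (edec_minus _ _ _ _ _ _ (edec_plus _ _ _ _ _ _ E1 E2) E3)).
      rewrite (IR_minus _ _ _ _ _ _ (edec_plus _ _ _ _ _ _ E1 E2) E3), (IR_plus _ _ _ _ _ _ E1 E2).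
      rewrite (IR_scal _ _ _ _ EC), (IR_scal _ _ _ _ EA), (IR_scal _ _ _ _ EB). fold J. rewrite IA, IB.
      assert (C1 : cpow X (nu - 1) = (cpow X nu / RtoC X)%C).
      { unfold Cminus. rewrite cpow_add, cpow_opp. assert (T := cpow_nat X 1 HXp). simpl INR in T. rewrite T, pow_1. reflexivity. }
      assert (C2 : cpow X (1 + nu) = (RtoC X * cpow X nu)%C).
      { rewrite cpow_add. assert (T := cpow_nat X 1 HXp). simpl INR in T. rewrite T, pow_1. reflexivity. }
      rewrite C1, C2. unfold c.
      replace (RtoC (X ^ 2)) with (RtoC X * RtoC X)%C by (rewrite <- RtoC_mult; f_equal; ring).
      assert (EX : RtoC X = (RtoC (INR q) * RtoC x)%C) by (unfold X; apply RtoC_mult).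
      rewrite RtoC_mult, (RtoC_inv 2), EX by lra. field. repeat split; assumption.
Qed.

End Strip.

(** * Continuation in [nu] *)

Lemma divsum_minus (f g : nat -> C) (n : nat) : divsum n (fun d => f d - g d)%C = (divsum n f - divsum n g)%C.
Proof.
  unfold divsum. induction (filter _ _) as [|d l IH]; simpl; [ring|]. rewrite IH. ring.
Qed.

Lemma holo_psum (f : nat -> C -> C) (n : nat) (z : C) :
  (forall k, holo (f k) z) -> holo (fun w => psum (fun k => f k w) n) z.
Proof.
  intros H. induction n as [|n IH]; cbn [psum]; [apply holo_const|apply holo_plus; auto].
Qed.

(** For [n >= 2 X] the factor [3 / 4] works; below that, finitely many nonzero values leave a
    positive minimum of the quotient. *)
Lemma sq_gap (X : R) : 0 < X -> (forall n, INR (S n) ^ 2 - X ^ 2 <> 0) ->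
  exists kap, 0 < kap /\ forall n, kap * INR (S n) ^ 2 <= Rabs (INR (S n) ^ 2 - X ^ 2).
Proof.
  intros HX Hne.
  assert (Hfin : forall N, exists kap, 0 < kap /\ forall n, (n < N)%nat -> kap * INR (S n) ^ 2 <= Rabs (INR (S n) ^ 2 - X ^ 2)).
  { induction N as [|N [kap [Hk IH]]]; [exists 1; split; [lra|intros; lia]|].
    assert (Hn := INR_S_pos N). assert (H2 : 0 < INR (S N) ^ 2) by (apply pow_lt, Hn).
    assert (Ha := Rabs_pos_lt _ (Hne N)).
    exists (Rmin kap (Rabs (INR (S N) ^ 2 - X ^ 2) / INR (S N) ^ 2)). split.
    - apply Rmin_pos; [exact Hk|]. apply Rdiv_lt_0_compat; assumption.
    - intros n Hlt. destruct (Nat.eq_dec n N) as [->|Hd].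
      + apply Rle_trans with (Rabs (INR (S N) ^ 2 - X ^ 2) / INR (S N) ^ 2 * INR (S N) ^ 2).
        * apply Rmult_le_compat_r; [lra|apply Rmin_r].
        * right. field. lra.
      + eapply Rle_trans; [|apply IH; lia]. apply Rmult_le_compat_r; [apply pow2_ge_0|apply Rmin_l]. }
  destruct (INR_unbounded (2 * X)) as [N0 HN0]. destruct (Hfin N0) as [kap [Hk H]].
  exists (Rmin kap (3 / 4)). split; [apply Rmin_pos; lra|]. intros n.
  assert (P := pow2_ge_0 (INR (S n))).
  destruct (Nat.lt_ge_cases n N0) as [Hn|Hn].
  - eapply Rle_trans; [|apply (H n Hn)]. apply Rmult_le_compat_r; [exact P|apply Rmin_l].
  - assert (T := HN0 (S n) ltac:(lia)). eapply Rle_trans; [apply Rmult_le_compat_r; [exact P|apply Rmin_r]|].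
    rewrite Rabs_pos_eq; nra.
Qed.

Lemma pow_exp_ln (y : R) (n : nat) : 0 < y -> y ^ n = exp (INR n * ln y).
Proof. intros Hy. rewrite <- Rpower_pow by exact Hy. reflexivity. Qed.

Section Continuation.

Variables (q : nat) (chi : Z -> C) (x : R).
Hypothesis Hchi : dirichlet_character q chi.
Hypothesis Hprim : primitive_character q chi.
Hypothesis Heven : even_character chi.
Hypothesis Hq2 : (2 <= q)%nat.
Hypothesis Hx : 0 < x.
Hypothesis HX : forall m : nat, (0 < m)%nat -> INR q * x <> INR m.

Let tau := gauss q chi 1.
Let X := INR q * x.
Let achi (n : nat) : C := chi (Z.of_nat n).

Let HXp : 0 < X := X_pos q chi x Hchi Hx.
Let HXne (n : nat) : INR (S n) ^ 2 - X ^ 2 <> 0 := X_sq_ne q chi x Hchi Hq2 Hx HX n.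

(** Coefficients free of [nu]: [tail_term_split] writes each term through exponentials in [nu], to
    which [cexp_second_order] applies. *)
Let c1 (N n k : nat) : C := (achi k * RtoC (/ (INR n ^ (2 * N)) / (INR n ^ 2 - X ^ 2)))%C.
Let c2 (N n k : nat) : C := (achi k * RtoC (/ (X ^ (2 * N)) / (INR n ^ 2 - X ^ 2)))%C.

Lemma tail_term_split (N : nat) (nu : C) (n : nat) : tail_term q chi x N nu (S n) =
  divsum (S n) (fun k => c1 N (S n) k * cexp (RtoC (ln (INR (S n / k)%nat)) * nu)
                        - c2 N (S n) k * cexp (RtoC (ln X - ln (INR k)) * nu))%C.
Proof.
  unfold tail_term, sigma_chi. fold X. rewrite <- divsum_scal_r. apply divsum_ext. intros k Hk Hm.
  destruct (div_exact_facts n k Hk Hm) as [Hm1 En].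
  assert (Kp : 0 < INR k) by (apply lt_0_INR; lia). assert (Mp : 0 < INR (S n / k)) by (apply lt_0_INR; lia).
  assert (Np := INR_S_pos n). assert (Hne := HXne n).
  assert (P1 : forall y, 0 < y -> cpow y (nu - 2 * INR N) = (cpow y nu * RtoC (/ y ^ (2 * N)))%C).
  { intros y Hy. unfold Cminus. rewrite cpow_add, cpow_opp.
    replace (2 * RtoC (INR N))%C with (RtoC (INR (2 * N))) by (rewrite mult_INR, RtoC_mult; reflexivity).
    rewrite cpow_nat, RtoC_inv by (try exact Hy; apply pow_nonzero; lra). reflexivity. }
  rewrite !P1 by assumption. unfold c1, c2.
  assert (E1 : cexp (RtoC (ln (INR (S n / k)%nat)) * nu) = (cpow (INR k) (- nu) * cpow (INR (S n)) nu)%C).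
  { unfold cpow. rewrite <- cexp_add, En, ln_mult, RtoC_plus by assumption. f_equal. ring. }
  assert (E2 : cexp (RtoC (ln X - ln (INR k)) * nu) = (cpow (INR k) (- nu) * cpow X nu)%C).
  { unfold cpow. rewrite <- cexp_add, RtoC_minus. f_equal. ring. }
  rewrite E1, E2. unfold Rdiv. rewrite !RtoC_mult, (RtoC_inv (INR (S n) ^ 2 - X ^ 2)) by exact Hne.
  unfold achi, Cdiv. ring.
Qed.

(** Origin of the strip. With [n = k m], the first term is of order [n^(- 2 N - 2) m^(s + 2 del)],
    summable over [m] when [s + 2 del < 2 N + 1]; the second is of order [n^(- 2) k^(- s + 2 del)],
    summable over [k] when [s - 2 del > - 1]. [e] is the margin in both, and [G] collects the powers
    of [X]. *)
Lemma coef_bound (N : nat) (s del e : R) : 0 < del -> 0 < e <= 1 -> e <= 2 * INR N + 1 - s - 2 * del -> e <= 1 + s - 2 * del ->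
  exists B, 0 < B /\ forall n k, (1 <= k)%nat -> (S n mod k = 0)%nat ->
    Cmod (c1 N (S n) k) * exp (ln (INR (S n / k)%nat) * s + 2 * del * Rabs (ln (INR (S n / k)%nat))) <= B * (pwr e k * pwr e (S n / k)%nat) /\
    Cmod (c2 N (S n) k) * exp ((ln X - ln (INR k)) * s + 2 * del * Rabs (ln X - ln (INR k))) <= B * (pwr e k * pwr e (S n / k)%nat).
Proof.
  intros Hdel He He1 He2. destruct (sq_gap X HXp HXne) as [kap [Hkap Hgap]].
  set (G := exp ((Rabs s + 2 * del) * Rabs (ln X))). assert (HG : 0 < G) by apply exp_pos.
  assert (PX : 0 < / X ^ (2 * N)) by (apply Rinv_0_lt_compat, pow_lt, HXp).
  assert (Hik : 0 < / kap) by (apply Rinv_0_lt_compat, Hkap).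
  exists (/ kap + / X ^ (2 * N) * / kap * G). split.
  { assert (0 < / X ^ (2 * N) * / kap * G) by (repeat apply Rmult_lt_0_compat; assumption). lra. }
  intros n k Hk Hm. destruct (div_exact_facts n k Hk Hm) as [Hm1 En]. set (m := (S n / k)%nat) in *.
  assert (K1 : 1 <= INR k) by (apply (le_INR 1); exact Hk). assert (M1 : 1 <= INR m) by (apply (le_INR 1); exact Hm1).
  assert (Lk : 0 <= ln (INR k)) by (rewrite <- ln_1; apply ln_le; lra).
  assert (Lm : 0 <= ln (INR m)) by (rewrite <- ln_1; apply ln_le; lra).
  assert (Np := INR_S_pos n). assert (Ln : ln (INR (S n)) = ln (INR k) + ln (INR m)) by (rewrite En; apply ln_mult; lra).
  assert (N2 : 0 < INR (S n) ^ 2) by (apply pow_lt, Np).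
  assert (Hinv : / Rabs (INR (S n) ^ 2 - X ^ 2) <= / kap * exp (- 2 * ln (INR (S n)))).
  { replace (- 2 * ln (INR (S n))) with (- (INR 2 * ln (INR (S n)))) by (simpl; ring).
    rewrite exp_Ropp, <- pow_exp_ln, <- Rinv_mult by exact Np.
    apply Rinv_le_contravar; [apply Rmult_lt_0_compat; assumption|apply Hgap]. }
  assert (Hc : Cmod (achi k) <= 1) by apply (chi_le_1 q chi Hchi). assert (Hc0 := Cmod_ge_0 (achi k)).
  assert (Hcoef : forall r, 0 < r -> Cmod (achi k * RtoC (r / (INR (S n) ^ 2 - X ^ 2))) <= r * (/ kap * exp (- 2 * ln (INR (S n))))).
  { intros r Hr. rewrite Cmod_mult, Cmod_R. unfold Rdiv. rewrite Rabs_mult, Rabs_inv, (Rabs_pos_eq r) by lra.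
    rewrite <- (Rmult_1_l (r * (/ kap * _))). apply Rmult_le_compat; [exact Hc0| |exact Hc|].
    - apply Rmult_le_pos; [lra|]. left. apply Rinv_0_lt_compat, Rabs_pos_lt, HXne.
    - apply Rmult_le_compat_l; [lra|exact Hinv]. }
  assert (Hpw : pwr e k * pwr e m = exp (- (1 + e) * ln (INR k) + - (1 + e) * ln (INR m))) by (unfold pwr; rewrite exp_plus; reflexivity).
  rewrite Hpw. set (Q := exp (- (1 + e) * ln (INR k) + - (1 + e) * ln (INR m))). assert (HQ : 0 < Q) by apply exp_pos.
  assert (HN0 := pos_INR N). split.
  - apply Rle_trans with (/ kap * Q).
    2:{ apply Rmult_le_compat_r; [lra|]. assert (0 < / X ^ (2 * N) * / kap * G) by (repeat apply Rmult_lt_0_compat; assumption). lra. }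
    eapply Rle_trans; [apply Rmult_le_compat_r; [left; apply exp_pos|]; apply Hcoef, Rinv_0_lt_compat, pow_lt, Np|].
    rewrite pow_exp_ln, <- exp_Ropp, mult_INR by exact Np.
    replace (exp (- (INR 2 * INR N * ln (INR (S n)))) * (/ kap * exp (- 2 * ln (INR (S n)))) * exp (ln (INR m) * s + 2 * del * Rabs (ln (INR m))))
      with (/ kap * exp (- (INR 2 * INR N * ln (INR (S n))) + - 2 * ln (INR (S n)) + (ln (INR m) * s + 2 * del * Rabs (ln (INR m)))))
      by (rewrite !exp_plus; ring).
    apply Rmult_le_compat_l; [lra|]. apply exp_le. rewrite Ln, Rabs_pos_eq by exact Lm. simpl (INR 2). nra.
  - apply Rle_trans with (/ X ^ (2 * N) * / kap * G * Q).
    2:{ apply Rmult_le_compat_r; [lra|]. lra. }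
    eapply Rle_trans; [apply Rmult_le_compat_r; [left; apply exp_pos|]; apply Hcoef, PX|].
    replace (/ X ^ (2 * N) * (/ kap * exp (- 2 * ln (INR (S n)))) * exp ((ln X - ln (INR k)) * s + 2 * del * Rabs (ln X - ln (INR k))))
      with (/ X ^ (2 * N) * / kap * exp (- 2 * ln (INR (S n)) + ((ln X - ln (INR k)) * s + 2 * del * Rabs (ln X - ln (INR k)))))
      by (rewrite exp_plus; ring).
    rewrite (Rmult_assoc _ G Q). apply Rmult_le_compat_l; [left; apply Rmult_lt_0_compat; assumption|].
    unfold G, Q. rewrite <- exp_plus. apply exp_le. rewrite Ln.
    assert (T1 : Rabs (ln X - ln (INR k)) <= Rabs (ln X) + ln (INR k)).
    { unfold Rminus. eapply Rle_trans; [apply Rabs_triang|]. rewrite Rabs_Ropp, (Rabs_pos_eq (ln (INR k))) by exact Lk. lra. }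
    assert (T2 : ln X * s <= Rabs s * Rabs (ln X)) by (rewrite <- Rabs_mult, (Rmult_comm s); apply Rle_abs).
    assert (T3 : 2 * del * Rabs (ln X - ln (INR k)) <= 2 * del * (Rabs (ln X) + ln (INR k))) by (apply Rmult_le_compat_l; lra).
    nra.
Qed.

Lemma tail_series (N : nat) (nu : C) : -1 < Re nu < 2 * INR N + 1 ->
  CS (fun n => tail_term q chi x N nu (S n)) (CSum (fun n => tail_term q chi x N nu (S n))).
Proof.
  intros Hnu. set (s := Re nu) in *. set (g := Rmin (2 * INR N + 1 - s) (1 + s)).
  assert (Hg : 0 < g) by (apply Rmin_pos; lra).
  assert (Hg1 := Rmin_l (2 * INR N + 1 - s) (1 + s)). assert (Hg2 := Rmin_r (2 * INR N + 1 - s) (1 + s)). fold g in Hg1, Hg2.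
  (* [g] is the distance to the nearer edge of the strip: half of it goes into [2 * del], the other
     half bounds [e]. *)
  set (del := g / 4). set (e := Rmin 1 (g / 2)). assert (He : 0 < e) by (apply Rmin_pos; lra).
  assert (He1 := Rmin_l 1 (g / 2)). assert (He2 := Rmin_r 1 (g / 2)). fold e in He1, He2.
  destruct (coef_bound N s del e) as [B [HB H]]; try (unfold del; lra).
  apply (CSum_dom _ (fun n => 2 * B * rconv (pwr e) (pwr e) (S n))).
  - intros n. rewrite tail_term_split.
    replace (2 * B * rconv (pwr e) (pwr e) (S n)) with (Re (divsum (S n) (fun k => RtoC (2 * B * (pwr e k * pwr e (S n / k)%nat))))).
    2:{ unfold rconv. rewrite <- re_scal_l, <- divsum_scal. f_equal. apply divsum_ext. intros. rewrite <- RtoC_mult. reflexivity. }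
    apply (divsum_le _ (fun k => 2 * B * (pwr e k * pwr e (S n / k)%nat))). intros k Hk Hm. destruct (H n k Hk Hm) as [H1 H2].
    assert (G : forall c lam, Cmod (c * cexp (RtoC lam * nu)) <= Cmod c * exp (lam * s + 2 * del * Rabs lam)).
    { intros c lam. rewrite Cmod_mult, Cmod_cexp, re_scal_l. apply Rmult_le_compat_l; [apply Cmod_ge_0|].
      apply exp_le. fold s. assert (T := Rabs_pos lam). assert (0 <= 2 * del * Rabs lam) by (apply Rmult_le_pos; unfold del; lra). lra. }
    eapply Rle_trans; [apply Cmod_triangle_minus|].
    assert (G1 := G (c1 N (S n) k) (ln (INR (S n / k)%nat))). assert (G2 := G (c2 N (S n) k) (ln X - ln (INR k))). lra.
  - apply (ex_series_scal (V := R_NormedModule) (2 * B)). apply ex_series_rconv; try (intros; left; apply exp_pos); apply ex_series_pwr, He.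
Qed.

(** The majorant of [tail_series] serves for the quadratic remainders too; the [2 * del] in
    [coef_bound] is the allowance that [cexp_second_order] requires. *)
Lemma holo_tail (N : nat) (nu : C) : -1 < Re nu < 2 * INR N + 1 ->
  holo (fun w => CSum (fun n => tail_term q chi x N w (S n))) nu.
Proof.
  intros Hnu. set (s := Re nu) in *. set (g := Rmin (2 * INR N + 1 - s) (1 + s)).
  assert (Hg : 0 < g) by (apply Rmin_pos; lra).
  assert (Hg1 := Rmin_l (2 * INR N + 1 - s) (1 + s)). assert (Hg2 := Rmin_r (2 * INR N + 1 - s) (1 + s)). fold g in Hg1, Hg2.
  set (del := g / 4). set (e := Rmin 1 (g / 2)). assert (He : 0 < e) by (apply Rmin_pos; lra).
  assert (He1 := Rmin_l 1 (g / 2)). assert (He2 := Rmin_r 1 (g / 2)). fold e in He1, He2.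
  assert (Hdel : 0 < del) by (unfold del; lra).
  destruct (coef_bound N s del e) as [B [HB H]]; try (unfold del; lra).
  set (K := / del + 4 / del ^ 2).
  assert (HK : 0 < K).
  { unfold K. assert (0 < / del) by (apply Rinv_0_lt_compat, Hdel).
    assert (0 < 4 / del ^ 2) by (apply Rdiv_lt_0_compat; [lra|apply pow_lt, Hdel]). lra. }
  assert (EM : forall n, 2 * (K * B) * rconv (pwr e) (pwr e) (S n) = Re (divsum (S n) (fun k => RtoC (2 * (K * B) * (pwr e k * pwr e (S n / k)%nat))))).
  { intros n. unfold rconv. rewrite <- re_scal_l, <- divsum_scal. f_equal. apply divsum_ext. intros. rewrite <- RtoC_mult. reflexivity. }
  apply (series_holo (fun n w => tail_term q chi x N w (S n)) _
    (fun n => divsum (S n) (fun k =>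
       c1 N (S n) k * (RtoC (ln (INR (S n / k)%nat)) * cexp (RtoC (ln (INR (S n / k)%nat)) * nu))
       - c2 N (S n) k * (RtoC (ln X - ln (INR k)) * cexp (RtoC (ln X - ln (INR k)) * nu)))%C)
    (fun n => 2 * (K * B) * rconv (pwr e) (pwr e) (S n)) nu del Hdel).
  - apply (ex_series_scal (V := R_NormedModule) (2 * (K * B))). apply ex_series_rconv; try (intros; left; apply exp_pos); apply ex_series_pwr, He.
  - intros n. rewrite EM. apply (divsum_le _ (fun k => 2 * (K * B) * (pwr e k * pwr e (S n / k)%nat))). intros k Hk Hm. destruct (H n k Hk Hm) as [H1 H2].
    assert (D0 : Cmod 0 < del) by (rewrite Cmod_0; exact Hdel).
    assert (G1 := proj1 (cexp_second_order (ln (INR (S n / k)%nat)) del (c1 N (S n) k) nu 0 Hdel D0)).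
    assert (G2 := proj1 (cexp_second_order (ln X - ln (INR k)) del (c2 N (S n) k) nu 0 Hdel D0)).
    fold K s in G1, G2. eapply Rle_trans; [apply Cmod_triangle_minus|].
    apply (Rmult_le_compat_l K) in H1; [|lra]. apply (Rmult_le_compat_l K) in H2; [|lra]. lra.
  - intros n h Hh. rewrite !tail_term_split, <- divsum_minus, <- divsum_scal_r, <- divsum_minus.
    replace (2 * (K * B) * rconv (pwr e) (pwr e) (S n) * Cmod h ^ 2) with
      (Re (divsum (S n) (fun k => RtoC (2 * (K * B) * (pwr e k * pwr e (S n / k)%nat) * Cmod h ^ 2)))).
    2:{ rewrite EM, <- re_scal_r, <- divsum_scal_r. f_equal. apply divsum_ext. intros. rewrite <- RtoC_mult. reflexivity. }
    apply (divsum_le _ (fun k => 2 * (K * B) * (pwr e k * pwr e (S n / k)%nat) * Cmod h ^ 2)). intros k Hk Hm. destruct (H n k Hk Hm) as [H1 H2].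
    assert (G1 := proj2 (cexp_second_order (ln (INR (S n / k)%nat)) del (c1 N (S n) k) nu h Hdel Hh)).
    assert (G2 := proj2 (cexp_second_order (ln X - ln (INR k)) del (c2 N (S n) k) nu h Hdel Hh)).
    fold K s in G1, G2.
    match type of G1 with Cmod ?a <= _ => match type of G2 with Cmod ?b <= _ =>
      match goal with |- Cmod ?r <= _ => replace r with (a - b)%C by ring end end end.
    eapply Rle_trans; [apply Cmod_triangle_minus|].
    apply (Rmult_le_compat_l K) in H1; [|lra]. apply (Rmult_le_compat_l K) in H2; [|lra].
    assert (P := pow2_ge_0 (Cmod h)).
    apply (Rmult_le_compat_r (Cmod h ^ 2)) in H1; [|exact P]. apply (Rmult_le_compat_r (Cmod h ^ 2)) in H2; [|exact P].
    lra.
  - intros h Hh. apply tail_series. rewrite Re_plus. fold s. assert (T := re_le_Cmod h). apply Rabs_le_between in T.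
    unfold del in Hh. lra.
Qed.

(** For [s = 2 (N + 1)] both [s] and [s - nu] lie to the right of [1], and [k^(- s) m^(nu - s) =
    k^(- nu) (k m)^(nu - s)]. *)
Lemma zeta_L_product (nu : C) (N : nat) : Re nu < 1 ->
  CS (fun n => sigma_chi (- nu) chi (S n) * cpow (INR (S n)) (nu - 2 * INR (S N)))%C
     (zeta (2 * INR (S N) - nu) * Lfun chi (2 * INR (S N)))%C.
Proof.
  intros Hnu. assert (HN := pos_INR N).
  set (s1 := (2 * RtoC (INR (S N)))%C). set (s2 := (s1 - nu)%C).
  assert (R1 : Re s1 = 2 * INR N + 2).
  { unfold s1. rewrite S_INR, <- RtoC_mult. cbn [Re RtoC fst]. ring. }
  assert (R2 : Re s2 = 2 * INR N + 2 - Re nu) by (unfold s2; rewrite Re_minus, R1; reflexivity).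
  assert (HL := proj2 (Lfun_continuation q chi Hchi Hprim Heven Hq2) s1 ltac:(lra)).
  assert (HZ := proj2 zeta_continuation s2 ltac:(lra)).
  assert (T := dirichlet_convolution (fun k => achi k * cpow (INR k) (- s1))%C (fun m => one_coef m * cpow (INR m) (- s2))%C
    (fun k => exp (- Re s1 * ln (INR k))) (fun m => exp (- Re s2 * ln (INR m))) _ _ HL HZ).
  rewrite (Cmult_comm (zeta s2)). eapply CS_ext; [|apply T].
  - intros n. cbv beta. unfold sigma_chi. rewrite <- divsum_scal_r. apply divsum_ext. intros k Hk Hm.
    destruct (div_exact_facts n k Hk Hm) as [Hm1 En].
    assert (Kp : 0 < INR k) by (apply lt_0_INR; lia). assert (Mp : 0 < INR (S n / k)) by (apply lt_0_INR; lia).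
    fold s1. unfold one_coef, achi.
    replace (chi (Z.of_nat k) * cpow (INR k) (- s1) * (1 * cpow (INR (S n / k)) (- s2)))%C
      with (chi (Z.of_nat k) * (cpow (INR k) (- s1) * cpow (INR (S n / k)) (- s2)))%C by ring.
    replace (cpow (INR k) (- nu) * chi (Z.of_nat k) * cpow (INR (S n)) (nu - s1))%C
      with (chi (Z.of_nat k) * (cpow (INR k) (- nu) * cpow (INR (S n)) (nu - s1)))%C by ring.
    f_equal. unfold cpow. rewrite <- !cexp_add, En, ln_mult, RtoC_plus by assumption. f_equal. unfold s2. ring.
  - intros n. apply (dirichlet_dom achi s1 n (achi_le q chi Hchi)).
  - intros n. apply (dirichlet_dom one_coef s2 n one_coef_le).
  - eapply ex_series_ext; [|apply (ex_series_power (Re s1 - 1)); lra]. intros n. cbv beta. apply (f_equal exp). ring.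
  - eapply ex_series_ext; [|apply (ex_series_power (Re s2 - 1)); lra]. intros n. cbv beta. apply (f_equal exp). ring.
Qed.

Let tail (N : nat) (nu : C) : C := CSum (fun n => tail_term q chi x N nu (S n)).
Let zl (nu : C) (j : nat) : C := (zeta (2 * INR (S j) - nu) * Lfun chi (2 * INR (S j)) * RtoC (X ^ (2 * S j - 1)))%C.

(** With [a = nu - 2 (N + 1)], [(n^(a + 2) - X^(a + 2)) / (n^2 - X^2) = n^a + X^2 (n^a - X^a) / (n^2
    - X^2)]; the first part sums to the product of [zeta] and [L]. *)
Lemma tail_step (nu : C) (N : nat) : -1 < Re nu < 1 ->
  (RtoC (X ^ (2 * N + 1)) * tail N nu)%C = (zl nu N + RtoC (X ^ (2 * S N + 1)) * tail (S N) nu)%C.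
Proof.
  intros Hnu. assert (HN := pos_INR N).
  assert (T1 := tail_series N nu ltac:(lra)). assert (T2 := tail_series (S N) nu ltac:(rewrite S_INR; lra)).
  fold (tail N nu) in T1. fold (tail (S N) nu) in T2.
  assert (T3 := zeta_L_product nu N ltac:(lra)).
  apply (CS_scal (RtoC (X ^ (2 * N + 1)))) in T1. apply (CS_scal (RtoC (X ^ (2 * S N + 1)))) in T2.
  apply (CS_scal (RtoC (X ^ (2 * N + 1)))) in T3.
  assert (T := CS_plus _ _ _ _ T3 T2).
  unfold zl. replace (2 * S N - 1)%nat with (2 * N + 1)%nat by lia.
  match type of T with CS _ ?l => transitivity l; [|ring] end.
  eapply CS_unique; [exact T1|]. eapply CS_ext; [|exact T]. intros n. cbv beta. unfold tail_term. fold X.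
  assert (Np := INR_S_pos n). assert (Hne := HXne n).
  assert (P1 : forall y, 0 < y -> cpow y (nu - 2 * INR N) = (cpow y (nu - 2 * INR (S N)) * RtoC (y ^ 2))%C).
  { intros y Hy. rewrite <- cpow_nat, <- cpow_add by exact Hy. f_equal. rewrite S_INR. simpl INR. rewrite !RtoC_plus. ring. }
  rewrite !P1 by assumption. replace (X ^ (2 * S N + 1)) with (X ^ (2 * N + 1) * X ^ 2).
  2:{ rewrite <- pow_add. f_equal. lia. }
  assert (Hn2 : RtoC (INR (S n) ^ 2 - X ^ 2) <> RtoC 0) by (apply RtoC_nz, Hne).
  rewrite RtoC_mult. rewrite RtoC_minus in *. field. exact Hn2.
Qed.

Lemma tail_shift (nu : C) (N : nat) : -1 < Re nu < 1 ->
  (RtoC X * tail 0 nu)%C = (psum (zl nu) N + RtoC (X ^ (2 * N + 1)) * tail N nu)%C.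
Proof.
  intros Hnu. induction N as [|N IH].
  - replace (2 * 0 + 1)%nat with 1%nat by lia. rewrite pow_1. simpl. ring.
  - rewrite IH, (tail_step nu N Hnu). cbn [psum]. ring.
Qed.

Let H (nu : C) : C := IR (fun v => cexp (nu * RtoC v) * bessel_kernel chi x v)%C.

(* Clearing the denominators leaves a difference that is holomorphic off the integers. *)
Let defect (N : nat) (nu : C) : C :=
  (4 * RtoC PI * H nu * (tau * csin (RtoC PI * nu / 2) * ccos (RtoC PI * nu / 2))
   - RtoC (INR q) * (Lfun chi nu * ccos (RtoC PI * nu / 2) * cpow X (nu - 1)
     - RtoC PI * Lfun chi (1 + nu) * csin (RtoC PI * nu / 2) * cpow X nu
     + 2 * ccos (RtoC PI * nu / 2) * psum (zl nu) N
     + 2 * ccos (RtoC PI * nu / 2) * RtoC (X ^ (2 * N + 1)) * tail N nu))%C.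

Lemma nonint_shift (nu : C) (k : Z) : nonint nu -> nonint (RtoC (IZR k) + nu) /\ nonint (RtoC (IZR k) - nu).
Proof.
  intros Hn. split; intros j E.
  - apply (Hn (j - k)%Z). rewrite minus_IZR, RtoC_minus, <- E. ring.
  - apply (Hn (k - j)%Z). rewrite minus_IZR, RtoC_minus, <- E. ring.
Qed.

Lemma holo_defect (N : nat) (nu : C) : -1 < Re nu < 2 * INR N + 1 -> nonint nu -> holo (defect N) nu.
Proof.
  intros Hnu Hn.
  assert (Hsin := holo_csin_half nu).
  assert (Hcos : holo (fun w => ccos (RtoC PI * w / 2)) nu).
  { apply holo_ccos. unfold Cdiv. apply holo_mult; [|apply holo_const]. apply holo_scal, holo_id. }
  assert (HL : forall z, z <> RtoC 1 -> holo (Lfun chi) z).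
  { intros z Hz. apply holo_ex_derive, (Lfun_continuation q chi Hchi Hprim Heven Hq2), Hz. }
  assert (HZ : forall z, z <> RtoC 1 -> holo zeta z).
  { intros z Hz. apply holo_ex_derive, zeta_continuation, Hz. }
  unfold defect. apply holo_minus.
  - apply holo_mult.
    + apply holo_scal. apply (holo_bessel_integral q chi x Hchi Hx).
    + apply holo_mult; [|exact Hcos]. apply holo_scal, Hsin.
  - apply holo_scal, holo_plus; [apply holo_plus; [apply holo_minus|]|].
    + apply holo_mult; [apply holo_mult|].
      * apply HL. exact (Hn 1%Z).
      * exact Hcos.
      * apply holo_cpow, holo_minus; [apply holo_id|apply holo_const].
    + apply holo_mult; [apply holo_mult|].
      * apply holo_scal. apply (holo_comp (Lfun chi) (fun w => 1 + w)%C).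
        -- apply holo_plus; [apply holo_const|apply holo_id].
        -- apply HL. exact (proj1 (nonint_shift nu 1 Hn) 1%Z).
      * exact Hsin.
      * apply holo_cpow, holo_id.
    + apply holo_mult; [apply holo_scal, Hcos|]. apply (holo_psum (fun k w => zl w k)). intros k. unfold zl.
      apply holo_mult; [apply holo_mult; [|apply holo_const]|apply holo_const].
      apply (holo_comp zeta (fun w => 2 * INR (S k) - w)%C).
      * apply holo_minus; [apply holo_const|apply holo_id].
      * apply HZ. replace (2 * RtoC (INR (S k)))%C with (RtoC (IZR (2 * Z.of_nat (S k)))).
        -- exact (proj2 (nonint_shift nu _ Hn) 1%Z).
        -- rewrite mult_IZR, <- INR_IZR_INZ, RtoC_mult. reflexivity.
    + apply holo_mult; [apply holo_mult; [apply holo_scal, Hcos|apply holo_const]|].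
      apply holo_tail, Hnu.
Qed.

Lemma defect_strip (N : nat) (nu : C) : 0 < Re nu < 1 -> nonint nu -> defect N nu = RtoC 0.
Proof.
  intros Hnu Hn.
  destruct (strip_identity q chi x Hchi Hprim Heven Hq2 Hx HX nu Hnu) as [S2 [HS E]].
  assert (ES : S2 = tail 0 nu).
  { eapply CS_unique; [exact HS|]. apply tail_series. simpl. lra. }
  subst S2. fold tau X (H nu) in E.
  assert (Hs := nonint_csin nu Hn). assert (Hc := nonint_ccos nu Hn).
  assert (Ht : tau <> RtoC 0) by (apply (gauss_nz q chi Hchi Hprim Hq2)).
  assert (Sh := tail_shift nu N ltac:(lra)).
  unfold defect. rewrite E.
  replace (RtoC (INR q) / tau * (Lfun chi nu / csin (RtoC PI * nu / 2) * cpow X (nu - 1)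
     - RtoC PI * Lfun chi (1 + nu) / ccos (RtoC PI * nu / 2) * cpow X nu
     + 2 / csin (RtoC PI * nu / 2) * RtoC X * tail 0 nu))%C
   with (RtoC (INR q) / tau * (Lfun chi nu / csin (RtoC PI * nu / 2) * cpow X (nu - 1)
     - RtoC PI * Lfun chi (1 + nu) / ccos (RtoC PI * nu / 2) * cpow X nu
     + 2 / csin (RtoC PI * nu / 2) * (RtoC X * tail 0 nu)))%C by ring.
  rewrite Sh. field. repeat split; assumption.
Qed.

(** The strip [0 < Re nu < 1] lies in [-1 < Re nu < 2 N + 1] for every [N], so the vanishing of
    [defect] spreads to the latter; off the integers [csin] and [ccos] do not vanish, nor does
    [tau], and they can be divided out again. *)
Lemma continued_identity (N : nat) (nu : C) : -1 < Re nu < 2 * INR N + 1 -> nonint nu ->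
  (4 * RtoC PI * H nu)%C = (RtoC (INR q) / tau * (Lfun chi nu / csin (RtoC PI * nu / 2) * cpow X (nu - 1)
     - RtoC PI * Lfun chi (1 + nu) / ccos (RtoC PI * nu / 2) * cpow X nu
     + 2 / csin (RtoC PI * nu / 2) * psum (zl nu) N
     + 2 / csin (RtoC PI * nu / 2) * RtoC (X ^ (2 * N + 1)) * tail N nu))%C.
Proof.
  intros Hnu Hn. assert (HN := pos_INR N).
  assert (D : defect N nu = RtoC 0).
  { apply (identity_strip (defect N) (-1) (2 * INR N + 1) 0 1); try lra; try assumption.
    - intros z Hz Hnz. apply holo_defect; assumption.
    - intros z Hz Hnz. apply defect_strip; assumption. }
  assert (Hs := nonint_csin nu Hn). assert (Hc := nonint_ccos nu Hn).
  assert (Ht : tau <> RtoC 0) by (apply (gauss_nz q chi Hchi Hprim Hq2)).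
  unfold defect in D. apply Ceq_minus in D.
  replace (4 * RtoC PI * H nu)%C with
    (4 * RtoC PI * H nu * (tau * csin (RtoC PI * nu / 2) * ccos (RtoC PI * nu / 2)) / (tau * csin (RtoC PI * nu / 2) * ccos (RtoC PI * nu / 2)))%C
    by (field; repeat split; assumption).
  rewrite D. field. repeat split; assumption.
Qed.

End Continuation.


Theorem theorem3p3 (nu : C) (q : nat) (chi : Z -> C) (N : nat) (x : R) :
  (forall k : Z, nu <> RtoC (IZR k)) ->
  0 <= Re nu ->
  dirichlet_character q chi ->
  ~ principal_character q chi ->
  even_character chi ->
  primitive_character q chi ->
  (Int_part ((Re nu + 1) / 2) <= Z.of_nat N)%Z ->
  0 < x ->
  (forall m : nat, (0 < m)%nat -> INR q * x <> INR m) ->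
  let qx := INR q * x in
  exists S1 S2 : C,
    is_series (K := C_AbsRing) (V := C_NormedModule)
      (fun n => (sigmabar_chi (- nu) (cconjchar chi) (S n)
                 * cpow (INR (S n)) (nu / 2)
                 * BesselK nu (4 * PI * sqrt (INR (S n) * x)))%C) S1 /\
    is_series (K := C_AbsRing) (V := C_NormedModule)
      (fun n => (sigma_chi (- nu) chi (S n)
                 * ((cpow (INR (S n)) (nu - 2 * INR N) - cpow qx (nu - 2 * INR N))
                    / RtoC (INR (S n) ^ 2 - qx ^ 2)))%C) S2 /\
    (8 * PI * cpow x (nu / 2) * S1 =
     RtoC (INR q) / gauss_sum q chi *
     ( Lfun chi nu / csin (PI * nu / 2) * cpow qx (nu - 1)
       - PI * Lfun chi (1 + nu) / ccos (PI * nu / 2) * cpow qx nu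
       + 2 / csin (PI * nu / 2) *
           csum 1 N (fun j => zeta (2 * INR j - nu) * Lfun chi (2 * INR j)
                              * RtoC (qx ^ (2 * j - 1)))
       + 2 / csin (PI * nu / 2) * RtoC (qx ^ (2 * N + 1)) * S2))%C.
Proof.
  intros Hni Hre Hchi Hnp Heven Hprim HN Hx HX qx.
  assert (Hq2 := nonprincipal_modulus q chi Hchi Hnp).
  (* The bound on the integer part says exactly [(Re nu + 1) / 2 < N + 1]. *)
  assert (Hlt : -1 < Re nu < 2 * INR N + 1).
  { split; [lra|]. destruct (base_Int_part ((Re nu + 1) / 2)) as [_ H2].
    apply IZR_le in HN. rewrite <- INR_IZR_INZ in HN. lra. }
  destruct (bessel_series q chi x Hchi Hx nu) as [_ S1].
  assert (S2 := tail_series q chi x Hchi Hq2 Hx HX N nu Hlt).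
  assert (E := continued_identity q chi x Hchi Hprim Heven Hq2 Hx HX N nu Hlt Hni).
  eexists. eexists. split; [exact S1|]. split; [exact S2|].
  rewrite (gauss_sum_gauss q chi Hchi Hq2), csum_psum.
  assert (Hxn := cpow_nz x (nu / 2)).
  match type of E with ?l = _ => transitivity l end.
  - field. exact Hxn.
  - rewrite E. reflexivity.
Qed.
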